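(* Let $\eta(u)$ be a continuous decreasing (differentiable) function of $u\ge 0$ with $0<\eta(u)\le 1/2$ and $\lim_{u\to\infty}\eta'(u)=0$, and define $\varpi(x):=\min_{u\ge 0}\big(\eta(u)\log x+u\big)$. Let $A>1$ be any fixed real number. Suppose that for some constant $C>5A$, \[ G(N)=\frac{N^2}{2}+O\!\left(N^2\exp(-C\,\varpi(N))\right)\quad\text{for all integers } N\ge 4. \] Then for all sufficiently large $|t|$, $\zeta(\sigma+it)\neq 0$ in the region $\sigma>1-\eta(\log|t|)$.
   Context: $\Lambda$ denotes the von Mangoldt function: $\Lambda(n)=\log p$ if $n=p^m$ for a prime $p$ and $m\ge1$, and $\Lambda(n)=0$ otherwise. For a positive integer $n$, $\psi_2(n):=\sum_{m+m'=n}\Lambda(m)\Lambda(m')$, the sum over positive integers $m,m'$. $G(N):=\sum_{1\le n\le N}\psi_2(n)$. *)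

(* Defs.v *)
From Stdlib Require Import Reals Lra Lia ZArith Znumtheory Zpow_facts.
From Stdlib Require Import Classical ClassicalEpsilon.
From Coquelicot Require Import Coquelicot.
Open Scope R_scope.

Definition is_prime_power (n p : nat) : Prop :=
  prime (Z.of_nat p) /\ exists m : nat, (1 <= m)%nat /\ n = (p ^ m)%nat.

Definition Lambda (n : nat) : R :=
  match excluded_middle_informative (exists p, is_prime_power n p) with
  | left H => ln (INR (proj1_sig (constructive_indefinite_description _ H)))
  | right _ => 0
  end.

(* [sum_n_m _ a b] is the empty sum when [b < a], so psi2 0 = psi2 1 = 0. *)
Definition psi2 (n : nat) : R :=
  sum_n_m (fun m => Lambda m * Lambda (n - m)) 1 (n - 1).

Definition G (N : nat) : R := sum_n_m psi2 1 N.

(* The infimum; it is attained when 1 <= x and eta is continuous and positive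
   on [0, +oo): see [varpi_is_min]. *)
Definition varpi (eta : R -> R) (x : R) : R :=
  real (Glb_Rbar (fun y => exists u, 0 <= u /\ y = eta u * ln x + u)).

Definition Cexp (z : C) : C := (exp (Re z) * cos (Im z), exp (Re z) * sin (Im z)).

(* x^s for x > 0. *)
Definition Rcpow (x : R) (s : C) : C := Cexp (s * RtoC (ln x))%C.

(* For 0 < Re s and s <> 1,
     zeta s = lim_N (sum_(1 <= n <= N) n^(-s) - N^(1-s) / (1-s)).
   [zeta_Dirichlet] and [zeta_holomorphic] show that this is the analytic
   continuation of the Dirichlet series to the punctured half-plane;
   the value is meaningless for Re s <= 0 and for s = 1. *)
Definition zeta_approx (s : C) (N : nat) : C :=
  (sum_n_m (fun n => Rcpow (INR n) (- s)) 1 N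
   - Rcpow (INR N) (1 - s) / (1 - s))%C.

Definition zeta (s : C) : C :=
  (real (Lim_seq (fun N => Re (zeta_approx s N))),
   real (Lim_seq (fun N => Im (zeta_approx s N)))).

Lemma Lambda_prime_power (n p : nat) : is_prime_power n p -> Lambda n = ln (INR p).
Proof.
  intros H. unfold Lambda.
  destruct (excluded_middle_informative _) as [E|E]; [|exfalso; eauto].
  destruct (constructive_indefinite_description _ E) as [q Hq]; simpl.
  f_equal. f_equal.
  destruct H as [Hp [m [Hm ->]]]. destruct Hq as [Hq [k [Hk Hpq]]].
  assert (Z.of_nat q = Z.of_nat p); [|lia].
  apply prime_power_prime with (n := Z.of_nat m); auto; [lia|].
  rewrite <- Nat2Z.inj_pow, Hpq, Nat2Z.inj_pow.
  destruct k as [|k]; [lia|].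
  rewrite Nat2Z.inj_succ, Z.pow_succ_r by lia. apply Z.divide_factor_l.
Qed.

Lemma Lambda_not_prime_power (n : nat) :
  ~ (exists p, is_prime_power n p) -> Lambda n = 0.
Proof.
  intros H. unfold Lambda. destruct (excluded_middle_informative _); tauto.
Qed.

Lemma varpi_is_min (eta : R -> R) (x : R) :
  (forall u, 0 <= u -> continue_in eta (fun v => 0 <= v) u) ->
  (forall u, 0 <= u -> 0 < eta u) -> 1 <= x ->
  (exists u, 0 <= u /\ varpi eta x = eta u * ln x + u) /\
  (forall u, 0 <= u -> varpi eta x <= eta u * ln x + u).
Proof.
  intros Hc Hp Hx.
  assert (Hl : 0 <= ln x) by (rewrite <- ln_1; destruct (Req_dec x 1) as [->|];
    [lra | left; apply ln_increasing; lra]).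
  set (f := fun u => eta (Rmax 0 u) * ln x + u).
  assert (Hf : forall u, 0 <= u -> f u = eta u * ln x + u).
  { intros u Hu; unfold f; rewrite Rmax_right by lra; reflexivity. }
  assert (Hcf : forall c, continuity_pt f c).
  { intros c. unfold f.
    apply continuity_pt_plus; [apply continuity_pt_mult|].
    - intros e He. destruct (Hc (Rmax 0 c) (Rmax_l _ _) e He) as [d [Hd H]].
      exists d; split; auto. intros y [_ Hy].
      unfold R_dist, dist in *; simpl in *; unfold Rdist in *.
      destruct (Req_dec (Rmax 0 c) (Rmax 0 y)) as [->|N].
      + rewrite Rminus_diag, Rabs_R0; lra.
      + apply H. split; [split; auto; apply Rmax_l|].
        revert Hy. unfold Rmax. do 2 destruct (Rle_dec _ _);
        unfold Rabs; repeat destruct (Rcase_abs _); lra.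
    - apply continuity_pt_const; intros a b; reflexivity.
    - apply derivable_continuous_pt, derivable_pt_id. }
  set (M := eta 0 * ln x).
  assert (HM : 0 <= M) by (apply Rmult_le_pos; auto; left; apply Hp; lra).
  destruct (continuity_ab_min f 0 M HM (fun c _ => Hcf c)) as [m [Hm Hm0]].
  assert (Hall : forall u, 0 <= u -> f m <= eta u * ln x + u).
  { intros u Hu. destruct (Rle_dec u M).
    - rewrite <- Hf by auto. apply Hm; lra.
    - apply Rle_trans with (f 0); [apply Hm; lra|].
      rewrite Hf by lra. fold M.
      assert (0 <= eta u * ln x) by (apply Rmult_le_pos; auto; left; apply Hp; lra).
      lra. }
  assert (Hv : varpi eta x = f m).
  { unfold varpi. rewrite (is_glb_Rbar_unique _ (Finite (f m))); auto.
    split.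
    - intros y [u [Hu ->]]. simpl. auto.
    - intros b Hb. apply Hb. exists m. split; [lra|]. apply Hf; lra. }
  rewrite Hv. split; auto. exists m; split; [lra|]. apply Hf; lra.
Qed.

Lemma Cmod_exp (z : C) : Cmod (Cexp z) = exp (Re z).
Proof.
  unfold Cmod, Cexp; simpl.
  replace (_ + _) with (Rsqr (exp (Re z))).
  - apply sqrt_Rsqr; left; apply exp_pos.
  - pose proof (sin2_cos2 (Im z)) as H. unfold Rsqr in *.
    transitivity (exp (Re z) * exp (Re z) * (sin (Im z) * sin (Im z) + cos (Im z) * cos (Im z)));
      [rewrite H|]; ring.
Qed.

Lemma Cexp_plus (z w : C) : Cexp (z + w) = (Cexp z * Cexp w)%C.
Proof.
  unfold Cexp, Re, Im; simpl.
  rewrite exp_plus, cos_plus, sin_plus. apply injective_projections; simpl; ring.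
Qed.

Lemma Cexp_0 : Cexp 0 = 1%C.
Proof. unfold Cexp; simpl. rewrite exp_0, cos_0, sin_0. apply injective_projections; simpl; ring. Qed.

Lemma Rcpow_1 (s : C) : Rcpow 1 s = 1%C.
Proof. unfold Rcpow. rewrite ln_1, <- Cexp_0. f_equal. ring. Qed.

Lemma Rcpow_1s (x : R) (s : C) : 0 < x -> Rcpow x (1 - s) = (RtoC x * Rcpow x (- s))%C.
Proof.
  intros H. unfold Rcpow.
  replace ((1 - s) * RtoC (ln x))%C with (RtoC (ln x) + (- s) * RtoC (ln x))%C by ring.
  rewrite Cexp_plus. f_equal. unfold Cexp; simpl.
  rewrite exp_ln, cos_0, sin_0 by auto. apply injective_projections; simpl; ring.
Qed.

Lemma Cmod_Rcpow (x : R) (s : C) : Cmod (Rcpow x s) = exp (Re s * ln x).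
Proof. unfold Rcpow. rewrite Cmod_exp. f_equal. destruct s; unfold Re; simpl; ring. Qed.

Lemma Cmod_le_sum (z : C) : Cmod z <= Rabs (Re z) + Rabs (Im z).
Proof.
  replace z with ((Re z, 0) + (0, Im z))%C at 1
    by (apply injective_projections; destruct z; simpl; ring).
  eapply Rle_trans; [apply Cmod_triangle|]. apply Req_le. f_equal; unfold Cmod; simpl.
  - replace (_ + _) with (Rsqr (Re z)) by (unfold Rsqr; ring). apply sqrt_Rsqr_abs.
  - replace (_ + _) with (Rsqr (Im z)) by (unfold Rsqr; ring). apply sqrt_Rsqr_abs.
Qed.

Lemma Im_le_Cmod (z : C) : Rabs (Im z) <= Cmod z.
Proof. eapply Rle_trans; [|apply Rmax_Cmod]. apply Rmax_r. Qed.

Definition Cder (f : R -> C) (x : R) (l : C) : Prop :=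
  is_derive (fun y => Re (f y)) x (Re l) /\ is_derive (fun y => Im (f y)) x (Im l).

Lemma Cder_eq f x l l' : Cder f x l -> l = l' -> Cder f x l'.
Proof. intros H <-; exact H. Qed.

Lemma Cder_const c x : Cder (fun _ => c) x 0.
Proof. split; simpl; apply (@is_derive_const R_AbsRing R_NormedModule). Qed.

Lemma Cder_RtoC r x l : is_derive r x l -> Cder (fun y => RtoC (r y)) x (RtoC l).
Proof. intros H; split; simpl; auto. apply (@is_derive_const R_AbsRing R_NormedModule). Qed.

Lemma Cder_plus f g x l m : Cder f x l -> Cder g x m -> Cder (fun y => f y + g y)%C x (l + m)%C.
Proof.
  intros [A B] [D E]; split; simpl;
  [exact (is_derive_plus _ _ _ _ _ A D)|exact (is_derive_plus _ _ _ _ _ B E)].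
Qed.

Lemma Cder_mult f g x l m : Cder f x l -> Cder g x m ->
  Cder (fun y => f y * g y)%C x (l * g x + f x * m)%C.
Proof.
  intros [A B] [D E].
  assert (P : forall (a b : R -> R) da db, is_derive a x da -> is_derive b x db ->
     is_derive (fun y => a y * b y) x (da * b x + a x * db)).
  { intros. apply (is_derive_mult a b x da db); auto. intros; apply Rmult_comm. }
  assert (Q : forall (a b : R -> R) da db, is_derive a x da -> is_derive b x db ->
     is_derive (fun y => a y + b y) x (da + db)) by (intros; apply @is_derive_plus; auto).
  assert (Q' : forall (a b : R -> R) da db, is_derive a x da -> is_derive b x db ->
     is_derive (fun y => a y - b y) x (da - db)) by (intros; apply @is_derive_minus; auto).
  split.
  - eapply is_derive_ext; [|evar_last].
    2: { apply Q'; [apply (P _ _ _ _ A D)|apply (P _ _ _ _ B E)]. }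
    + intros t; simpl; reflexivity.
    + simpl. unfold Re, Im. ring.
  - eapply is_derive_ext; [|evar_last].
    2: { apply Q; [apply (P _ _ _ _ A E)|apply (P _ _ _ _ B D)]. }
    + intros t; simpl; reflexivity.
    + simpl. unfold Re, Im. ring.
Qed.

Lemma Cder_Cexp (c : C) (r : R -> R) (x l : R) : is_derive r x l ->
  Cder (fun y => Cexp (c * RtoC (r y))) x (c * RtoC l * Cexp (c * RtoC (r x)))%C.
Proof.
  intros H. assert (Hx : ex_derive r x) by (exists l; auto).
  assert (H' := is_derive_unique _ _ _ H).
  split; unfold Cexp, Re, Im; simpl; (auto_derive; [auto|]);
    change (Derive (fun y => r y) x) with (Derive r x); rewrite H'; unfold Rminus; ring.
Qed.

Lemma C_MVT (f f' : R -> C) (a b M : R) : a <= b ->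
  (forall x, a <= x <= b -> Cder f x (f' x)) ->
  (forall x, a <= x <= b -> Cmod (f' x) <= M) ->
  Cmod (f b - f a) <= 2 * M * (b - a).
Proof.
  intros Hab Hd HM.
  assert (S : forall (g g' : R -> R), (forall x, a <= x <= b -> is_derive g x (g' x)) ->
     (forall x, a <= x <= b -> Rabs (g' x) <= M) -> Rabs (g b - g a) <= M * (b - a)).
  { intros g g' Hg Hm.
    destruct (MVT_gen g a b g') as [c [Hc ->]].
    - rewrite Rmin_left, Rmax_right by auto. intros; apply Hg; lra.
    - rewrite Rmin_left, Rmax_right by auto. intros x Hx.
      apply continuity_pt_filterlim. apply (@ex_derive_continuous R_AbsRing R_NormedModule).
      exists (g' x); auto.
    - rewrite Rmin_left, Rmax_right in Hc by auto.
      rewrite Rabs_mult, (Rabs_pos_eq (b - a)) by lra.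
      apply Rmult_le_compat_r; [lra|auto]. }
  eapply Rle_trans; [apply Cmod_le_sum|].
  assert (H1 := S (fun x => Re (f x)) (fun x => Re (f' x)) (fun x Hx => proj1 (Hd x Hx))
    (fun x Hx => Rle_trans _ _ _ (re_le_Cmod _) (HM x Hx))).
  assert (H2 := S (fun x => Im (f x)) (fun x => Im (f' x)) (fun x Hx => proj2 (Hd x Hx))
    (fun x Hx => Rle_trans _ _ _ (Im_le_Cmod _) (HM x Hx))).
  simpl in *. unfold Rminus in *. unfold Re, Im in *. lra.
Qed.

Lemma Re_le_Cmod' (z : C) : Re z <= Cmod z.
Proof. eapply Rle_trans; [apply Rle_abs|apply re_le_Cmod]. Qed.

Lemma exp_le (x y : R) : x <= y -> exp x <= exp y.
Proof. intros [H| ->]; [left; apply exp_increasing; auto | lra]. Qed.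

Lemma Cexp_taylor1 (z : C) : Cmod (Cexp z - 1) <= 2 * Cmod z * exp (Cmod z).
Proof.
  pose proof (C_MVT (fun t => Cexp (z * RtoC t)) (fun t => z * RtoC 1 * Cexp (z * RtoC t))%C
    0 1 (Cmod z * exp (Cmod z)) ltac:(lra)) as H.
  simpl in H. replace (z * 1)%C with z in H by ring.
  replace (z * 0)%C with (RtoC 0) in H by ring. rewrite Cexp_0 in H.
  eapply Rle_trans; [apply H|lra].
  - intros x Hx.
    eapply Cder_eq; [exact (Cder_Cexp z (fun t => t) x 1 (@is_derive_id R_AbsRing x))|cbv beta; ring].
  - intros x Hx. rewrite Cmod_mult, Cmod_exp.
    apply Rmult_le_compat_l; [apply Cmod_ge_0|]. apply exp_le.
    eapply Rle_trans; [apply Re_le_Cmod'|]. rewrite Cmod_mult, Cmod_R.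
    rewrite Rabs_pos_eq by lra. pose proof (Cmod_ge_0 z). nra.
Qed.

Lemma Cexp_taylor2 (z : C) : Cmod (Cexp z - 1 - z) <= 4 * Cmod z ^ 2 * exp (Cmod z).
Proof.
  pose proof (C_MVT (fun t => Cexp (z * RtoC t) + (- z) * RtoC t)%C
    (fun t => z * (Cexp (z * RtoC t) - 1))%C
    0 1 (Cmod z * (2 * Cmod z * exp (Cmod z))) ltac:(lra)) as H.
  simpl in H. replace (z * 1)%C with z in H by ring.
  replace (z * 0)%C with (RtoC 0) in H by ring. rewrite Cexp_0 in H.
  match type of H with _ -> _ -> Cmod ?a <= _ => replace a with (Cexp z - 1 - z)%C in H by ring end.
  eapply Rle_trans; [apply H|simpl; lra].
  - intros x Hx.
    eapply Cder_eq.
    + apply Cder_plus.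
      * exact (Cder_Cexp z (fun t => t) x 1 (@is_derive_id R_AbsRing x)).
      * apply Cder_mult; [apply Cder_const|].
        apply Cder_RtoC, (@is_derive_id R_AbsRing x).
    + cbv beta. change (@one R_AbsRing) with 1. ring.
  - intros x Hx. rewrite Cmod_mult. pose proof (Cmod_ge_0 z).
    apply Rmult_le_compat_l; [auto|].
    eapply Rle_trans; [apply Cexp_taylor1|]. rewrite Cmod_mult, Cmod_R, Rabs_pos_eq by lra.
    assert (0 <= Cmod z * x <= Cmod z) by nra.
    assert (exp (Cmod z * x) <= exp (Cmod z)) by (apply exp_le; lra).
    pose proof (exp_pos (Cmod z * x)). nra.
Qed.

Lemma is_derive_ln' x : 0 < x -> is_derive ln x (/ x).
Proof. intros; auto_derive; auto; field; lra. Qed.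

Definition Kfun (a s : C) (x : R) : C :=
  (((1 - s) * (RtoC x - a) - RtoC x) * Rcpow x (- s))%C.

Definition Kdfun (a s : C) (x : R) : C :=
  ((- (RtoC x - a) - ((1 - s) * (RtoC x - a) - RtoC x) * RtoC (ln x)) * Rcpow x (- s))%C.

Lemma Cder_Rcpow x s : 0 < x -> Cder (fun y => Rcpow y s) x (s * RtoC (/ x) * Rcpow x s)%C.
Proof. intros; unfold Rcpow; apply Cder_Cexp, is_derive_ln'; auto. Qed.

Lemma RtoC_neq0 x : 0 < x -> RtoC x <> RtoC 0.
Proof. intros H E. apply RtoC_inj in E. lra. Qed.

Lemma Cder_id x : Cder RtoC x 1.
Proof. apply (Cder_RtoC (fun y => y)), (@is_derive_id R_AbsRing x). Qed.

Lemma Cder_K a s x : 0 < x ->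
  Cder (Kfun a s) x ((RtoC x - a) * (s * (s - 1) * RtoC (/ x) * Rcpow x (- s)))%C.
Proof.
  intros Hx. unfold Kfun.
  assert (HN : Cder (fun y => - RtoC y)%C x (- (1))%C) by (split; simpl; auto_derive; auto; ring).
  assert (H1 : Cder (fun y => RtoC y - a)%C x 1%C).
  { eapply Cder_eq; [apply Cder_plus; [apply Cder_id|apply Cder_const]|ring]. }
  assert (H2 : Cder (fun y => (1 - s) * (RtoC y - a) - RtoC y)%C x (- s)%C).
  { eapply Cder_eq.
    - unfold Cminus at 1. apply (Cder_plus (fun y => (1 - s) * (RtoC y - a))%C _ x); [|exact HN].
      apply Cder_mult; [apply Cder_const|exact H1].
    - cbv beta. ring. }
  eapply Cder_eq.
  - apply Cder_mult; [apply H2|apply Cder_Rcpow; exact Hx].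
  - cbv beta. rewrite RtoC_inv by lra. field. apply RtoC_neq0; auto.
Qed.

Lemma Cder_Kd a s x : 0 < x ->
  Cder (Kdfun a s) x ((RtoC x - a) *
    ((2 * s - 1 - s * (s - 1) * RtoC (ln x)) * RtoC (/ x) * Rcpow x (- s)))%C.
Proof.
  intros Hx. unfold Kdfun.
  assert (HN : Cder (fun y => - RtoC y)%C x (- (1))%C) by (split; simpl; auto_derive; auto; ring).
  assert (H1 : Cder (fun y => RtoC y - a)%C x 1%C).
  { eapply Cder_eq; [apply Cder_plus; [apply Cder_id|apply Cder_const]|ring]. }
  assert (H2 : Cder (fun y => (1 - s) * (RtoC y - a) - RtoC y)%C x (- s)%C).
  { eapply Cder_eq.
    - unfold Cminus at 1. apply (Cder_plus (fun y => (1 - s) * (RtoC y - a))%C _ x); [|exact HN].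
      apply Cder_mult; [apply Cder_const|exact H1].
    - cbv beta. ring. }
  assert (H3 : Cder (fun y => - (RtoC y - a))%C x (- (1))%C) by
    (destruct H1; split; simpl in *; auto_derive; auto; ring).
  assert (HL := Cder_RtoC ln x _ (is_derive_ln' x Hx)).
  assert (H4 := Cder_mult _ _ _ _ _ H2 HL).
  assert (H5 : Cder (fun y => - (((1 - s) * (RtoC y - a) - RtoC y) * RtoC (ln y)))%C x
     (- (- s * RtoC (ln x) + ((1 - s) * (RtoC x - a) - RtoC x) * RtoC (/ x)))%C).
  { destruct H4 as [P Q]. split.
    - apply (is_derive_opp (V := R_NormedModule)) in P. exact P.
    - apply (is_derive_opp (V := R_NormedModule)) in Q. exact Q. }
  eapply Cder_eq.
  - apply Cder_mult; [apply (Cder_plus _ _ _ _ _ H3 H5)|apply Cder_Rcpow; exact Hx].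
  - cbv beta. rewrite RtoC_inv by lra. field. apply RtoC_neq0; auto.
Qed.

Definition Qfun (a : R) (s : C) : C := (Kfun a s (a + 1) - Kfun a s a)%C.
Definition Qdfun (a : R) (s : C) : C := (Kdfun a s (a + 1) - Kdfun a s a)%C.

Lemma ln_ge0 x : 1 <= x -> 0 <= ln x.
Proof. intros [H| <-]; [left; rewrite <- ln_1; apply ln_increasing; lra | rewrite ln_1; lra]. Qed.

Lemma ln_le' x y : 0 < x -> x <= y -> ln x <= ln y.
Proof. intros H [H1| <-]; [left; apply ln_increasing; lra|lra]. Qed.

Lemma one_plus_log (d L : R) : 0 < d <= 1 -> 0 <= L -> 1 + L <= exp (d * L) / d.
Proof.
  intros Hd HL. apply Rmult_le_reg_r with d; [lra|].
  unfold Rdiv. rewrite Rmult_assoc, Rinv_l, Rmult_1_r by lra.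
  assert (1 + d * L <= exp (d * L)).
  { destruct (Req_dec (d * L) 0) as [->|N]; [rewrite exp_0; lra|].
    left. apply exp_ineq1; auto. }
  nra.
Qed.

Lemma kernel_bound (a x B : R) (s P : C) : 1 <= a -> a <= x <= a + 1 -> Cmod P <= B ->
  Cmod ((RtoC x - RtoC a) * (P * RtoC (/ x) * Rcpow x (- s)))%C
    <= B * exp (- (1 + Re s) * ln x).
Proof.
  intros Ha Hx HP.
  assert (0 < / x) by (apply Rinv_0_lt_compat; lra).
  rewrite <- RtoC_minus, !Cmod_mult, !Cmod_R, Cmod_Rcpow, !Rabs_pos_eq by lra.
  replace (Re (- s)%C) with (- Re s) by (destruct s; reflexivity).
  replace (- (1 + Re s) * ln x) with (- ln x + - Re s * ln x) by ring.
  rewrite exp_plus, exp_Ropp, exp_ln by lra.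
  pose proof (Cmod_ge_0 P). pose proof (exp_pos (- Re s * ln x)).
  assert (0 <= / x * exp (- Re s * ln x)) by nra.
  replace (Cmod P * / x * exp (- Re s * ln x)) with (Cmod P * (/ x * exp (- Re s * ln x))) by ring.
  assert (Cmod P * (/ x * exp (- Re s * ln x)) <= B * (/ x * exp (- Re s * ln x)))
    by (apply Rmult_le_compat_r; auto).
  assert (0 <= Cmod P * (/ x * exp (- Re s * ln x))) by nra.
  nra.
Qed.

Lemma exp_ln_mono (e a x : R) : 0 < e -> 1 <= a -> a <= x ->
  exp (- (1 + e) * ln x) <= exp (- (1 + e) * ln a).
Proof.
  intros. apply exp_le. pose proof (ln_le' a x ltac:(lra) ltac:(lra)). nra.
Qed.

Lemma Q_bound (s : C) (e : R) : 0 < e <= Re s -> exists B, forall a, 1 <= a ->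
  Cmod (Qfun a s) <= B * exp (- (1 + e) * ln a).
Proof.
  intros He. set (M := Cmod (s * (s - 1))).
  assert (HM : 0 <= M) by apply Cmod_ge_0.
  exists (2 * M). intros a Ha. unfold Qfun.
  eapply Rle_trans.
  - apply (C_MVT _ _ a (a + 1) (M * exp (- (1 + e) * ln a)) ltac:(lra)
      (fun x Hx => Cder_K a s x ltac:(lra))).
    intros x Hx. eapply Rle_trans; [apply kernel_bound; auto; apply Rle_refl|].
    fold M. apply Rmult_le_compat_l; auto.
    eapply Rle_trans; [|apply (exp_ln_mono e a x); lra].
    apply exp_le. pose proof (ln_ge0 x ltac:(lra)). nra.
  - apply Req_le; ring.
Qed.

Lemma Qd_bound (s : C) (e d : R) : 0 < e -> 0 < d <= 1 -> e + d <= Re s ->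
  exists B, forall a, 1 <= a -> Cmod (Qdfun a s) <= B * exp (- (1 + e) * ln a).
Proof.
  intros He Hd Hs. set (M := (Cmod (2 * s - 1) + Cmod (s * (s - 1)))%R).
  assert (HM : 0 <= M) by (apply Rplus_le_le_0_compat; apply Cmod_ge_0).
  assert (HMd : 0 <= M / d) by (apply Rdiv_le_0_compat; lra).
  exists (2 * (M / d)). intros a Ha. unfold Qdfun.
  eapply Rle_trans.
  - apply (C_MVT _ _ a (a + 1) (M / d * exp (- (1 + e) * ln a)) ltac:(lra)
      (fun x Hx => Cder_Kd a s x ltac:(lra))).
    intros x Hx. pose proof (ln_ge0 x ltac:(lra)) as HL.
    eapply Rle_trans; [apply kernel_bound with (B := M * (1 + ln x)); auto|].
    + unfold Cminus at 1. eapply Rle_trans; [apply Cmod_triangle|].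
      rewrite Cmod_opp, (Cmod_mult _ (RtoC (ln x))), Cmod_R, Rabs_pos_eq by auto.
      pose proof (Cmod_ge_0 (2 * s - 1)). pose proof (Cmod_ge_0 (s * (s - 1))).
      unfold M. nra.
    + pose proof (one_plus_log d (ln x) Hd HL).
      apply Rle_trans with (M * (exp (d * ln x) / d) * exp (- (1 + Re s) * ln x)).
      * apply Rmult_le_compat_r; [left; apply exp_pos|]. apply Rmult_le_compat_l; auto.
      * replace (M * (exp (d * ln x) / d) * exp (- (1 + Re s) * ln x))
          with (M / d * (exp (d * ln x) * exp (- (1 + Re s) * ln x))) by (field; lra).
        rewrite <- exp_plus. apply Rmult_le_compat_l; auto.
        eapply Rle_trans; [|apply (exp_ln_mono e a x); lra].
        apply exp_le. nra.
  - apply Req_le; ring.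
Qed.

Lemma Cder_minus f g x l m : Cder f x l -> Cder g x m -> Cder (fun y => f y - g y)%C x (l - m)%C.
Proof.
  intros [A B] [D E]; split; simpl;
  [exact (is_derive_minus _ _ _ _ _ A D)|exact (is_derive_minus _ _ _ _ _ B E)].
Qed.

Lemma Q_taylor (s : C) (e d : R) : 0 < e -> 0 < d <= 1 -> e + 3 * d <= Re s ->
  exists B, 0 <= B /\ forall a w, 1 <= a -> Cmod w <= d ->
    Cmod (Qfun a (s + w) - Qfun a s - w * Qdfun a s)
      <= B * Cmod w ^ 2 * exp (- (1 + e) * ln a).
Proof.
  intros He Hd Hs.
  set (p1 := Cmod (2 * s - 1)). set (p0 := Cmod (s * (s - 1))).
  assert (Hp1 : 0 <= p1) by apply Cmod_ge_0. assert (Hp0 : 0 <= p0) by apply Cmod_ge_0.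
  set (M := 1 + (p1 + 1) + 4 * (p0 + p1 + 1)).
  assert (HM : 0 <= M) by (unfold M; lra).
  assert (HMd : 0 <= M / (d * d)) by (apply Rdiv_le_0_compat; nra).
  exists (2 * (M / (d * d))). split; [lra|]. intros a w Ha Hw.
  pose proof (Cmod_ge_0 w) as Hw0.
  assert (E : (Qfun a (s + w) - Qfun a s - w * Qdfun a s)%C =
    ((Kfun a (s + w) (a + 1) - Kfun a s (a + 1) - w * Kdfun a s (a + 1))
     - (Kfun a (s + w) a - Kfun a s a - w * Kdfun a s a))%C)
    by (unfold Qfun, Qdfun; ring).
  rewrite E. clear E.
  eapply Rle_trans.
  - apply (C_MVT (fun x => Kfun a (s + w) x - Kfun a s x - w * Kdfun a s x)%C
      (fun x => (RtoC x - RtoC a) *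
         ((w * w * (1 - (2 * s - 1 + w) * RtoC (ln x))
           + (s + w) * (s + w - 1) * (Cexp (- w * RtoC (ln x)) - 1 - (- w * RtoC (ln x))))
          * RtoC (/ x) * Rcpow x (- s)))%C
      a (a + 1) (M / (d * d) * Cmod w ^ 2 * exp (- (1 + e) * ln a)) ltac:(lra)).
    + intros x Hx. eapply Cder_eq.
      * apply Cder_minus; [apply Cder_minus; apply Cder_K; lra|].
        apply Cder_mult; [apply Cder_const|apply Cder_Kd; lra].
      * cbv beta.
        replace (Rcpow x (- (s + w))) with (Rcpow x (- s) * Cexp (- w * RtoC (ln x)))%C
          by (unfold Rcpow; rewrite <- Cexp_plus; f_equal; ring).
        ring.
    + intros x Hx. pose proof (ln_ge0 x ltac:(lra)) as HL. set (L := ln x) in *.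
      eapply Rle_trans;
        [apply kernel_bound with (B := M * Cmod w ^ 2 * ((1 + L) * (1 + L)) * exp (d * L)); auto|].
      * assert (Hexp : 1 <= exp (d * L)).
        { rewrite <- exp_0. apply exp_le. nra. }
        eapply Rle_trans; [apply Cmod_triangle|].
        rewrite !(Cmod_mult (w * w)), !(Cmod_mult w w).
        assert (A1 : Cmod (1 - (2 * s - 1 + w) * RtoC L) <= 1 + (p1 + 1) * L).
        { unfold Cminus at 1. eapply Rle_trans; [apply Cmod_triangle|].
          rewrite Cmod_opp, Cmod_1, Cmod_mult, Cmod_R, (Rabs_pos_eq L) by auto.
          pose proof (Cmod_triangle (2 * s - 1) w). fold p1 in H. nra. }
        assert (A2 : Cmod ((s + w) * (s + w - 1)) <= p0 + p1 + 1).
        { replace ((s + w) * (s + w - 1))%C with (s * (s - 1) + (w * (2 * s - 1) + w * w))%C by ring.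
          eapply Rle_trans; [apply Cmod_triangle|].
          pose proof (Cmod_triangle (w * (2 * s - 1)) (w * w)) as H.
          rewrite !(Cmod_mult w) in H. fold p0; fold p1 in H. nra. }
        assert (A3 : Cmod (Cexp (- w * RtoC L) - 1 - (- w * RtoC L))
                     <= 4 * (Cmod w * L) ^ 2 * exp (d * L)).
        { eapply Rle_trans; [apply Cexp_taylor2|].
          rewrite Cmod_mult, Cmod_opp, Cmod_R, (Rabs_pos_eq L) by auto.
          apply Rmult_le_compat_l; [nra|]. apply exp_le. nra. }
        rewrite (Cmod_mult ((s + w) * (s + w - 1))).
        set (X := exp (d * L)) in *.
        assert (B1 : Cmod w * Cmod w * Cmod (1 - (2 * s - 1 + w) * RtoC L) <=
          Cmod w ^ 2 * (1 + (p1 + 1) * L)).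
        { replace (Cmod w * Cmod w) with (Cmod w ^ 2) by ring.
          apply Rmult_le_compat_l; [nra|auto]. }
        assert (B2 : Cmod ((s + w) * (s + w - 1)) * Cmod (Cexp (- w * RtoC L) - 1 - (- w * RtoC L))
          <= (p0 + p1 + 1) * (4 * (Cmod w * L) ^ 2 * X))
          by (apply Rmult_le_compat; auto; apply Cmod_ge_0).
        eapply Rle_trans; [apply Rplus_le_compat; [apply B1|apply B2]|].
        replace (Cmod w ^ 2 * (1 + (p1 + 1) * L) + (p0 + p1 + 1) * (4 * (Cmod w * L) ^ 2 * X))
          with (Cmod w ^ 2 * ((1 + (p1 + 1) * L) + 4 * (p0 + p1 + 1) * (L * L) * X)) by ring.
        replace (M * Cmod w ^ 2 * ((1 + L) * (1 + L)) * X)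
          with (Cmod w ^ 2 * (M * ((1 + L) * (1 + L)) * X)) by ring.
        apply Rmult_le_compat_l; [nra|].
        assert (C1 : 1 + (p1 + 1) * L <= (1 + (p1 + 1)) * ((1 + L) * (1 + L)) * X).
        { apply Rle_trans with ((1 + (p1 + 1)) * ((1 + L) * (1 + L)) * 1); [nra|].
          apply Rmult_le_compat_l; [nra|auto]. }
        assert (C2 : 4 * (p0 + p1 + 1) * (L * L) * X <= 4 * (p0 + p1 + 1) * ((1 + L) * (1 + L)) * X).
        { apply Rmult_le_compat_r; [lra|]. apply Rmult_le_compat_l; nra. }
        unfold M. lra.
      * pose proof (one_plus_log d L Hd HL) as H1.
        set (Y := exp (d * L)) in *.
        assert (HY : 0 < Y) by apply exp_pos.
        apply Rle_trans with (M * Cmod w ^ 2 * ((Y / d) * (Y / d)) * Y * exp (- (1 + Re s) * L)).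
        -- apply Rmult_le_compat_r; [left; apply exp_pos|].
           apply Rmult_le_compat_r; [lra|]. apply Rmult_le_compat_l; [nra|].
           apply Rmult_le_compat; lra.
        -- replace (M * Cmod w ^ 2 * ((Y / d) * (Y / d)) * Y * exp (- (1 + Re s) * L))
             with (M / (d * d) * Cmod w ^ 2 * (Y * Y * Y * exp (- (1 + Re s) * L)))
             by (field; lra).
           apply Rmult_le_compat_l; [nra|].
           unfold Y. rewrite <- !exp_plus.
           eapply Rle_trans; [|apply (exp_ln_mono e a x); lra].
           apply exp_le. fold L. nra.
  - apply Req_le; ring.
Qed.

Lemma power_series_bounded (e : R) : 0 < e -> exists U, 0 <= U /\
  (forall n, sum_n (fun k => exp (- (1 + e) * ln (INR (S k)))) n <= U).
Proof.
  intros He. exists (1 + / e).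
  assert (0 < / e) by (apply Rinv_0_lt_compat; auto).
  split; [lra|].
  assert (Step : forall a, 1 <= a ->
     exp (- (1 + e) * ln (a + 1)) <= / e * (exp (- e * ln a) - exp (- e * ln (a + 1)))).
  { intros a Ha.
    destruct (MVT_gen (fun x => exp (- e * ln x)) a (a + 1)
       (fun x => - e * / x * exp (- e * ln x))) as [c [Hc Hc']].
    - rewrite Rmin_left, Rmax_right by lra. intros x Hx. auto_derive; [lra|field; lra].
    - rewrite Rmin_left, Rmax_right by lra. intros x Hx. apply continuity_pt_filterlim.
      apply (@ex_derive_continuous R_AbsRing R_NormedModule (fun x => exp (- e * ln x))).
      auto_derive. lra.
    - rewrite Rmin_left, Rmax_right in Hc by lra. cbv beta in Hc'.
      replace (exp (- e * ln a) - exp (- e * ln (a + 1)))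
        with (e * (/ c * exp (- e * ln c))) by lra.
      rewrite <- Rmult_assoc, Rinv_l, Rmult_1_l by lra.
      replace (/ c * exp (- e * ln c)) with (exp (- (1 + e) * ln c)).
      + apply exp_ln_mono; lra.
      + replace (- (1 + e) * ln c) with (- ln c + - e * ln c) by ring.
        rewrite exp_plus, exp_Ropp, exp_ln by lra. reflexivity. }
  assert (Main : forall n, sum_n (fun k => exp (- (1 + e) * ln (INR (S k)))) n
     <= 1 + / e * (1 - exp (- e * ln (INR (S n))))).
  { induction n as [|n IH].
    - rewrite sum_O. change (INR 1) with 1. rewrite ln_1, !Rmult_0_r, exp_0. lra.
    - rewrite sum_Sn. change plus with Rplus.
      pose proof (Step (INR (S n))) as S1. rewrite <- S_INR in S1.
      assert (1 <= INR (S n)) by (rewrite S_INR; pose proof (pos_INR n); lra).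
      specialize (S1 H0). lra. }
  intros n. specialize (Main n). pose proof (exp_pos (- e * ln (INR (S n)))). nra.
Qed.

Lemma ex_series_power (e : R) : 0 < e -> ex_series (fun k => exp (- (1 + e) * ln (INR (S k)))).
Proof.
  intros He. destruct (power_series_bounded e He) as [U [_ HU]].
  destruct (ex_finite_lim_seq_incr (sum_n (fun k => exp (- (1 + e) * ln (INR (S k))))) U)
    as [l Hl]; auto.
  - intros n. rewrite sum_Sn. change plus with Rplus.
    pose proof (exp_pos (- (1 + e) * ln (INR (S (S n))))). lra.
  - exists l. exact Hl.
Qed.

Definition Ccvg (u : nat -> C) (l : C) : Prop :=
  forall eps, 0 < eps -> exists N, forall n, (N <= n)%nat -> Cmod (u n - l) < eps.

Lemma Ccvg_series (a : nat -> C) (l : C) :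
  is_series (V := C_NormedModule) a l <-> Ccvg (sum_n (G := C_AbelianGroup) a) l.
Proof.
  split.
  - intros H eps He.
    assert (S2 : 0 < sqrt 2) by (apply sqrt_lt_R0; lra).
    assert (He' : 0 < eps / sqrt 2) by (apply Rdiv_lt_0_compat; lra).
    destruct (proj1 (filterlim_locally _ _) H (mkposreal _ He')) as [N HN].
    exists N. intros n Hn. specialize (HN n Hn).
    apply C_NormedModule_mixin_compat2 in HN. simpl in HN.
    replace eps with (sqrt 2 * (eps / sqrt 2)) by (field; lra). exact HN.
  - intros H. apply (proj2 (filterlim_locally _ _)). intros [eps He].
    destruct (H eps He) as [N HN]. exists N. intros n Hn.
    apply C_NormedModule_mixin_compat1. exact (HN n Hn).
Qed.

Lemma Ccvg_bound (u : nat -> C) l M : Ccvg u l -> (forall n, Cmod (u n) <= M) -> Cmod l <= M.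
Proof.
  intros H HM. apply Rnot_lt_le. intros Hlt.
  destruct (H (Cmod l - M)) as [N HN]; [lra|].
  specialize (HN N (le_n _)). specialize (HM N).
  pose proof (Cmod_triangle (u N) (- (u N - l))) as T. rewrite Cmod_opp in T.
  replace (u N + - (u N - l))%C with l in T by ring. lra.
Qed.

Lemma Ccvg_Re u l : Ccvg u l -> is_lim_seq (fun n => Re (u n)) (Re l).
Proof.
  intros H. apply is_lim_seq_spec. intros [eps He]. destruct (H eps He) as [N HN].
  exists N. intros n Hn. simpl. eapply Rle_lt_trans; [|apply (HN n Hn)].
  apply (re_le_Cmod (u n - l)).
Qed.

Lemma Ccvg_Im u l : Ccvg u l -> is_lim_seq (fun n => Im (u n)) (Im l).
Proof.
  intros H. apply is_lim_seq_spec. intros [eps He]. destruct (H eps He) as [N HN].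
  exists N. intros n Hn. simpl. eapply Rle_lt_trans; [|apply (HN n Hn)].
  apply (Im_le_Cmod (u n - l)).
Qed.

Lemma zeta_eq s l : Ccvg (zeta_approx s) l -> zeta s = l.
Proof.
  intros H. unfold zeta.
  rewrite (is_lim_seq_unique _ _ (Ccvg_Re _ _ H)), (is_lim_seq_unique _ _ (Ccvg_Im _ _ H)).
  destruct l; reflexivity.
Qed.

Definition Qs (s : C) (n : nat) : C := Qfun (INR (S n)) s.
Definition Qds (s : C) (n : nat) : C := Qdfun (INR (S n)) s.

Lemma INR_S_ge1 n : 1 <= INR (S n).
Proof. rewrite S_INR. pose proof (pos_INR n). lra. Qed.

Lemma ex_series_C_bound (a : nat -> C) (B e : R) : 0 < e ->
  (forall n, Cmod (a n) <= B * exp (- (1 + e) * ln (INR (S n)))) ->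
  exists l, is_series (V := C_NormedModule) a l.
Proof.
  intros He H.
  apply (@ex_series_le C_AbsRing C_CompleteNormedModule a
    (fun n => B * exp (- (1 + e) * ln (INR (S n))))).
  - intros n. change (norm (a n)) with (Cmod (a n)). apply H.
  - apply (@ex_series_scal R_AbsRing R_NormedModule). apply ex_series_power; auto.
Qed.

Lemma series_C_bound (a : nat -> C) (l : C) (B e U : R) : 0 <= B ->
  (forall n, sum_n (fun k => exp (- (1 + e) * ln (INR (S k)))) n <= U) ->
  (forall n, Cmod (a n) <= B * exp (- (1 + e) * ln (INR (S n)))) ->
  is_series (V := C_NormedModule) a l -> Cmod l <= B * U.
Proof.
  intros HB HU Ha Hl. apply Ccvg_series in Hl. apply (Ccvg_bound _ _ _ Hl).
  intros n. apply Rle_trans with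
    (B * sum_n (fun k => exp (- (1 + e) * ln (INR (S k)))) n);
    [|apply Rmult_le_compat_l; auto].
  induction n as [|n IH].
  - rewrite !sum_O. apply Ha.
  - rewrite !sum_Sn. change (@plus R_AbelianGroup) with Rplus.
    eapply Rle_trans; [apply Cmod_triangle|]. specialize (Ha (S n)).
    rewrite Rmult_plus_distr_l. change (@plus R_AbelianMonoid) with Rplus.
    apply Rplus_le_compat; auto.
Qed.

Lemma ex_series_Q s : 0 < Re s -> exists l, is_series (V := C_NormedModule) (Qs s) l.
Proof.
  intros Hs. destruct (Q_bound s (Re s)) as [B HB]; [lra|].
  apply (ex_series_C_bound _ B (Re s)); auto. intros n. apply HB, INR_S_ge1.
Qed.

Lemma one_minus_neq0 (s : C) : s <> RtoC 1 -> (1 - s)%C <> RtoC 0.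
Proof.
  intros H E. apply H. replace s with (1 - (1 - s))%C by ring. rewrite E. ring.
Qed.

Lemma zeta_approx_eq s n : s <> RtoC 1 ->
  zeta_approx s (S (S n)) = ((- s + sum_n (G := C_AbelianGroup) (Qs s) n) / (1 - s))%C.
Proof.
  intros Hs. apply one_minus_neq0 in Hs.
  assert (Z1 : zeta_approx s 1 = (- s / (1 - s))%C).
  { unfold zeta_approx. rewrite sum_n_n. simpl. rewrite !Rcpow_1. field. auto. }
  assert (Step : forall m, zeta_approx s (S (S m)) = (zeta_approx s (S m) + Qs s m / (1 - s))%C).
  { intros m. unfold zeta_approx. rewrite sum_n_Sm by lia.
    change plus with Cplus. unfold Qs, Qfun, Kfun.
    rewrite <- S_INR. pose proof (INR_S_ge1 m). pose proof (INR_S_ge1 (S m)).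
    rewrite !Rcpow_1s by lra.
    rewrite (S_INR (S m)), RtoC_plus. field. auto. }
  induction n as [|n IH].
  - rewrite Step, Z1, sum_O. field. auto.
  - rewrite Step, IH, sum_Sn. change plus with Cplus. field. auto.
Qed.

Lemma zeta_cvg s l : s <> RtoC 1 -> is_series (V := C_NormedModule) (Qs s) l ->
  Ccvg (zeta_approx s) ((- s + l) / (1 - s))%C.
Proof.
  intros Hs Hl. apply Ccvg_series in Hl. intros eps He.
  pose proof (one_minus_neq0 s Hs) as H1.
  assert (P : 0 < Cmod (1 - s)) by (apply Cmod_gt_0; auto).
  destruct (Hl (eps * Cmod (1 - s))) as [N HN]; [apply Rmult_lt_0_compat; auto|].
  exists (S (S N)). intros [|[|n]] Hn; [lia|lia|].
  rewrite zeta_approx_eq by auto.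
  replace ((- s + sum_n (G := C_AbelianGroup) (Qs s) n) / (1 - s) - (- s + l) / (1 - s))%C
    with ((sum_n (G := C_AbelianGroup) (Qs s) n - l) / (1 - s))%C by (field; auto).
  rewrite Cmod_div by auto. apply Rmult_lt_reg_r with (Cmod (1 - s)); auto.
  unfold Rdiv. rewrite Rmult_assoc, Rinv_l, Rmult_1_r by lra. apply HN. lia.
Qed.

Lemma Rcpow_vanish s : 1 < Re s -> Ccvg (fun N => Rcpow (INR N) (1 - s) / (1 - s))%C 0.
Proof.
  intros Hs eps He.
  assert (H1 : (1 - s)%C <> RtoC 0).
  { apply one_minus_neq0. intros ->. simpl in Hs. lra. }
  assert (P : 0 < Cmod (1 - s)) by (apply Cmod_gt_0; auto).
  set (y := eps * Cmod (1 - s)). assert (Hy : 0 < y) by (apply Rmult_lt_0_compat; auto).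
  destruct (INR_unbounded (exp (ln y / (1 - Re s)))) as [N HN].
  exists N. intros n Hn.
  replace (Rcpow (INR n) (1 - s) / (1 - s) - 0)%C with (Rcpow (INR n) (1 - s) / (1 - s))%C by ring.
  rewrite Cmod_div, Cmod_Rcpow by auto. apply Rmult_lt_reg_r with (Cmod (1 - s)); auto.
  unfold Rdiv. rewrite Rmult_assoc, Rinv_l, Rmult_1_r by lra. fold y.
  rewrite <- (exp_ln y) by auto. apply exp_increasing.
  replace (Re (1 - s)%C) with (1 - Re s) by (destruct s; reflexivity).
  assert (HnN : INR N <= INR n) by (apply le_INR; auto).
  assert (ln y / (1 - Re s) < ln (INR n)).
  { rewrite <- (ln_exp (ln y / (1 - Re s))). apply ln_increasing; [apply exp_pos|lra]. }
  apply Ropp_lt_cancel.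
  replace (- ln y) with ((Re s - 1) * (ln y / (1 - Re s))) by (field; lra). nra.
Qed.

Lemma zeta_Dirichlet (s : C) : 1 < Re s ->
  is_series (V := C_NormedModule) (fun n => Rcpow (INR (S n)) (- s)) (zeta s).
Proof.
  intros Hs.
  assert (H1 : s <> RtoC 1) by (intros ->; simpl in Hs; lra).
  destruct (ex_series_Q s) as [l Hl]; [lra|].
  pose proof (zeta_cvg s l H1 Hl) as Hz. rewrite (zeta_eq _ _ Hz).
  apply Ccvg_series. intros eps He.
  destruct (Hz (eps / 2)) as [N HN]; [lra|].
  destruct (Rcpow_vanish s Hs (eps / 2)) as [N' HN']; [lra|].
  exists (N + N')%nat. intros n Hn.
  specialize (HN (S n) ltac:(lia)). specialize (HN' (S n) ltac:(lia)).
  replace (sum_n (G := C_AbelianGroup) (fun n => Rcpow (INR (S n)) (- s)) n)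
    with (zeta_approx s (S n) + Rcpow (INR (S n)) (1 - s) / (1 - s))%C.
  - set (z := ((- s + l) / (1 - s))%C) in *.
    replace (zeta_approx s (S n) + Rcpow (INR (S n)) (1 - s) / (1 - s) - z)%C
      with ((zeta_approx s (S n) - z) + (Rcpow (INR (S n)) (1 - s) / (1 - s) - 0))%C by ring.
    eapply Rle_lt_trans; [apply Cmod_triangle|]. lra.
  - unfold zeta_approx, sum_n. rewrite <- sum_n_m_S.
    change (sum_n_m (G := C_AbelianGroup)) with (sum_n_m (G := C_AbelianMonoid)).
    ring.
Qed.

Definition Cdiff2 (f : C -> C) (s l : C) : Prop := exists d B, 0 < d /\ 0 <= B /\
  forall w, Cmod w <= d -> Cmod (f (s + w) - f s - w * l)%C <= B * Cmod w ^ 2.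

Lemma Cdiff2_ex_derive f s l : Cdiff2 f s l ->
  is_derive (K := C_AbsRing) (V := C_NormedModule) f s l.
Proof.
  intros [d [B [Hd [HB H]]]]. split.
  - apply (is_linear_scal_l (K := C_AbsRing) (V := C_NormedModule)).
  - intros x Hx. apply (is_filter_lim_locally_unique (K := C_AbsRing) (V := AbsRing_NormedModule C_AbsRing)) in Hx. subst x.
    intros [eps He]. simpl.
    assert (Hd' : 0 < Rmin d (eps / (B + 1))).
    { apply Rmin_glb_lt; auto. apply Rdiv_lt_0_compat; lra. }
    exists (mkposreal _ Hd'). intros y Hy.
    assert (Hy' : Cmod (y - s) < Rmin d (eps / (B + 1))) by exact Hy.
    pose proof (Rmin_l d (eps / (B + 1))). pose proof (Rmin_r d (eps / (B + 1))).
    change (Cmod (f y - f s - (y - s) * l) <= eps * Cmod (y - s)).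
    specialize (H (y - s)%C ltac:(lra)).
    assert (E : forall a b : C, (a + (b - a))%C = b) by (intros; ring).
    rewrite (E s y) in H.
    eapply Rle_trans; [apply H|]. pose proof (Cmod_ge_0 (y - s)).
    assert (B * Cmod (y - s) <= eps).
    { apply Rle_trans with ((B + 1) * (eps / (B + 1))); [|apply Req_le; field; lra].
      apply Rmult_le_compat; lra. }
    nra.
Qed.

Lemma Cdiff2_mult f g s l m : Cdiff2 f s l -> Cdiff2 g s m ->
  Cdiff2 (fun z => f z * g z)%C s (l * g s + f s * m)%C.
Proof.
  intros [d1 [B1 [Hd1 [HB1 H1]]]] [d2 [B2 [Hd2 [HB2 H2]]]].
  set (F := Cmod (f s)). set (G0 := Cmod (g s)). set (P := Cmod l). set (Q := Cmod m).
  assert (0 <= F) by apply Cmod_ge_0. assert (0 <= G0) by apply Cmod_ge_0.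
  assert (0 <= P) by apply Cmod_ge_0. assert (0 <= Q) by apply Cmod_ge_0.
  assert (0 <= P * Q) by nra. assert (0 <= (F + P) * B2) by nra.
  assert (0 <= B1 * (G0 + Q)) by nra. assert (0 <= B1 * B2) by nra.
  exists (Rmin 1 (Rmin d1 d2)), (P * Q + (F + P) * B2 + B1 * (G0 + Q) + B1 * B2).
  split; [repeat apply Rmin_glb_lt; lra|]. split; [lra|].
  intros w Hw.
  pose proof (Rmin_l 1 (Rmin d1 d2)). pose proof (Rmin_r 1 (Rmin d1 d2)).
  pose proof (Rmin_l d1 d2). pose proof (Rmin_r d1 d2).
  specialize (H1 w ltac:(lra)). specialize (H2 w ltac:(lra)).
  set (r1 := (f (s + w) - f s - w * l)%C) in *. set (r2 := (g (s + w) - g s - w * m)%C) in *.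
  replace (f (s + w) * g (s + w) - f s * g s - w * (l * g s + f s * m))%C
    with (w * w * (l * m) + (f s + w * l) * r2 + r1 * (g s + w * m) + r1 * r2)%C
    by (unfold r1, r2; ring).
  pose proof (Cmod_ge_0 w) as W0.
  set (W := Cmod w) in *. assert (W <= 1) by lra. assert (W2 : 0 <= W ^ 2 <= 1) by (simpl; nra).
  assert (X1 : Cmod (w * w * (l * m)) <= P * Q * W ^ 2).
  { rewrite !Cmod_mult. fold P Q W. apply Req_le; ring. }
  assert (Y1 : Cmod (f s + w * l) <= F + P).
  { eapply Rle_trans; [apply Cmod_triangle|]. rewrite Cmod_mult. fold F P W. nra. }
  assert (Y2 : Cmod (g s + w * m) <= G0 + Q).
  { eapply Rle_trans; [apply Cmod_triangle|]. rewrite Cmod_mult. fold G0 Q W. nra. }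
  assert (X2 : Cmod ((f s + w * l) * r2) <= (F + P) * (B2 * W ^ 2)).
  { rewrite Cmod_mult. apply Rmult_le_compat; auto; apply Cmod_ge_0. }
  assert (X3 : Cmod (r1 * (g s + w * m)) <= (B1 * W ^ 2) * (G0 + Q)).
  { rewrite Cmod_mult. apply Rmult_le_compat; auto; apply Cmod_ge_0. }
  assert (X4 : Cmod (r1 * r2) <= B1 * B2 * W ^ 2).
  { rewrite Cmod_mult. apply Rle_trans with ((B1 * W ^ 2) * (B2 * W ^ 2)).
    - apply Rmult_le_compat; auto; apply Cmod_ge_0.
    - replace (B1 * W ^ 2 * (B2 * W ^ 2)) with (B1 * B2 * W ^ 2 * W ^ 2) by ring.
      assert (0 <= B1 * B2 * W ^ 2) by (apply Rmult_le_pos; lra). nra. }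
  eapply Rle_trans; [apply Cmod_triangle|].
  eapply Rle_trans; [apply Rplus_le_compat_r, Cmod_triangle|].
  eapply Rle_trans; [apply Rplus_le_compat_r, Rplus_le_compat_r, Cmod_triangle|].
  lra.
Qed.

Lemma Cdiff2_inv s : s <> RtoC 1 -> Cdiff2 (fun z => / (1 - z))%C s (/ ((1 - s) * (1 - s)))%C.
Proof.
  intros Hs. apply one_minus_neq0 in Hs.
  assert (P : 0 < Cmod (1 - s)) by (apply Cmod_gt_0; auto).
  set (p := Cmod (1 - s)) in *.
  exists (p / 2), (2 / (p * p * p)). split; [lra|].
  assert (P3 : 0 < p * p * p) by (repeat apply Rmult_lt_0_compat; auto).
  split; [apply Rdiv_le_0_compat; lra|].
  intros w Hw.
  assert (Hq : p / 2 <= Cmod (1 - (s + w))).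
  { pose proof (Cmod_triangle (1 - (s + w)) w) as T.
    replace (1 - (s + w) + w)%C with (1 - s)%C in T by ring. fold p in T. lra. }
  assert (Hn : (1 - (s + w))%C <> RtoC 0) by (apply Cmod_gt_0; lra).
  replace (/ (1 - (s + w)) - / (1 - s) - w * / ((1 - s) * (1 - s)))%C
    with (w * w / ((1 - s) * (1 - s) * (1 - (s + w))))%C by (field; auto).
  rewrite Cmod_div by (repeat apply Cmult_neq_0; auto).
  rewrite !Cmod_mult. fold p. set (q := Cmod (1 - (s + w))) in *.
  replace (2 / (p * p * p) * Cmod w ^ 2) with (Cmod w * Cmod w * / (p * p * (p / 2))) by (field; lra).
  unfold Rdiv. apply Rmult_le_compat_l; [pose proof (Cmod_ge_0 w); nra|].
  apply Rinv_le_contravar; [|apply Rmult_le_compat_l; nra].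
  apply Rmult_lt_0_compat; nra.
Qed.

Lemma ex_F : exists F : C -> C, forall s, 0 < Re s -> is_series (V := C_NormedModule) (Qs s) (F s).
Proof.
  exists (fun s => epsilon (inhabits (RtoC 0))
    (fun l => is_series (V := C_NormedModule) (Qs s) l)).
  intros s Hs. apply epsilon_spec, ex_series_Q, Hs.
Qed.

Lemma Cdiff2_F F s : (forall s, 0 < Re s -> is_series (V := C_NormedModule) (Qs s) (F s)) ->
  0 < Re s -> exists l, Cdiff2 (fun z => - z + F z)%C s l.
Proof.
  intros HF Hs.
  set (d := Rmin 1 (Re s / 4)).
  assert (Hd : 0 < d <= 1) by (split; [apply Rmin_glb_lt; lra|apply Rmin_l]).
  assert (Hd' : d <= Re s / 4) by apply Rmin_r.
  set (e := Re s / 4). assert (He : 0 < e) by (unfold e; lra).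
  destruct (Qd_bound s e d) as [B1 HB1]; auto; [unfold e; lra|].
  destruct (Q_taylor s e d) as [B [HB HT]]; auto; [unfold e; lra|].
  destruct (power_series_bounded e He) as [U [HU0 HU]].
  destruct (ex_series_C_bound (Qds s) B1 e He) as [D HD].
  { intros n. apply HB1, INR_S_ge1. }
  exists (- (1) + D)%C. exists d, (B * U). split; [lra|]. split; [nra|].
  intros w Hw.
  replace (- (s + w) + F (s + w) - (- s + F s) - w * (- (1) + D))%C
    with (F (s + w) - F s - w * D)%C by ring.
  assert (Hsw : 0 < Re (s + w)%C).
  { pose proof (re_le_Cmod w) as T. apply Rabs_le_between in T.
    unfold Re in *; simpl in *. lra. }
  assert (HS : is_series (V := C_NormedModule)
     (fun n => Qs (s + w) n - Qs s n - w * Qds s n)%C (F (s + w) - F s - w * D)%C).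
  { exact (is_series_minus _ _ _ _ (is_series_minus _ _ _ _ (HF _ Hsw) (HF _ Hs))
      (is_series_scal (V := C_NormedModule) w _ _ HD)). }
  replace (B * U * Cmod w ^ 2) with (B * Cmod w ^ 2 * U) by ring.
  apply (series_C_bound _ _ (B * Cmod w ^ 2) e U) in HS; auto.
  - apply Rmult_le_pos; auto. pose proof (Cmod_ge_0 w); nra.
  - intros n. apply HT; auto. apply INR_S_ge1.
Qed.

Lemma zeta_holomorphic (s : C) : 0 < Re s -> s <> RtoC 1 ->
  ex_derive (K := C_AbsRing) (V := C_NormedModule) zeta s.
Proof.
  intros Hs H1. destruct ex_F as [F HF].
  destruct (Cdiff2_F F s HF Hs) as [l Hl].
  pose proof (Cdiff2_mult _ _ _ _ _ Hl (Cdiff2_inv s H1)) as [d [B [Hd [HB HT]]]].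
  eexists. apply Cdiff2_ex_derive.
  pose proof (one_minus_neq0 s H1) as H2.
  assert (P : 0 < Cmod (1 - s)) by (apply Cmod_gt_0; auto).
  exists (Rmin d (Rmin (Re s / 2) (Cmod (1 - s) / 2))), B.
  split; [repeat apply Rmin_glb_lt; lra|]. split; auto.
  intros w Hw.
  pose proof (Rmin_l d (Rmin (Re s / 2) (Cmod (1 - s) / 2))).
  pose proof (Rmin_r d (Rmin (Re s / 2) (Cmod (1 - s) / 2))).
  pose proof (Rmin_l (Re s / 2) (Cmod (1 - s) / 2)).
  pose proof (Rmin_r (Re s / 2) (Cmod (1 - s) / 2)).
  assert (Z : forall z, 0 < Re z -> z <> RtoC 1 -> zeta z = ((- z + F z) * / (1 - z))%C).
  { intros z Hz Hz1. apply zeta_eq. apply (zeta_cvg z (F z)); auto. }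
  rewrite (Z s), (Z (s + w)%C); auto.
  - apply HT. lra.
  - pose proof (re_le_Cmod w) as T. apply Rabs_le_between in T.
    unfold Re in *; simpl in *. lra.
  - intros E. assert (E' : (1 - s)%C = w) by (rewrite <- E; ring).
    rewrite E' in *. lra.
Qed.

(* Main.v *)
(** Let [D(z) = sum (Lambda(n) - 1) z^n] and [m(z) = z / (1 - z)]. Then [D (D + 2 m)] is [1 - z] times the
    generating function of the error term of [G], so the hypothesis makes it small near the unit circle; by
    continuity along circles [D] is the small root, which gives cancellation in the smoothed sums
    [sum (Lambda(n) - 1) p(n tau)] with a Gamma kernel [p] of width about [1 / |t|]. A Mellin transform turns this
    into bounds for the Taylor coefficients of [zeta' / zeta] at [s0 = 1 + a + i t] with [a = M eta(log|t|)]: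
    the coefficients of index between about [M log|t|] and [(M + e) log|t|], scaled to the radius
    [a + (1 + nu) eta], are below a negative power of [|t|]. The kernel costs [|t|^4] and the scaling costs [|t|],
    which is why [C > 5] is needed. As [zeta] is close to a polynomial of degree [e log|t|] on that disc, a zero
    in [|s - s0| < a + eta] is impossible: on a circle where the polynomial is not too small, the argument
    principle (averaged over roots of unity) would count it. For this [varpi] enters only through
    [varpi(x) >= min (eta(u) log x, u)] with [u = log|t|]. The argument needs [eta -> 0] and [eta >= |t|^-e];
    if [eta] has a positive infimum, [zeta' / zeta] has a Taylor series converging beyond the disc,
    and if [eta < |t|^-e] the 3-4-1 inequality suffices. *)

Require Import Defs.
From Stdlib Require Import Reals Lra Lia ZArith Znumtheory.
From Stdlib Require Import Classical ClassicalEpsilon FunctionalExtensionality.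
From mathcomp Require all_boot all_order all_algebra qpoly complex Rstruct.
From Coquelicot Require Import Coquelicot.
Open Scope R_scope.

(** * Complex series *)

(** At a fixed height the hypothesis gives the relative error [N^-th + ka] with
    [th = C0 eta(log|t|)] and [ka = |t|^-C0]. Only a window of indices is. Scaled to radius
    [a + (1 + nu) eta], a part regular up to [a + C0 eta] has shrunk to about [|t|^-(C0-1)] at index
    [M log|t|]; the [ka] part, regular only up to [a], has grown by about [|t|] there and keeps
    growing; and [M] must be large for the trivially estimated range of [tau] to have died out.
    Hence a polynomial whose degree is below the length of the window; it approximates [zeta] well
    enough because [zeta] is bounded by a small power of [|t|] on a much larger disc. The factor
    [|t|^4] is [j^2], with [j] of order [|t|^2] so that [x^(i t)] is nearly constant on the kernel:
    its transform, of size [1/j], has to be divided out, and the estimate of [D] near the unit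
    circle loses another [j]. *)

Fixpoint Csum (a : nat -> C) (n : nat) : C :=
  match n with O => RtoC 0 | S k => (Csum a k + a k)%C end.

Fixpoint Rsum (a : nat -> R) (n : nat) : R :=
  match n with O => 0 | S k => Rsum a k + a k end.

(** A total sum: [epsilon] returns an arbitrary value for a divergent series, so facts about [CS a]
    come through [CS_unique], mostly after [dom_cv] has been given a summable real majorant. *)
Definition CS (a : nat -> C) : C := epsilon (inhabits (RtoC 0)) (fun l => Ccvg (Csum a) l).

Lemma Csum_ext a b n : (forall k, (k < n)%nat -> a k = b k) -> Csum a n = Csum b n.
Proof. induction n; intros H; simpl; [auto|]. rewrite IHn, H; auto. Qed.

Lemma Rsum_ext a b n : (forall k, (k < n)%nat -> a k = b k) -> Rsum a n = Rsum b n.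
Proof. induction n; intros H; simpl; [auto|]. rewrite IHn, H; auto. Qed.

Lemma Csum_plus a b n : Csum (fun k => a k + b k)%C n = (Csum a n + Csum b n)%C.
Proof. induction n; simpl; [ring|rewrite IHn; ring]. Qed.

Lemma Rsum_plus a b n : Rsum (fun k => a k + b k) n = Rsum a n + Rsum b n.
Proof. induction n; simpl; [ring|rewrite IHn; ring]. Qed.

Lemma Csum_scal c a n : Csum (fun k => c * a k)%C n = (c * Csum a n)%C.
Proof. induction n; simpl; [ring|rewrite IHn; ring]. Qed.

Lemma Rsum_scal c a n : Rsum (fun k => c * a k) n = c * Rsum a n.
Proof. induction n; simpl; [ring|rewrite IHn; ring]. Qed.

Lemma Csum_opp a n : Csum (fun k => - a k)%C n = (- Csum a n)%C.
Proof. induction n; simpl; [ring|rewrite IHn; ring]. Qed.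

Lemma Csum_0 n : Csum (fun _ => RtoC 0) n = RtoC 0.
Proof. induction n; simpl; [auto|rewrite IHn; ring]. Qed.

Lemma Csum_zero a n : (forall k, (k < n)%nat -> a k = RtoC 0) -> Csum a n = RtoC 0.
Proof. intros H. rewrite (Csum_ext _ (fun _ => RtoC 0)); auto. apply Csum_0. Qed.

Lemma Rsum_const c n : Rsum (fun _ => c) n = INR n * c.
Proof. induction n; [simpl; ring|]. rewrite S_INR; simpl; rewrite IHn; ring. Qed.

Lemma Rsum_le a b n : (forall k, (k < n)%nat -> a k <= b k) -> Rsum a n <= Rsum b n.
Proof.
  induction n; intros H; simpl; [lra|].
  apply Rplus_le_compat; [apply IHn; auto|apply H; auto].
Qed.

Lemma Rsum_nonneg a n : (forall k, (k < n)%nat -> 0 <= a k) -> 0 <= Rsum a n.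
Proof. intros H. rewrite <- (Rmult_0_r (INR n)), <- Rsum_const. apply Rsum_le; auto. Qed.

Lemma Cmod_Csum a n : Cmod (Csum a n) <= Rsum (fun k => Cmod (a k)) n.
Proof.
  induction n; simpl; [rewrite Cmod_0; lra|].
  eapply Rle_trans; [apply Cmod_triangle|]. lra.
Qed.

Lemma Cmod_Csum_le a M n : (forall k, (k < n)%nat -> Cmod (a k) <= M k) -> Cmod (Csum a n) <= Rsum M n.
Proof. intros H. eapply Rle_trans; [apply Cmod_Csum|]. apply Rsum_le; auto. Qed.

Lemma Csum_split a n m : Csum a (n + m) = (Csum a n + Csum (fun k => a (n + k)%nat) m)%C.
Proof.
  induction m; simpl; [rewrite Nat.add_0_r; ring|].
  rewrite Nat.add_succ_r. simpl. rewrite IHm. ring.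
Qed.

Lemma Rsum_split a n m : Rsum a (n + m) = Rsum a n + Rsum (fun k => a (n + k)%nat) m.
Proof.
  induction m; simpl; [rewrite Nat.add_0_r; ring|].
  rewrite Nat.add_succ_r. simpl. rewrite IHm. ring.
Qed.

Lemma Csum_S_l a n : Csum a (S n) = (a O + Csum (fun k => a (S k)) n)%C.
Proof. replace (S n) with (1 + n)%nat by lia. rewrite Csum_split. simpl. ring. Qed.

Lemma Rsum_S_l a n : Rsum a (S n) = a O + Rsum (fun k => a (S k)) n.
Proof. replace (S n) with (1 + n)%nat by lia. rewrite Rsum_split. simpl. ring. Qed.

Lemma Csum_swap (a : nat -> nat -> C) n m :
  Csum (fun i => Csum (a i) m) n = Csum (fun j => Csum (fun i => a i j) n) m.
Proof.
  induction n; simpl; [rewrite Csum_0; auto|].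
  rewrite IHn, <- Csum_plus. reflexivity.
Qed.

Lemma RtoC_Rsum a n : RtoC (Rsum a n) = Csum (fun k => RtoC (a k)) n.
Proof. induction n; simpl; auto. rewrite RtoC_plus, IHn. auto. Qed.

Lemma sum_n_Rsum a n : sum_n a n = Rsum a (S n).
Proof.
  induction n; [rewrite sum_O; simpl; symmetry; apply Rplus_0_l|].
  rewrite sum_Sn, IHn. reflexivity.
Qed.

Lemma sum_n_Csum a n : sum_n (G := C_AbelianGroup) a n = Csum a (S n).
Proof.
  induction n; [rewrite sum_O; simpl; symmetry; apply Cplus_0_l|].
  rewrite sum_Sn, IHn. reflexivity.
Qed.

Lemma Ccvg_lim u l : Ccvg u l <-> is_lim_seq (fun n => Cmod (u n - l)) 0.
Proof.
  rewrite <- is_lim_seq_spec. split.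
  - intros H [e He]. destruct (H e He) as [N HN]. exists N. intros n Hn. simpl.
    rewrite Rminus_0_r, Rabs_pos_eq by apply Cmod_ge_0. auto.
  - intros H e He. destruct (H (mkposreal e He)) as [N HN]. exists N. intros n Hn.
    specialize (HN n Hn). simpl in HN.
    rewrite Rminus_0_r, Rabs_pos_eq in HN by apply Cmod_ge_0. auto.
Qed.

Lemma Ccvg_squeeze u l e N : (forall n, (N <= n)%nat -> Cmod (u n - l) <= e n) ->
  is_lim_seq e 0 -> Ccvg u l.
Proof.
  intros H He. apply Ccvg_lim. apply (is_lim_seq_le_le_loc (fun _ => 0) _ e).
  - exists N. intros n Hn. split; [apply Cmod_ge_0|auto].
  - apply is_lim_seq_const.
  - exact He.
Qed.

Lemma Ccvg_const c : Ccvg (fun _ => c) c.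
Proof. intros e He. exists O. intros n _. replace (c - c)%C with (RtoC 0) by ring. rewrite Cmod_0; auto. Qed.

Lemma Ccvg_ext_loc u v l N : (forall n, (N <= n)%nat -> u n = v n) -> Ccvg u l -> Ccvg v l.
Proof.
  intros E H e He. destruct (H e He) as [M HM]. exists (N + M)%nat. intros n Hn.
  rewrite <- E by lia. apply HM. lia.
Qed.

Lemma Ccvg_ext u v l : (forall n, u n = v n) -> Ccvg u l -> Ccvg v l.
Proof. intros E. apply (Ccvg_ext_loc _ _ _ O). auto. Qed.

Lemma Ccvg_plus u v l m : Ccvg u l -> Ccvg v m -> Ccvg (fun n => u n + v n)%C (l + m)%C.
Proof.
  intros H1 H2. apply Ccvg_lim in H1. apply Ccvg_lim in H2.
  apply (Ccvg_squeeze _ _ (fun n => Cmod (u n - l) + Cmod (v n - m)) O).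
  - intros n _. replace (u n + v n - (l + m))%C with ((u n - l) + (v n - m))%C by ring.
    apply Cmod_triangle.
  - replace (Finite 0) with (Rbar_plus 0 0) by (simpl; f_equal; ring).
    apply is_lim_seq_plus'; auto.
Qed.

Lemma Ccvg_scal c u l : Ccvg u l -> Ccvg (fun n => c * u n)%C (c * l)%C.
Proof.
  intros H1. apply Ccvg_lim in H1.
  apply (Ccvg_squeeze _ _ (fun n => Cmod c * Cmod (u n - l)) O).
  - intros n _. replace (c * u n - c * l)%C with (c * (u n - l))%C by ring.
    rewrite Cmod_mult; lra.
  - replace (Finite 0) with (Rbar_mult (Cmod c) 0) by (simpl; f_equal; ring).
    apply is_lim_seq_scal_l; auto.
Qed.

Lemma Ccvg_opp u l : Ccvg u l -> Ccvg (fun n => - u n)%C (- l)%C.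
Proof.
  intros H. replace (- l)%C with (- (1) * l)%C by ring.
  apply (Ccvg_ext (fun n => - (1) * u n)%C); [intros; ring|]. apply Ccvg_scal; auto.
Qed.

Lemma Ccvg_minus u v l m : Ccvg u l -> Ccvg v m -> Ccvg (fun n => u n - v n)%C (l - m)%C.
Proof. intros H1 H2. apply Ccvg_plus; auto. apply Ccvg_opp; auto. Qed.

Lemma Ccvg_unique u l m : Ccvg u l -> Ccvg u m -> l = m.
Proof.
  intros H1 H2. apply injective_projections.
  - pose proof (is_lim_seq_unique _ _ (Ccvg_Re _ _ H1)) as E1.
    rewrite (is_lim_seq_unique _ _ (Ccvg_Re _ _ H2)) in E1. injection E1; auto.
  - pose proof (is_lim_seq_unique _ _ (Ccvg_Im _ _ H1)) as E1.
    rewrite (is_lim_seq_unique _ _ (Ccvg_Im _ _ H2)) in E1. injection E1; auto.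
Qed.

Lemma Ccvg_bound_loc u l M N : Ccvg u l -> (forall n, (N <= n)%nat -> Cmod (u n) <= M) -> Cmod l <= M.
Proof.
  intros H HM. apply (Ccvg_bound (fun n => u (N + n)%nat)).
  - intros e He. destruct (H e He) as [K HK]. exists K. intros n Hn. apply HK. lia.
  - intros n. apply HM. lia.
Qed.

Lemma Ccvg_S u l : Ccvg u l <-> Ccvg (fun n => u (S n)) l.
Proof.
  split; intros H e He; destruct (H e He) as [K HK].
  - exists K. intros n Hn. apply HK. lia.
  - exists (S K). intros [|n] Hn; [lia|]. apply HK. lia.
Qed.

Lemma CS_unique a l : Ccvg (Csum a) l -> CS a = l.
Proof.
  intros H. apply (Ccvg_unique (Csum a)); auto.
  unfold CS. apply epsilon_spec. exists l; auto.
Qed.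

Lemma CS_ext a b : (forall n, a n = b n) -> CS a = CS b.
Proof. intros H. f_equal. apply functional_extensionality; auto. Qed.

Lemma is_series_Ccvg a l : is_series (V := C_NormedModule) a l <-> Ccvg (Csum a) l.
Proof.
  rewrite Ccvg_series, (Ccvg_S (Csum a)). split; apply Ccvg_ext; intros n;
  rewrite sum_n_Csum; auto.
Qed.

Lemma Series_lim M : ex_series M -> is_lim_seq (Rsum M) (Series M).
Proof.
  intros H. apply (is_lim_seq_incr_1 (Rsum M)).
  apply (is_lim_seq_ext (sum_n M)); [intros; apply sum_n_Rsum|]. apply (Series_correct _ H).
Qed.

Lemma Rsum_le_Series M n : (forall n, 0 <= M n) -> ex_series M -> Rsum M n <= Series M.
Proof.
  intros H0 H. apply (is_lim_seq_incr_compare (Rsum M)); [apply Series_lim; auto|].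
  intros k. simpl. specialize (H0 k). lra.
Qed.

Lemma ex_series_Rsum_bound M B : (forall n, 0 <= M n) -> (forall n, Rsum M n <= B) ->
  ex_series M /\ Series M <= B.
Proof.
  intros H0 HB.
  assert (X : ex_finite_lim_seq (Rsum M)).
  { apply (ex_finite_lim_seq_incr _ B); auto. intros n; simpl; specialize (H0 n); lra. }
  destruct X as [l Hl].
  assert (Hs : is_series M l).
  { change (is_lim_seq (sum_n M) l).
    apply (is_lim_seq_ext (fun n => Rsum M (S n))); [intros; symmetry; apply sum_n_Rsum|].
    apply -> (is_lim_seq_incr_1 (Rsum M)); auto. }
  split; [exists l; auto|]. rewrite (is_series_unique _ _ Hs).
  exact (is_lim_seq_le (Rsum M) (fun _ => B) l B HB Hl (is_lim_seq_const B)).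
Qed.

Lemma dom_cv a M : (forall n, Cmod (a n) <= M n) -> ex_series M -> Ccvg (Csum a) (CS a).
Proof.
  intros H HM.
  destruct (@ex_series_le C_AbsRing C_CompleteNormedModule a M) as [l Hl]; auto.
  apply is_series_Ccvg in Hl. rewrite (CS_unique _ _ Hl). auto.
Qed.

Lemma dom_tail a M n : (forall n, Cmod (a n) <= M n) -> ex_series M ->
  Cmod (CS a - Csum a n) <= Series M - Rsum M n.
Proof.
  intros H HM.
  assert (P : forall n, 0 <= M n) by (intros k; eapply Rle_trans; [apply Cmod_ge_0|apply H]).
  apply (Ccvg_bound_loc (fun m => Csum a m - Csum a n)%C _ _ n).
  - apply Ccvg_minus; [apply (dom_cv _ M); auto|apply Ccvg_const].
  - intros m Hm. replace m with (n + (m - n))%nat by lia.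
    rewrite Csum_split. replace (Csum a n + Csum (fun k => a (n + k)%nat) (m - n) - Csum a n)%C
      with (Csum (fun k => a (n + k)%nat) (m - n)) by ring.
    eapply Rle_trans; [apply (Cmod_Csum_le _ (fun k => M (n + k)%nat)); auto|].
    pose proof (Rsum_le_Series M (n + (m - n)) P HM) as T. rewrite Rsum_split in T. lra.
Qed.

Lemma dom_bound a M : (forall n, Cmod (a n) <= M n) -> ex_series M -> Cmod (CS a) <= Series M.
Proof.
  intros H HM. pose proof (dom_tail a M O H HM) as T. simpl in T.
  replace (CS a - 0)%C with (CS a) in T by ring. lra.
Qed.

(** Dominated convergence for series. A cut-off [K] makes the tails of all the series smaller than
    [e / 4] at once, and the finitely many remaining terms converge. The limit passages under an
    infinite sum below rest on it. *)
Lemma tannery (a : nat -> nat -> C) (b : nat -> C) (M : nat -> R) :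
  (forall N n, Cmod (a N n) <= M n) -> ex_series M ->
  (forall n, Ccvg (fun N => a N n) (b n)) ->
  Ccvg (fun N => CS (a N)) (CS b).
Proof.
  intros H HM Hc.
  assert (Hb : forall n, Cmod (b n) <= M n).
  { intros n. apply (Ccvg_bound _ _ _ (Hc n)). auto. }
  intros e He.
  pose proof (Series_lim M HM) as L. apply is_lim_seq_spec in L.
  destruct (L (mkposreal (e / 4) ltac:(lra))) as [K HK]. specialize (HK K (le_n _)).
  simpl in HK. apply Rabs_lt_between in HK.
  assert (Hf : Ccvg (fun N => Csum (a N) K) (Csum b K)).
  { clear -Hc. induction K; simpl; [apply Ccvg_const|]. apply Ccvg_plus; auto. }
  destruct (Hf (e / 4)) as [N HN]; [lra|].
  exists N. intros n Hn. specialize (HN n Hn).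
  pose proof (dom_tail (a n) M K (H n) HM) as T1.
  pose proof (dom_tail b M K Hb HM) as T2.
  replace (CS (a n) - CS b)%C with
    ((CS (a n) - Csum (a n) K) + ((Csum (a n) K - Csum b K) + - (CS b - Csum b K)))%C by ring.
  eapply Rle_lt_trans; [apply Cmod_triangle|].
  eapply Rle_lt_trans; [apply Rplus_le_compat_l, Cmod_triangle|]. rewrite Cmod_opp. lra.
Qed.

Lemma CS_finite a K : (forall n, (K <= n)%nat -> a n = RtoC 0) -> CS a = Csum a K.
Proof.
  intros H. apply CS_unique. apply (Ccvg_ext_loc (fun _ => Csum a K) _ _ K); [|apply Ccvg_const].
  intros n Hn. replace n with (K + (n - K))%nat by lia. rewrite Csum_split.
  rewrite (Csum_zero (fun k => a (K + k)%nat)); [ring|]. intros; apply H; lia.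
Qed.

Lemma CS_plus a b Ma Mb : (forall n, Cmod (a n) <= Ma n) -> ex_series Ma ->
  (forall n, Cmod (b n) <= Mb n) -> ex_series Mb ->
  CS (fun n => a n + b n)%C = (CS a + CS b)%C.
Proof.
  intros. apply CS_unique. apply (Ccvg_ext (fun n => Csum a n + Csum b n)%C).
  - intros; rewrite Csum_plus; auto.
  - apply Ccvg_plus; eapply dom_cv; eauto.
Qed.

Lemma CS_scal c a M : (forall n, Cmod (a n) <= M n) -> ex_series M ->
  CS (fun n => c * a n)%C = (c * CS a)%C.
Proof.
  intros. apply CS_unique. apply (Ccvg_ext (fun n => c * Csum a n)%C).
  - intros; rewrite Csum_scal; auto.
  - apply Ccvg_scal. eapply dom_cv; eauto.
Qed.

Lemma CS_Csum (a : nat -> nat -> C) (M : nat -> nat -> R) K :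
  (forall i n, (i < K)%nat -> Cmod (a i n) <= M i n) -> (forall i, (i < K)%nat -> ex_series (M i)) ->
  CS (fun n => Csum (fun i => a i n) K) = Csum (fun i => CS (a i)) K.
Proof.
  intros H HM. apply CS_unique.
  apply (Ccvg_ext (fun n => Csum (fun i => Csum (a i) n) K)); [intros; apply Csum_swap|].
  assert (X : forall i, (i < K)%nat -> Ccvg (Csum (a i)) (CS (a i))) by (intros; eapply dom_cv; eauto).
  clear -X. induction K; simpl; [apply Ccvg_const|]. apply Ccvg_plus; auto.
Qed.

Lemma CS_S_l a M : (forall n, Cmod (a n) <= M n) -> ex_series M ->
  CS a = (a O + CS (fun n => a (S n)))%C.
Proof.
  intros H HM. symmetry. apply (Ccvg_unique (fun n => Csum a (S n))).
  - apply (Ccvg_ext (fun n => a O + Csum (fun k => a (S k)) n)%C); [intros; rewrite Csum_S_l; auto|].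
    apply Ccvg_plus; [apply Ccvg_const|]. apply (dom_cv _ (fun n => M (S n))); auto.
    apply (ex_series_incr_1 M); auto.
  - apply -> (Ccvg_S (Csum a)). eapply dom_cv; eauto.
Qed.

Lemma ex_series_ext' (a b : nat -> R) : (forall n, a n = b n) -> ex_series a -> ex_series b.
Proof. apply ex_series_ext. Qed.

Lemma ex_series_scal' (c : R) (a : nat -> R) : ex_series a -> ex_series (fun n => c * a n).
Proof. intros H. apply (@ex_series_scal R_AbsRing R_NormedModule c a H). Qed.

Lemma ex_series_plus' (a b : nat -> R) : ex_series a -> ex_series b -> ex_series (fun n => a n + b n).
Proof. intros H K. apply (@ex_series_plus R_AbsRing R_NormedModule a b H K). Qed.

Lemma ex_series_dom (a b : nat -> R) : (forall n, 0 <= a n <= b n) -> ex_series b -> ex_series a.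
Proof.
  intros H. apply (@ex_series_le R_AbsRing R_CompleteNormedModule a b).
  intros n. change (norm (a n)) with (Rabs (a n)). specialize (H n). rewrite Rabs_pos_eq; lra.
Qed.

Lemma ex_series_S (a : nat -> R) : ex_series a <-> ex_series (fun n => a (S n)).
Proof. apply (@ex_series_incr_1 R_AbsRing R_NormedModule). Qed.

Lemma Csum_cauchy_product a b K :
  Csum (fun N => Csum (fun m => a m * b (N - m)%nat)%C (S N)) K
  = Csum (fun m => a m * Csum b (K - m))%C K.
Proof.
  induction K; [auto|].
  change (Csum ?f (S K)) with (Csum f K + f K)%C. cbv beta. rewrite IHK.
  change (Csum (fun m => a m * b (K - m)%nat)%C (S K))
    with (Csum (fun m => a m * b (K - m)%nat)%C K + a K * b (K - K)%nat)%C.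
  rewrite Cplus_assoc, <- Csum_plus. f_equal.
  - apply Csum_ext. intros m Hm. replace (S K - m)%nat with (S (K - m)) by lia. simpl. ring.
  - replace (S K - K)%nat with 1%nat by lia. rewrite Nat.sub_diag. simpl. ring.
Qed.

(** The triangular partial sums become series in [m] alone with inner sum [Csum b (K - m)].
    Truncated subtraction makes the terms with [m >= K] vanish, so [tannery] applies as [K]
    grows. *)
Lemma CS_cauchy_product a b Ma Mb : (forall n, Cmod (a n) <= Ma n) -> ex_series Ma ->
  (forall n, Cmod (b n) <= Mb n) -> ex_series Mb ->
  Ccvg (Csum (fun N => Csum (fun m => a m * b (N - m)%nat)%C (S N))) (CS a * CS b)%C.
Proof.
  intros Ha HMa Hb HMb.
  assert (Pb : forall n, 0 <= Mb n) by (intros k; eapply Rle_trans; [apply Cmod_ge_0|apply Hb]).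
  replace (CS a * CS b)%C with (CS (fun m => a m * CS b)%C).
  2:{ rewrite (CS_ext _ (fun m => CS b * a m)%C) by (intros; ring).
      rewrite (CS_scal _ _ Ma); auto. ring. }
  apply (Ccvg_ext (fun K => CS (fun m => a m * Csum b (K - m))%C)).
  { intros K. rewrite Csum_cauchy_product. apply CS_finite.
    intros n Hn. replace (K - n)%nat with O by lia. simpl. ring. }
  apply (tannery _ _ (fun m => Series Mb * Ma m)).
  - intros N n. rewrite Cmod_mult, Rmult_comm. apply Rmult_le_compat; auto using Cmod_ge_0.
    eapply Rle_trans; [apply (Cmod_Csum_le _ Mb); auto|]. apply Rsum_le_Series; auto.
  - apply ex_series_scal'; auto.
  - intros n. apply Ccvg_scal. intros e He.
    destruct (dom_cv b Mb Hb HMb e He) as [N HN]. exists (N + n)%nat. intros k Hk. apply HN. lia.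
Qed.

(** * Taylor series of the complex exponential *)

Lemma Rabs_le_of_deriv (f df g dg : R -> R) (b : R) : 0 <= b ->
  (forall x, 0 <= x <= b -> is_derive f x (df x)) ->
  (forall x, 0 <= x <= b -> is_derive g x (dg x)) ->
  (forall x, 0 <= x <= b -> Rabs (df x) <= dg x) ->
  Rabs (f b - f 0) <= g b - g 0.
Proof.
  intros Hb Hf Hg H.
  assert (A : forall h dh : R -> R, (forall x, 0 <= x <= b -> is_derive h x (dh x)) ->
     (forall x, 0 <= x <= b -> 0 <= dh x) -> h 0 <= h b).
  { intros h dh Hh Hp. destruct (MVT_gen h 0 b dh) as [c [Hc E]].
    - rewrite Rmin_left, Rmax_right by auto. intros; apply Hh; lra.
    - rewrite Rmin_left, Rmax_right by auto. intros x Hx. apply continuity_pt_filterlim.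
      apply (@ex_derive_continuous R_AbsRing R_NormedModule). exists (dh x); auto.
    - rewrite Rmin_left, Rmax_right in Hc by auto. specialize (Hp c Hc). nra. }
  assert (A1 := A (fun x => g x - f x) (fun x => dg x - df x)).
  assert (A2 := A (fun x => g x + f x) (fun x => dg x + df x)).
  cbv beta in A1, A2. apply Rabs_le.
  assert (g 0 - f 0 <= g b - f b).
  { apply A1; intros x Hx; specialize (H x Hx); [apply @is_derive_minus; auto|].
    apply Rabs_le_between in H. lra. }
  assert (g 0 + f 0 <= g b + f b).
  { apply A2; intros x Hx; specialize (H x Hx); [apply @is_derive_plus; auto|].
    apply Rabs_le_between in H. lra. }
  lra.
Qed.

Lemma Cmod_le_2max (z : C) (M : R) : Rabs (Re z) <= M -> Rabs (Im z) <= M -> Cmod z <= 2 * M.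
Proof. intros. pose proof (Cmod_le_sum z). lra. Qed.

Definition expt (z : C) (k : nat) : C := (z ^ k * RtoC (/ INR (fact k)))%C.

Lemma Cmod_expt z k : Cmod (expt z k) = Cmod z ^ k / INR (fact k).
Proof.
  unfold expt. rewrite Cmod_mult, Cmod_pow, Cmod_R, Rabs_pos_eq; auto.
  left; apply Rinv_0_lt_compat, INR_fact_lt_0.
Qed.

Lemma Cder_expt_sum z n x :
  Cder (fun y => Csum (expt (z * RtoC y)) (S n)) x (z * Csum (expt (z * RtoC x)) n)%C.
Proof.
  induction n.
  - simpl. eapply Cder_eq; [|instantiate (1 := RtoC 0); ring].
    split; (eapply is_derive_ext; [|apply (@is_derive_const R_AbsRing R_NormedModule)]);
    intros t; simpl; reflexivity.
  - assert (D : Cder (fun y => expt (z * RtoC y) (S n)) x (z * expt (z * RtoC x) n)%C).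
    { assert (D : Cder (fun y => (z ^ S n * RtoC (/ INR (fact (S n)))) * RtoC (y ^ S n))%C x
         (0 * RtoC (x ^ S n) + (z ^ S n * RtoC (/ INR (fact (S n)))) * RtoC (INR (S n) * x ^ n))%C).
      { apply (Cder_mult (fun _ => z ^ S n * RtoC (/ INR (fact (S n))))%C (fun y => RtoC (y ^ S n)));
          [apply Cder_const|]. apply Cder_RtoC.
        apply is_derive_Reals. exact (derivable_pt_lim_pow x (S n)). }
      assert (E : (0 * RtoC (x ^ S n) + (z ^ S n * RtoC (/ INR (fact (S n)))) * RtoC (INR (S n) * x ^ n))%C
        = (z * expt (z * RtoC x) n)%C).
      { unfold expt. rewrite Cpow_mult_l, <- RtoC_pow.
        replace (RtoC (/ INR (fact n))) with (RtoC (/ INR (fact (S n))) * RtoC (INR (S n)))%C.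
        - rewrite RtoC_mult, Cpow_S. ring.
        - rewrite <- RtoC_mult. f_equal. rewrite fact_simpl, mult_INR. field.
          split; [apply INR_fact_neq_0|apply not_0_INR; lia]. }
      rewrite E in D. clear E.
      destruct D as [D1 D2]. split.
      - eapply is_derive_ext; [|exact D1]. intros y. cbv beta. f_equal. unfold expt.
        rewrite Cpow_mult_l, <- RtoC_pow. ring.
      - eapply is_derive_ext; [|exact D2]. intros y. cbv beta. f_equal. unfold expt.
        rewrite Cpow_mult_l, <- RtoC_pow. ring. }
    eapply Cder_eq; [exact (Cder_plus (fun y => Csum (expt (z * RtoC y)) (S n)) _ x _ _ IHn D)|].
    simpl. ring.
Qed.

(** Induction on [n] by integrating the previous remainder. Real and imaginary parts are bounded
    separately, which doubles the constant at each integration; the resulting [2 ^ n] is harmless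
    against the factorial. *)
Lemma Cexp_remainder z n x : 0 <= x <= 1 ->
  Cmod (Cexp (z * RtoC x) - Csum (expt (z * RtoC x)) n)
  <= 2 ^ n * exp (Cmod z) * (Cmod z * x) ^ n / INR (fact n).
Proof.
  revert x. induction n; intros x Hx.
  - simpl. replace (Cexp (z * RtoC x) - 0)%C with (Cexp (z * RtoC x)) by ring.
    rewrite Cmod_exp. unfold Rdiv. rewrite Rmult_1_l, Rinv_1, !Rmult_1_r. apply exp_le.
    eapply Rle_trans; [apply Re_le_Cmod'|]. rewrite Cmod_mult, Cmod_R, Rabs_pos_eq by lra.
    pose proof (Cmod_ge_0 z). nra.
  - set (r := fun y => (Cexp (z * RtoC y) - Csum (expt (z * RtoC y)) (S n))%C).
    set (dr := fun y => (z * (Cexp (z * RtoC y) - Csum (expt (z * RtoC y)) n))%C).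
    assert (Hr : forall y, Cder r y (dr y)).
    { intros y. eapply Cder_eq.
      - apply Cder_minus; [|apply Cder_expt_sum].
        exact (Cder_Cexp z (fun t => t) y 1 (@is_derive_id R_AbsRing y)).
      - unfold dr. cbv beta. ring. }
    set (K := 2 ^ n * exp (Cmod z) * Cmod z ^ S n / INR (fact (S n))).
    assert (HK : 0 <= K).
    { unfold K. apply Rdiv_le_0_compat; [|apply INR_fact_lt_0].
      apply Rmult_le_pos; [apply Rmult_le_pos; [apply pow_le; lra|left; apply exp_pos]|].
      apply pow_le, Cmod_ge_0. }
    assert (B : forall y, 0 <= y <= x -> Cmod (dr y) <= K * (INR (S n) * y ^ n)).
    { intros y Hy. unfold dr. rewrite Cmod_mult. specialize (IHn y ltac:(lra)).
      eapply Rle_trans; [apply Rmult_le_compat_l; [apply Cmod_ge_0|apply IHn]|].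
      apply Req_le. unfold K. rewrite Rpow_mult_distr, fact_simpl, mult_INR. simpl (Cmod z ^ S n).
      field. split; [apply INR_fact_neq_0|apply not_0_INR; lia]. }
    assert (G : forall y, is_derive (fun y => K * y ^ S n) y (K * (INR (S n) * y ^ n))).
    { intros y. apply is_derive_scal. apply is_derive_Reals.
      exact (derivable_pt_lim_pow y (S n)). }
    assert (Z0 : r 0 = RtoC 0).
    { unfold r. replace (z * 0)%C with (RtoC 0) by ring. rewrite Cexp_0, Csum_S_l.
      rewrite (Csum_zero _ n); [unfold expt; simpl; rewrite Rinv_1; ring|].
      intros k _. unfold expt. rewrite Cpow_S. ring. }
    assert (B1 := Rabs_le_of_deriv (fun y => Re (r y)) (fun y => Re (dr y))
      (fun y => K * y ^ S n) (fun y => K * (INR (S n) * y ^ n)) x ltac:(lra)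
      (fun y _ => proj1 (Hr y)) (fun y _ => G y)
      (fun y Hy => Rle_trans _ _ _ (re_le_Cmod _) (B y Hy))).
    assert (B2 := Rabs_le_of_deriv (fun y => Im (r y)) (fun y => Im (dr y))
      (fun y => K * y ^ S n) (fun y => K * (INR (S n) * y ^ n)) x ltac:(lra)
      (fun y _ => proj2 (Hr y)) (fun y _ => G y)
      (fun y Hy => Rle_trans _ _ _ (Im_le_Cmod _) (B y Hy))).
    cbv beta in B1, B2. rewrite Z0 in B1, B2. simpl (Re 0) in B1. simpl (Im 0) in B2.
    rewrite pow_i in B1, B2 by lia. rewrite Rmult_0_r, !Rminus_0_r in B1, B2.
    eapply Rle_trans; [apply (Cmod_le_2max (r x)); eauto|].
    apply Req_le. unfold K. rewrite Rpow_mult_distr. simpl (2 ^ S n). field. apply INR_fact_neq_0.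
Qed.

Lemma pow_fact_lim (x : R) : is_lim_seq (fun n => x ^ n / INR (fact n)) 0.
Proof.
  apply is_lim_seq_Reals. intros e He. destruct (cv_speed_pow_fact x e He) as [N HN].
  exists N. apply HN.
Qed.

Lemma ex_series_exp x : ex_series (fun k => x ^ k / INR (fact k)).
Proof.
  exists (exp x). apply (is_series_ext (fun k => / INR (fact k) * x ^ k)).
  - intros n; apply Rmult_comm.
  - apply is_pseries_R. apply is_exp_Reals.
Qed.

Lemma Series_exp x : Series (fun k => x ^ k / INR (fact k)) = exp x.
Proof.
  apply is_series_unique. apply (is_series_ext (fun k => / INR (fact k) * x ^ k)).
  - intros n; apply Rmult_comm.
  - apply is_pseries_R. apply is_exp_Reals.
Qed.

Lemma Cexp_series z : CS (expt z) = Cexp z.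
Proof.
  apply CS_unique. apply (Ccvg_squeeze _ _ (fun n => exp (Cmod z) * ((2 * Cmod z) ^ n / INR (fact n))) O).
  - intros n _. pose proof (Cexp_remainder z n 1 ltac:(lra)) as H.
    replace (z * 1)%C with z in H by ring.
    replace (Csum (expt z) n - Cexp z)%C with (- (Cexp z - Csum (expt z) n))%C by ring.
    rewrite Cmod_opp. eapply Rle_trans; [apply H|]. apply Req_le.
    rewrite Rmult_1_r, (Rpow_mult_distr 2). field. apply INR_fact_neq_0.
  - replace (Finite 0) with (Rbar_mult (exp (Cmod z)) 0) by (simpl; f_equal; ring).
    apply is_lim_seq_scal_l, pow_fact_lim.
Qed.

(** * Averages over roots of unity *)

Definition cis (x : R) : C := (cos x, sin x).

Lemma cis_plus x y : cis (x + y) = (cis x * cis y)%C.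
Proof. unfold cis. rewrite cos_plus, sin_plus. apply injective_projections; simpl; ring. Qed.

Lemma cis_0 : cis 0 = 1%C.
Proof. unfold cis. rewrite cos_0, sin_0. reflexivity. Qed.

Lemma cis_pow x n : (cis x ^ n)%C = cis (INR n * x).
Proof.
  induction n; [simpl; rewrite Rmult_0_l, cis_0; auto|].
  rewrite Cpow_S, IHn, S_INR, Rmult_plus_distr_r, Rmult_1_l, cis_plus. ring.
Qed.

Lemma Cmod_cis x : Cmod (cis x) = 1.
Proof.
  unfold Cmod, cis; simpl. pose proof (sin2_cos2 x) as H. unfold Rsqr in H.
  replace (cos x * (cos x * 1) + sin x * (sin x * 1)) with 1 by lra. apply sqrt_1.
Qed.

Lemma cis_2PI_nat n : cis (2 * PI * INR n) = 1%C.
Proof.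
  unfold cis. replace (2 * PI * INR n) with (0 + 2 * INR n * PI) by ring.
  rewrite cos_period, sin_period, cos_0, sin_0. auto.
Qed.

Lemma cis_neg_nat n : cis (- (2 * PI * INR n)) = 1%C.
Proof.
  pose proof (cis_plus (2 * PI * INR n) (- (2 * PI * INR n))) as H.
  rewrite Rplus_opp_r, cis_0, cis_2PI_nat in H. rewrite H. ring.
Qed.

Lemma cis_neq_1 x : 0 < Rabs x < 2 * PI -> cis x <> 1%C.
Proof.
  assert (A : forall x, 0 < x < 2 * PI -> cos x <> 1).
  { intros y Hy E. replace y with (2 * (y / 2)) in E by field. rewrite cos_2a_sin in E.
    pose proof (sin_gt_0 (y / 2) ltac:(lra) ltac:(lra)). nra. }
  intros H E. injection E as E1 _. unfold Rabs in H. destruct (Rcase_abs x).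
  - apply (A (- x)); auto. rewrite cos_neg; auto.
  - apply (A x); auto.
Qed.

Lemma Csum_geom q n : ((1 - q) * Csum (fun l => q ^ l) n = 1 - q ^ n)%C.
Proof.
  induction n; [simpl; ring|].
  change (Csum (fun l => q ^ l)%C (S n)) with (Csum (fun l => q ^ l) n + q ^ n)%C.
  rewrite Cmult_plus_distr_l, IHn, Cpow_S. ring.
Qed.

(** [rou N l] runs through the [N]-th roots of unity and [rouV N l] is its inverse, named so that
    negative powers become natural powers. [avg] plays the role of a contour integral over a
    circle. *)
Definition rou (N l : nat) : C := cis (2 * PI * INR l / INR N).
Definition rouV (N l : nat) : C := cis (- (2 * PI * INR l / INR N)).
Definition avg (N : nat) (f : nat -> C) : C := (RtoC (/ INR N) * Csum f N)%C.

Lemma Cmod_rou N l : Cmod (rou N l) = 1. Proof. apply Cmod_cis. Qed.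
Lemma Cmod_rouV N l : Cmod (rouV N l) = 1. Proof. apply Cmod_cis. Qed.

Lemma rou_pow_N N l : (0 < N)%nat -> (rou N l ^ N)%C = 1%C.
Proof.
  intros H. unfold rou. rewrite cis_pow.
  replace (INR N * (2 * PI * INR l / INR N)) with (2 * PI * INR l) by (field; apply not_0_INR; lia).
  apply cis_2PI_nat.
Qed.

Lemma avg_bound N f B : (0 < N)%nat -> (forall l, (l < N)%nat -> Cmod (f l) <= B) -> Cmod (avg N f) <= B.
Proof.
  intros HN H. assert (P : 0 < INR N) by (apply lt_0_INR; auto).
  unfold avg. rewrite Cmod_mult, Cmod_R, Rabs_pos_eq by (left; apply Rinv_0_lt_compat; auto).
  assert (Cmod (Csum f N) <= INR N * B).
  { rewrite <- Rsum_const. apply Cmod_Csum_le; auto. }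
  apply Rmult_le_reg_l with (INR N); auto. rewrite <- Rmult_assoc, Rinv_r, Rmult_1_l by lra. auto.
Qed.

Lemma avg_const N c : (0 < N)%nat -> avg N (fun _ => c) = c.
Proof.
  intros HN. assert (P : 0 < INR N) by (apply lt_0_INR; auto). unfold avg.
  assert (E : forall n, Csum (fun _ => c) n = (RtoC (INR n) * c)%C).
  { induction n; [simpl; ring|]. rewrite S_INR, RtoC_plus. simpl. rewrite IHn. ring. }
  rewrite E, Cmult_assoc, <- RtoC_mult, Rinv_l by lra. ring.
Qed.

Lemma avg_ext N f g : (forall l, (l < N)%nat -> f l = g l) -> avg N f = avg N g.
Proof. intros H. unfold avg. f_equal. apply Csum_ext; auto. Qed.

Lemma avg_plus N f g : avg N (fun l => f l + g l)%C = (avg N f + avg N g)%C.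
Proof. unfold avg. rewrite Csum_plus. ring. Qed.

Lemma avg_scal N c f : avg N (fun l => c * f l)%C = (c * avg N f)%C.
Proof. unfold avg. rewrite Csum_scal. ring. Qed.

Lemma avg_Csum N (f : nat -> nat -> C) K :
  avg N (fun l => Csum (fun k => f k l) K) = Csum (fun k => avg N (f k)) K.
Proof.
  unfold avg. rewrite Csum_scal. f_equal. rewrite Csum_swap. reflexivity.
Qed.

(** A geometric sum whose ratio is an [N]-th root of unity; [k] and [j] being different and below
    [N] makes the ratio differ from 1. *)
Lemma avg_char N k j : (k < N)%nat -> (j < N)%nat -> k <> j ->
  avg N (fun l => rou N l ^ k * rouV N l ^ j)%C = RtoC 0.
Proof.
  intros Hk Hj Hkj. assert (P : 0 < INR N) by (apply lt_0_INR; lia).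
  set (q := cis (2 * PI * (INR k - INR j) / INR N)).
  unfold avg. rewrite (Csum_ext _ (fun l => q ^ l)%C).
  - assert (Q : q <> 1%C).
    { apply cis_neq_1. unfold Rdiv. rewrite !Rabs_mult, Rabs_inv, (Rabs_pos_eq (INR N)) by lra.
      pose proof PI_RGT_0. rewrite (Rabs_pos_eq 2), (Rabs_pos_eq PI) by lra.
      assert (0 < Rabs (INR k - INR j) < INR N).
      { apply lt_INR in Hk. apply lt_INR in Hj. pose proof (pos_INR k). pose proof (pos_INR j).
        assert (INR k <> INR j) by (intros E; apply INR_eq in E; auto).
        split; [apply Rabs_pos_lt; lra|]. apply Rabs_def1; lra. }
      split.
      - apply Rmult_lt_0_compat; [nra|apply Rinv_0_lt_compat; auto].
      - apply Rmult_lt_reg_r with (INR N); auto. rewrite Rmult_assoc, Rinv_l by lra. nra. }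
    pose proof (Csum_geom q N) as G.
    replace (q ^ N)%C with (RtoC 1) in G.
    2:{ unfold q. rewrite cis_pow.
        replace (INR N * (2 * PI * (INR k - INR j) / INR N)) with (2 * PI * INR k + - (2 * PI * INR j))
          by (field; lra).
        rewrite cis_plus, cis_2PI_nat, cis_neg_nat. ring. }
    assert (Q1 : (1 - q)%C <> RtoC 0) by (intros E; apply Q; replace q with (1 - (1 - q))%C by ring; rewrite E; ring).
    replace (Csum (fun l => q ^ l)%C N) with (RtoC 0); [ring|].
    replace (RtoC 0) with (/ (1 - q) * (1 - 1))%C by ring.
    rewrite <- G. field. auto.
  - intros l _. unfold rou, rouV, q. rewrite !cis_pow, <- cis_plus. f_equal. field. lra.
Qed.

Lemma avg_char_same N j : (0 < N)%nat -> avg N (fun l => rou N l ^ j * rouV N l ^ j)%C = RtoC 1.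
Proof.
  intros H. rewrite (avg_ext _ _ (fun _ => RtoC 1)); [apply avg_const; auto|].
  intros l _. rewrite <- Cpow_mult_l. unfold rou, rouV.
  rewrite <- cis_plus, Rplus_opp_r, cis_0. apply Cpow_1_l.
Qed.

(** * Power series on a closed disc *)

Definition Ana (R : R) (f : C -> C) (c : nat -> C) : Prop :=
  ex_series (fun k => Cmod (c k) * R ^ k) /\
  forall w, Cmod w <= R -> f w = CS (fun k => c k * w ^ k)%C.

Lemma Ana_term_bound (c : nat -> C) R w k : Cmod w <= R -> Cmod (c k * w ^ k) <= Cmod (c k) * R ^ k.
Proof.
  intros H. rewrite Cmod_mult, Cmod_pow. apply Rmult_le_compat_l; [apply Cmod_ge_0|].
  apply pow_incr. split; [apply Cmod_ge_0|auto].
Qed.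

(** For [N > k + j] the average against [rouV ^ j] kills the [k]-th term unless [k = j], and
    [tannery] lets [N] tend to infinity under the sum. This replaces Cauchy's integral formula for
    coefficients. *)
Lemma coef_extract R f c j : 0 <= R -> Ana R f c ->
  Ccvg (fun N => avg N (fun l => f (RtoC R * rou N l)%C * rouV N l ^ j)%C) (c j * RtoC R ^ j)%C.
Proof.
  intros HR [Hs Hf].
  set (A := fun N k => avg N (fun l => rou N l ^ k * rouV N l ^ j)%C).
  apply Ccvg_S.
  apply (Ccvg_ext (fun N => CS (fun k => c k * RtoC R ^ k * A (S N) k)%C)).
  - intros N. unfold A. symmetry.
    transitivity (avg (S N) (fun l => CS (fun k => (c k * RtoC R ^ k) * (rou (S N) l ^ k * rouV (S N) l ^ j))%C)).
    + apply avg_ext. intros l _.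
      assert (W : Cmod (RtoC R * rou (S N) l) <= R).
      { rewrite Cmod_mult, Cmod_R, Cmod_rou, Rabs_pos_eq; lra. }
      rewrite Hf by exact W. rewrite Cmult_comm, <- (CS_scal _ _ (fun k => Cmod (c k) * R ^ k)); auto.
      * apply CS_ext. intros k. rewrite Cpow_mult_l. ring.
      * intros k. apply Ana_term_bound; auto.
    + unfold avg at 1.
      rewrite <- (CS_Csum (fun l k => (c k * RtoC R ^ k) * (rou (S N) l ^ k * rouV (S N) l ^ j))%C
        (fun _ k => Cmod (c k) * R ^ k)); auto.
      2:{ intros l k _. rewrite !Cmod_mult, !Cmod_pow, Cmod_R, Cmod_rou, Cmod_rouV, !pow1, (Rabs_pos_eq R); lra. }
      rewrite <- (CS_scal _ _ (fun k => INR (S N) * (Cmod (c k) * R ^ k))).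
      * apply CS_ext. intros k. rewrite Csum_scal. unfold avg. ring.
      * intros k. rewrite <- Rsum_const. apply Cmod_Csum_le. intros l _.
        rewrite !Cmod_mult, !Cmod_pow, Cmod_R, Cmod_rou, Cmod_rouV, !pow1, (Rabs_pos_eq R); lra.
      * apply ex_series_scal'; auto.
  - assert (E : CS (fun k => if Nat.eq_dec k j then c k * RtoC R ^ k else RtoC 0)%C = (c j * RtoC R ^ j)%C).
    { rewrite (CS_finite _ (S j)).
      - simpl. rewrite Csum_zero; [destruct (Nat.eq_dec j j); [ring|lia]|].
        intros k Hk. destruct (Nat.eq_dec k j); [lia|auto].
      - intros k Hk. destruct (Nat.eq_dec k j); [lia|auto]. }
    rewrite <- E. apply (tannery _ _ (fun k => Cmod (c k) * R ^ k)); auto.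
    + intros N k. rewrite !Cmod_mult, Cmod_pow, Cmod_R, (Rabs_pos_eq R) by auto.
      rewrite <- (Rmult_1_r (Cmod (c k) * R ^ k)) at 2. apply Rmult_le_compat_l.
      * apply Rmult_le_pos; [apply Cmod_ge_0|apply pow_le; auto].
      * apply avg_bound; [lia|]. intros l _.
        rewrite Cmod_mult, !Cmod_pow, Cmod_rou, Cmod_rouV, !pow1; lra.
    + intros k. apply (Ccvg_ext_loc (fun _ => if Nat.eq_dec k j then c k * RtoC R ^ k else RtoC 0)%C _ _ (k + j)%nat);
        [|apply Ccvg_const].
      intros n Hn. unfold A. destruct (Nat.eq_dec k j) as [->|Hkj].
      * rewrite avg_char_same by lia. ring.
      * rewrite avg_char by lia. ring.
Qed.

Lemma cauchy_estimate R f c j H : 0 <= R -> Ana R f c ->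
  (forall w, Cmod w = R -> Cmod (f w) <= H) -> Cmod (c j) * R ^ j <= H.
Proof.
  intros HR Hf HH. pose proof (coef_extract R f c j HR Hf) as X.
  replace (Cmod (c j) * R ^ j) with (Cmod (c j * RtoC R ^ j))
    by (rewrite Cmod_mult, Cmod_pow, Cmod_R, Rabs_pos_eq; auto).
  apply (Ccvg_bound_loc _ _ _ 1%nat X). intros N HN. apply avg_bound; auto.
  intros l _. rewrite Cmod_mult, Cmod_pow, Cmod_rouV, pow1, Rmult_1_r. apply HH.
  rewrite Cmod_mult, Cmod_R, Cmod_rou, Rabs_pos_eq; lra.
Qed.

Lemma Ana_ext R f g c : (forall w, Cmod w <= R -> f w = g w) -> Ana R f c -> Ana R g c.
Proof. intros H [A B]. split; auto. intros w Hw. rewrite <- H; auto. Qed.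

Lemma Ana_plus R f g c d : 0 <= R -> Ana R f c -> Ana R g d ->
  Ana R (fun w => f w + g w)%C (fun k => c k + d k)%C.
Proof.
  intros HR [A1 B1] [A2 B2]. split.
  - apply (ex_series_dom _ (fun k => Cmod (c k) * R ^ k + Cmod (d k) * R ^ k)).
    + intros k. split; [apply Rmult_le_pos; [apply Cmod_ge_0|apply pow_le; auto]|].
      rewrite <- Rmult_plus_distr_r. apply Rmult_le_compat_r; [apply pow_le; auto|apply Cmod_triangle].
    + apply ex_series_plus'; auto.
  - intros w Hw. rewrite B1, B2 by auto. symmetry.
    rewrite <- (CS_plus _ _ (fun k => Cmod (c k) * R ^ k) (fun k => Cmod (d k) * R ^ k)); auto.
    + apply CS_ext. intros; ring.
    + intros; apply Ana_term_bound; auto.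
    + intros; apply Ana_term_bound; auto.
Qed.

Lemma Ana_scal R f c a : 0 <= R -> Ana R f c -> Ana R (fun w => a * f w)%C (fun k => a * c k)%C.
Proof.
  intros HR [A1 B1]. split.
  - apply (ex_series_ext' (fun k => Cmod a * (Cmod (c k) * R ^ k))).
    + intros k. rewrite Cmod_mult. ring.
    + apply ex_series_scal'; auto.
  - intros w Hw. rewrite B1 by auto. rewrite <- (CS_scal _ _ (fun k => Cmod (c k) * R ^ k)); auto.
    + apply CS_ext. intros; ring.
    + intros; apply Ana_term_bound; auto.
Qed.

Lemma Ana_Csum R (f : nat -> C -> C) (c : nat -> nat -> C) N : 0 <= R ->
  (forall n, (n < N)%nat -> Ana R (f n) (c n)) ->
  Ana R (fun w => Csum (fun n => f n w) N) (fun k => Csum (fun n => c n k) N).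
Proof.
  intros HR. induction N; intros H.
  - split.
    + apply (ex_series_ext' (fun _ => 0)); [intros; simpl; rewrite Cmod_0; ring|].
      apply (ex_series_Rsum_bound _ 0); intros n; [lra|rewrite Rsum_const; lra].
    + intros w _. simpl. rewrite (CS_finite _ O); auto. intros; ring.
  - simpl. apply Ana_plus; auto.
Qed.

Lemma Ana_mult R f g c d : 0 <= R -> Ana R f c -> Ana R g d ->
  Ana R (fun w => f w * g w)%C (fun k => Csum (fun i => c i * d (k - i)%nat)%C (S k)).
Proof.
  intros HR [A1 B1] [A2 B2]. split.
  - set (u := fun k => Cmod (c k) * R ^ k) in *. set (v := fun k => Cmod (d k) * R ^ k) in *.
    assert (Pu : forall k, 0 <= u k) by (intros; apply Rmult_le_pos; [apply Cmod_ge_0|apply pow_le; auto]).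
    assert (Pv : forall k, 0 <= v k) by (intros; apply Rmult_le_pos; [apply Cmod_ge_0|apply pow_le; auto]).
    apply (ex_series_dom _ (fun n => sum_f_R0 (fun k => u k * v (n - k)%nat) n)).
    + intros n. split; [apply Rmult_le_pos; [apply Cmod_ge_0|apply pow_le; auto]|].
      apply Rle_trans with (Rsum (fun k => Cmod (c k) * Cmod (d (n - k)%nat)) (S n) * R ^ n).
      * apply Rmult_le_compat_r; [apply pow_le; auto|]. apply Cmod_Csum_le. intros k _.
        rewrite Cmod_mult; lra.
      * rewrite <- sum_n_Reals, sum_n_Rsum, Rmult_comm, <- Rsum_scal. apply Rsum_le.
        intros k Hk. unfold u, v. replace n with (k + (n - k))%nat at 1 by lia.
        rewrite pow_add. apply Req_le. ring.
    + destruct A1 as [la Hla], A2 as [lb Hlb]. exists (la * lb). apply is_series_mult; auto.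
      * exists la. apply (is_series_ext u); auto. intros n; rewrite Rabs_pos_eq; auto.
      * exists lb. apply (is_series_ext v); auto. intros n; rewrite Rabs_pos_eq; auto.
  - intros w Hw. rewrite B1, B2 by auto. symmetry. apply CS_unique.
    eapply Ccvg_ext; [|apply (CS_cauchy_product (fun k => c k * w ^ k)%C (fun k => d k * w ^ k)%C
      (fun k => Cmod (c k) * R ^ k) (fun k => Cmod (d k) * R ^ k)); auto;
      intros; apply Ana_term_bound; auto].
    intros n. apply Csum_ext. intros N _. rewrite Cmult_comm, <- Csum_scal. apply Csum_ext.
    intros m Hm. assert (E : (w ^ N = w ^ m * w ^ (N - m))%C)
      by (rewrite <- Cpow_add_r; f_equal; lia). rewrite E. ring.
Qed.

Lemma Ana_exp R al : 0 <= R -> Ana R (fun w => Cexp (al * w)) (fun k => expt al k).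
Proof.
  intros HR. split.
  - apply (ex_series_ext' (fun k => (Cmod al * R) ^ k / INR (fact k))); [|apply ex_series_exp].
    intros k. rewrite Cmod_expt, Rpow_mult_distr. field. apply INR_fact_neq_0.
  - intros w _. rewrite <- Cexp_series. apply CS_ext. intros k. unfold expt.
    rewrite Cpow_mult_l. ring.
Qed.

Lemma CS_geom q : Cmod q < 1 -> CS (fun k => q ^ k)%C = (/ (1 - q))%C.
Proof.
  intros H.
  assert (N1 : (1 - q)%C <> RtoC 0).
  { intros E. assert (q = 1%C) by (replace q with (1 - (1 - q))%C by ring; rewrite E; ring).
    subst q. rewrite Cmod_1 in H. lra. }
  apply CS_unique.
  apply (Ccvg_squeeze _ _ (fun n => / Cmod (1 - q) * Cmod q ^ n) O).
  - intros n _.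
    replace (Csum (fun k => q ^ k)%C n - / (1 - q))%C with (- (/ (1 - q) * q ^ n))%C.
    + rewrite Cmod_opp, Cmod_mult, Cmod_inv, Cmod_pow by auto. lra.
    + replace (- (/ (1 - q) * q ^ n))%C with (/ (1 - q) * (1 - q ^ n) - / (1 - q))%C by ring.
      rewrite <- Csum_geom. field. auto.
  - replace (Finite 0) with (Rbar_mult (/ Cmod (1 - q)) 0) by (simpl; f_equal; ring).
    apply is_lim_seq_scal_l, is_lim_seq_geom. rewrite Rabs_pos_eq; auto using Cmod_ge_0.
Qed.

Lemma ex_series_geom' r : 0 <= r < 1 -> ex_series (fun k => r ^ k).
Proof. intros H. apply ex_series_geom. rewrite Rabs_pos_eq; lra. Qed.

Lemma Ana_inv R b : 0 <= R < Cmod b -> Ana R (fun w => / (b - w))%C (fun k => / b ^ S k)%C.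
Proof.
  intros [HR Hb]. assert (B0 : b <> RtoC 0) by (apply Cmod_gt_0; lra).
  assert (Q : forall w, Cmod w <= R -> Cmod (w / b) < 1).
  { intros w Hw. rewrite Cmod_div by auto. apply Rmult_lt_reg_r with (Cmod b); [lra|].
    unfold Rdiv. rewrite Rmult_assoc, Rinv_l by lra. lra. }
  split.
  - apply (ex_series_ext' (fun k => / Cmod b * (R / Cmod b) ^ k)).
    + intros k. rewrite Cmod_inv, Cmod_pow by (apply Cpow_nz; auto). unfold Rdiv.
      rewrite Rpow_mult_distr, pow_inv. simpl. rewrite Rinv_mult. ring.
    + apply ex_series_scal', ex_series_geom'. split; [apply Rdiv_le_0_compat; lra|].
      apply Rmult_lt_reg_r with (Cmod b); [lra|]. unfold Rdiv. rewrite Rmult_assoc, Rinv_l by lra. lra.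
  - intros w Hw. specialize (Q w Hw).
    replace (/ (b - w))%C with (/ b * / (1 - w / b))%C.
    + rewrite <- (CS_geom _ Q). rewrite <- (CS_scal _ _ (fun k => Cmod (w / b) ^ k)).
      * apply CS_ext. intros k. unfold Cdiv. rewrite Cpow_mult_l, Cpow_inv, Cpow_S by auto.
        field. split; auto. apply Cpow_nz; auto.
      * intros k. rewrite Cmod_pow; lra.
      * apply ex_series_geom'. split; auto using Cmod_ge_0.
    + assert ((b - w)%C <> RtoC 0).
      { intros E. assert (w = b) by (replace w with (b - (b - w))%C by ring; rewrite E; ring).
        subst w. lra. }
      field. split; auto.
Qed.

(** * Dirichlet convolution *)

Definition dconv (x y : nat -> C) (n : nat) : C :=
  Csum (fun d => if Nat.eqb (n mod S d) 0 then x (S d) * y (n / S d)%nat else RtoC 0)%C n.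

Lemma div_S_step K d : (0 < d)%nat ->
  (S K / d)%nat = if Nat.eqb (S K mod d) 0 then S (K / d) else (K / d)%nat.
Proof.
  intros Hd. pose proof (Nat.div_mod K d ltac:(lia)) as E1. pose proof (Nat.mod_upper_bound K d ltac:(lia)).
  destruct (Nat.eq_dec (S (K mod d)) d) as [E|E].
  - assert (X : S K = (d * S (K / d) + 0)%nat) by nia.
    rewrite (Nat.div_unique (S K) d (S (K / d)) 0), <- (Nat.mod_unique (S K) d (S (K / d)) 0); auto; lia.
  - assert (X : S K = (d * (K / d) + S (K mod d))%nat) by lia.
    rewrite (Nat.div_unique (S K) d (K / d) (S (K mod d))), <- (Nat.mod_unique (S K) d (K / d) (S (K mod d))); auto; lia.
Qed.

(** Pairs with product at most [K] are grouped by the first factor; in the induction [K / S d] goes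
    up by one exactly when [S d] divides [S K]. *)
Lemma Csum_dconv x y K : Csum (fun n => dconv x y (S n)) K
  = Csum (fun d => x (S d) * Csum (fun e => y (S e)) (K / S d))%C K.
Proof.
  induction K; [auto|].
  change (Csum (fun n => dconv x y (S n)) (S K)) with (Csum (fun n => dconv x y (S n)) K + dconv x y (S K))%C.
  rewrite IHK.
  replace (Csum (fun d => x (S d) * Csum (fun e => y (S e)) (K / S d))%C K)
    with (Csum (fun d => x (S d) * Csum (fun e => y (S e)) (K / S d))%C (S K)).
  2:{ change (Csum ?f (S K)) with (Csum f K + f K)%C. cbv beta.
      rewrite (Nat.div_small K (S K)) by lia. simpl. ring. }
  unfold dconv. rewrite <- Csum_plus. apply Csum_ext. intros d Hd.
  rewrite (div_S_step K (S d)) by lia.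
  destruct (Nat.eqb (S K mod S d) 0); simpl; ring.
Qed.

(** Compared with the Cauchy product the inner range is [K / S d], which still tends to infinity for
    each fixed [d], so [tannery] works in the same way. *)
Lemma Ccvg_dconv x y Mx My :
  (forall n, Cmod (x (S n)) <= Mx n) -> ex_series Mx ->
  (forall n, Cmod (y (S n)) <= My n) -> ex_series My ->
  Ccvg (Csum (fun n => dconv x y (S n))) (CS (fun n => x (S n)) * CS (fun n => y (S n)))%C.
Proof.
  intros Hx HMx Hy HMy.
  assert (Py : forall n, 0 <= My n) by (intros k; eapply Rle_trans; [apply Cmod_ge_0|apply Hy]).
  replace (CS (fun n => x (S n)) * CS (fun n => y (S n)))%C
    with (CS (fun d => x (S d) * CS (fun n => y (S n)))%C).
  2:{ rewrite (CS_ext _ (fun m => CS (fun n => y (S n)) * x (S m))%C) by (intros; ring).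
      rewrite (CS_scal _ _ Mx); auto. ring. }
  apply (Ccvg_ext (fun K => CS (fun d => x (S d) * Csum (fun e => y (S e)) (K / S d))%C)).
  { intros K. rewrite Csum_dconv. apply CS_finite.
    intros n Hn. rewrite Nat.div_small by lia. simpl. ring. }
  apply (tannery _ _ (fun m => Series My * Mx m)).
  - intros N n. rewrite Cmod_mult, Rmult_comm. apply Rmult_le_compat; auto using Cmod_ge_0.
    eapply Rle_trans; [apply (Cmod_Csum_le _ My); auto|]. apply Rsum_le_Series; auto.
  - apply ex_series_scal'; auto.
  - intros n. apply Ccvg_scal. intros e He.
    destruct (dom_cv _ My Hy HMy e He) as [N HN]. exists (N * S n)%nat. intros k Hk. apply HN.
    apply Nat.div_le_lower_bound; lia.
Qed.

(** * Complex polynomials *)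

Fixpoint Cprod (a : nat -> C) (n : nat) : C :=
  match n with O => RtoC 1 | S k => (Cprod a k * a k)%C end.

Lemma Cprod_ext a b n : (forall k, (k < n)%nat -> a k = b k) -> Cprod a n = Cprod b n.
Proof. induction n; intros H; simpl; [auto|]. rewrite IHn, H; auto. Qed.

Definition lsum (f : C -> C) (l : list C) : C :=
  List.fold_right (fun z acc => (f z + acc)%C) (RtoC 0) l.
Definition lprod (f : C -> C) (l : list C) : C :=
  List.fold_right (fun z acc => (f z * acc)%C) (RtoC 1) l.

(** Transports factorization into linear factors and Lagrange interpolation from the algebraically
    closed field [complex R] to the pairs of reals used elsewhere; the module keeps the algebraic
    notations local. *)
Module FTA.
Import all_boot all_order all_algebra qpoly complex Rstruct.
Import GRing.Theory.
Local Open Scope ring_scope.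

Definition toC (z : complex R) : C := (Re z, Im z).
Definition ofC (z : C) : complex R := Complex (fst z) (snd z).

Lemma toCK z : ofC (toC z) = z. Proof. by case: z. Qed.
Lemma ofCK z : toC (ofC z) = z. Proof. by case: z. Qed.
Lemma toC_add x y : toC (x + y) = Cplus (toC x) (toC y).
Proof. by case: x => a b; case: y => c d. Qed.
Lemma toC_mul x y : toC (x * y) = Cmult (toC x) (toC y).
Proof. by case: x => a b; case: y => c d. Qed.
Lemma toC_opp x : toC (- x) = Copp (toC x).
Proof. by case: x => a b. Qed.
Lemma toC_exp x n : toC (x ^+ n) = Cpow (toC x) n.
Proof. elim: n => [|n IH]; first by []. by rewrite exprS toC_mul IH. Qed.
Lemma toC_nat n : toC n%:R = RtoC (INR n).
Proof.
elim: n => [|n IH]; first by [].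
by rewrite S_INR -addn1 natrD toC_add IH RtoC_plus.
Qed.

Lemma toC_sum (f : nat -> complex R) n :
  toC (\sum_(i < n) f i) = Csum (fun k => toC (f k)) n.
Proof. elim: n => [|n IH]; first by rewrite big_ord0. by rewrite big_ord_recr /= toC_add IH. Qed.

Lemma deriv_prod_horner (rs : seq (complex R)) w : all (fun r => w != r) rs ->
  (\prod_(r <- rs) ('X - r%:P))^`().[w] =
  (\prod_(r <- rs) ('X - r%:P)).[w] * \sum_(r <- rs) (w - r)^-1.
Proof.
elim: rs => [|r rs IH] /=; first by rewrite !big_nil -polyC1 derivC !hornerC mulr0.
case/andP => Hr /IH E. rewrite !big_cons derivM derivXsubC mul1r hornerD !hornerM hornerXsubC E.
rewrite mulrDr mulrAC divff ?subr_eq0 // mul1r. congr (_ + _). by rewrite mulrA.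
Qed.

Lemma toC_lprod (rs : seq (complex R)) (w : complex R) :
  toC (\prod_(r <- rs) (w - r)) = lprod (fun r => Cminus (toC w) r) [seq toC r | r <- rs].
Proof.
elim: rs => [|r rs IH]; first by rewrite big_nil.
by rewrite big_cons toC_mul toC_add toC_opp IH.
Qed.

Lemma toC_inv x : x != 0 -> toC x^-1 = Cinv (toC x).
Proof.
move=> Hx.
have Nx : toC x <> RtoC 0%R by move=> E; move/eqP: Hx; apply; rewrite -(toCK x) E.
have E : Cmult (toC x) (toC x^-1) = RtoC 1%R by rewrite -toC_mul divff.
by rewrite -(Cmult_1_l (toC x^-1)) -(Cinv_l (toC x) Nx) -Cmult_assoc E Cmult_1_r.
Qed.

Lemma toC_lsum (rs : seq (complex R)) (w : complex R) : all (fun r => w != r) rs ->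
  toC (\sum_(r <- rs) w / (w - r)) = lsum (fun r => Cdiv (toC w) (Cminus (toC w) r)) [seq toC r | r <- rs].
Proof.
elim: rs => [|r rs IH] /=; first by rewrite big_nil.
case/andP => Hr Hrs. rewrite big_cons toC_add toC_mul toC_inv ?subr_eq0 // toC_add toC_opp IH //.
Qed.

(** The second identity is [w P'(w) = P(w) sum w / (w - r)], multiplied by [w] so that each summand
    can be averaged over a circle by [avg_pole]. Roots are listed with multiplicity, and [lc] is 0
    for the zero polynomial. *)
Lemma poly_factor (n : nat) (c : nat -> C) :
  exists (lc : C) (rs : list C), forall w : C,
    Csum (fun k => Cmult (c k) (Cpow w k)) n = Cmult lc (lprod (fun r => Cminus w r) rs) /\
    ((forall r, List.In r rs -> w <> r) ->
     Csum (fun k => Cmult (RtoC (INR k)) (Cmult (c k) (Cpow w k))) n =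
     Cmult (Csum (fun k => Cmult (c k) (Cpow w k)) n) (lsum (fun r => Cdiv w (Cminus w r)) rs)).
Proof.
pose p : {poly complex R} := \poly_(i < n) ofC (c i).
have [rs Hp] := closed_field_poly_normal p.
exists (toC (lead_coef p)), [seq toC r | r <- rs] => w.
have Ev : Csum (fun k => Cmult (c k) (Cpow w k)) n = toC p.[ofC w].
  rewrite horner_poly (toC_sum (fun i => ofC (c i) * ofC w ^+ i)). apply: Csum_ext => k _.
  by rewrite toC_mul toC_exp !ofCK.
have Ed : Csum (fun k => Cmult (RtoC (INR k)) (Cmult (c k) (Cpow w k))) n = toC (ofC w * p^`().[ofC w]).
  rewrite /p poly_def linear_sum horner_sum mulr_sumr.
  rewrite (eq_bigr (fun i : 'I_n => (nat_of_ord i)%:R * (ofC (c i) * ofC w ^+ i))).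
    rewrite (toC_sum (fun i => i%:R * (ofC (c i) * ofC w ^+ i))). apply: Csum_ext => k _.
    by rewrite !toC_mul toC_exp !ofCK toC_nat.
  move=> i _. rewrite /= derivZ derivXn hornerZ hornerMn hornerXn.
  case: (nat_of_ord i) => [|k]; first by rewrite mulr0n !mulr0 mul0r.
  rewrite /= exprS -mulr_natl.
  have E (a b x y : complex R) : a * (b * (x * y)) = x * (b * (a * y)) by rewrite mulrCA [RHS]mulrCA; congr (_ * _); rewrite mulrCA.
  by rewrite E.
split.
  rewrite Ev [in LHS]Hp hornerZ toC_mul. congr (Cmult _ _).
  rewrite horner_prod -[in RHS](ofCK w) -toC_lprod. congr toC. apply: eq_bigr => r _.
  by rewrite hornerXsubC.
move=> Hw.
have Hall : all (fun r => ofC w != r) rs.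
  apply/allP => r Hr. apply/eqP => E. apply: (Hw (toC r)); last by rewrite -E ofCK.
  have : toC r \in [seq toC r | r <- rs] by apply: map_f.
  elim: [seq _ | _ <- _] => [|x l IH] //=. rewrite inE => /orP [/eqP ->|/IH ?]; by [left|right].
have EL : lsum (fun r => Cdiv w (Cminus w r)) [seq toC r | r <- rs]
  = toC (\sum_(r <- rs) ofC w / (ofC w - r)) by rewrite toC_lsum // ofCK.
rewrite Ed Ev EL -toC_mul. congr toC.
rewrite [in LHS]Hp derivZ hornerZ deriv_prod_horner // [in X in _ = X * _]Hp hornerZ.
rewrite -mulr_sumr [LHS]mulrCA -[RHS]mulrA. congr (_ * _). exact: mulrCA.
Qed.

Lemma toC_prod (f : nat -> complex R) n :
  toC (\prod_(i < n) f i) = Cprod (fun k => toC (f k)) n.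
Proof. elim: n => [|n IH]; first by rewrite big_ord0. by rewrite big_ord_recr /= toC_mul IH. Qed.

(** The constant term is the value at 0 of the interpolating polynomial, hence a combination of the
    values at the nodes with weights [prod x_j / (x_j - x_i)]. *)
Lemma lagrange_at_0 (n : nat) (c x : nat -> C) :
  (forall i j, x i = x j -> i = j) -> (0 < n)%N ->
  c 0%N = Csum (fun i => Cmult (Csum (fun k => Cmult (c k) (Cpow (x i) k)) n)
     (Cprod (fun j => if Nat.eqb j i then RtoC 1%R else Cdiv (x j) (Cminus (x j) (x i))) n)) n.
Proof.
move=> xinj n0.
pose p : {poly complex R} := \poly_(i < n) ofC (c i).
pose y i := ofC (x i).
have yinj : injective y by move=> i j /(congr1 toC); rewrite !ofCK => /xinj.
have sp : (size p <= n)%N by apply: size_poly.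
have := lagrange_gen n0 yinj sp.
move/(congr1 (fun q : {poly complex R} => toC q.[0])).
rewrite {1}horner_coef0 coef_poly n0 ofCK => ->.
pose F (i : nat) := p.[y i] * \prod_(j < n) (if (j : nat) != i then y j / (y j - y i) else 1).
rewrite horner_sum (eq_bigr (fun i : 'I_n => F i)).
  rewrite (toC_sum F) /F. apply: Csum_ext => i _. rewrite toC_mul. congr (Cmult _ _).
    rewrite horner_poly (toC_sum (fun k => ofC (c k) * y i ^+ k)). apply: Csum_ext => k _.
    by rewrite toC_mul toC_exp !ofCK.
  rewrite (toC_prod (fun j => if j != i then y j / (y j - y i) else 1)).
  apply: Cprod_ext => j _. case: (Nat.eqb_spec j i) => [->|/eqP ne]; first by rewrite eqxx.
  rewrite ne toC_mul toC_inv ?toC_add ?toC_opp ?ofCK //.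
  by rewrite subr_eq0 (inj_eq yinj).
move=> i _. rewrite /F hornerM hornerC lagrangeE // hornerM hornerC. congr (_ * _).
rewrite !horner_prod -[in RHS]big_mkcond -prodfV -big_split /=.
apply: eq_bigr => j ne. rewrite !hornerXsubC sub0r.
by rewrite -[y j - y i]opprB invrN !mulrN [in LHS]mulrC.
Qed.

End FTA.

Import FTA.

Fixpoint Rprod (a : nat -> R) (n : nat) : R :=
  match n with O => 1 | S k => Rprod a k * a k end.

Lemma Rprod_nonneg a n : (forall k, (k < n)%nat -> 0 <= a k) -> 0 <= Rprod a n.
Proof. induction n; intros H; simpl; [lra|]. apply Rmult_le_pos; auto. Qed.

Lemma Rprod_le a b n : (forall k, (k < n)%nat -> 0 <= a k <= b k) -> Rprod a n <= Rprod b n.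
Proof.
  induction n; intros H; simpl; [lra|].
  apply Rmult_le_compat; [apply Rprod_nonneg; intros; apply H; lia|apply H; lia|apply IHn; auto|apply H; lia].
Qed.

Lemma Cmod_Cprod a n : Cmod (Cprod a n) = Rprod (fun k => Cmod (a k)) n.
Proof. induction n; simpl; [apply Cmod_1|]. rewrite Cmod_mult, IHn; auto. Qed.

(** These are the interpolation weights for equally spaced radii: the distances to the nodes below
    [i] multiply to [i!], those to the nodes above to [m!]. *)
Lemma Rprod_nodes (q : R) (i m : nat) : 0 < q ->
  Rprod (fun j => if Nat.eqb j i then 1 else q / Rabs (INR j - INR i)) (S i + m)
  = q ^ (i + m) / (INR (fact i) * INR (fact m)).
Proof.
  intros Hq. induction m.
  - rewrite Nat.add_0_r.
    change (Rprod ?f (S i)) with (Rprod f i * f i). cbv beta. rewrite Nat.eqb_refl, Rmult_1_r.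
    assert (E : forall k, (k <= i)%nat ->
      Rprod (fun j => if Nat.eqb j i then 1 else q / Rabs (INR j - INR i)) k
      = q ^ k * INR (fact (i - k)) / INR (fact i)).
    { induction k; intros Hk.
      - simpl. rewrite Nat.sub_0_r. field. apply INR_fact_neq_0.
      - change (Rprod ?f (S k)) with (Rprod f k * f k). cbv beta. rewrite IHk by lia.
        destruct (Nat.eqb_spec k i); [lia|].
        replace (i - k)%nat with (S (i - S k)) by lia. rewrite fact_simpl, mult_INR.
        replace (Rabs (INR k - INR i)) with (INR (S (i - S k))).
        + simpl (q ^ S k). field. split; [apply INR_fact_neq_0|apply not_0_INR; lia].
        + rewrite <- Rabs_Ropp, Ropp_minus_distr, <- minus_INR by lia.
          rewrite Rabs_pos_eq by apply pos_INR. f_equal. lia. }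
    rewrite E by lia. rewrite Nat.sub_diag, Nat.add_0_r. simpl (fact 0). simpl (INR 1). field. apply INR_fact_neq_0.
  - rewrite Nat.add_succ_r. change (Rprod ?f (S (S i + m))) with (Rprod f (S i + m) * f (S i + m)%nat).
    cbv beta. rewrite IHm. destruct (Nat.eqb_spec (S i + m) i); [lia|].
    replace (Rabs (INR (S i + m) - INR i)) with (INR (S m)).
    + rewrite Nat.add_succ_r. rewrite (fact_simpl m), mult_INR. simpl (q ^ S (i + m)). field.
      repeat split; try apply INR_fact_neq_0. apply not_0_INR; lia.
    + rewrite <- minus_INR by lia. rewrite Rabs_pos_eq by apply pos_INR. f_equal. lia.
Qed.

Lemma Rsum_inv_fact n : Rsum (fun i => / (INR (fact i) * INR (fact (n - i)))) (S n) = 2 ^ n / INR (fact n).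
Proof.
  pose proof (binomial 1 1 n) as B. rewrite <- sum_n_Reals, sum_n_Rsum in B.
  replace (1 + 1) with 2 in B by ring. rewrite B. unfold Rdiv. rewrite Rmult_comm, <- Rsum_scal.
  apply Rsum_ext. intros k Hk. rewrite !pow1. unfold Binomial.C. field.
  repeat split; apply INR_fact_neq_0.
Qed.

Lemma pow_n_fact n : INR n ^ n / INR (fact n) <= exp (INR n).
Proof.
  pose proof (Rsum_le_Series (fun k => INR n ^ k / INR (fact k)) (S n)) as H.
  rewrite Series_exp in H. simpl in H. eapply Rle_trans; [|apply H].
  - assert (0 <= Rsum (fun k => INR n ^ k / INR (fact k)) n); [|lra].
    apply Rsum_nonneg. intros k _. apply Rdiv_le_0_compat; [apply pow_le, pos_INR|apply INR_fact_lt_0].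
  - intros k. apply Rdiv_le_0_compat; [apply pow_le, pos_INR|apply INR_fact_lt_0].
  - apply ex_series_exp.
Qed.

(* If every circle contained a point where the polynomial is small, Lagrange interpolation at
   points on equally spaced circles would make its constant term small. *)
Lemma min_modulus (n : nat) (c : nat -> C) (r1 r2 : R) : 0 < r1 < r2 -> (0 < n)%nat ->
  exists r, r1 <= r <= r2 /\ forall w, Cmod w = r ->
    Cmod (c O) <= Cmod (Csum (fun k => c k * w ^ k)%C (S n)) * (2 * exp 1 * (r2 / (r2 - r1))) ^ n.
Proof.
  intros Hr Hn. apply NNPP. intros Hno.
  set (P := fun w => Csum (fun k => c k * w ^ k)%C (S n)) in *.
  set (Q := r2 / (r2 - r1)) in *.
  assert (HQ : 0 < Q) by (apply Rdiv_lt_0_compat; lra).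
  (* The weights add up to at most [sum (Q n)^n / (i! (n-i)!) = (2 Q n)^n / n!], and
     [n^n / n! <= e^n] turns this into [K]. *)
  set (K := (2 * exp 1 * Q) ^ n) in *.
  assert (HK : 0 < K) by (apply pow_lt; pose proof (exp_pos 1); nra).
  assert (Hn' : 0 < INR n) by (apply lt_0_INR; auto).
  set (rr := fun j => r1 + (r2 - r1) * (INR j / INR n)).
  assert (Hrr : forall j, 0 < rr j).
  { intros j. unfold rr. assert (0 <= INR j / INR n) by (apply Rdiv_le_0_compat; [apply pos_INR|auto]). nra. }
  (* [lagrange_at_0] asks for an injective sequence over all of [nat]; past [n] the nodes are
     arbitrary points on further circles. *)
  assert (Hex : forall j, exists z, Cmod z = rr j /\ ((j <= n)%nat -> Cmod (P z) * K < Cmod (c O))).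
  { intros j. destruct (le_lt_dec j n) as [Hj|Hj].
    - apply NNPP. intros H. apply Hno. exists (rr j). split.
      + unfold rr. assert (0 <= INR j / INR n <= 1).
        { split; [apply Rdiv_le_0_compat; [apply pos_INR|auto]|].
          apply Rmult_le_reg_r with (INR n); auto. unfold Rdiv. rewrite Rmult_assoc, Rinv_l by lra.
          apply le_INR in Hj. lra. }
        nra.
      + intros w Hw. apply Rnot_lt_le. intros Hlt. apply H. exists w. split; auto.
    - exists (RtoC (rr j)). split; [rewrite Cmod_R, Rabs_pos_eq; auto; left; auto|lia]. }
  set (x := fun j => epsilon (inhabits (RtoC 0)) (fun z => Cmod z = rr j /\ ((j <= n)%nat -> Cmod (P z) * K < Cmod (c O)))).
  assert (Hx : forall j, Cmod (x j) = rr j /\ ((j <= n)%nat -> Cmod (P (x j)) * K < Cmod (c O))).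
  { intros j. unfold x. apply epsilon_spec. apply Hex. }
  assert (Hd : forall i j, rr i - rr j = (r2 - r1) / INR n * (INR i - INR j)).
  { intros i j. unfold rr. field. lra. }
  assert (Hdp : 0 < (r2 - r1) / INR n) by (apply Rdiv_lt_0_compat; lra).
  (* Whatever their arguments, two nodes are at least as far apart as their radii differ. *)
  assert (Hdist : forall i j, (r2 - r1) / INR n * Rabs (INR j - INR i) <= Cmod (x j - x i)).
  { intros i j. rewrite <- (Rabs_pos_eq ((r2 - r1) / INR n)) at 1 by lra. rewrite <- Rabs_mult, <- Hd.
    rewrite <- (proj1 (Hx i)), <- (proj1 (Hx j)).
    pose proof (Cmod_triangle (x j - x i) (x i)) as T1. pose proof (Cmod_triangle (x i - x j) (x j)) as T2.
    replace (x j - x i + x i)%C with (x j) in T1 by ring. replace (x i - x j + x j)%C with (x i) in T2 by ring.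
    replace (x i - x j)%C with (- (x j - x i))%C in T2 by ring. rewrite Cmod_opp in T2.
    apply Rabs_le. lra. }
  assert (Hinj : forall i j, x i = x j -> i = j).
  { intros i j E. apply INR_eq. specialize (Hdist i j). rewrite E in Hdist.
    replace (x j - x j)%C with (RtoC 0) in Hdist by ring. rewrite Cmod_0 in Hdist.
    destruct (Req_dec (INR j) (INR i)); [auto|exfalso].
    assert (0 < Rabs (INR j - INR i)) by (apply Rabs_pos_lt; lra). nra. }
  pose proof (lagrange_at_0 (S n) c x Hinj) as L. specialize (L eq_refl).
  apply (f_equal Cmod) in L.
  assert (B : Cmod (c O) < Cmod (c O)); [|lra].
  assert (Hc0 : 0 < Cmod (c O)).
  { pose proof (proj2 (Hx O) ltac:(lia)). pose proof (Cmod_ge_0 (P (x O))). nra. }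
  rewrite L at 1.
  eapply Rle_lt_trans; [apply Cmod_Csum|].
  set (lam := Cmod (c O) / K).
  assert (Hlam : forall i, (i <= n)%nat -> Cmod (P (x i)) < lam).
  { intros i Hi. apply Rmult_lt_reg_r with K; auto. unfold lam, Rdiv. rewrite Rmult_assoc, Rinv_l by lra.
    rewrite Rmult_1_r. apply Hx; auto. }
  assert (Hlam0 : 0 < lam) by (apply Rdiv_lt_0_compat; auto).
  assert (Hprod : forall i, (i <= n)%nat ->
    Cmod (Cprod (fun j => if Nat.eqb j i then RtoC 1 else x j / (x j - x i))%C (S n))
      <= (Q * INR n) ^ n * / (INR (fact i) * INR (fact (n - i)))).
  { intros i Hi. rewrite Cmod_Cprod.
    replace (S n) with (S i + (n - i))%nat by lia.
    apply Rle_trans with (Rprod (fun j => if Nat.eqb j i then 1 else (Q * INR n) / Rabs (INR j - INR i)) (S i + (n - i))).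
    - apply Rprod_le. intros j Hj. destruct (Nat.eqb_spec j i) as [->|Hji]; [rewrite Cmod_1; lra|].
      assert (Hne : (x j - x i)%C <> RtoC 0).
      { intros E. apply Hji, Hinj. replace (x j) with (x j - x i + x i)%C by ring. rewrite E. ring. }
      split; [apply Cmod_ge_0|]. rewrite Cmod_div by auto.
      assert (A0 : 0 < Rabs (INR j - INR i)).
      { apply Rabs_pos_lt. intros E. apply Hji, INR_eq. lra. }
      assert (A1 : Cmod (x j) <= r2).
      { rewrite (proj1 (Hx j)). unfold rr.
        assert (INR j / INR n <= 1).
        { apply Rmult_le_reg_r with (INR n); auto. unfold Rdiv. rewrite Rmult_assoc, Rinv_l by lra.
          assert (Hjn : (j <= n)%nat) by lia. apply le_INR in Hjn. lra. }
        nra. }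
      replace (Q * INR n / Rabs (INR j - INR i)) with (r2 / ((r2 - r1) / INR n * Rabs (INR j - INR i)))
        by (unfold Q; field; lra).
      unfold Rdiv at 1 2. apply Rmult_le_compat; auto using Cmod_ge_0.
      + left; apply Rinv_0_lt_compat, Cmod_gt_0; auto.
      + apply Rinv_le_contravar; [apply Rmult_lt_0_compat; auto|apply Hdist].
    - rewrite Rprod_nodes by nra. replace (i + (n - i))%nat with n by lia. apply Rle_refl. }
  apply Rlt_le_trans with (Rsum (fun i => lam * ((Q * INR n) ^ n * / (INR (fact i) * INR (fact (n - i))))) (S n)).
  - assert (S : forall m, (m <= n)%nat -> Rsum (fun i => Cmod (P (x i) *
       Cprod (fun j => if Nat.eqb j i then RtoC 1 else x j / (x j - x i))%C (S n))) (S m)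
       < Rsum (fun i => lam * ((Q * INR n) ^ n * / (INR (fact i) * INR (fact (n - i))))) (S m)).
    { assert (T : forall i, (i <= n)%nat -> Cmod (P (x i) *
       Cprod (fun j => if Nat.eqb j i then RtoC 1 else x j / (x j - x i))%C (S n))
       < lam * ((Q * INR n) ^ n * / (INR (fact i) * INR (fact (n - i))))).
      { intros i Hi. rewrite Cmod_mult. specialize (Hprod i Hi). specialize (Hlam i Hi).
        assert (0 < (Q * INR n) ^ n * / (INR (fact i) * INR (fact (n - i)))).
        { apply Rmult_lt_0_compat; [apply pow_lt; nra|]. apply Rinv_0_lt_compat, Rmult_lt_0_compat; apply INR_fact_lt_0. }
        pose proof (Cmod_ge_0 (P (x i))).
        pose proof (Cmod_ge_0 (Cprod (fun j => if Nat.eqb j i then RtoC 1 else x j / (x j - x i))%C (S n))).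
        eapply Rle_lt_trans; [apply Rmult_le_compat_l; [auto|apply Hprod]|].
        apply Rmult_lt_compat_r; auto. }
      induction m; intros Hm.
      - simpl. pose proof (T O ltac:(lia)) as T0. simpl in T0. lra.
      - change (Rsum ?f (S (S m))) with (Rsum f (S m) + f (S m)). cbv beta.
        apply Rplus_lt_compat; [apply IHm; lia|apply T; lia]. }
    apply (S n). lia.
  - rewrite !Rsum_scal, Rsum_inv_fact.
    unfold lam. apply Rle_trans with (Cmod (c O) / K * K); [|apply Req_le; field; lra].
    apply Rmult_le_compat_l; [left; auto|]. unfold K.
    rewrite !Rpow_mult_distr. pose proof (pow_n_fact n) as E.
    replace (exp 1 ^ n) with (exp (INR n)).
    + replace (Q ^ n * INR n ^ n * (2 ^ n / INR (fact n))) with (2 ^ n * Q ^ n * (INR n ^ n / INR (fact n)))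
        by (field; apply INR_fact_neq_0).
      assert (0 < 2 ^ n * Q ^ n) by (apply Rmult_lt_0_compat; apply pow_lt; lra). nra.
    + clear. induction n; [simpl; apply exp_0|]. rewrite S_INR, exp_plus, IHn. simpl. ring.
Qed.

Lemma Cmult_reg_l (a b c : C) : a <> RtoC 0 -> (a * b = a * c)%C -> b = c.
Proof.
  intros Ha E. replace b with (/ a * (a * b))%C by (field; auto). rewrite E. field. auto.
Qed.

Lemma pow_le_base (x : R) (N : nat) : 0 <= x <= 1 -> (1 <= N)%nat -> x ^ N <= x.
Proof.
  intros Hx HN. destruct N as [|N]; [lia|]. simpl.
  assert (x ^ N <= 1) by (rewrite <- (pow1 N); apply pow_incr; auto).
  assert (0 <= x ^ N) by (apply pow_le; lra). nra.
Qed.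

Lemma Cmod_sub_ge (a b : C) : Cmod a - Cmod b <= Cmod (a - b).
Proof. pose proof (Cmod_triangle (a - b) b) as T. replace (a - b + b)%C with a in T by ring. lra. Qed.

Lemma Cmod_sub_ge' (a b : C) : Cmod b - Cmod a <= Cmod (a - b).
Proof. replace (a - b)%C with (- (b - a))%C by ring. rewrite Cmod_opp. apply Cmod_sub_ge. Qed.

(** With [q = rho / r] and [o] a root of unity, [1 / (1 - q/o) = (1 - q^N)^-1 sum_(k<N) q^k o^-k]
    because [o^N = 1]; on averaging only [k = 0] survives. Points [rho] inside and outside the
    circle are treated alike. *)
Lemma avg_pole N r rho : 0 < r -> (0 < N)%nat -> Cmod rho <> r ->
  avg N (fun l => (RtoC r * rou N l) / (RtoC r * rou N l - rho))%C = (/ (1 - (rho / RtoC r) ^ N))%C.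
Proof.
  intros Hr HN Hrho. set (q := (rho / RtoC r)%C).
  assert (Rr : RtoC r <> RtoC 0) by (apply RtoC_neq0; auto).
  assert (Hq : Cmod q <> 1).
  { unfold q. rewrite Cmod_div, Cmod_R, Rabs_pos_eq by (auto; lra). intros E. apply Hrho.
    apply Rmult_eq_reg_r with (/ r); [|apply Rinv_neq_0_compat; lra].
    rewrite Rinv_r by lra. exact E. }
  assert (D : (1 - q ^ N)%C <> RtoC 0).
  { intros E. assert (E1 : (q ^ N)%C = 1%C) by (replace (q ^ N)%C with (1 - (1 - q ^ N))%C by ring; rewrite E; ring).
    apply (f_equal Cmod) in E1. rewrite Cmod_pow, Cmod_1 in E1.
    destruct (Rtotal_order (Cmod q) 1) as [L|[L|L]]; [|auto|].
    - assert (Cmod q ^ N < 1); [|lra]. apply pow_lt_1_compat; [split; [apply Cmod_ge_0|auto]|auto].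
    - assert (1 < Cmod q ^ N); [|lra]. apply Rlt_pow_R1; auto. }
  transitivity (avg N (fun l => / (1 - q ^ N) * Csum (fun k => q ^ k * rouV N l ^ k)%C N)%C).
  - apply avg_ext. intros l _.
    assert (V : (rou N l * rouV N l)%C = 1%C)
      by (unfold rou, rouV; rewrite <- cis_plus, Rplus_opp_r; apply cis_0).
    set (o := rou N l) in *. set (o' := rouV N l) in *.
    assert (O0 : o <> RtoC 0) by (intros E; rewrite E in V; apply (f_equal fst) in V; simpl in V; lra).
    rewrite (Csum_ext _ (fun k => (q * o') ^ k)%C) by (intros; rewrite Cpow_mult_l; auto).
    pose proof (Csum_geom (q * o') N) as G. rewrite Cpow_mult_l in G.
    assert (VN : (o' ^ N)%C = 1%C).
    { transitivity ((o * o') ^ N)%C; [|rewrite V; apply Cpow_1_l].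
      rewrite Cpow_mult_l. unfold o. rewrite rou_pow_N by auto. ring. }
    rewrite VN, Cmult_1_r in G. set (S := Csum (fun k => (q * o') ^ k)%C N) in *.
    assert (Eq : rho = (RtoC r * q)%C) by (unfold q; field; auto). rewrite Eq.
    assert (X : (RtoC r * o - RtoC r * q)%C = (RtoC r * o * (1 - q * o'))%C).
    { replace (RtoC r * o * (1 - q * o'))%C with (RtoC r * o - RtoC r * q * (o * o'))%C by ring. rewrite V. ring. }
    assert (Y : (1 - q * o')%C <> RtoC 0).
    { intros E. rewrite E in G. apply D. rewrite <- G. ring. }
    rewrite X. apply Cmult_reg_l with (1 - q ^ N)%C; auto. rewrite <- G at 1. field. repeat split; auto.
  - rewrite avg_scal, avg_Csum. rewrite Csum_ext with (b := fun k => if Nat.eqb k 0 then RtoC 1 else RtoC 0).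
    + destruct N as [|N]; [lia|]. rewrite Csum_S_l, Csum_zero; [simpl; ring|]. auto.
    + intros k Hk. rewrite avg_scal. destruct (Nat.eqb_spec k 0) as [->|Hk0].
      * rewrite (avg_ext _ _ (fun _ => RtoC 1)); [rewrite avg_const by auto; simpl; ring|]. intros; simpl; auto.
      * pose proof (avg_char N 0 k ltac:(lia) Hk ltac:(auto)) as E.
        rewrite (avg_ext _ _ (fun l => rou N l ^ 0 * rouV N l ^ k)%C), E; [ring|]. intros; simpl; ring.
Qed.

(** Since [q ^ N] tends to 0 or to infinity, a root inside the circle is counted with weight 1 and a
    root outside with weight 0: the argument principle in discrete form. *)
Lemma avg_pole_lim r rho : 0 < r -> Cmod rho <> r ->
  Ccvg (fun N => avg N (fun l => (RtoC r * rou N l) / (RtoC r * rou N l - rho))%C)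
    (RtoC (if Rlt_dec (Cmod rho) r then 1 else 0)).
Proof.
  intros Hr Hrho. set (q := (rho / RtoC r)%C).
  assert (Rr : RtoC r <> RtoC 0) by (apply RtoC_neq0; auto).
  assert (Hq : Cmod q = Cmod rho / r).
  { unfold q. rewrite Cmod_div, Cmod_R, Rabs_pos_eq by (auto; lra). auto. }
  pose proof (Cmod_ge_0 rho) as P0.
  apply (Ccvg_ext_loc (fun N => / (1 - q ^ N))%C _ _ 1%nat);
    [intros N HN; symmetry; apply avg_pole; auto|].
  destruct (Rlt_dec (Cmod rho) r) as [L|L].
  - assert (Q : 0 <= Cmod q < 1).
    { rewrite Hq. split; [apply Rdiv_le_0_compat; auto|]. apply Rmult_lt_reg_r with r; auto.
      unfold Rdiv. rewrite Rmult_assoc, Rinv_l; lra. }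
    apply (Ccvg_squeeze _ _ (fun N => / (1 - Cmod q) * Cmod q ^ N) 1%nat).
    + intros N HN.
      assert (X : Cmod q ^ N <= Cmod q).
      { apply pow_le_base; auto; lra. }
      assert (D : 1 - Cmod q <= Cmod (1 - q ^ N)).
      { pose proof (Cmod_sub_ge 1 (q ^ N)) as T. rewrite Cmod_1, Cmod_pow in T. lra. }
      assert (D0 : (1 - q ^ N)%C <> RtoC 0) by (apply Cmod_gt_0; lra).
      replace (/ (1 - q ^ N) - 1)%C with (/ (1 - q ^ N) * q ^ N)%C by (field; auto).
      rewrite Cmod_mult, Cmod_inv, Cmod_pow by auto. apply Rmult_le_compat_r; [apply pow_le; lra|].
      apply Rinv_le_contravar; lra.
    + replace (Finite 0) with (Rbar_mult (/ (1 - Cmod q)) 0) by (simpl; f_equal; ring).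
      apply is_lim_seq_scal_l, is_lim_seq_geom. rewrite Rabs_pos_eq; lra.
  - assert (Q : 1 < Cmod q).
    { rewrite Hq. apply Rmult_lt_reg_r with r; auto. unfold Rdiv. rewrite Rmult_assoc, Rinv_l by lra.
      destruct (Rtotal_order (Cmod rho) r) as [?|[?|?]]; lra. }
    set (p := / Cmod q). assert (Hp : 0 < p < 1).
    { unfold p. split; [apply Rinv_0_lt_compat; lra|]. rewrite <- Rinv_1. apply Rinv_lt_contravar; lra. }
    apply (Ccvg_squeeze _ _ (fun N => / (1 - p) * p ^ N) 1%nat).
    + intros N HN.
      assert (X : p ^ N <= p) by (apply pow_le_base; auto; lra).
      assert (PN : 0 < p ^ N) by (apply pow_lt; lra).
      assert (E : Cmod q ^ N * p ^ N = 1) by (rewrite <- Rpow_mult_distr; unfold p; rewrite Rinv_r by lra; apply pow1).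
      assert (D : Cmod q ^ N - 1 <= Cmod (1 - q ^ N)).
      { pose proof (Cmod_sub_ge' 1 (q ^ N)) as T. rewrite Cmod_1, Cmod_pow in T. lra. }
      assert (D1 : (1 - p) * / p ^ N <= Cmod (1 - q ^ N)).
      { eapply Rle_trans; [|apply D]. apply Rmult_le_reg_r with (p ^ N); auto.
        rewrite Rmult_assoc, Rinv_l by lra.
        replace ((Cmod q ^ N - 1) * p ^ N) with (Cmod q ^ N * p ^ N - p ^ N) by ring. lra. }
      assert (D2 : 0 < (1 - p) * / p ^ N) by (apply Rmult_lt_0_compat; [lra|apply Rinv_0_lt_compat; auto]).
      assert (D0 : (1 - q ^ N)%C <> RtoC 0) by (apply Cmod_gt_0; lra).
      replace (/ (1 - q ^ N) - 0)%C with (/ (1 - q ^ N))%C by ring. rewrite Cmod_inv by auto.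
      apply Rle_trans with (/ ((1 - p) * / p ^ N)); [apply Rinv_le_contravar; auto|].
      rewrite Rinv_mult, Rinv_inv. lra.
    + replace (Finite 0) with (Rbar_mult (/ (1 - p)) 0) by (simpl; f_equal; ring).
      apply is_lim_seq_scal_l, is_lim_seq_geom. rewrite Rabs_pos_eq; lra.
Qed.

Lemma lprod_0 f l : lprod f l = RtoC 0 -> exists z, List.In z l /\ f z = RtoC 0.
Proof.
  induction l as [|z l IH]; simpl; intros H.
  - apply RtoC_inj in H. lra.
  - destruct (classic (f z = RtoC 0)) as [E|E]; [eauto|].
    destruct IH as [y [Hy E']]; eauto.
    replace (lprod f l) with (/ f z * (f z * lprod f l))%C by (field; auto). unfold lprod in *. rewrite H. ring.
Qed.

Lemma lprod_In_0 f l z : List.In z l -> f z = RtoC 0 -> lprod f l = RtoC 0.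
Proof.
  induction l as [|y l IH]; simpl; intros H E; [tauto|].
  destruct H as [->|H]; [rewrite E; ring|]. unfold lprod in *. rewrite IH; auto. ring.
Qed.

(* A zero inside the circle makes the average of wP'/P over the circle at least 1, while the average
   of the polynomial w tau(w) vanishes. *)
Lemma no_zero_inside (n m : nat) (p tau : nat -> C) (r d lam : R) (w1 : C) :
  0 < r -> 0 < lam -> 2 * d < lam ->
  (forall w, Cmod w = r -> lam <= Cmod (Csum (fun k => p k * w ^ k)%C n)) ->
  (forall w, Cmod w = r ->
     Cmod (Csum (fun k => RtoC (INR k) * (p k * w ^ k))%C n
       - Csum (fun k => p k * w ^ k)%C n * (w * Csum (fun k => tau k * w ^ k) m)) <= d)%C ->
  Cmod w1 < r -> Csum (fun k => p k * w1 ^ k)%C n <> RtoC 0.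
Proof.
  intros Hr Hlam Hd HP HD Hw1 H0.
  destruct (poly_factor n p) as [lc [rs F]].
  set (P := fun w => Csum (fun k => p k * w ^ k)%C n) in *.
  assert (HC : Cmod (RtoC r) = r) by (rewrite Cmod_R, Rabs_pos_eq; lra).
  assert (Hlc : lc <> RtoC 0).
  { intros E. specialize (HP (RtoC r) HC). rewrite (proj1 (F (RtoC r))), E, Cmult_0_l, Cmod_0 in HP. lra. }
  assert (Hroots : forall z, List.In z rs -> Cmod z <> r).
  { intros z Hz E. specialize (HP z E). rewrite (proj1 (F z)) in HP.
    rewrite (lprod_In_0 _ _ z Hz) in HP by ring. rewrite Cmult_0_r, Cmod_0 in HP. lra. }
  assert (Hin : List.In w1 rs).
  { pose proof (proj1 (F w1)) as E. fold (P w1) in E. unfold P in E. rewrite H0 in E.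
    destruct (lprod_0 (fun z => w1 - z)%C rs) as [z [Hz Ez]].
    - apply Cmult_reg_l with lc; auto. rewrite <- E. ring.
    - replace w1 with z; auto. replace z with (w1 - (w1 - z))%C by ring. rewrite Ez. ring. }
  set (cnt := lsum (fun z => RtoC (if Rlt_dec (Cmod z) r then 1 else 0)) rs).
  assert (Hcnt : 1 <= Re cnt).
  { unfold cnt. clear -Hin Hw1.
    assert (P : forall l, 0 <= Re (lsum (fun z => RtoC (if Rlt_dec (Cmod z) r then 1 else 0)) l)).
    { induction l; simpl; [lra|]. unfold lsum, Re in *. destruct (Rlt_dec (Cmod a) r); simpl in *; lra. }
    induction rs as [|a l IH]; simpl in *; [tauto|]. specialize (P l).
    destruct Hin as [->|Hin].
    - destruct (Rlt_dec (Cmod w1) r); [|tauto]. unfold lsum, Re in *; simpl in *; lra.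
    - specialize (IH Hin). unfold lsum, Re in *. destruct (Rlt_dec (Cmod a) r); simpl in *; lra. }
  set (g := fun N l => lsum (fun z => (RtoC r * rou N l) / (RtoC r * rou N l - z))%C rs).
  assert (L : Ccvg (fun N => avg N (g N)) cnt).
  { unfold g, cnt. clear -Hroots Hr. induction rs as [|a l IH].
    - simpl. apply (Ccvg_ext (fun _ => RtoC 0)); [|apply Ccvg_const]. intros N. unfold avg. rewrite Csum_0. ring.
    - simpl. apply (Ccvg_ext (fun N => avg N (fun l0 => (RtoC r * rou N l0) / (RtoC r * rou N l0 - a))%C
        + avg N (fun l0 => lsum (fun z => (RtoC r * rou N l0) / (RtoC r * rou N l0 - z)) l)%C)%C).
      + intros N. rewrite <- avg_plus. reflexivity.
      + apply Ccvg_plus; [apply avg_pole_lim; auto; apply Hroots; left; auto|].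
        apply IH. intros z Hz. apply Hroots. right; auto. }
  (* The polynomial [w tau(w)] has no constant term, so its average is 0 once [N] exceeds its
     degree. Subtracting it leaves a function of modulus at most [d / lam < 1/2] on the circle. *)
  assert (B : Cmod cnt <= 1 / 2).
  { apply (Ccvg_bound_loc _ _ _ (S (S m)) L). intros N HN.
    set (wt := fun l => (RtoC r * rou N l * Csum (fun k => tau k * (RtoC r * rou N l) ^ k) m)%C).
    assert (A0 : avg N wt = RtoC 0).
    { unfold wt. rewrite (avg_ext _ _ (fun l => Csum (fun k => (RtoC r ^ S k * tau k) * (rou N l ^ S k * rouV N l ^ 0)) m)%C).
      - rewrite avg_Csum. apply Csum_zero. intros k Hk. rewrite avg_scal, avg_char by lia. ring.
      - intros l _. rewrite <- Csum_scal. apply Csum_ext. intros k _. rewrite Cpow_mult_l. simpl. ring. }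
    replace (avg N (g N)) with (avg N (fun l => g N l - wt l)%C).
    2:{ unfold Cminus. rewrite avg_plus.
        rewrite (avg_ext _ (fun l => - wt l)%C (fun l => - (1) * wt l)%C) by (intros; ring).
        rewrite avg_scal, A0. ring. }
    apply avg_bound; [lia|]. intros l _.
    assert (W : Cmod (RtoC r * rou N l) = r) by (rewrite Cmod_mult, HC, Cmod_rou; lra).
    unfold g, wt. set (w := (RtoC r * rou N l)%C) in *.
    specialize (HP w W). specialize (HD w W).
    assert (NZ : P w <> RtoC 0) by (apply Cmod_gt_0; unfold P; lra).
    assert (NR : forall z, List.In z rs -> w <> z).
    { intros z Hz E. apply (Hroots z Hz). rewrite <- E. auto. }
    pose proof (proj2 (F w) NR) as E. rewrite E in HD. fold (P w) in HD, HP |- *.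
    set (A := lsum (fun z => w / (w - z))%C rs) in *. set (T := (w * Csum (fun k => tau k * w ^ k) m)%C) in *.
    change (Csum (fun k => p k * w ^ k)%C n) with (P w) in *.
    replace (P w * A - P w * T)%C with (P w * (A - T))%C in HD by ring. rewrite Cmod_mult in HD.
    pose proof (Cmod_ge_0 (A - T)). nra. }
  pose proof (Re_le_Cmod' cnt). lra.
Qed.

Lemma Rsum_geom_half q n : 0 <= q <= 1 / 2 -> Rsum (fun k => q ^ S k) n <= 1.
Proof.
  intros Hq. assert (G : (1 - q) * Rsum (fun k => q ^ k) n = 1 - q ^ n).
  { induction n; [simpl; ring|]. simpl. rewrite Rmult_plus_distr_l, IHn. ring. }
  rewrite (Rsum_ext _ (fun k => q * q ^ k)) by (intros; simpl; auto). rewrite Rsum_scal.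
  set (S := Rsum (fun k => q ^ k) n) in *.
  assert (P : 0 <= S) by (apply Rsum_nonneg; intros; apply pow_le; lra).
  assert (0 <= q ^ n) by (apply pow_le; lra).
  assert (q * S <= (1 - q) * S) by (apply Rmult_le_compat_r; lra). lra.
Qed.

Lemma geom_tail_le H q n K : 0 <= H -> 0 <= q <= 1 / 2 ->
  Rsum (fun k => H * q ^ (S n + k)) K <= H * q ^ n.
Proof.
  intros HH Hq. rewrite (Rsum_ext _ (fun k => H * q ^ n * q ^ S k)).
  - rewrite Rsum_scal. pose proof (Rsum_geom_half q K Hq).
    assert (0 <= H * q ^ n) by (apply Rmult_le_pos; auto; apply pow_le; lra). nra.
  - intros k _. replace (S n + k)%nat with (n + S k)%nat by lia. rewrite pow_add. ring.
Qed.

(** * Truncation of a power series whose logarithmic derivative is known in a window *)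

Section Truncation.

Variables (n m : nat) (f t : nat -> C) (r2 H B dl q : R).
Hypothesis (Hr2 : 0 < r2) (HH : 0 <= H) (HB : 0 <= B) (Hdl : 0 <= dl) (Hq : 0 <= q <= 1 / 2).
(** [Hrec] says [f' = t f] for the generating series. [q] measures how much farther than [r2] the
    series [f] is bounded, and [dl] is the size of the coefficients of [t] in the window from [m] to
    [n + m]; nothing is assumed about [t] beyond it. *)
Hypothesis Hrec : forall k, (RtoC (INR (S k)) * f (S k))%C = Csum (fun i => t i * f (k - i)%nat)%C (S k).
Hypothesis Hf : forall k, Cmod (f k) * r2 ^ k <= H * q ^ k.
Hypothesis Ht : forall i, (i < m)%nat -> Cmod (t i) * r2 ^ i <= B.
Hypothesis Ht' : forall i, (m <= i < n + m)%nat -> Cmod (t i) * r2 ^ i <= dl.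

Let F (w : C) (K : nat) := Csum (fun k => f k * w ^ k)%C K.

Lemma term_le (a : C) (w : C) k M : Cmod w <= r2 -> Cmod a * r2 ^ k <= M -> Cmod (a * w ^ k) <= M.
Proof. intros Hw Ha. eapply Rle_trans; [apply (Ana_term_bound (fun _ => a) r2 w k Hw)|auto]. Qed.

Lemma F_bound w K : Cmod w <= r2 -> Cmod (F w K) <= 2 * H.
Proof.
  intros Hw. unfold F. destruct K; [simpl; rewrite Cmod_0; lra|]. rewrite Csum_S_l.
  eapply Rle_trans; [apply Cmod_triangle|].
  assert (Cmod (f O * w ^ 0) <= H).
  { apply term_le; auto. specialize (Hf O). simpl in *. lra. }
  assert (Cmod (Csum (fun k => f (S k) * w ^ S k) K)%C <= H); [|lra].
  eapply Rle_trans; [apply (Cmod_Csum_le _ (fun k => H * q ^ (1 + k)))|].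
  - intros k _. apply term_le; auto.
  - pose proof (geom_tail_le H q 0 K HH Hq) as G. simpl in *. lra.
Qed.

Lemma F_tail w K : Cmod w <= r2 -> Cmod (Csum (fun k => f (S n + k)%nat * w ^ (S n + k)) K)%C <= H * q ^ n.
Proof.
  intros Hw. eapply Rle_trans; [apply (Cmod_Csum_le _ (fun k => H * q ^ (S n + k)))|].
  - intros k _. apply term_le; auto.
  - apply geom_tail_le; auto.
Qed.

(** With [tau] the part of [t] below [m], the recurrence is used up to index [n + m]. What remains
    of [w P' - P w tau] are tails of [f], of size [q ^ n], and products of [f] with window
    coefficients of [t], of size [dl]; no coefficient beyond the window enters. The constant [th] is
    at the disposal of [zero_free_disc]. *)
Lemma log_derivative_defect (w th : C) : Cmod w <= r2 -> Cmod th <= H * q ^ n ->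
  Cmod (Csum (fun k => RtoC (INR k) * (f k * w ^ k))%C (S n)
    - (Csum (fun k => f k * w ^ k)%C (S n) + th) * (w * Csum (fun i => t i * w ^ i) m))%C
  <= H * ((2 * INR m * B * r2 + INR (n + m)) * q ^ n + 2 * INR n * r2 * dl).
Proof.
  intros Hw Hth.
  set (tau := Csum (fun i => t i * w ^ i)%C m).
  assert (Hqn : 0 <= q ^ n) by (apply pow_le; lra).
  assert (Htau : Cmod tau <= INR m * B).
  { rewrite <- Rsum_const. apply Cmod_Csum_le. intros i Hi. apply term_le; auto. }
  assert (Hsh : forall K, Csum (fun k => RtoC (INR k) * (f k * w ^ k))%C (S K)
     = (w * Csum (fun d => Csum (fun i => t i * w ^ i * (f (d - i)%nat * w ^ (d - i))) (S d)) K)%C).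
  { intros K. rewrite Csum_S_l. simpl INR at 1. rewrite Cmult_0_l, Cplus_0_l, <- Csum_scal.
    apply Csum_ext. intros d _.
    replace (RtoC (INR (S d)) * (f (S d) * w ^ S d))%C with (w * w ^ d * (RtoC (INR (S d)) * f (S d)))%C
      by (rewrite Cpow_S; ring).
    rewrite Hrec, <- Cmult_assoc. f_equal. rewrite <- Csum_scal. apply Csum_ext. intros i Hi.
    assert (E : (w ^ d = w ^ i * w ^ (d - i))%C) by (rewrite <- Cpow_add_r; f_equal; lia).
    rewrite E. ring. }
  assert (Hsplit : Csum (fun k => RtoC (INR k) * (f k * w ^ k))%C (S n) =
    (w * (tau * F w (S n) + Csum (fun i => t i * w ^ i * (F w (n + m - i) - F w (S n))) m
      + Csum (fun i => t (m + i)%nat * w ^ (m + i) * F w (n - i)) n)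
      - Csum (fun d => RtoC (INR (S n + d)) * (f (S n + d)%nat * w ^ (S n + d))) m)%C).
  { assert (E1 : Csum (fun k => RtoC (INR k) * (f k * w ^ k))%C (S (n + m)) =
      (w * Csum (fun i => t i * w ^ i * F w (n + m - i)) (n + m))%C).
    { rewrite Hsh. f_equal. rewrite (Csum_cauchy_product (fun i => t i * w ^ i)%C (fun k => f k * w ^ k)%C). reflexivity. }
    change (S (n + m)) with (S n + m)%nat in E1. rewrite Csum_split in E1.
    assert (E2 : Csum (fun i => t i * w ^ i * F w (n + m - i))%C (n + m) =
      (tau * F w (S n) + Csum (fun i => t i * w ^ i * (F w (n + m - i) - F w (S n))) m
       + Csum (fun i => t (m + i)%nat * w ^ (m + i) * F w (n - i)) n)%C).
    { replace (Csum (fun i => t i * w ^ i * F w (n + m - i))%C (n + m))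
        with (Csum (fun i => t i * w ^ i * F w (n + m - i))%C (m + n)) by (f_equal; lia).
      rewrite Csum_split. f_equal.
      - unfold tau. rewrite (Cmult_comm (Csum _ m)), <- Csum_scal, <- Csum_plus. apply Csum_ext. intros; ring.
      - apply Csum_ext. intros i _. do 2 f_equal. lia. }
    rewrite <- E2, <- E1. ring. }
  rewrite Hsplit. clear Hsplit. fold (F w (S n)).
  match goal with |- Cmod ?X <= _ => replace X with
    (w * (Csum (fun i => t i * w ^ i * (F w (n + m - i) - F w (S n))) m
      + (Csum (fun i => t (m + i)%nat * w ^ (m + i) * F w (n - i)) n - th * tau))
      - Csum (fun d => RtoC (INR (S n + d)) * (f (S n + d)%nat * w ^ (S n + d))) m)%C by ring end.
  assert (B1 : Cmod (Csum (fun i => t i * w ^ i * (F w (n + m - i) - F w (S n))) m)%C <= INR m * (B * (H * q ^ n))).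
  { rewrite <- Rsum_const. apply Cmod_Csum_le. intros i Hi. rewrite Cmod_mult.
    apply Rmult_le_compat; auto using Cmod_ge_0; [apply term_le; auto|].
    unfold F. replace (n + m - i)%nat with (S n + (m - 1 - i))%nat by lia. rewrite Csum_split.
    match goal with |- Cmod ?X <= _ => replace X with
      (Csum (fun k => f (S n + k)%nat * w ^ (S n + k)) (m - 1 - i))%C by ring end.
    apply F_tail; auto. }
  assert (B2 : Cmod (Csum (fun i => t (m + i)%nat * w ^ (m + i) * F w (n - i)) n)%C <= INR n * (dl * (2 * H))).
  { rewrite <- Rsum_const. apply Cmod_Csum_le. intros i Hi. rewrite Cmod_mult.
    apply Rmult_le_compat; auto using Cmod_ge_0; [|apply F_bound; auto].
    apply term_le; auto. apply Ht'. lia. }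
  assert (B3 : Cmod (th * tau) <= H * q ^ n * (INR m * B)).
  { rewrite Cmod_mult. apply Rmult_le_compat; auto using Cmod_ge_0. }
  assert (B4 : Cmod (Csum (fun d => RtoC (INR (S n + d)) * (f (S n + d)%nat * w ^ (S n + d))) m)%C
     <= INR (n + m) * (H * q ^ n)).
  { apply Rle_trans with (Rsum (fun d => INR (n + m) * (H * q ^ (S n + d))) m).
    - apply Cmod_Csum_le. intros d Hd. rewrite Cmod_mult, Cmod_R, Rabs_pos_eq by apply pos_INR.
      apply Rmult_le_compat; auto using Cmod_ge_0, pos_INR; [apply le_INR; lia|]. apply term_le; auto.
    - rewrite Rsum_scal. apply Rmult_le_compat_l; [apply pos_INR|]. apply geom_tail_le; auto. }
  unfold Cminus at 1. eapply Rle_trans; [apply Cmod_triangle|]. rewrite Cmod_opp, Cmod_mult.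
  eapply Rle_trans; [apply Rplus_le_compat; [apply Rmult_le_compat; [apply Cmod_ge_0|apply Cmod_ge_0|apply Hw|]|apply B4]|].
  - eapply Rle_trans; [apply Cmod_triangle|]. apply Rplus_le_compat; [apply B1|].
    unfold Cminus. eapply Rle_trans; [apply Cmod_triangle|]. rewrite Cmod_opp.
    apply Rplus_le_compat; [apply B2|apply B3].
  - apply Req_le. ring.
Qed.

End Truncation.

(** If [f] vanished at [w1], its truncation would be small there, and adding a small constant [th]
    would make [w1] an exact zero of a polynomial [p]. [min_modulus] finds a circle between [r1] and
    [r2] on which [p] is not small, and on it [log_derivative_defect] feeds [no_zero_inside], which
    forbids that zero. *)
Lemma zero_free_disc (n m : nat) (f t : nat -> C) (r1 r2 H B dl q : R) (w1 : C) :
  0 < r1 < r2 -> (0 < n)%nat -> 0 <= H -> 0 <= B -> 0 <= dl -> 0 <= q <= 1 / 2 ->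
  f O = RtoC 1 ->
  (forall k, (RtoC (INR (S k)) * f (S k))%C = Csum (fun i => t i * f (k - i)%nat)%C (S k)) ->
  (forall k, Cmod (f k) * r2 ^ k <= H * q ^ k) ->
  (forall i, (i < m)%nat -> Cmod (t i) * r2 ^ i <= B) ->
  (forall i, (m <= i < n + m)%nat -> Cmod (t i) * r2 ^ i <= dl) ->
  H * q ^ n <= 1 / 2 ->
  4 * (H * ((2 * INR m * B * r2 + INR (n + m)) * q ^ n + 2 * INR n * r2 * dl))
    * (2 * exp 1 * (r2 / (r2 - r1))) ^ n < 1 ->
  Cmod w1 < r1 ->
  CS (fun k => f k * w1 ^ k)%C <> RtoC 0.
Proof.
  intros Hr Hn HH HB Hdl Hq Hf0 Hrec Hf Ht Ht' Hqn Hsmall Hw1 H0.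
  set (K := (2 * exp 1 * (r2 / (r2 - r1))) ^ n) in *.
  set (d := H * ((2 * INR m * B * r2 + INR (n + m)) * q ^ n + 2 * INR n * r2 * dl)) in *.
  assert (HK : 0 < K).
  { apply pow_lt. pose proof (exp_pos 1). assert (0 < r2 / (r2 - r1)) by (apply Rdiv_lt_0_compat; lra). nra. }
  set (th := (- Csum (fun k => f k * w1 ^ k) (S n))%C).
  assert (Dom : forall k, Cmod (f k * w1 ^ k) <= H * q ^ k).
  { intros k. apply (term_le r2); auto; lra. }
  assert (Ex : ex_series (fun k => H * q ^ k)) by (apply ex_series_scal', ex_series_geom'; lra).
  assert (Hth : Cmod th <= H * q ^ n).
  { unfold th.
    apply (Ccvg_bound_loc (fun N => Csum (fun k => f k * w1 ^ k) N - Csum (fun k => f k * w1 ^ k) (S n))%C _ _ (S n)).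
    - replace (- Csum (fun k => f k * w1 ^ k) (S n))%C
        with (CS (fun k => f k * w1 ^ k) - Csum (fun k => f k * w1 ^ k) (S n))%C by (rewrite H0; ring).
      apply Ccvg_minus; [apply (dom_cv _ _ Dom Ex)|apply Ccvg_const].
    - intros N HN. replace N with (S n + (N - S n))%nat by lia. rewrite Csum_split.
      match goal with |- Cmod ?X <= _ => replace X with
        (Csum (fun k => f (S n + k)%nat * w1 ^ (S n + k)) (N - S n))%C by ring end.
      apply (F_tail n f r2 H q); auto; lra. }
  set (p := fun k => (f k + if Nat.eqb k 0 then th else RtoC 0)%C).
  assert (HP : forall w, Csum (fun k => p k * w ^ k)%C (S n) = (Csum (fun k => f k * w ^ k) (S n) + th)%C).
  { intros w. rewrite !Csum_S_l. unfold p. simpl. rewrite (Csum_ext _ (fun k => f (S k) * (w * w ^ k))%C).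
    - ring.
    - intros; ring. }
  assert (HP' : forall w, Csum (fun k => RtoC (INR k) * (p k * w ^ k))%C (S n)
     = Csum (fun k => RtoC (INR k) * (f k * w ^ k))%C (S n)).
  { intros w. apply Csum_ext. intros [|k] _; unfold p; simpl; ring. }
  destruct (min_modulus n p r1 r2 Hr Hn) as [r [Hr' Hmin]]. fold K in Hmin.
  assert (Hp0 : 1 / 2 <= Cmod (p O)).
  { unfold p. simpl. rewrite Hf0. pose proof (Cmod_sub_ge 1 (- th)) as T. rewrite Cmod_1, Cmod_opp in T.
    replace (1 - - th)%C with (1 + th)%C in T by ring. lra. }
  apply (no_zero_inside (S n) m p t r d (/ (2 * K)) w1).
  - lra.
  - apply Rinv_0_lt_compat; lra.
  - apply Rmult_lt_reg_r with (2 * K); [lra|]. rewrite Rinv_l by lra. lra.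
  - intros w Hw. specialize (Hmin w Hw). apply Rmult_le_reg_r with (2 * K); [lra|].
    rewrite Rinv_l by lra. lra.
  - intros w Hw. rewrite HP, HP'. apply (log_derivative_defect n m f t r2 H B dl q); auto; lra.
  - lra.
  - rewrite HP. unfold th. ring.
Qed.

(** * The von Mangoldt function *)

Lemma Lambda_nonneg n : 0 <= Lambda n.
Proof.
  destruct (classic (exists p, is_prime_power n p)) as [[p Hp]|H].
  - rewrite (Lambda_prime_power n p Hp). destruct Hp as [Hp _]. apply prime_ge_2 in Hp.
    apply ln_ge0. replace 1 with (INR 1) by auto. apply le_INR. lia.
  - rewrite Lambda_not_prime_power; auto; lra.
Qed.

Lemma Lambda_0 : Lambda 0 = 0.
Proof.
  apply Lambda_not_prime_power. intros [p [Hp [m [Hm E]]]]. apply prime_ge_2 in Hp.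
  assert (p ^ m <> 0)%nat by (apply Nat.pow_nonzero; lia). lia.
Qed.

Lemma Lambda_1 : Lambda 1 = 0.
Proof.
  apply Lambda_not_prime_power. intros [p [Hp [m [Hm E]]]]. apply prime_ge_2 in Hp.
  assert (1 < p ^ m)%nat by (apply Nat.pow_gt_1; lia). lia.
Qed.

Lemma exists_prime_divisor n : (2 <= n)%nat -> exists p, prime (Z.of_nat p) /\ Nat.divide p n.
Proof.
  induction n as [n IH] using (well_founded_induction lt_wf). intros Hn.
  destruct (prime_dec (Z.of_nat n)) as [Hp|Hp]; [exists n; split; auto; apply Nat.divide_refl|].
  destruct (not_prime_divide (Z.of_nat n)) as [d [Hd1 Hd2]]; [lia|auto|].
  destruct (IH (Z.to_nat d)) as [p [Hp1 Hp2]]; [lia|lia|].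
  exists p. split; auto. apply Nat.divide_trans with (Z.to_nat d); auto.
  destruct Hd2 as [q Hq]. exists (Z.to_nat q).
  apply Nat2Z.inj. rewrite Nat2Z.inj_mul, !Z2Nat.id; nia.
Qed.

Lemma Rsum_single f n k0 : (k0 < n)%nat -> (forall k, (k < n)%nat -> k <> k0 -> f k = 0) -> Rsum f n = f k0.
Proof.
  induction n; intros Hk H; [lia|]. simpl. destruct (Nat.eq_dec n k0) as [->|Hn].
  - rewrite (Rsum_ext _ (fun _ => 0)); [rewrite Rsum_const; ring|]. intros k Hk'. apply H; lia.
  - rewrite IHn; [rewrite (H n); auto; ring|lia|]. intros; apply H; lia.
Qed.

Lemma Lambda_neq0 d : Lambda d <> 0 -> exists q i, prime (Z.of_nat q) /\ (1 <= i)%nat /\ d = (q ^ i)%nat.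
Proof.
  intros H. destruct (classic (exists p, is_prime_power d p)) as [[p [Hp [i [Hi E]]]]|Hn].
  - exists p, i. auto.
  - exfalso. apply H, Lambda_not_prime_power; auto.
Qed.

Lemma divide_nat_Z (a b : nat) : Nat.divide a b <-> (Z.of_nat a | Z.of_nat b)%Z.
Proof.
  split.
  - intros [q E]. exists (Z.of_nat q). lia.
  - intros [q E]. destruct (Nat.eq_dec b 0) as [->|Hb]; [apply Nat.divide_0_r|].
    exists (Z.to_nat q). apply Nat2Z.inj. rewrite Nat2Z.inj_mul, Z2Nat.id; nia.
Qed.

Lemma prime_pow_divide_cofactor (p q i n : nat) : prime (Z.of_nat p) -> prime (Z.of_nat q) -> q <> p ->
  Nat.divide (q ^ i) (p * n) -> Nat.divide (q ^ i) n.
Proof.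
  intros Hp Hq Hne H. apply divide_nat_Z in H. apply divide_nat_Z. rewrite Nat2Z.inj_mul in H.
  apply Gauss with (Z.of_nat p); auto. clear H.
  assert (G : rel_prime (Z.of_nat q) (Z.of_nat p)).
  { apply prime_rel_prime; auto. intros D. apply Hne. apply prime_div_prime in D; auto. lia. }
  induction i.
  - apply rel_prime_1.
  - simpl. rewrite Nat2Z.inj_mul. apply rel_prime_sym, rel_prime_mult; apply rel_prime_sym; auto.
Qed.

(** Strong induction through [n = p n']: the divisor sums of [n] and [n'] differ in a single term,
    at [p ^ e], the exact power of [p] in [n], and that term is [ln p]. *)
Lemma sum_Lambda_divisors n : (1 <= n)%nat ->
  Rsum (fun d => if Nat.eqb (n mod S d) 0 then Lambda (S d) else 0) n = ln (INR n).
Proof.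
  induction n as [n IH] using (well_founded_induction lt_wf). intros Hn.
  destruct (Nat.eq_dec n 1) as [->|Hn1].
  { simpl. rewrite Lambda_1, ln_1. ring. }
  destruct (exists_prime_divisor n ltac:(lia)) as [p [Hp [n' En]]].
  pose proof (prime_ge_2 _ Hp) as Hp2.
  rewrite Nat.mul_comm in En.
  assert (Hn' : (1 <= n' < n)%nat) by nia.
  assert (Dv : forall m d, Nat.eqb (m mod S d) 0 = true <-> Nat.divide (S d) m).
  { intros m d. rewrite Nat.eqb_eq. apply Nat.mod_divide. lia. }
  (* The sum for [n'] is padded with zero terms up to [n] so that the difference can be taken term
     by term. *)
  assert (Ext : Rsum (fun d => if Nat.eqb (n' mod S d) 0 then Lambda (S d) else 0) n' =
                Rsum (fun d => if Nat.eqb (n' mod S d) 0 then Lambda (S d) else 0) n).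
  { assert (Ed : n = (n' + (n - n'))%nat) by lia. rewrite Ed. rewrite Rsum_split. clear Ed.
    rewrite (Rsum_ext (fun k => if Nat.eqb (n' mod S (n' + k)) 0 then _ else _) (fun _ => 0)).
    - rewrite Rsum_const. ring.
    - intros k _. rewrite Nat.mod_small by lia. destruct (Nat.eqb_spec n' 0); [lia|auto]. }
  assert (Ex : exists e, (1 <= e)%nat /\ Nat.divide (p ^ e) n /\ ~ Nat.divide (p ^ e) n').
  { apply NNPP. intros Hno.
    assert (All : forall i, Nat.divide (p ^ S i) n).
    { induction i; [simpl; rewrite Nat.mul_1_r, En; apply Nat.divide_factor_l|].
      assert (D : Nat.divide (p ^ S i) n') by (apply NNPP; intros D; apply Hno; exists (S i); repeat split; auto; lia).
      destruct D as [x Hx]. exists x. rewrite En, Hx. simpl. ring. }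
    specialize (All n). apply Nat.divide_pos_le in All; [|lia].
    assert (n < p ^ n)%nat by (apply Nat.pow_gt_lin_r; lia).
    assert (p ^ n <= p ^ S n)%nat by (apply Nat.pow_le_mono_r; lia). lia. }
  destruct Ex as [e [He [De Nde]]].
  assert (Ppos : (1 <= p ^ e)%nat) by (pose proof (Nat.pow_nonzero p e); lia).
  assert (Ple : (p ^ e <= n)%nat) by (apply Nat.divide_pos_le; auto; lia).
  assert (Diff : Rsum (fun d => (if Nat.eqb (n mod S d) 0 then Lambda (S d) else 0)
      + - (if Nat.eqb (n' mod S d) 0 then Lambda (S d) else 0)) n = ln (INR p)).
  { rewrite (Rsum_single _ n (p ^ e - 1)); [|lia|].
    - replace (S (p ^ e - 1)) with (p ^ e)%nat by lia.
      destruct (Nat.eqb_spec (n mod p ^ e) 0) as [E|E].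
      2:{ exfalso. apply E. apply Nat.mod_divide; auto. lia. }
      destruct (Nat.eqb_spec (n' mod p ^ e) 0) as [E'|E'].
      { exfalso. apply Nde. apply Nat.mod_divide in E'; auto. lia. }
      rewrite (Lambda_prime_power (p ^ e) p); [ring|]. split; auto. exists e; auto.
    - intros d Hd Hne.
      destruct (Nat.eqb (n' mod S d) 0) eqn:E'.
      + apply Dv in E'. assert (E : Nat.eqb (n mod S d) 0 = true).
        { apply Dv. rewrite En. apply Nat.divide_mul_r; auto. }
        rewrite E. ring.
      + destruct (Nat.eqb (n mod S d) 0) eqn:E; [|ring].
        apply Dv in E. assert (N' : ~ Nat.divide (S d) n') by (intros X; apply Dv in X; congruence).
        destruct (Req_dec (Lambda (S d)) 0) as [->|NZ]; [ring|exfalso].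
        destruct (Lambda_neq0 _ NZ) as [q [i [Hq [Hi Ed]]]]. rewrite Ed in E, N'.
        destruct (Nat.eq_dec q p) as [->|Hqp].
        2:{ apply N'. apply prime_pow_divide_cofactor with p; auto. rewrite <- En; auto. }
        assert (Step : forall a b, (a < b)%nat -> Nat.divide (p ^ b) n -> Nat.divide (p ^ a) n').
        { intros a b Hab D. apply Nat.divide_trans with (p ^ (b - 1))%nat.
          - exists (p ^ (b - 1 - a))%nat. rewrite <- Nat.pow_add_r. f_equal. lia.
          - replace b with (S (b - 1)) in D by lia. simpl in D. rewrite En in D.
            apply Nat.mul_divide_cancel_l in D; auto. lia. }
        destruct (lt_eq_lt_dec i e) as [[L|L]|L].
        * apply N', (Step i e); auto.
        * subst i. lia.
        * apply Nde, (Step e i); auto. }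
  rewrite Rsum_plus in Diff.
  rewrite (Rsum_ext (fun k => - _) (fun k => (-1) * (if Nat.eqb (n' mod S k) 0 then Lambda (S k) else 0))) in Diff
    by (intros; ring).
  rewrite Rsum_scal, <- Ext, (IH n') in Diff by lia.
  rewrite En at 2. rewrite mult_INR, ln_mult; [lra| |]; apply lt_0_INR; lia.
Qed.

Lemma Lambda_le_ln n : (1 <= n)%nat -> Lambda n <= ln (INR n).
Proof.
  intros Hn. rewrite <- sum_Lambda_divisors by auto. destruct n as [|n]; [lia|].
  change (Rsum ?f (S n)) with (Rsum f n + f n). cbv beta.
  rewrite Nat.mod_same by lia. rewrite Nat.eqb_refl.
  match goal with |- _ <= ?A + _ => assert (0 <= A); [|lra] end.
  apply Rsum_nonneg. intros k _. destruct (Nat.eqb _ 0); [apply Lambda_nonneg|lra].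
Qed.

(** * Taylor coefficients of zeta and of its logarithmic derivative *)

(** The coefficient of [w^k] in [(n+1)^-(s+w)]. Hence [phi], [tcf] and [epsc] are the Taylor
    coefficients at [s] of zeta, of [zeta'/zeta] and of [- zeta'/zeta - zeta]. *)
Definition dterm (s : C) (k n : nat) : C :=
  (Rcpow (INR (S n)) (- s) * expt (RtoC (- ln (INR (S n)))) k)%C.

Definition phi (s : C) (k : nat) : C := CS (dterm s k).
Definition tcf (s : C) (k : nat) : C := (- CS (fun n => RtoC (Lambda (S n)) * dterm s k n))%C.
Definition epsc (s : C) (k : nat) : C := CS (fun n => RtoC (Lambda (S n) - 1) * dterm s k n)%C.

Lemma pow_fact_exp (d x : R) k : 0 < d -> 0 <= x -> x ^ k / INR (fact k) <= exp (d * x) / d ^ k.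
Proof.
  intros Hd Hx.
  assert (H : (d * x) ^ k / INR (fact k) <= exp (d * x)).
  { rewrite <- Series_exp. pose proof (Rsum_le_Series (fun k => (d * x) ^ k / INR (fact k)) (S k)) as H.
    simpl in H.
    assert (P : forall n, 0 <= (d * x) ^ n / INR (fact n)).
    { intros n. apply Rdiv_le_0_compat; [apply pow_le; nra|apply INR_fact_lt_0]. }
    specialize (H P (ex_series_exp _)).
    assert (0 <= Rsum (fun k => (d * x) ^ k / INR (fact k)) k) by (apply Rsum_nonneg; auto). lra. }
  rewrite Rpow_mult_distr in H. assert (0 < d ^ k) by (apply pow_lt; auto).
  apply Rmult_le_reg_l with (d ^ k); auto. replace (d ^ k * (exp (d * x) / d ^ k)) with (exp (d * x)) by (field; lra).
  eapply Rle_trans; [|apply H]. apply Req_le. field. apply INR_fact_neq_0.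
Qed.

Lemma ln_INR_S n : 0 <= ln (INR (S n)).
Proof. apply ln_ge0, INR_S_ge1. Qed.

Lemma Cmod_dterm s k n : Cmod (dterm s k n)
  = exp (- Re s * ln (INR (S n))) * (ln (INR (S n)) ^ k / INR (fact k)).
Proof.
  unfold dterm. rewrite Cmod_mult, Cmod_Rcpow, Cmod_expt, Cmod_R, Rabs_Ropp, Rabs_pos_eq by apply ln_INR_S.
  reflexivity.
Qed.

(** Majorant of [(1 + ln n) |dterm|] for [Re s >= 1 + a]. Half of the surplus [a] is spent, a
    quarter on [1 + ln n] and a quarter on [(ln n)^k / k!], and the other half keeps the series
    convergent. The factor [1 + ln n] pays for a weight [Lambda]. *)
Definition DM (a : R) (k n : nat) : R :=
  4 / a / (a / 4) ^ k * exp (- (1 + a / 2) * ln (INR (S n))).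

Lemma DM_ex a k : 0 < a -> ex_series (DM a k).
Proof. intros Ha. apply ex_series_scal'. apply ex_series_power. lra. Qed.

Lemma dterm_bound s a k n : 1 + a <= Re s -> 0 < a <= 4 ->
  (1 + ln (INR (S n))) * Cmod (dterm s k n) <= DM a k n.
Proof.
  intros Hs Ha. rewrite Cmod_dterm. set (x := ln (INR (S n))).
  assert (Hx : 0 <= x) by apply ln_INR_S.
  assert (P0 : 0 <= x ^ k / INR (fact k)) by (apply Rdiv_le_0_compat; [apply pow_le; auto|apply INR_fact_lt_0]).
  apply Rle_trans with ((1 + x) * (exp (- (1 + a) * x) * (x ^ k / INR (fact k)))).
  { apply Rmult_le_compat_l; [lra|]. apply Rmult_le_compat_r; auto. apply exp_le. nra. }
  pose proof (one_plus_log (a / 4) x ltac:(lra) Hx) as H1.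
  pose proof (pow_fact_exp (a / 4) x k ltac:(lra) Hx) as H2.
  unfold DM. fold x. assert (P : 0 < (a / 4) ^ k) by (apply pow_lt; lra).
  apply Rle_trans with ((exp (a / 4 * x) / (a / 4)) * (exp (- (1 + a) * x) * (exp (a / 4 * x) / (a / 4) ^ k))).
  - apply Rmult_le_compat; [lra| |auto|].
    + apply Rmult_le_pos; [left; apply exp_pos|auto].
    + apply Rmult_le_compat_l; [left; apply exp_pos|auto].
  - apply Req_le. replace (- (1 + a / 2) * x) with (a / 4 * x + - (1 + a) * x + a / 4 * x) by lra.
    rewrite !exp_plus. field. lra.
Qed.

Lemma dterm_bound1 s a k n : 1 + a <= Re s -> 0 < a <= 4 -> Cmod (dterm s k n) <= DM a k n.
Proof.
  intros Hs Ha. eapply Rle_trans; [|apply (dterm_bound s a k n Hs Ha)].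
  pose proof (Cmod_ge_0 (dterm s k n)). pose proof (ln_INR_S n). nra.
Qed.

Lemma Lambda_dterm_bound s a k n (c : R) : 1 + a <= Re s -> 0 < a <= 4 -> Rabs c <= 1 + ln (INR (S n)) ->
  Cmod (RtoC c * dterm s k n) <= DM a k n.
Proof.
  intros Hs Ha Hc. eapply Rle_trans; [|apply (dterm_bound s a k n Hs Ha)].
  rewrite Cmod_mult, Cmod_R. apply Rmult_le_compat_r; auto using Cmod_ge_0.
Qed.

Lemma Lambda_abs n : Rabs (Lambda (S n)) <= 1 + ln (INR (S n)).
Proof.
  rewrite Rabs_pos_eq by apply Lambda_nonneg. pose proof (Lambda_le_ln (S n) ltac:(lia)). lra.
Qed.

Lemma Lambda1_abs n : Rabs (Lambda (S n) - 1) <= 1 + ln (INR (S n)).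
Proof.
  pose proof (Lambda_le_ln (S n) ltac:(lia)). pose proof (Lambda_nonneg (S n)). pose proof (ln_INR_S n).
  apply Rabs_le. lra.
Qed.

Lemma tcf_eps s a k : 1 + a <= Re s -> 0 < a <= 4 -> tcf s k = (- (epsc s k + phi s k))%C.
Proof.
  intros Hs Ha. unfold tcf, epsc, phi. f_equal.
  rewrite <- (CS_plus _ _ (DM a k) (DM a k)); auto using DM_ex, dterm_bound1.
  - apply CS_ext. intros n. rewrite RtoC_minus. ring.
  - intros n. apply Lambda_dterm_bound; auto using Lambda1_abs.
  - apply DM_ex; lra.
  - apply DM_ex; lra.
Qed.

Lemma expt_RtoC x k : expt (RtoC x) k = RtoC (x ^ k / INR (fact k)).
Proof. unfold expt, Rdiv. rewrite RtoC_mult, RtoC_pow. reflexivity. Qed.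

Lemma expt_plus x y k : expt (RtoC (x + y)) k = Csum (fun i => expt (RtoC x) i * expt (RtoC y) (k - i))%C (S k).
Proof.
  rewrite (Csum_ext _ (fun i => RtoC (x ^ i / INR (fact i) * (y ^ (k - i) / INR (fact (k - i))))))
    by (intros; rewrite !expt_RtoC, <- RtoC_mult; auto).
  rewrite <- RtoC_Rsum, expt_RtoC. f_equal. rewrite binomial, <- sum_n_Reals, sum_n_Rsum.
  unfold Rdiv at 1. rewrite Rmult_comm, <- Rsum_scal. apply Rsum_ext. intros i Hi.
  unfold Binomial.C. field. repeat split; apply INR_fact_neq_0.
Qed.

Lemma expt_S x k : (RtoC (INR (S k)) * expt (RtoC x) (S k) = RtoC x * expt (RtoC x) k)%C.
Proof.
  rewrite !expt_RtoC, <- !RtoC_mult. f_equal. rewrite fact_simpl, mult_INR. simpl (x ^ S k). field.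
  split; [apply INR_fact_neq_0|apply not_0_INR; lia].
Qed.

Lemma Rcpow_mult x y s : 0 < x -> 0 < y -> Rcpow (x * y) s = (Rcpow x s * Rcpow y s)%C.
Proof. intros. unfold Rcpow. rewrite <- Cexp_plus, ln_mult, RtoC_plus by auto. f_equal. ring. Qed.

(* The identity [Lambda * 1 = log], read off on Taylor coefficients: zeta' = zeta . (zeta'/zeta). *)
Lemma phi_rec s a k : 1 + a <= Re s -> 0 < a <= 4 ->
  (RtoC (INR (S k)) * phi s (S k))%C = Csum (fun i => tcf s i * phi s (k - i)%nat)%C (S k).
Proof.
  intros Hs Ha.
  set (x := fun i d => (RtoC (Lambda d) * (Rcpow (INR d) (- s) * expt (RtoC (- ln (INR d))) i))%C).
  set (y := fun j e => (Rcpow (INR e) (- s) * expt (RtoC (- ln (INR e))) j)%C).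
  assert (Hx : forall i n, Cmod (x i (S n)) <= DM a i n).
  { intros i n. apply (Lambda_dterm_bound s a i n); auto. apply Lambda_abs. }
  assert (Hy : forall i n, Cmod (y i (S n)) <= DM a i n).
  { intros i n. apply (dterm_bound1 s a i n); auto. }
  assert (Hex : forall i, ex_series (DM a i)) by (intros; apply DM_ex; lra).
  assert (Hcv : forall i j, Ccvg (Csum (fun n => dconv (x i) (y j) (S n)))
     (CS (fun n => x i (S n)) * CS (fun n => y j (S n)))%C).
  { intros i j. apply (Ccvg_dconv (x i) (y j) (DM a i) (DM a j)); auto. }
  assert (P : Ccvg (Csum (fun n => Csum (fun i => - dconv (x i) (y (k - i)%nat) (S n)) (S k))%C)
    (Csum (fun i => tcf s i * phi s (k - i)%nat)%C (S k))).
  { apply (Ccvg_ext (fun N => Csum (fun i => - Csum (fun n => dconv (x i) (y (k - i)%nat) (S n)) N) (S k))%C).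
    - intros N. rewrite (Csum_swap (fun n i => - dconv (x i) (y (k - i)%nat) (S n))%C).
      apply Csum_ext. intros i _. rewrite Csum_opp. auto.
    - generalize (S k) as K. intros K. induction K; [simpl; apply Ccvg_const|]. cbn [Csum].
      apply Ccvg_plus; auto.
      replace (tcf s K * phi s (k - K)%nat)%C with (- (CS (fun n => x K (S n)) * CS (fun n => y (k - K)%nat (S n))))%C.
      + apply Ccvg_opp. apply Hcv.
      + unfold tcf, phi, dterm. unfold x, y. ring. }
  apply (fun X => Ccvg_unique _ _ _ X P).
  apply (Ccvg_ext (fun N => RtoC (INR (S k)) * Csum (dterm s (S k)) N)%C).
  - intros N. rewrite <- Csum_scal. apply Csum_ext. intros n _.
    (* One factor [l] of [l^(k+1)] is expanded as a sum of [Lambda] over divisors; the remaining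
       [l^k / k!] is split between divisor and cofactor by [expt_plus]. *)
    unfold dterm. set (l := - ln (INR (S n))).
    transitivity (Rcpow (INR (S n)) (- s) * (RtoC (INR (S k)) * expt (RtoC l) (S k)))%C; [ring|].
    rewrite expt_S.
    assert (L : RtoC l = (- Csum (fun d => if Nat.eqb (S n mod S d) 0 then RtoC (Lambda (S d)) else RtoC 0) (S n))%C).
    { unfold l. rewrite RtoC_opp, <- (sum_Lambda_divisors (S n)) by lia. f_equal. rewrite RtoC_Rsum.
      apply Csum_ext. intros d _. destruct (Nat.eqb _ 0); auto. }
    rewrite L at 1. unfold dconv.
    transitivity (Csum (fun d => Csum (fun i => - (if Nat.eqb (S n mod S d) 0
       then x i (S d) * y (k - i)%nat (S n / S d)%nat else RtoC 0)) (S k)) (S n))%C.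
    + rewrite <- Csum_opp, (Cmult_comm (Csum _ (S n))), Cmult_assoc, <- Csum_scal. apply Csum_ext. intros d Hd.
      destruct (Nat.eqb_spec (S n mod S d) 0) as [E|E].
      * set (e := (S n / S d)%nat).
        assert (En : S n = (S d * e)%nat) by (unfold e; pose proof (Nat.div_mod (S n) (S d) ltac:(lia)); lia).
        assert (He : (0 < e)%nat) by (destruct e; lia).
        assert (Pd : 0 < INR (S d)) by (apply lt_0_INR; lia).
        assert (Pe : 0 < INR e) by (apply lt_0_INR; lia).
        assert (El : l = - ln (INR (S d)) + - ln (INR e)).
        { unfold l. rewrite En, mult_INR, ln_mult by auto. ring. }
        rewrite El, expt_plus. rewrite En, mult_INR, Rcpow_mult by auto. unfold x, y.
        rewrite Csum_opp. transitivity (- (Rcpow (INR (S d)) (- s) * Rcpow (INR e) (- s) * RtoC (Lambda (S d)) *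
           Csum (fun i => expt (RtoC (- ln (INR (S d)))) i * expt (RtoC (- ln (INR e))) (k - i)) (S k)))%C; [ring|].
        f_equal. rewrite <- Csum_scal. apply Csum_ext. intros; ring.
      * rewrite Csum_zero; [ring|]. intros; ring.
    + rewrite Csum_swap. apply Csum_ext. intros i _. rewrite Csum_opp. reflexivity.
  - apply Ccvg_scal. apply (dom_cv _ (DM a (S k))); auto. intros; apply dterm_bound1; auto.
Qed.

(** * The 3-4-1 inequality *)

Lemma dterm_0 s n : dterm s 0 n = Rcpow (INR (S n)) (- s).
Proof. unfold dterm, expt. simpl. rewrite Rinv_1. ring. Qed.

Lemma zeta_phi0 s a : 1 + a <= Re s -> 0 < a -> zeta s = phi s 0.
Proof.
  intros Hs Ha. symmetry. unfold phi. apply CS_unique.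
  pose proof (zeta_Dirichlet s ltac:(lra)) as H. apply is_series_Ccvg in H.
  eapply Ccvg_ext; [|apply H]. intros n. apply Csum_ext. intros; rewrite dterm_0; auto.
Qed.

Lemma ln_le_sub1 x : 0 < x -> ln x <= x - 1.
Proof. intros H. pose proof (exp_ineq1_le (ln x)). rewrite exp_ln in H0 by auto. lra. Qed.

Lemma ln_succ_ge x : 0 < x -> / (x + 1) <= ln (x + 1) - ln x.
Proof.
  intros H. pose proof (ln_le_sub1 (x / (x + 1)) ltac:(apply Rdiv_lt_0_compat; lra)) as L.
  unfold Rdiv in L. rewrite ln_mult, ln_Rinv in L; [|lra|lra|apply Rinv_0_lt_compat; lra].
  replace (x * / (x + 1) - 1) with (- / (x + 1)) in L by (field; lra). lra.
Qed.

Lemma tail_step b x : 0 < b -> 0 < x ->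
  exp (- (1 + b) * ln (x + 1)) <= / b * (exp (- b * ln x) - exp (- b * ln (x + 1))).
Proof.
  intros Hb Hx. pose proof (ln_succ_ge x Hx) as L.
  replace (- (1 + b) * ln (x + 1)) with (- ln (x + 1) + - b * ln (x + 1)) by ring.
  rewrite exp_plus, exp_Ropp, exp_ln by lra.
  replace (- b * ln x) with (b * (ln (x + 1) - ln x) + - b * ln (x + 1)) by ring. rewrite exp_plus.
  pose proof (exp_ineq1_le (b * (ln (x + 1) - ln x))) as E.
  set (E1 := exp (- b * ln (x + 1))). assert (0 < E1) by apply exp_pos.
  apply Rmult_le_reg_l with b; auto. rewrite <- Rmult_assoc, Rmult_assoc.
  replace (b * (/ b * (exp (b * (ln (x + 1) - ln x)) * E1 - E1)))
    with ((exp (b * (ln (x + 1) - ln x)) - 1) * E1) by (field; lra).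
  rewrite <- Rmult_assoc. apply Rmult_le_compat_r; [lra|].
  apply Rle_trans with (b * (ln (x + 1) - ln x)); [|lra]. apply Rmult_le_compat_l; lra.
Qed.

(** Comparison with the integral of [x^-(1+b)], carried out as a telescoping sum. *)
Lemma power_sum_le b N K : 0 < b -> (1 <= N)%nat ->
  Rsum (fun k => exp (- (1 + b) * ln (INR (N + S k)))) K <= / b * exp (- b * ln (INR N)).
Proof.
  intros Hb HN.
  assert (E : Rsum (fun k => exp (- (1 + b) * ln (INR (N + S k)))) K
    <= / b * (exp (- b * ln (INR N)) - exp (- b * ln (INR (N + K))))).
  { induction K.
    - simpl. rewrite Nat.add_0_r. lra.
    - simpl Rsum. pose proof (tail_step b (INR (N + K)) Hb ltac:(apply lt_0_INR; lia)) as T.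
      rewrite <- S_INR in T. replace (S (N + K)) with (N + S K)%nat in T by lia. lra. }
  eapply Rle_trans; [apply E|]. pose proof (exp_pos (- b * ln (INR (N + K)))).
  apply Rmult_le_compat_l; [left; apply Rinv_0_lt_compat; auto|lra].
Qed.

Lemma phi0_bound s a : 1 + a <= Re s -> 0 < a -> Cmod (phi s 0) <= 1 + / a.
Proof.
  intros Hs Ha.
  destruct (ex_series_Rsum_bound (fun n => exp (- (1 + a) * ln (INR (S n)))) (1 + / a)) as [E B].
  - intros n; left; apply exp_pos.
  - intros [|n]; [simpl; assert (0 < / a) by (apply Rinv_0_lt_compat; auto); lra|].
    rewrite Rsum_S_l. pose proof (power_sum_le a 1 n Ha ltac:(lia)) as P.
    simpl INR at 1. rewrite ln_1, Rmult_0_r, exp_0. simpl (INR 1) in P. rewrite ln_1, Rmult_0_r, exp_0 in P.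
    apply Rplus_le_compat_l. rewrite Rmult_1_r in P. exact P.
  - eapply Rle_trans; [|apply B]. apply dom_bound; auto. intros n. rewrite dterm_0, Cmod_Rcpow.
    apply exp_le. replace (Re (- s)%C) with (- Re s) by (destruct s; reflexivity).
    pose proof (ln_INR_S n). nra.
Qed.

Lemma Cder_of_quadratic (f : R -> C) x l d K : 0 < d -> 0 <= K ->
  (forall h, Rabs h <= d -> Cmod (f (x + h)%R - f x - RtoC h * l) <= K * h ^ 2) -> Cder f x l.
Proof.
  intros Hd HK H.
  assert (Q : forall (g : R -> R) m, (forall h, Rabs h <= d -> Rabs (g (x + h) - g x - h * m) <= K * h ^ 2) ->
     is_derive g x m).
  { intros g m Hg. apply is_derive_Reals. intros e He.
    assert (Hd' : 0 < Rmin d (e / (K + 1))) by (apply Rmin_glb_lt; auto; apply Rdiv_lt_0_compat; lra).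
    exists (mkposreal _ Hd'). intros h Hh0 Hh. simpl in Hh.
    pose proof (Rmin_l d (e / (K + 1))). pose proof (Rmin_r d (e / (K + 1))).
    specialize (Hg h ltac:(lra)).
    replace ((g (x + h) - g x) / h - m) with ((g (x + h) - g x - h * m) / h) by (field; auto).
    unfold Rdiv. rewrite Rabs_mult, Rabs_inv. assert (P : 0 < Rabs h) by (apply Rabs_pos_lt; auto).
    apply Rmult_lt_reg_r with (Rabs h); auto. rewrite Rmult_assoc, Rinv_l, Rmult_1_r by lra.
    eapply Rle_lt_trans; [apply Hg|]. rewrite <- (Rabs_pos_eq (h ^ 2)) by apply pow2_ge_0.
    rewrite <- RPow_abs. simpl. rewrite Rmult_1_r, <- Rmult_assoc. apply Rmult_lt_compat_r; auto.
    apply Rle_lt_trans with (K * (e / (K + 1))); [apply Rmult_le_compat_l; lra|].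
    apply Rmult_lt_reg_r with (K + 1); [lra|]. replace (K * (e / (K + 1)) * (K + 1)) with (K * e) by (field; lra). nra. }
  split; apply Q; intros h Hh; eapply Rle_trans; [|apply (H h Hh)| |apply (H h Hh)].
  - eapply Rle_trans; [|apply re_le_Cmod]. apply Req_le. f_equal. unfold Re; simpl. ring.
  - eapply Rle_trans; [|apply Im_le_Cmod]. apply Req_le. f_equal. unfold Im; simpl. ring.
Qed.

(** Second-order Taylor bound, term by term in the real direction. The factor [e^(|h| L)] of the
    remainder costs a quarter of [a] in the exponent, and [L^2 = 2 (L^2 / 2!)] turns the constant 4
    of [Cexp_taylor2] into 8. *)
Lemma phi0_derive t a x : 0 < a <= 4 -> 1 + a <= x ->
  Cder (fun y => phi (y, t) 0) x (phi (x, t) 1).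
Proof.
  intros Ha Hx. set (s := (x, t) : C).
  assert (Hb : forall (y : R) k n, 1 + a / 2 <= y -> Cmod (dterm (y, t) k n) <= DM (a / 2) k n).
  { intros y k n Hy. apply dterm_bound1; [simpl; lra|lra]. }
  assert (He : forall k, ex_series (DM (a / 2) k)) by (intros; apply DM_ex; lra).
  assert (P : forall n, 0 <= DM (a / 2) 2 n).
  { intros n. eapply Rle_trans; [apply Cmod_ge_0|apply (Hb x); lra]. }
  apply (Cder_of_quadratic _ _ _ (a / 4) (8 * Series (DM (a / 2) 2))).
  - lra.
  - pose proof (Rsum_le_Series _ 0 P (He _)) as Q. simpl in Q. lra.
  - intros h Hh. fold s. pose proof Hh as Hh'. apply Rabs_le_between in Hh.
    assert (B1 : forall n, Cmod (RtoC h * dterm s 1 n) <= Rabs h * DM (a / 2) 1 n).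
    { intros n. rewrite Cmod_mult, Cmod_R. apply Rmult_le_compat_l; [apply Rabs_pos|]. apply Hb; lra. }
    assert (B2 : forall n, Cmod (dterm s 0 n + RtoC h * dterm s 1 n) <= DM (a / 2) 0 n + Rabs h * DM (a / 2) 1 n).
    { intros n. eapply Rle_trans; [apply Cmod_triangle|]. apply Rplus_le_compat; auto. apply Hb; lra. }
    assert (E2 : ex_series (fun n => DM (a / 2) 0 n + Rabs h * DM (a / 2) 1 n))
      by (apply ex_series_plus'; auto using ex_series_scal').
    replace (phi ((x + h)%R, t) 0 - phi s 0 - RtoC h * phi s 1)%C with
      (CS (fun n => dterm ((x + h)%R, t) 0 n + - (1) * (dterm s 0 n + RtoC h * dterm s 1 n))%C).
    2:{ unfold phi.
        rewrite (CS_plus _ _ (DM (a / 2) 0) (fun n => DM (a / 2) 0 n + Rabs h * DM (a / 2) 1 n)); auto.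
        - rewrite (CS_scal _ _ (fun n => DM (a / 2) 0 n + Rabs h * DM (a / 2) 1 n)); auto.
          rewrite (CS_plus _ _ (DM (a / 2) 0) (fun n => Rabs h * DM (a / 2) 1 n)); auto using ex_series_scal'.
          + rewrite (CS_scal _ _ (DM (a / 2) 1)); [ring| |auto]. intros n. apply Hb; lra.
          + intros n. apply Hb; lra.
        - intros n. apply Hb; lra.
        - intros n. rewrite Cmod_mult, Cmod_opp, Cmod_1, Rmult_1_l. auto. }
    replace (8 * Series (DM (a / 2) 2) * h ^ 2) with (Series (fun n => 8 * h ^ 2 * DM (a / 2) 2 n))
      by (rewrite Series_scal_l; ring).
    apply dom_bound; [|apply ex_series_scal'; auto].
    intros n. set (L := ln (INR (S n))). assert (HL : 0 <= L) by apply ln_INR_S.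
    set (z := RtoC (- (h * L))).
    assert (E : (dterm ((x + h)%R, t) 0 n + - (1) * (dterm s 0 n + RtoC h * dterm s 1 n))%C
      = (dterm s 0 n * (Cexp z - 1 - z))%C).
    { unfold dterm, z. fold L. replace (Rcpow (INR (S n)) (- ((x + h)%R, t)))
        with (Rcpow (INR (S n)) (- s) * Cexp (RtoC (- (h * L))))%C.
      - rewrite !expt_RtoC. simpl. replace (1 / 1) with 1 by field.
        replace (- L * 1 / 1) with (- L) by field. rewrite !RtoC_opp, RtoC_mult. ring.
      - unfold Rcpow. rewrite <- Cexp_plus. f_equal. fold L. unfold s.
        apply injective_projections; simpl; ring. }
    rewrite E, Cmod_mult. eapply Rle_trans; [apply Rmult_le_compat_l; [apply Cmod_ge_0|apply Cexp_taylor2]|].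
    unfold z. rewrite Cmod_R, Rabs_Ropp, Rabs_mult, (Rabs_pos_eq L) by auto.
    pose proof (Hb (1 + a / 2) 2%nat n ltac:(lra)) as B.
    rewrite Cmod_dterm in B |- *. fold L in B |- *. unfold s. simpl Re in *.
    assert (HE : exp (- x * L) * exp (Rabs h * L) <= exp (- (1 + a / 2) * L)).
    { rewrite <- exp_plus. apply exp_le. nra. }
    rewrite pow_O in *. simpl (fact _) in *. simpl (INR 1). simpl (INR 2) in B.
    assert (Q : 0 <= 4 * (Rabs h * L) ^ 2) by (pose proof (pow2_ge_0 (Rabs h * L)); lra).
    apply Rle_trans with (exp (- (1 + a / 2) * L) * (4 * (Rabs h * L) ^ 2)).
    + replace (exp (- x * L) * (1 / 1) * (4 * (Rabs h * L) ^ 2 * exp (Rabs h * L)))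
        with (exp (- x * L) * exp (Rabs h * L) * (4 * (Rabs h * L) ^ 2)) by field.
      apply Rmult_le_compat_r; auto.
    + rewrite Rpow_mult_distr, RPow_abs, (Rabs_pos_eq (h ^ 2)) by apply pow2_ge_0.
      assert (0 <= 8 * h ^ 2) by (pose proof (pow2_ge_0 h); lra).
      replace (exp (- (1 + a / 2) * L) * (4 * (h ^ 2 * L ^ 2)))
        with (8 * h ^ 2 * (exp (- (1 + a / 2) * L) * (L ^ 2 / (1 + 1)))) by field.
      apply Rmult_le_compat_l; auto.
Qed.

Lemma CS_Re_nonneg a M : (forall n, Cmod (a n) <= M n) -> ex_series M -> (forall n, 0 <= Re (a n)) -> 0 <= Re (CS a).
Proof.
  intros H HM Hp. pose proof (Ccvg_Re _ _ (dom_cv a M H HM)) as L.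
  apply (is_lim_seq_le (fun _ => 0) _ 0 (Re (CS a))) in L; auto; [|apply is_lim_seq_const].
  intros n. induction n; simpl; [lra|]. specialize (Hp n). unfold Re in *. simpl. lra.
Qed.

Lemma cos_341 x : 0 <= 3 + 4 * cos x + cos (2 * x).
Proof. rewrite cos_2a_cos. pose proof (pow2_ge_0 (1 + cos x)). simpl in H. lra. Qed.

Lemma tcf_341 x t a : 0 < a <= 4 -> 1 + a <= x ->
  3 * Re (tcf (x, 0) 0) + 4 * Re (tcf (x, t) 0) + Re (tcf (x, (2 * t)%R) 0) <= 0.
Proof.
  intros Ha Hx.
  set (u := fun v n => (RtoC (Lambda (S n)) * dterm (x, v) 0 n)%C).
  assert (B : forall v n, Cmod (u v n) <= DM a 0 n).
  { intros v n. apply Lambda_dterm_bound; auto. apply Lambda_abs. }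
  assert (E : ex_series (DM a 0)) by (apply DM_ex; lra).
  assert (B' : forall (c : R) v n, 0 <= c -> Cmod (RtoC c * u v n) <= c * DM a 0 n).
  { intros c v n Hc. rewrite Cmod_mult, Cmod_R, Rabs_pos_eq by auto. apply Rmult_le_compat_l; auto. }
  assert (Sm : CS (fun n => (RtoC 3 * u 0 n + RtoC 4 * u t n) + u (2 * t)%R n)%C
    = ((RtoC 3 * CS (u 0) + RtoC 4 * CS (u t)) + CS (u (2 * t)%R))%C).
  { rewrite (CS_plus _ _ (fun n => 3 * DM a 0 n + 4 * DM a 0 n) (DM a 0)); auto.
    - rewrite (CS_plus _ _ (fun n => 3 * DM a 0 n) (fun n => 4 * DM a 0 n)); auto using ex_series_scal'.
      + rewrite !(CS_scal _ _ (DM a 0)); auto.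
      + intros n; apply B'; lra.
      + intros n; apply B'; lra.
    - intros n. eapply Rle_trans; [apply Cmod_triangle|]. apply Rplus_le_compat; apply B'; lra.
    - apply ex_series_plus'; auto using ex_series_scal'. }
  assert (P : 0 <= Re (CS (fun n => (RtoC 3 * u 0 n + RtoC 4 * u t n) + u (2 * t)%R n)%C)).
  { apply (CS_Re_nonneg _ (fun n => 3 * DM a 0 n + 4 * DM a 0 n + DM a 0 n)).
    - intros n. eapply Rle_trans; [apply Cmod_triangle|]. apply Rplus_le_compat; [|apply B].
      eapply Rle_trans; [apply Cmod_triangle|]. apply Rplus_le_compat; apply B'; lra.
    - apply ex_series_plus'; auto. apply ex_series_plus'; auto using ex_series_scal'.
    - intros n. unfold u. rewrite !dterm_0. unfold Rcpow, Cexp, Re, Im.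
      set (L := ln (INR (S n))) in *. simpl.
      pose proof (Lambda_nonneg (S n)) as HL. set (la := Lambda (S n)) in *.
      pose proof (cos_341 (t * L)) as K.
      replace (- x * L - - 0 * 0) with (- x * L) by ring. replace (- x * L - - t * 0) with (- x * L) by ring.
      replace (- x * L - - (2 * t) * 0) with (- x * L) by ring.
      replace (- x * 0 + - 0 * L) with 0 by ring. replace (- x * 0 + - t * L) with (- (t * L)) by ring.
      replace (- x * 0 + - (2 * t) * L) with (- (2 * (t * L))) by ring.
      rewrite cos_0, !cos_neg, sin_0. pose proof (exp_pos (- x * L)) as Q.
      match goal with |- 0 <= ?A => replace A with (la * exp (- x * L) * (3 + 4 * cos (t * L) + cos (2 * (t * L)))) by ring end.
      apply Rmult_le_pos; auto. apply Rmult_le_pos; lra. }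
  rewrite Sm in P. unfold tcf. fold (u 0) (u t) (u (2 * t)%R).
  unfold Re in *. simpl in *. lra.
Qed.

Lemma Cmod_sq z : Cmod z ^ 2 = Re z ^ 2 + Im z ^ 2.
Proof. unfold Cmod. rewrite pow2_sqrt; [reflexivity|]. pose proof (pow2_ge_0 (fst z)). pose proof (pow2_ge_0 (snd z)). lra. Qed.

(** [u] is the logarithmic derivative of [f] at [x] in multiplied form, meaningful before [f] is
    known not to vanish. *)
Definition log_deriv (f : R -> R) (x u : R) : Prop := is_derive f x (f x * u).

Lemma log_deriv_mult f g x u v : log_deriv f x u -> log_deriv g x v ->
  log_deriv (fun y => f y * g y) x (u + v).
Proof.
  intros Hf Hg. unfold log_deriv in *.
  replace (f x * g x * (u + v)) with (f x * u * g x + f x * (g x * v)) by ring.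
  apply (is_derive_mult f g x _ _ Hf Hg). intros; apply Rmult_comm.
Qed.

Lemma phi0_log_deriv t a x : 0 < a <= 4 -> 1 + a <= x ->
  log_deriv (fun y => Cmod (phi (y, t) 0) ^ 2) x (2 * Re (tcf (x, t) 0)).
Proof.
  intros Ha Hx. destruct (phi0_derive t a x Ha Hx) as [D1 D2].
  pose proof (phi_rec (x, t) a 0 Hx Ha) as E.
  assert (E1 : phi (x, t) 1 = (tcf (x, t) 0 * phi (x, t) 0)%C).
  { simpl in E. rewrite Cmult_1_l in E. rewrite E. ring. }
  rewrite E1 in D1, D2.
  set (f := fun y => Re (phi (y, t) 0)) in *. set (g := fun y => Im (phi (y, t) 0)) in *.
  unfold log_deriv. apply (is_derive_ext (fun y => f y * f y + g y * g y)).
  { intros y. rewrite Cmod_sq. unfold f, g. simpl. ring. }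
  rewrite Cmod_sq.
  replace ((Re (phi (x, t) 0) ^ 2 + Im (phi (x, t) 0) ^ 2) * (2 * Re (tcf (x, t) 0)))
    with ((Re (tcf (x, t) 0 * phi (x, t) 0)%C * f x + f x * Re (tcf (x, t) 0 * phi (x, t) 0)%C)
      + (Im (tcf (x, t) 0 * phi (x, t) 0)%C * g x + g x * Im (tcf (x, t) 0 * phi (x, t) 0)%C)).
  - apply @is_derive_plus.
    + apply (is_derive_mult f f x _ _ D1 D1). intros; apply Rmult_comm.
    + apply (is_derive_mult g g x _ _ D2 D2). intros; apply Rmult_comm.
  - unfold f, g, Re, Im. simpl. ring.
Qed.

Lemma phi0_lim_1 t : is_lim_seq (fun m => Cmod (phi (INR m + 2, t) 0)) 1.
Proof.
  assert (L : Ccvg (fun m => phi ((INR m + 2)%R, t) 0) 1).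
  { replace (RtoC 1) with (CS (fun n => if Nat.eqb n 0 then RtoC 1 else RtoC 0)).
    2:{ rewrite (CS_finite _ 1); [simpl; ring|]. intros [|n] Hn; [lia|auto]. }
    apply (tannery _ _ (DM 1 0)).
    - intros m n. apply dterm_bound1; [|lra]. simpl. pose proof (pos_INR m). lra.
    - apply DM_ex; lra.
    - intros [|n].
      + simpl. apply (Ccvg_ext (fun _ => RtoC 1)); [|apply Ccvg_const].
        intros m. rewrite dterm_0. simpl INR. rewrite Rcpow_1. auto.
      + cbn [Nat.eqb]. set (L := ln (INR (S (S n)))).
        assert (HL : 0 < L) by (unfold L; rewrite <- ln_1; apply ln_increasing; [lra|];
          rewrite S_INR; pose proof (INR_S_ge1 n); lra).
        apply (Ccvg_squeeze _ _ (fun m => exp (- L) ^ m) O).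
        * intros m _. replace (dterm ((INR m + 2)%R, t) 0 (S n) - 0)%C with (dterm ((INR m + 2)%R, t) 0 (S n)) by ring.
          rewrite dterm_0, Cmod_Rcpow. fold L. simpl Re.
          assert (E : exp (- L) ^ m = exp (- (INR m * L))).
          { clear. induction m; [simpl; rewrite Rmult_0_l, Ropp_0, exp_0; auto|].
            rewrite S_INR. simpl. rewrite IHm, <- exp_plus. f_equal. ring. }
          rewrite E. apply exp_le. nra.
        * apply is_lim_seq_geom. rewrite Rabs_pos_eq by (left; apply exp_pos).
          rewrite <- exp_0. apply exp_increasing. lra. }
  apply Ccvg_lim in L. apply is_lim_seq_spec in L. apply is_lim_seq_spec. intros e.
  destruct (L e) as [N HN]. exists N. intros m Hm. specialize (HN m Hm).
  rewrite Rminus_0_r, Rabs_pos_eq in HN by apply Cmod_ge_0. eapply Rle_lt_trans; [|apply HN].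
  pose proof (Cmod_triangle (phi ((INR m + 2)%R, t) 0 - 1) 1) as T1.
  pose proof (Cmod_triangle (- (phi ((INR m + 2)%R, t) 0 - 1)) (phi ((INR m + 2)%R, t) 0)) as T2.
  rewrite Cmod_opp in T2. rewrite Cmod_1 in T1.
  replace (phi ((INR m + 2)%R, t) 0 - 1 + 1)%C with (phi ((INR m + 2)%R, t) 0) in T1 by ring.
  replace (- (phi ((INR m + 2)%R, t) 0 - 1) + phi ((INR m + 2)%R, t) 0)%C with (RtoC 1) in T2 by ring.
  rewrite Cmod_1 in T2. apply Rabs_le. lra.
Qed.

(** The classical inequality with exponents doubled, so that the squared moduli can be
    differentiated and no logarithm of zeta occurs. The product is nonincreasing in [x] by [tcf_341]
    and tends to 1, hence is at least 1; nonvanishing is then a consequence. *)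
Lemma three_four_one t x : 1 < x ->
  1 <= Cmod (phi (x, 0) 0) ^ 6 * Cmod (phi (x, t) 0) ^ 8 * Cmod (phi (x, (2 * t)%R) 0) ^ 2.
Proof.
  intros Hx. set (N := fun t y => Cmod (phi (y, t) 0) ^ 2).
  set (H := fun y => (N 0 y * (N 0 y * N 0 y)) * ((N t y * N t y) * (N t y * N t y)) * N (2 * t) y).
  set (a := Rmin 4 (x - 1)).
  assert (Ha : 0 < a <= 4) by (split; [apply Rmin_glb_lt; lra|apply Rmin_l]).
  assert (Hxa : 1 + a <= x) by (pose proof (Rmin_r 4 (x - 1)); unfold a; lra).
  assert (N0 : forall v y, 0 <= N v y) by (intros; apply pow2_ge_0).
  assert (HD : forall y, x <= y -> exists u, u <= 0 /\ log_deriv H y u).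
  { intros y Hy.
    pose proof (phi0_log_deriv 0 a y Ha ltac:(lra)) as L0.
    pose proof (phi0_log_deriv t a y Ha ltac:(lra)) as L1.
    pose proof (phi0_log_deriv (2 * t) a y Ha ltac:(lra)) as L2.
    pose proof (log_deriv_mult _ _ _ _ _ (log_deriv_mult _ _ _ _ _
      (log_deriv_mult _ _ _ _ _ L0 (log_deriv_mult _ _ _ _ _ L0 L0))
      (log_deriv_mult _ _ _ _ _ (log_deriv_mult _ _ _ _ _ L1 L1) (log_deriv_mult _ _ _ _ _ L1 L1))) L2) as L.
    refine (ex_intro _ _ (conj _ L)).
    pose proof (tcf_341 y t a Ha ltac:(lra)). lra. }
  assert (H0 : forall y, 0 <= H y).
  { intros y. unfold H. generalize (N0 0 y) (N0 t y) (N0 (2 * t) y).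
    generalize (N 0 y) (N t y) (N (2 * t) y). intros. repeat apply Rmult_le_pos; auto. }
  assert (Hdec : forall y, x <= y -> H y <= H x).
  { intros y Hy. destruct (MVT_gen H x y (Derive H)) as [c [Hc E]].
    - rewrite Rmin_left, Rmax_right by auto. intros z Hz. apply Derive_correct.
      destruct (HD z ltac:(lra)) as [u [_ Hu]]. eexists; apply Hu.
    - rewrite Rmin_left, Rmax_right by auto. intros z Hz. apply continuity_pt_filterlim.
      apply (@ex_derive_continuous R_AbsRing R_NormedModule).
      destruct (HD z ltac:(lra)) as [u [_ Hu]]. eexists; apply Hu.
    - rewrite Rmin_left, Rmax_right in Hc by auto.
      destruct (HD c ltac:(lra)) as [u [Hu0 Hu]]. apply is_derive_unique in Hu. rewrite Hu in E.
      assert (0 <= H c * - u * (y - x)) by (apply Rmult_le_pos; [apply Rmult_le_pos; auto; lra|lra]). lra. }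
  assert (NL : forall v, is_lim_seq (fun m => N v (INR m + 2)) 1).
  { intros v. unfold N. simpl. replace (Finite 1) with (Finite (1 * (1 * 1))) by (f_equal; ring).
    apply is_lim_seq_mult'; [apply phi0_lim_1|]. apply is_lim_seq_mult'; [apply phi0_lim_1|apply is_lim_seq_const]. }
  assert (HL : is_lim_seq (fun m => H (INR m + 2)) 1).
  { unfold H. replace (Finite 1) with (Finite ((1 * (1 * 1)) * ((1 * 1) * (1 * 1)) * 1)) by (f_equal; ring).
    repeat apply is_lim_seq_mult'; apply NL. }
  assert (R1 : 1 <= H x).
  { apply (is_lim_seq_le_loc (fun m => H (INR m + 2)) (fun _ => H x) 1 (H x)); auto; [|apply is_lim_seq_const].
    destruct (INR_unbounded x) as [M HM]. exists M. intros m Hm. apply Hdec. apply le_INR in Hm. lra. }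
  eapply Rle_trans; [apply R1|]. apply Req_le. unfold H, N. ring.
Qed.

Lemma phi0_neq_0 t x : 1 < x -> phi (x, t) 0 <> RtoC 0.
Proof.
  intros Hx E. pose proof (three_four_one t x Hx) as H. rewrite E, Cmod_0 in H.
  rewrite (pow_ne_zero 8) in H by lia. lra.
Qed.

(** The exponents 6 and 2 of the factors bounded above by [1 + 1/a] add up to the exponent 8 of the
    factor in question. *)
Lemma phi0_lower t a : 0 < a -> / (1 + / a) <= Cmod (phi (1 + a, t) 0).
Proof.
  intros Ha. pose proof (three_four_one t (1 + a) ltac:(lra)) as H.
  assert (Ia : 0 < / a) by (apply Rinv_0_lt_compat; auto).
  set (z := 1 + / a) in *. assert (Hz : 0 < z) by (unfold z; lra).
  assert (B : forall v, 0 <= Cmod (phi (1 + a, v) 0) <= z).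
  { intros v. split; [apply Cmod_ge_0|]. apply phi0_bound; simpl; lra. }
  set (c := Cmod (phi (1 + a, t) 0)) in *.
  assert (H2 : 1 <= z ^ 6 * c ^ 8 * z ^ 2).
  { eapply Rle_trans; [apply H|]. assert (0 <= c ^ 8) by (apply pow_le, B).
    apply Rmult_le_compat; try (apply pow_le, B); [apply Rmult_le_pos; auto; apply pow_le, B| |apply pow_incr, B].
    apply Rmult_le_compat_r; auto. apply pow_incr, B. }
  apply Rnot_lt_le. intros Hc.
  assert (z * c < 1).
  { apply Rmult_lt_reg_l with (/ z); [apply Rinv_0_lt_compat; auto|]. rewrite <- Rmult_assoc, Rinv_l by lra. lra. }
  replace (z ^ 6 * c ^ 8 * z ^ 2) with ((z * c) ^ 8) in H2 by ring.
  assert ((z * c) ^ 8 < 1); [|lra]. apply pow_lt_1_compat; [|lia]. split; auto.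
  apply Rmult_le_pos; [lra|apply B].
Qed.

(** * Local power series of zeta *)

Lemma zeta_approx_Csum s N : zeta_approx s N =
  (Csum (fun n => Rcpow (INR (S n)) (- s)) N - Rcpow (INR N) (1 - s) / (1 - s))%C.
Proof.
  unfold zeta_approx. f_equal. destruct N.
  - rewrite sum_n_m_zero by lia. reflexivity.
  - change (sum_n_m (G := C_AbelianMonoid)) with (sum_n_m (G := C_AbelianGroup)).
    rewrite <- (sum_n_m_S (G := C_AbelianGroup)). exact (sum_n_Csum _ N).
Qed.

Lemma Ccvg_zeta s : 0 < Re s -> s <> RtoC 1 -> Ccvg (zeta_approx s) (zeta s).
Proof.
  intros Hs H1. destruct (ex_series_Q s Hs) as [l Hl].
  pose proof (zeta_cvg s l H1 Hl) as H. rewrite (zeta_eq _ _ H). exact H.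
Qed.

(** One step of Euler summation: [(x+1)^-s] against the integral of [y^-s] over a unit interval. Two
    mean value estimates, each with constant 2, give the 4. *)
Lemma zeta_approx_step s x : 0 <= Re s -> s <> RtoC 1 -> 1 <= x ->
  Cmod (Rcpow (x + 1) (- s) - (Rcpow (x + 1) (1 - s) - Rcpow x (1 - s)) / (1 - s))
  <= 4 * Cmod s * exp (- (1 + Re s) * ln x).
Proof.
  intros Hs H1 Hx. apply one_minus_neq0 in H1.
  set (c := Rcpow (x + 1) (- s)).
  assert (Hd : forall y, x <= y <= x + 1 -> Cmod (c - Rcpow y (- s)) <= 2 * (Cmod s * exp (- (1 + Re s) * ln x))).
  { intros y Hy. pose proof (C_MVT (fun z => Rcpow z (- s)) (fun z => (- s) * RtoC (/ z) * Rcpow z (- s))%C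
      y (x + 1) (Cmod s * exp (- (1 + Re s) * ln x)) ltac:(lra)) as M.
    assert (P : 0 <= Cmod s * exp (- (1 + Re s) * ln x)) by (apply Rmult_le_pos; [apply Cmod_ge_0|left; apply exp_pos]).
    eapply Rle_trans; [apply M|].
    - intros z Hz. apply Cder_Rcpow. lra.
    - intros z Hz. rewrite !Cmod_mult, Cmod_opp, Cmod_R, Cmod_Rcpow.
      rewrite Rabs_pos_eq by (left; apply Rinv_0_lt_compat; lra). rewrite Rmult_assoc.
      apply Rmult_le_compat_l; [apply Cmod_ge_0|].
      replace (Re (- s)%C) with (- Re s) by (destruct s; reflexivity).
      replace (/ z) with (exp (- ln z)) by (rewrite exp_Ropp, exp_ln; lra). rewrite <- exp_plus. apply exp_le.
      pose proof (ln_le' x z ltac:(lra) ltac:(lra)). nra.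
    - nra. }
  pose proof (C_MVT (fun y => c * RtoC y + (- / (1 - s)) * Rcpow y (1 - s))%C (fun y => c - Rcpow y (- s))%C
    x (x + 1) (2 * (Cmod s * exp (- (1 + Re s) * ln x))) ltac:(lra)) as M.
  replace (c - (Rcpow (x + 1) (1 - s) - Rcpow x (1 - s)) / (1 - s))%C with
    (c * RtoC (x + 1) + - / (1 - s) * Rcpow (x + 1) (1 - s) - (c * RtoC x + - / (1 - s) * Rcpow x (1 - s)))%C.
  - eapply Rle_trans; [apply M; auto|apply Req_le; ring].
    intros y Hy. eapply Cder_eq.
    + apply Cder_plus; (apply Cder_mult; [apply Cder_const|]); [apply Cder_id|apply Cder_Rcpow; lra].
    + cbv beta. rewrite Rcpow_1s by lra. rewrite RtoC_inv by lra. field. split; auto. apply RtoC_neq0; lra.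
  - rewrite RtoC_plus. field. auto.
Qed.

Lemma Re_opp s : Re (- s)%C = - Re s. Proof. destruct s; reflexivity. Qed.
Lemma Re_1_minus s : Re (1 - s)%C = 1 - Re s. Proof. destruct s; reflexivity. Qed.
Lemma Re_plus s w : Re (s + w)%C = Re s + Re w. Proof. destruct s, w; reflexivity. Qed.

Lemma harmonic_le N : (1 <= N)%nat -> Rsum (fun n => / INR (S n)) N <= 1 + ln (INR N).
Proof.
  intros HN. induction N as [|N IH]; [lia|]. destruct N as [|N].
  - simpl. rewrite ln_1, Rinv_1. lra.
  - change (Rsum ?f (S (S N))) with (Rsum f (S N) + f (S N)). cbv beta. specialize (IH ltac:(lia)).
    pose proof (ln_succ_ge (INR (S N)) ltac:(apply lt_0_INR; lia)) as L. rewrite <- S_INR in L. lra.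
Qed.

(** The partial sum up to [N0 >= |s| / 2] is bounded trivially; beyond it the increments sum to at
    most a constant times [|s| N0^(d-1)]. In 42, the first part accounts for 2 and the second for
    40. *)
Lemma zeta_approx_bound s d N0 N : 0 <= d <= 3 / 4 -> 1 - d <= Re s -> 1 <= Cmod (1 - s) ->
  (1 <= N0)%nat -> (N0 <= N)%nat -> Cmod s <= 2 * INR N0 ->
  Cmod (zeta_approx s N) <= exp (d * ln (INR N0)) * (42 + ln (INR N0)).
Proof.
  intros Hd Hs H1 HN0 HN Hm.
  assert (Hs1 : s <> RtoC 1).
  { intros E. rewrite E in H1. replace (1 - 1)%C with (RtoC 0) in H1 by ring. rewrite Cmod_0 in H1. lra. }
  pose proof (one_minus_neq0 s Hs1) as Hn1.
  assert (P0 : 1 <= INR N0) by (replace 1 with (INR 1) by auto; apply le_INR; auto).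
  assert (L0 : 0 <= ln (INR N0)) by (apply ln_ge0; auto).
  set (X := exp (d * ln (INR N0))). assert (HX : 1 <= X) by (unfold X; rewrite <- exp_0; apply exp_le; nra).
  assert (B0 : Cmod (zeta_approx s N0) <= X * (2 + ln (INR N0))).
  { rewrite zeta_approx_Csum. unfold Cminus at 1. eapply Rle_trans; [apply Cmod_triangle|]. rewrite Cmod_opp.
    assert (A1 : Cmod (Csum (fun n => Rcpow (INR (S n)) (- s)) N0) <= X * (1 + ln (INR N0))).
    { apply Rle_trans with (Rsum (fun n => X * / INR (S n)) N0).
      - apply Cmod_Csum_le. intros n Hn. rewrite Cmod_Rcpow, Re_opp.
        replace (/ INR (S n)) with (exp (- ln (INR (S n)))) by (rewrite exp_Ropp, exp_ln; auto; apply lt_0_INR; lia).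
        unfold X. rewrite <- exp_plus. apply exp_le. pose proof (ln_INR_S n).
        assert (ln (INR (S n)) <= ln (INR N0)) by (apply ln_le'; [apply lt_0_INR; lia|apply le_INR; lia]). nra.
      - rewrite Rsum_scal. apply Rmult_le_compat_l; [lra|]. apply harmonic_le; auto. }
    assert (A2 : Cmod (Rcpow (INR N0) (1 - s) / (1 - s)) <= X).
    { rewrite Cmod_div by auto. rewrite Cmod_Rcpow, Re_1_minus.
      assert (exp ((1 - Re s) * ln (INR N0)) <= X) by (apply exp_le; nra).
      apply Rmult_le_reg_r with (Cmod (1 - s)); [lra|]. unfold Rdiv. rewrite Rmult_assoc, Rinv_l by lra.
      assert (X * 1 <= X * Cmod (1 - s)) by (apply Rmult_le_compat_l; lra). lra. }
    lra. }
  assert (Step : forall n, (1 <= n)%nat -> Cmod (zeta_approx s (S n) - zeta_approx s n)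
     <= 4 * Cmod s * exp (- (1 + (1 - d)) * ln (INR n))).
  { intros n Hn. rewrite !zeta_approx_Csum.
    change (Csum ?f (S n)) with (Csum f n + f n)%C. cbv beta.
    replace (Csum (fun n0 => Rcpow (INR (S n0)) (- s)) n + Rcpow (INR (S n)) (- s) - Rcpow (INR (S n)) (1 - s) / (1 - s) -
       (Csum (fun n0 => Rcpow (INR (S n0)) (- s)) n - Rcpow (INR n) (1 - s) / (1 - s)))%C
      with (Rcpow (INR (S n)) (- s) - (Rcpow (INR (S n)) (1 - s) - Rcpow (INR n) (1 - s)) / (1 - s))%C
      by (field; auto).
    rewrite S_INR. eapply Rle_trans; [apply zeta_approx_step; auto; [lra|]|].
    - replace 1 with (INR 1) by auto; apply le_INR; auto.
    - pose proof (Cmod_ge_0 s). apply Rmult_le_compat_l; [lra|]. apply exp_le.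
      assert (0 <= ln (INR n)) by (apply ln_ge0; replace 1 with (INR 1) by auto; apply le_INR; auto). nra. }
  assert (Tail : forall K, Cmod (zeta_approx s (N0 + K) - zeta_approx s N0)
     <= 4 * Cmod s * Rsum (fun k => exp (- (1 + (1 - d)) * ln (INR (N0 + k)))) K).
  { induction K.
    - rewrite Nat.add_0_r. replace (zeta_approx s N0 - zeta_approx s N0)%C with (RtoC 0) by ring.
      rewrite Cmod_0. simpl. lra.
    - rewrite Nat.add_succ_r. simpl Rsum. specialize (Step (N0 + K)%nat ltac:(lia)).
      replace (zeta_approx s (S (N0 + K)) - zeta_approx s N0)%C with
        ((zeta_approx s (S (N0 + K)) - zeta_approx s (N0 + K)) + (zeta_approx s (N0 + K) - zeta_approx s N0))%C by ring.
      eapply Rle_trans; [apply Cmod_triangle|]. lra. }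
  specialize (Tail (N - N0)%nat). replace (N0 + (N - N0))%nat with N in Tail by lia.
  assert (TS : Rsum (fun k => exp (- (1 + (1 - d)) * ln (INR (N0 + k)))) (N - N0) <= 5 * (X * / INR N0)).
  { assert (E1 : exp (- (1 - d) * ln (INR N0)) = X * / INR N0).
    { unfold X. replace (/ INR N0) with (exp (- ln (INR N0))) by (rewrite exp_Ropp, exp_ln; auto; lra).
      rewrite <- exp_plus. f_equal. ring. }
    assert (PX : 0 < X * / INR N0) by (rewrite <- E1; apply exp_pos).
    destruct (N - N0)%nat as [|K]; [simpl; lra|]. rewrite Rsum_S_l, Nat.add_0_r.
    pose proof (power_sum_le (1 - d) N0 K ltac:(lra) HN0) as P. rewrite E1 in P.
    assert (exp (- (1 + (1 - d)) * ln (INR N0)) <= X * / INR N0) by (rewrite <- E1; apply exp_le; nra).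
    assert (/ (1 - d) * (X * / INR N0) <= 4 * (X * / INR N0)).
    { apply Rmult_le_compat_r; [lra|]. replace 4 with (/ (1 / 4)) by field. apply Rinv_le_contravar; lra. }
    lra. }
  assert (T2 : Cmod (zeta_approx s N - zeta_approx s N0) <= 40 * X).
  { eapply Rle_trans; [apply Tail|]. pose proof (Cmod_ge_0 s).
    apply Rle_trans with (4 * (2 * INR N0) * (5 * (X * / INR N0))).
    - apply Rmult_le_compat; [lra| |lra|auto]. apply Rsum_nonneg; intros; left; apply exp_pos.
    - apply Req_le. field. lra. }
  replace (zeta_approx s N) with (zeta_approx s N0 + (zeta_approx s N - zeta_approx s N0))%C by ring.
  eapply Rle_trans; [apply Cmod_triangle|]. lra.
Qed.

(** Taylor coefficients at [s0] of the correction term [- N^(1-s) / (1-s)] of [zeta_approx], as the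
    Cauchy product of an exponential and a geometric series. *)
Definition pole_coef (s0 : C) (N k : nat) : C :=
  (- Rcpow (INR N) (1 - s0) *
    Csum (fun i => expt (RtoC (- ln (INR N))) i * / (1 - s0) ^ S (k - i)) (S k))%C.

Lemma Ana_pole s0 N R : 0 <= R < Cmod (1 - s0) ->
  Ana R (fun w => - (Rcpow (INR N) (1 - (s0 + w)) / (1 - (s0 + w))))%C (pole_coef s0 N).
Proof.
  intros HR. unfold pole_coef.
  apply (Ana_ext _ (fun w => - Rcpow (INR N) (1 - s0) * (Cexp (RtoC (- ln (INR N)) * w) * / ((1 - s0) - w)))%C).
  - intros w _. replace (1 - (s0 + w))%C with (1 - s0 - w)%C by ring. unfold Cdiv.
    replace (Rcpow (INR N) (1 - s0 - w)) with (Rcpow (INR N) (1 - s0) * Cexp (RtoC (- ln (INR N)) * w))%C; [ring|].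
    unfold Rcpow. rewrite <- Cexp_plus. f_equal. rewrite RtoC_opp. ring.
  - apply (Ana_scal R (fun w => Cexp (RtoC (- ln (INR N)) * w) * / ((1 - s0) - w))%C); [lra|].
    apply (Ana_mult R _ _ (expt (RtoC (- ln (INR N)))) (fun k => / (1 - s0) ^ S k)%C); [lra| |].
    + apply Ana_exp; lra.
    + apply Ana_inv; lra.
Qed.

Lemma Ana_dirichlet s0 n R : 0 <= R -> Ana R (fun w => Rcpow (INR (S n)) (- (s0 + w)))%C (fun k => dterm s0 k n).
Proof.
  intros HR. unfold dterm.
  apply (Ana_ext _ (fun w => Rcpow (INR (S n)) (- s0) * Cexp (RtoC (- ln (INR (S n))) * w))%C).
  - intros w _. unfold Rcpow. rewrite <- Cexp_plus. f_equal. rewrite RtoC_opp. ring.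
  - apply Ana_scal; auto. apply Ana_exp; auto.
Qed.

Lemma Ana_zeta_approx s0 N R : 0 <= R < Cmod (1 - s0) ->
  Ana R (fun w => zeta_approx (s0 + w) N) (fun k => Csum (dterm s0 k) N + pole_coef s0 N k)%C.
Proof.
  intros HR.
  apply (Ana_ext _ (fun w => Csum (fun n => Rcpow (INR (S n)) (- (s0 + w))) N
    + - (Rcpow (INR N) (1 - (s0 + w)) / (1 - (s0 + w))))%C).
  - intros w _. rewrite zeta_approx_Csum. ring.
  - apply Ana_plus; [lra| |apply Ana_pole; auto].
    apply (Ana_Csum R (fun n w => Rcpow (INR (S n)) (- (s0 + w)))%C (fun n k => dterm s0 k n)); [lra|].
    intros n _. apply Ana_dirichlet; lra.
Qed.

Lemma exp_pow (x : R) (m : nat) : exp x ^ m = exp (INR m * x).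
Proof.
  induction m; [simpl; rewrite Rmult_0_l, exp_0; auto|].
  rewrite S_INR. simpl. rewrite IHm, <- exp_plus. f_equal. ring.
Qed.

Lemma power_vanish b : 0 < b -> is_lim_seq (fun N => exp (- b * ln (INR N))) 0.
Proof.
  intros Hb. apply is_lim_seq_spec. intros [e He].
  destruct (INR_unbounded (exp (- ln e / b))) as [N HN]. exists (S N). intros n Hn. simpl.
  rewrite Rminus_0_r, Rabs_pos_eq by (left; apply exp_pos).
  rewrite <- (exp_ln e) by auto. apply exp_increasing.
  assert (- ln e / b < ln (INR n)).
  { rewrite <- (ln_exp (- ln e / b)). apply ln_increasing; [apply exp_pos|].
    eapply Rlt_le_trans; [apply HN|]. apply le_INR. lia. }
  apply Rmult_lt_compat_l with (r := b) in H; auto.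
  replace (b * (- ln e / b)) with (- ln e) in H by (field; lra). lra.
Qed.

(** On the circle of radius [a / 2] the real part stays above 1, so Cauchy's estimate makes the
    coefficients of the correction term vanish in the limit. *)
Lemma zeta_coef_cvg t a k : 0 < a <= 1 -> 2 <= Rabs t ->
  Ccvg (fun N => Csum (dterm ((1 + a)%R, t) k) N + pole_coef ((1 + a)%R, t) N k)%C (phi ((1 + a)%R, t) k).
Proof.
  intros Ha Ht. set (s0 := ((1 + a)%R, t) : C).
  assert (H1 : 2 <= Cmod (1 - s0)).
  { eapply Rle_trans; [|apply Im_le_Cmod]. unfold s0. simpl. rewrite Rplus_0_l, Rabs_Ropp. auto. }
  replace (phi s0 k) with (phi s0 k + 0)%C by ring. apply Ccvg_plus.
  - apply (dom_cv _ (DM a k)); [|apply DM_ex; lra]. intros n. apply dterm_bound1; [simpl; lra|lra].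
  - assert (Pk : 0 < (a / 2) ^ k) by (apply pow_lt; lra).
    apply (Ccvg_squeeze _ _ (fun N => / (a / 2) ^ k * exp (- (a / 2) * ln (INR N))) 1%nat).
    + intros N HN. replace (pole_coef s0 N k - 0)%C with (pole_coef s0 N k) by ring.
      pose proof (cauchy_estimate (a / 2) _ _ k (exp (- (a / 2) * ln (INR N))) ltac:(lra)
        (Ana_pole s0 N (a / 2) ltac:(lra))) as CE.
      apply Rmult_le_reg_r with ((a / 2) ^ k); auto.
      replace (/ (a / 2) ^ k * exp (- (a / 2) * ln (INR N)) * (a / 2) ^ k) with (exp (- (a / 2) * ln (INR N)))
        by (field; lra).
      apply CE. intros w Hw. rewrite Cmod_opp.
      assert (W : 1 <= Cmod (1 - (s0 + w))).
      { replace (1 - (s0 + w))%C with ((1 - s0) - w)%C by ring.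
        pose proof (Cmod_triangle ((1 - s0) - w) w) as T. replace (1 - s0 - w + w)%C with (1 - s0)%C in T by ring. lra. }
      rewrite Cmod_div by (apply Cmod_gt_0; lra). rewrite Cmod_Rcpow, Re_1_minus, Re_plus.
      assert (L : 0 <= ln (INR N)) by (apply ln_ge0; replace 1 with (INR 1) by auto; apply le_INR; auto).
      assert (E : exp ((1 - (Re s0 + Re w)) * ln (INR N)) <= exp (- (a / 2) * ln (INR N))).
      { apply exp_le. pose proof (re_le_Cmod w) as T. apply Rabs_le_between in T. unfold s0; simpl Re. nra. }
      apply Rmult_le_reg_r with (Cmod (1 - (s0 + w))); [lra|]. unfold Rdiv. rewrite Rmult_assoc, Rinv_l by lra.
      pose proof (exp_pos (- (a / 2) * ln (INR N))). nra.
    + replace (Finite 0) with (Rbar_mult (/ (a / 2) ^ k) 0) by (simpl; f_equal; ring).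
      apply is_lim_seq_scal_l. apply power_vanish. lra.
Qed.

Lemma INR_archimed_pos x : 0 <= x -> exists N, x <= INR N <= x + 1.
Proof.
  intros Hx. destruct (archimed x) as [H1 H2]. exists (Z.to_nat (up x)).
  rewrite INR_IZR_INZ, Z2Nat.id; [lra|]. apply le_IZR. lra.
Qed.

Definition Hz (d t : R) : R := 100 * exp (d * ln (Rabs t)) * (1 + ln (Rabs t)).

Lemma zeta_local t a d : 0 < a <= 1 -> 0 <= d <= 3 / 4 -> 6 <= Rabs t ->
  (forall k, Cmod (phi ((1 + a)%R, t) k) * (a + d) ^ k <= Hz d t) /\
  (forall w, Cmod w < a + d -> Cmod w < 1 + a ->
     zeta (((1 + a)%R, t) + w)%C = CS (fun k => phi ((1 + a)%R, t) k * w ^ k)%C).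
Proof.
  intros Ha Hd Ht. set (s0 := ((1 + a)%R, t) : C). set (R := a + d).
  assert (Rt : R <= 7 / 4) by (unfold R; lra).
  assert (H1 : Rabs t <= Cmod (1 - s0)).
  { eapply Rle_trans; [|apply Im_le_Cmod]. unfold s0. simpl. rewrite Rplus_0_l, Rabs_Ropp. lra. }
  assert (Hs0 : Cmod s0 <= 2 + Rabs t).
  { eapply Rle_trans; [apply Cmod_le_sum|]. unfold s0; simpl. rewrite (Rabs_pos_eq (1 + a)); lra. }
  destruct (INR_archimed_pos (Rabs t)) as [N0 [HN1 HN2]]; [lra|].
  assert (HN0 : (1 <= N0)%nat) by (apply INR_le; simpl; lra).
  assert (LN : ln (INR N0) <= ln (Rabs t) + 1).
  { apply Rle_trans with (ln (Rabs t * exp 1)).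
    - apply ln_le'; [lra|]. pose proof (exp_ineq1 1 ltac:(lra)). nra.
    - rewrite ln_mult, ln_exp; [lra|lra|apply exp_pos]. }
  assert (Lt : 0 <= ln (Rabs t)) by (apply ln_ge0; lra).
  assert (B : forall w N, Cmod w <= R -> (N0 <= N)%nat -> Cmod (zeta_approx (s0 + w) N) <= Hz d t).
  { intros w N Hw HN.
    pose proof (re_le_Cmod w) as T. apply Rabs_le_between in T.
    eapply Rle_trans; [apply (zeta_approx_bound (s0 + w) d N0 N); auto|].
    - rewrite Re_plus. unfold s0; simpl Re. unfold R in *. lra.
    - replace (1 - (s0 + w))%C with ((1 - s0) - w)%C by ring.
      pose proof (Cmod_triangle ((1 - s0) - w) w) as T2. replace (1 - s0 - w + w)%C with (1 - s0)%C in T2 by ring. lra.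
    - eapply Rle_trans; [apply Cmod_triangle|]. lra.
    (* [N0 <= e |t|] and [d <= 3/4] give [N0^d <= e^(3/4) |t|^d], and [e^(3/4) <= 2.3] because
       [2.3^4 > 27 >= e^3]. *)
    - unfold Hz. apply Rle_trans with ((2.3 * exp (d * ln (Rabs t))) * (43 * (1 + ln (Rabs t)))).
      + apply Rmult_le_compat; [left; apply exp_pos| | |].
        * assert (0 <= ln (INR N0)) by (apply ln_ge0; lra). lra.
        * apply Rle_trans with (exp (3 / 4) * exp (d * ln (Rabs t))).
          -- rewrite <- exp_plus. apply exp_le. nra.
          -- apply Rmult_le_compat_r; [left; apply exp_pos|].
             assert (E1 : exp (3 / 4) * exp (3 / 4) * exp (3 / 4) * exp (3 / 4) <= 27).
             { rewrite <- !exp_plus. replace (3 / 4 + 3 / 4 + 3 / 4 + 3 / 4) with (1 + 1 + 1) by field.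
               rewrite !exp_plus. pose proof exp_le_3. pose proof (exp_pos 1).
               assert (exp 1 * exp 1 <= 9) by nra. nra. }
             apply Rnot_lt_le. intros L. assert (2.3 * 2.3 < exp (3 / 4) * exp (3 / 4)) by nra.
             assert ((2.3 * 2.3) * (2.3 * 2.3) < (exp (3 / 4) * exp (3 / 4)) * (exp (3 / 4) * exp (3 / 4))) by nra.
             nra.
        * nra.
      + pose proof (exp_pos (d * ln (Rabs t))). nra. }
  set (c := fun N k => (Csum (dterm s0 k) N + pole_coef s0 N k)%C).
  assert (An : forall N, Ana R (fun w => zeta_approx (s0 + w) N) (c N)).
  { intros N. apply Ana_zeta_approx. unfold R in *. lra. }
  assert (CE : forall N k, (N0 <= N)%nat -> Cmod (c N k) * R ^ k <= Hz d t).
  { intros N k HN. apply (cauchy_estimate R _ _ k _ ltac:(unfold R; lra) (An N)).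
    intros w Hw. apply B; auto; lra. }
  assert (Cv : forall k, Ccvg (fun N => c N k) (phi s0 k)).
  { intros k. apply zeta_coef_cvg; auto; lra. }
  assert (PR : 0 < R) by (unfold R; lra).
  split.
  - intros k. replace (Cmod (phi s0 k) * R ^ k) with (Cmod (RtoC (R ^ k) * phi s0 k)).
    + apply (Ccvg_bound_loc (fun N => RtoC (R ^ k) * c N k)%C _ _ N0); [apply Ccvg_scal; auto|].
      intros N HN. rewrite Cmod_mult, Cmod_R, Rabs_pos_eq, Rmult_comm by (apply pow_le; lra). auto.
    + rewrite Cmod_mult, Cmod_R, Rabs_pos_eq by (apply pow_le; lra). ring.
  - intros w Hw Hw2. apply (Ccvg_unique (fun N => zeta_approx (s0 + w) (N0 + N)%nat)).
    + assert (Z : Ccvg (zeta_approx (s0 + w)) (zeta (s0 + w))).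
      { apply Ccvg_zeta.
        - pose proof (re_le_Cmod w) as T. apply Rabs_le_between in T. rewrite Re_plus. unfold s0; simpl Re. lra.
        - intros E. assert (E2 : (1 - s0)%C = w) by (rewrite <- E; ring). rewrite E2 in H1. unfold R in *. lra. }
      intros e He. destruct (Z e He) as [M HM]. exists M. intros n Hn. apply HM. lia.
    + apply (Ccvg_ext (fun N => CS (fun k => c (N0 + N)%nat k * w ^ k)%C)).
      * intros N. symmetry. apply (proj2 (An (N0 + N)%nat)). lra.
      * apply (tannery _ _ (fun k => Hz d t * (Cmod w / R) ^ k)).
        -- intros N k. unfold Rdiv. rewrite Rpow_mult_distr, pow_inv, Cmod_mult, Cmod_pow.
           specialize (CE (N0 + N)%nat k ltac:(lia)). assert (0 < R ^ k) by (apply pow_lt; auto).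
           replace (Cmod (c (N0 + N)%nat k) * Cmod w ^ k) with ((Cmod (c (N0 + N)%nat k) * R ^ k) * (Cmod w ^ k * / R ^ k))
             by (field; lra).
           apply Rmult_le_compat_r; auto. apply Rmult_le_pos; [apply pow_le, Cmod_ge_0|left; apply Rinv_0_lt_compat; auto].
        -- apply ex_series_scal', ex_series_geom'. split; [apply Rdiv_le_0_compat; auto using Cmod_ge_0|].
           apply Rmult_lt_reg_r with R; auto. unfold Rdiv. rewrite Rmult_assoc, Rinv_l by lra. lra.
        -- intros k. apply (Ccvg_ext (fun N => w ^ k * c (N0 + N)%nat k)%C); [intros; ring|].
           replace (phi s0 k * w ^ k)%C with (w ^ k * phi s0 k)%C by ring. apply Ccvg_scal.
           intros e He. destruct (Cv k e He) as [M HM]. exists M. intros n Hn. apply HM. lia.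
Qed.

(** * The generating function of Lambda *)

Lemma Rsum_abel (a : nat -> R) r M : 0 <= r -> (forall n, 0 <= a n) ->
  (1 - r) * Rsum (fun n => a n * r ^ n) (S M) <= a O + Rsum (fun n => (a (S n) - a n) * r ^ S n) M.
Proof.
  intros Hr Ha.
  assert (E : (1 - r) * Rsum (fun n => a n * r ^ n) (S M)
    = a O + Rsum (fun n => (a (S n) - a n) * r ^ S n) M - a M * r ^ S M).
  { induction M; [simpl; ring|].
    change (Rsum (fun n => a n * r ^ n) (S (S M))) with (Rsum (fun n => a n * r ^ n) (S M) + a (S M) * r ^ S M).
    rewrite Rmult_plus_distr_l, IHM. simpl. ring. }
  rewrite E. assert (0 <= a M * r ^ S M) by (apply Rmult_le_pos; auto; apply pow_le; auto). lra.
Qed.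

Lemma Rsum_geom_le r M : 0 <= r < 1 -> Rsum (fun n => r ^ n) M <= / (1 - r).
Proof.
  intros Hr. assert (G : (1 - r) * Rsum (fun n => r ^ n) M = 1 - r ^ M).
  { induction M; [simpl; ring|]. simpl. rewrite Rmult_plus_distr_l, IHM. ring. }
  apply Rmult_le_reg_l with (1 - r); [lra|]. rewrite G, Rinv_r by lra.
  assert (0 <= r ^ M) by (apply pow_le; lra). lra.
Qed.

Lemma Rsum_n_le r M : 0 <= r < 1 -> Rsum (fun n => INR n * r ^ n) M <= (/ (1 - r)) ^ 2.
Proof.
  intros Hr. assert (P : 0 < / (1 - r)) by (apply Rinv_0_lt_compat; lra).
  destruct M as [|M]; [simpl; nra|].
  pose proof (Rsum_abel INR r M ltac:(lra) pos_INR) as A.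
  rewrite (Rsum_ext (fun n => (INR (S n) - INR n) * r ^ S n) (fun n => r * r ^ n)) in A by (intros; rewrite S_INR; simpl; ring).
  rewrite Rsum_scal in A. change (Rsum (pow r) M) with (Rsum (fun n => r ^ n) M) in A.
  pose proof (Rsum_geom_le r M Hr) as Gm.
  assert (r * Rsum (fun n => r ^ n) M <= / (1 - r)).
  { assert (0 <= Rsum (fun n => r ^ n) M) by (apply Rsum_nonneg; intros; apply pow_le; lra). nra. }
  apply Rmult_le_reg_l with (1 - r); [lra|]. simpl (INR 0) in A.
  replace ((1 - r) * (/ (1 - r)) ^ 2) with (/ (1 - r)) by (field; lra). lra.
Qed.

Lemma Rsum_n2_le r M : 0 <= r < 1 -> Rsum (fun n => INR n ^ 2 * r ^ n) M <= 2 * (/ (1 - r)) ^ 3.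
Proof.
  intros Hr. assert (P : 0 < / (1 - r)) by (apply Rinv_0_lt_compat; lra).
  destruct M as [|M]; [simpl; assert (0 < / (1 - r) * / (1 - r)) by nra; nra|].
  pose proof (Rsum_abel (fun n => INR n ^ 2) r M ltac:(lra) (fun n => pow2_ge_0 _)) as A. cbv beta in A.
  assert (B : Rsum (fun n => (INR (S n) ^ 2 - INR n ^ 2) * r ^ S n) M <= 2 * (/ (1 - r)) ^ 2).
  { apply Rle_trans with (2 * Rsum (fun n => INR n * r ^ n) (S M)).
    - rewrite (Rsum_S_l (fun n => INR n * r ^ n)). simpl (INR 0). rewrite Rmult_0_l, Rplus_0_l.
      rewrite <- Rsum_scal. apply Rsum_le. intros n _. rewrite <- Rmult_assoc.
      apply Rmult_le_compat_r; [apply pow_le; lra|]. rewrite S_INR. pose proof (pos_INR n). nra.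
    - pose proof (Rsum_n_le r (S M) Hr). lra. }
  apply Rmult_le_reg_l with (1 - r); [lra|]. simpl (INR 0) in A. rewrite (pow_ne_zero 2), Rplus_0_l in A by lia.
  replace ((1 - r) * (2 * (/ (1 - r)) ^ 3)) with (2 * (/ (1 - r)) ^ 2) by (field; lra). lra.
Qed.

(** [N (N - 1) / 2] sums [n - 1], the number of ways to write [n] as a sum of two positive integers.
    So [gE] sums the coefficients of [F^2 - m^2], where [F] is the series of [Lambda]. *)
Definition gE (N : nat) : R := G N - INR N * (INR N - 1) / 2.

(** A bound at one fixed height: [th] is [C0 eta(log|t|)] and [ka] is [|t|^-C0] in the main case,
    and [ka = 0] when [eta] is bounded below. *)
Definition Ebound (K th ka : R) : Prop := forall N, (1 <= N)%nat ->
  Rabs (gE N) <= K * (INR N ^ 2 * (exp (- th * ln (INR N)) + ka)).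

Lemma G_0 : G 0 = 0.
Proof. unfold G. rewrite sum_n_m_zero by lia. reflexivity. Qed.

Lemma G_S n : G (S n) = G n + psi2 (S n).
Proof. unfold G. rewrite sum_n_Sm by lia. reflexivity. Qed.

Lemma gE_0 : gE 0 = 0.
Proof. unfold gE. rewrite G_0. simpl. field. Qed.

Lemma gE_S n : gE (S n) - gE n = psi2 (S n) - INR n.
Proof. unfold gE. rewrite G_S, S_INR. field. Qed.

(** The added end terms vanish because [Lambda 0 = 0]; this is the shape of a Cauchy square. *)
Lemma psi2_Rsum N : psi2 N = Rsum (fun m => Lambda m * Lambda (N - m)) (S N).
Proof.
  unfold psi2. destruct N as [|N].
  - rewrite sum_n_m_zero by lia. simpl. rewrite Lambda_0. change zero with 0. ring.
  - replace (S N - 1)%nat with N by lia.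
    change (Rsum ?f (S (S N))) with (Rsum f (S N) + f (S N)). cbv beta. rewrite Nat.sub_diag, Lambda_0, Rmult_0_r, Rplus_0_r.
    rewrite Rsum_S_l, Lambda_0, Rmult_0_l, Rplus_0_l.
    destruct N as [|N]; [rewrite sum_n_m_zero by lia; reflexivity|].
    rewrite <- sum_n_m_S, <- sum_n_Rsum. reflexivity.
Qed.

Definition unit1 (n : nat) : R := if Nat.eqb n 0 then 0 else 1.
Definition ee (n : nat) : R := Lambda n - unit1 n.
Definition pser (c : nat -> R) (z : C) : C := CS (fun n => RtoC (c n) * z ^ n)%C.

Lemma Lambda_le_INR n : 0 <= Lambda n <= INR n.
Proof.
  split; [apply Lambda_nonneg|]. destruct n; [rewrite Lambda_0; simpl; lra|].
  eapply Rle_trans; [apply Lambda_le_ln; lia|].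
  pose proof (ln_le_sub1 (INR (S n)) ltac:(apply lt_0_INR; lia)). lra.
Qed.

Lemma unit1_le n : 0 <= unit1 n <= INR n.
Proof. destruct n; unfold unit1; simpl Nat.eqb; [simpl; lra|]. pose proof (INR_S_ge1 n). lra. Qed.

Lemma ee_le n : Rabs (ee n) <= INR n.
Proof. unfold ee. pose proof (Lambda_le_INR n). pose proof (unit1_le n). apply Rabs_le. lra. Qed.

Lemma pser_term c z n M : Rabs (c n) <= M -> Cmod (RtoC (c n) * z ^ n) <= M * Cmod z ^ n.
Proof.
  intros H. rewrite Cmod_mult, Cmod_R, Cmod_pow. apply Rmult_le_compat_r; auto. apply pow_le, Cmod_ge_0.
Qed.

Lemma ex_series_n r : 0 <= r < 1 -> ex_series (fun n => INR n * r ^ n).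
Proof.
  intros Hr. apply (ex_series_Rsum_bound _ ((/ (1 - r)) ^ 2)).
  - intros n. apply Rmult_le_pos; [apply pos_INR|apply pow_le; lra].
  - intros n. apply Rsum_n_le; auto.
Qed.

Lemma ex_series_n2 r : 0 <= r < 1 -> ex_series (fun n => INR n ^ 2 * r ^ n).
Proof.
  intros Hr. apply (ex_series_Rsum_bound _ (2 * (/ (1 - r)) ^ 3)).
  - intros n. apply Rmult_le_pos; [apply pow2_ge_0|apply pow_le; lra].
  - intros n. apply Rsum_n2_le; auto.
Qed.

Lemma Cpow_geom_unit z : Cmod z < 1 -> pser unit1 z = (z / (1 - z))%C.
Proof.
  intros Hz.
  assert (H1 : (1 - z)%C <> RtoC 0).
  { intros E. assert (z = 1%C) by (replace z with (1 - (1 - z))%C by ring; rewrite E; ring). subst z. rewrite Cmod_1 in Hz. lra. }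
  unfold pser. rewrite (CS_S_l _ (fun n => INR n * Cmod z ^ n)).
  - rewrite (CS_ext _ (fun n => z * z ^ n)%C).
    + rewrite (CS_scal _ _ (fun n => Cmod z ^ n)).
      * rewrite CS_geom by auto. unfold unit1. simpl. field. auto.
      * intros n. rewrite Cmod_pow. lra.
      * apply ex_series_geom'. split; auto using Cmod_ge_0.
    + intros n. unfold unit1. simpl. ring.
  - intros n. apply pser_term. rewrite Rabs_pos_eq; apply unit1_le.
  - apply ex_series_n. split; auto using Cmod_ge_0.
Qed.

Lemma pser_ee z : Cmod z < 1 -> pser ee z = (pser Lambda z - pser unit1 z)%C.
Proof.
  intros Hz. unfold Cminus. replace (- pser unit1 z)%C with (- (1) * pser unit1 z)%C by ring.
  assert (X : ex_series (fun n => INR n * Cmod z ^ n)) by (apply ex_series_n; split; auto using Cmod_ge_0).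
  assert (Bu : forall n, Cmod (RtoC (unit1 n) * z ^ n) <= INR n * Cmod z ^ n).
  { intros n. apply pser_term. rewrite Rabs_pos_eq; apply unit1_le. }
  unfold pser. rewrite <- (CS_scal _ _ (fun n => INR n * Cmod z ^ n)); auto.
  rewrite <- (CS_plus _ _ (fun n => INR n * Cmod z ^ n) (fun n => INR n * Cmod z ^ n)); auto.
  - apply CS_ext. intros n. unfold ee. rewrite RtoC_minus. ring.
  - intros n. apply pser_term. rewrite Rabs_pos_eq; apply Lambda_le_INR.
  - intros n. rewrite Cmod_mult, Cmod_opp, Cmod_1, Rmult_1_l. auto.
Qed.

Lemma gE_bound K th ka : Ebound K th ka -> 0 <= th -> 0 <= ka <= 1 -> 0 <= K -> forall N, Rabs (gE N) <= K * 2 * INR N ^ 2.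
Proof.
  intros HE Hth Hka HK N. destruct N as [|N].
  - rewrite gE_0, Rabs_R0. simpl. lra.
  - eapply Rle_trans; [apply HE; lia|]. pose proof (pow2_ge_0 (INR (S N))).
    assert (exp (- th * ln (INR (S N))) <= 1).
    { rewrite <- exp_0. apply exp_le. pose proof (ln_INR_S N). nra. }
    rewrite Rmult_assoc. apply Rmult_le_compat_l; auto. nra.
Qed.

(** As [D + 2 m = F + m], the left side is [F^2 - m^2], whose coefficients are the increments of
    [gE]; the factor [1 - z] on the right produces the same increments. *)
Lemma generating_identity K z : Cmod z < 1 -> (forall N, Rabs (gE N) <= K * INR N ^ 2) ->
  (pser ee z * (pser ee z + 2 * pser unit1 z))%C = ((1 - z) * pser gE z)%C.
Proof.
  intros Hz HE. assert (Hz' : 0 <= Cmod z < 1) by (split; auto using Cmod_ge_0).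
  assert (X1 : ex_series (fun n => INR n * Cmod z ^ n)) by (apply ex_series_n; auto).
  assert (X2 : ex_series (fun n => K * INR n ^ 2 * Cmod z ^ n)).
  { apply (ex_series_ext' (fun n => K * (INR n ^ 2 * Cmod z ^ n))); [intros; ring|].
    apply ex_series_scal', ex_series_n2; auto. }
  assert (BL : forall n, Cmod (RtoC (Lambda n) * z ^ n) <= INR n * Cmod z ^ n).
  { intros n. apply pser_term. rewrite Rabs_pos_eq; apply Lambda_le_INR. }
  assert (BU : forall n, Cmod (RtoC (unit1 n) * z ^ n) <= INR n * Cmod z ^ n).
  { intros n. apply pser_term. rewrite Rabs_pos_eq; apply unit1_le. }
  assert (BE : forall n, Cmod (RtoC (gE n) * z ^ n) <= K * INR n ^ 2 * Cmod z ^ n).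
  { intros n. apply pser_term. auto. }
  rewrite pser_ee by auto.
  set (F := pser Lambda z). set (m := pser unit1 z).
  replace ((F - m) * (F - m + 2 * m))%C with (F * F - m * m)%C by ring.
  pose proof (CS_cauchy_product _ _ _ _ BL X1 BL X1) as PF.
  pose proof (CS_cauchy_product _ _ _ _ BU X1 BU X1) as PU.
  pose proof (Ccvg_minus _ _ _ _ PF PU) as P. fold F m in P.
  apply (Ccvg_unique _ _ _ P). clear P PF PU.
  apply Ccvg_S.
  assert (Conv : forall a, Csum (fun N => Csum (fun k => RtoC (a k) * z ^ k * (RtoC (a (N - k)%nat) * z ^ (N - k)))%C (S N))
     = Csum (fun N => RtoC (Rsum (fun k => (a k * a (N - k)%nat)%R) (S N)) * z ^ N)%C).
  { intros a. apply functional_extensionality. intros M. apply Csum_ext. intros N _.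
    rewrite RtoC_Rsum, Cmult_comm, <- Csum_scal. apply Csum_ext. intros k Hk.
    assert (E : (z ^ N = z ^ k * z ^ (N - k))%C) by (rewrite <- Cpow_add_r; f_equal; lia).
    rewrite E, RtoC_mult. ring. }
  rewrite !Conv.
  assert (U : forall N, Rsum (fun k => unit1 k * unit1 (N - k)) (S N) = INR (N - 1)).
  { intros [|N]; [unfold unit1; simpl; ring|].
    change (Rsum ?f (S (S N))) with (Rsum f (S N) + f (S N)). cbv beta.
    rewrite Rsum_S_l, Nat.sub_diag. replace (unit1 0) with 0 by reflexivity.
    rewrite (Rsum_ext _ (fun _ => 1)).
    - rewrite Rsum_const. replace (S N - 1)%nat with N by lia. ring.
    - intros k Hk. unfold unit1. replace (S N - S k)%nat with (S (N - S k)) by lia. simpl. ring. }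
  assert (Sh : ((1 - z) * pser gE z)%C = CS (fun n => RtoC (gE (S n) - gE n) * z ^ S n)%C).
  { replace ((1 - z) * pser gE z)%C with (pser gE z + - z * pser gE z)%C by ring.
    unfold pser. rewrite (CS_S_l _ _ BE X2) at 1. rewrite gE_0, Cmult_0_l, Cplus_0_l.
    rewrite <- (CS_scal _ _ _ BE X2).
    rewrite <- (CS_plus _ _ (fun n => K * INR (S n) ^ 2 * Cmod z ^ S n) (fun n => Cmod z * (K * INR n ^ 2 * Cmod z ^ n))).
    - apply CS_ext. intros n. rewrite RtoC_minus, Cpow_S. ring.
    - intros n. apply (BE (S n)).
    - apply -> (ex_series_S (fun n => K * INR n ^ 2 * Cmod z ^ n)); auto.
    - intros n. rewrite Cmod_mult, Cmod_opp. apply Rmult_le_compat_l; auto using Cmod_ge_0.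
    - apply ex_series_scal'; auto. }
  rewrite Sh.
  apply (Ccvg_ext (Csum (fun n => RtoC (gE (S n) - gE n) * z ^ S n)%C)).
  - intros M. unfold Cminus. rewrite <- Csum_opp, <- Csum_plus, Csum_S_l.
    rewrite (U 0%nat), <- psi2_Rsum. replace (psi2 0) with 0 by (rewrite psi2_Rsum; simpl; rewrite Lambda_0; ring).
    simpl (INR (0 - 1)). replace (RtoC 0 * z ^ 0 + - (RtoC 0 * z ^ 0))%C with (RtoC 0) by ring.
    rewrite Cplus_0_l. apply Csum_ext. intros n _. rewrite U, <- psi2_Rsum, gE_S.
    replace (S n - 1)%nat with n by lia. rewrite RtoC_minus. ring.
  - apply (dom_cv _ (fun n => K * INR (S n) ^ 2 * Cmod z ^ S n + Cmod z * (K * INR n ^ 2 * Cmod z ^ n))).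
    + intros n. replace (RtoC (gE (S n) - gE n) * z ^ S n)%C with
        (RtoC (gE (S n)) * z ^ S n + - z * (RtoC (gE n) * z ^ n))%C by (rewrite RtoC_minus, Cpow_S; ring).
      eapply Rle_trans; [apply Cmod_triangle|]. apply Rplus_le_compat; [apply (BE (S n))|].
      rewrite Cmod_mult, Cmod_opp. apply Rmult_le_compat_l; auto using Cmod_ge_0.
    + apply ex_series_plus'; [apply -> (ex_series_S (fun n => K * INR n ^ 2 * Cmod z ^ n)); auto|apply ex_series_scal'; auto].
Qed.

Lemma exp_ln_ratio_le th v : 0 <= th <= 1 -> 0 < v -> exp (th * ln v) <= 1 + v.
Proof.
  intros Hth Hv. destruct (Rle_dec 1 v) as [H|H].
  - apply Rle_trans with (exp (ln v)); [apply exp_le|rewrite exp_ln; lra].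
    pose proof (ln_ge0 v H). nra.
  - apply Rle_trans with (exp 0); [apply exp_le|rewrite exp_0; lra].
    assert (ln v <= 0) by (rewrite <- ln_1; apply ln_le'; lra). nra.
Qed.

Lemma pow_incr_le2 x y : 0 <= y -> x ^ 2 <= y ^ 2 -> x <= y.
Proof. intros Hy H. apply Rnot_lt_le. intros L. simpl in H. nra. Qed.

Lemma cos_abs x : cos (Rabs x) = cos x.
Proof. unfold Rabs. destruct (Rcase_abs x); auto using cos_neg. Qed.

Section Generating.

Variables (K th ka : R).
Hypothesis (HE : Ebound K th ka) (Hth : 0 <= th <= 1) (Hka : 0 <= ka <= 1) (HK : 0 <= K).

(** For [th <= 1], [N^-th <= (1-r)^th (1 + 1 / (N (1-r)))], so summation keeps the saving with [N]
    replaced by [1 / (1-r)]. *)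
Lemma gE_sum_le r M : 0 <= r < 1 ->
  Rsum (fun n => Rabs (gE n) * r ^ n) M <= 3 * K * (/ (1 - r)) ^ 3 * (exp (th * ln (1 - r)) + ka).
Proof.
  intros Hr. set (X := / (1 - r)). assert (HX : 0 < X) by (apply Rinv_0_lt_compat; lra).
  assert (EX : 1 - r = / X) by (unfold X; rewrite Rinv_inv; auto).
  assert (LX : ln (1 - r) = - ln X) by (rewrite EX, ln_Rinv; auto).
  rewrite LX. set (Y := exp (th * - ln X)). assert (HY : 0 < Y) by apply exp_pos.
  apply Rle_trans with (Rsum (fun n => (K * (Y + ka)) * (INR n ^ 2 * r ^ n) + (K * Y * X) * (INR n * r ^ n)) M).
  - apply Rsum_le. intros n _. destruct n as [|n].
    + rewrite gE_0, Rabs_R0. simpl. lra.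
    + assert (Pr : 0 <= r ^ S n) by (apply pow_le; lra).
      assert (P1 : 0 < INR (S n)) by (apply lt_0_INR; lia).
      assert (E : exp (- th * ln (INR (S n))) <= Y * (1 + X / INR (S n))).
      { replace (- th * ln (INR (S n))) with (th * - ln X + th * ln (X / INR (S n))).
        - rewrite exp_plus. apply Rmult_le_compat_l; [left; auto|]. apply exp_ln_ratio_le; auto.
          apply Rdiv_lt_0_compat; auto.
        - unfold Rdiv. rewrite ln_mult, ln_Rinv; auto; [ring|apply Rinv_0_lt_compat; auto]. }
      apply Rle_trans with (K * (INR (S n) ^ 2 * (Y * (1 + X / INR (S n)) + ka)) * r ^ S n).
      * apply Rmult_le_compat_r; auto. eapply Rle_trans; [apply HE; lia|].
        apply Rmult_le_compat_l; auto. apply Rmult_le_compat_l; [apply pow2_ge_0|lra].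
      * apply Req_le. field. lra.
  - rewrite Rsum_plus, !Rsum_scal. pose proof (Rsum_n_le r M Hr) as B1. pose proof (Rsum_n2_le r M Hr) as B2.
    fold X in B1, B2.
    assert (A1 : 0 <= K * (Y + ka)) by (apply Rmult_le_pos; lra).
    assert (A2 : 0 <= K * Y * X) by (apply Rmult_le_pos; [apply Rmult_le_pos|]; lra).
    apply Rle_trans with (K * (Y + ka) * (2 * X ^ 3) + K * Y * X * X ^ 2).
    + apply Rplus_le_compat; apply Rmult_le_compat_l; auto.
    + assert (0 <= K * ka * X ^ 3) by (apply Rmult_le_pos; [apply Rmult_le_pos; lra|apply pow_le; lra]).
      replace (K * Y * X * X ^ 2) with (K * Y * X ^ 3) by ring. nra.
Qed.

Lemma gE_poly N : Rabs (gE N) <= K * 2 * INR N ^ 2.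
Proof. apply (gE_bound K th ka); auto; lra. Qed.

Lemma gE_pser_bound z : Cmod z < 1 ->
  Cmod (pser gE z) <= 3 * K * (/ (1 - Cmod z)) ^ 3 * (exp (th * ln (1 - Cmod z)) + ka).
Proof.
  intros Hz. assert (Hr : 0 <= Cmod z < 1) by (split; auto using Cmod_ge_0).
  destruct (ex_series_Rsum_bound (fun n => Rabs (gE n) * Cmod z ^ n)
    (3 * K * (/ (1 - Cmod z)) ^ 3 * (exp (th * ln (1 - Cmod z)) + ka))) as [E B].
  - intros n. apply Rmult_le_pos; [apply Rabs_pos|apply pow_le; lra].
  - intros n. apply gE_sum_le; auto.
  - eapply Rle_trans; [|apply B]. apply dom_bound; auto. intros n. apply pser_term. lra.
Qed.

Lemma pser_R c r : 0 <= r < 1 -> (forall n, 0 <= c n <= INR n) ->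
  pser c (RtoC r) = RtoC (Series (fun n => c n * r ^ n)) /\ ex_series (fun n => c n * r ^ n).
Proof.
  intros Hr Hc.
  assert (E : ex_series (fun n => c n * r ^ n)).
  { apply (ex_series_dom _ (fun n => INR n * r ^ n)); [|apply ex_series_n; auto].
    intros n. specialize (Hc n). assert (0 <= r ^ n) by (apply pow_le; lra). split; [nra|].
    apply Rmult_le_compat_r; lra. }
  split; auto. unfold pser. apply CS_unique.
  apply Ccvg_lim. apply (is_lim_seq_ext (fun n => Rabs (Rsum (fun n => c n * r ^ n) n - Series (fun n => c n * r ^ n)))).
  - intros n. rewrite (Csum_ext _ (fun n => RtoC (c n * r ^ n))) by (intros; rewrite RtoC_mult, RtoC_pow; auto).
    rewrite <- RtoC_Rsum, <- RtoC_minus, Cmod_R. auto.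
  - apply is_lim_seq_spec. intros e. pose proof (Series_lim _ E) as L. apply is_lim_seq_spec in L.
    destruct (L e) as [N HN]. exists N. intros n Hn. rewrite Rminus_0_r, Rabs_Rabsolu. auto.
Qed.

(** A Chebyshev bound read off the hypothesis: on the real axis the identity says
    [F^2 = m^2 + O(X^2)] with [X = 1 / (1-r)], and [F >= 0]. *)
Lemma Lambda_series_bound r : 0 <= r < 1 -> Series (fun n => Lambda n * r ^ n) <= (1 + 6 * K) * / (1 - r).
Proof.
  intros Hr. destruct (pser_R Lambda r Hr Lambda_le_INR) as [EF XF].
  destruct (pser_R unit1 r Hr unit1_le) as [EU XU].
  set (F := Series (fun n => Lambda n * r ^ n)) in *. set (m := Series (fun n => unit1 n * r ^ n)) in *.
  assert (Cr : Cmod (RtoC r) = r) by (rewrite Cmod_R, Rabs_pos_eq; lra).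
  pose proof (generating_identity _ (RtoC r) ltac:(lra) gE_poly) as I.
  rewrite pser_ee, EF, EU in I by lra.
  assert (I2 : RtoC (F * F - m * m) = ((1 - RtoC r) * pser gE (RtoC r))%C).
  { rewrite <- I. rewrite RtoC_minus, !RtoC_mult. ring. }
  apply (f_equal Cmod) in I2. rewrite Cmod_R, Cmod_mult in I2.
  rewrite <- RtoC_minus, Cmod_R, (Rabs_pos_eq (1 - r)) in I2 by lra.
  pose proof (gE_pser_bound (RtoC r) ltac:(lra)) as B. rewrite Cr in B.
  set (X := / (1 - r)) in *. assert (HX : 0 < X) by (apply Rinv_0_lt_compat; lra).
  assert (HX1 : 1 <= X) by (unfold X; rewrite <- Rinv_1; apply Rinv_le_contravar; lra).
  assert (Hm : m = r * X).
  { apply RtoC_inj. rewrite <- EU, Cpow_geom_unit by lra. unfold X.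
    rewrite <- RtoC_minus, <- RtoC_div by lra. reflexivity. }
  assert (E1 : exp (th * ln (1 - r)) <= 1).
  { apply Rle_trans with (exp 0); [apply exp_le|rewrite exp_0; lra]. assert (ln (1 - r) <= 0) by (rewrite <- ln_1; apply ln_le'; lra).
    rewrite <- (Rmult_0_r th). apply Rmult_le_compat_l; lra. }
  assert (B2 : F * F - m * m <= 6 * K * X ^ 2).
  { eapply Rle_trans; [apply Rle_abs|]. rewrite I2.
    apply Rle_trans with ((1 - r) * (3 * K * X ^ 3 * (1 + 1))).
    - apply Rmult_le_compat_l; [lra|]. eapply Rle_trans; [apply B|]. apply Rmult_le_compat_l; [|lra].
      apply Rmult_le_pos; [lra|apply pow_le; lra].
    - apply Req_le. unfold X. field. lra. }
  assert (F0 : 0 <= F).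
  { pose proof (Rsum_le_Series _ 0 (fun n => Rmult_le_pos _ _ (Lambda_nonneg n) (pow_le r n (proj1 Hr))) XF) as T.
    exact T. }
  assert (M1 : 0 <= m <= X) by (rewrite Hm; split; [apply Rmult_le_pos; lra|rewrite <- (Rmult_1_l X) at 2; apply Rmult_le_compat_r; lra]).
  apply Rnot_lt_le. intros L.
  assert (P2 : 0 <= (1 + 6 * K) * X) by (apply Rmult_le_pos; lra).
  assert (L2 : ((1 + 6 * K) * X) * ((1 + 6 * K) * X) < F * F) by (apply Rmult_le_0_lt_compat; auto).
  assert (m * m <= X * X) by (apply Rmult_le_compat; lra).
  assert (0 <= K * X ^ 2) by (apply Rmult_le_pos; auto; apply pow_le; lra).
  assert (0 <= K * K * X ^ 2) by (apply Rmult_le_pos; [nra|apply pow_le; lra]). simpl in *. nra.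
Qed.

Lemma ee_sum_bound r : 0 <= r < 1 -> ex_series (fun n => Rabs (ee n) * r ^ n) /\
  Series (fun n => Rabs (ee n) * r ^ n) <= (2 + 6 * K) * / (1 - r).
Proof.
  intros Hr. destruct (pser_R Lambda r Hr Lambda_le_INR) as [_ XF].
  destruct (pser_R unit1 r Hr unit1_le) as [_ XU].
  assert (D : forall n, 0 <= Rabs (ee n) * r ^ n <= Lambda n * r ^ n + unit1 n * r ^ n).
  { intros n. assert (0 <= r ^ n) by (apply pow_le; lra). split; [apply Rmult_le_pos; auto; apply Rabs_pos|].
    rewrite <- Rmult_plus_distr_r. apply Rmult_le_compat_r; auto. unfold ee.
    pose proof (Lambda_nonneg n). pose proof (unit1_le n). apply Rabs_le. lra. }
  split; [apply (ex_series_dom _ _ D), ex_series_plus'; auto|].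
  eapply Rle_trans; [apply (Series_le _ _ D), ex_series_plus'; auto|].
  rewrite Series_plus by auto. pose proof (Lambda_series_bound r Hr).
  assert (Series (fun n => unit1 n * r ^ n) <= / (1 - r)); [|lra].
  apply (ex_series_Rsum_bound (fun n => unit1 n * r ^ n)).
  - intros n. apply Rmult_le_pos; [apply unit1_le|apply pow_le; lra].
  - intros n. eapply Rle_trans; [|apply (Rsum_geom_le r n Hr)]. apply Rsum_le. intros k _.
    assert (0 <= r ^ k) by (apply pow_le; lra). unfold unit1. destruct (Nat.eqb k 0); lra.
Qed.

Lemma pser_ee_bound z : Cmod z < 1 -> Cmod (pser ee z) <= (2 + 6 * K) * / (1 - Cmod z).
Proof.
  intros Hz. destruct (ee_sum_bound (Cmod z)) as [E B]; [split; auto using Cmod_ge_0|].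
  eapply Rle_trans; [|apply B]. apply dom_bound; auto. intros n. apply pser_term. lra.
Qed.

Lemma cis_lipschitz a b : Cmod (cis b - cis a) <= 2 * Rabs (b - a).
Proof.
  assert (W : forall x y, x <= y -> Cmod (cis y - cis x) <= 2 * (y - x)).
  { intros x y Hxy. pose proof (C_MVT cis (fun t => (- sin t, cos t)) x y 1 Hxy) as M.
    rewrite Rmult_1_r in M. apply M.
    - intros t _. split; unfold cis; simpl; auto_derive; auto; ring.
    - intros t _. unfold Cmod; simpl. pose proof (sin2_cos2 t) as Q. unfold Rsqr in Q.
      replace (- sin t * (- sin t * 1) + cos t * (cos t * 1)) with 1 by lra. rewrite sqrt_1. lra. }
  destruct (Rle_dec a b) as [H|H].
  - rewrite Rabs_pos_eq by lra. auto.
  - rewrite Rabs_minus_sym, Rabs_pos_eq by lra. replace (cis b - cis a)%C with (- (cis a - cis b))%C by ring.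
    rewrite Cmod_opp. apply W. lra.
Qed.

(** Supplies the continuity along an arc that the intermediate value argument in [pser_ee_small]
    consumes. *)
Lemma pser_arc_lipschitz c r x : 0 <= r < 1 -> (forall n, Rabs (c n) <= INR n) ->
  exists L, 0 <= L /\ forall s s', Cmod (pser c (RtoC r * cis (s * x)) - pser c (RtoC r * cis (s' * x))) <= L * Rabs (s - s').
Proof.
  intros Hr Hc.
  assert (Cr : forall y, Cmod (RtoC r * cis y) = r) by (intros; rewrite Cmod_mult, Cmod_R, Cmod_cis, Rabs_pos_eq; lra).
  set (M := fun n => INR n ^ 2 * r ^ n).
  assert (EM : ex_series M) by (apply ex_series_n2; auto).
  assert (PM : forall n, 0 <= M n) by (intros; apply Rmult_le_pos; [apply pow2_ge_0|apply pow_le; lra]).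
  exists (2 * Rabs x * Series M). split.
  - pose proof (Rsum_le_Series M 0 PM EM) as Q. simpl in Q. pose proof (Rabs_pos x).
    apply Rmult_le_pos; [lra|auto].
  - intros s s'.
    assert (B : forall y n, Cmod (RtoC (c n) * (RtoC r * cis y) ^ n) <= INR n * r ^ n).
    { intros y n. rewrite <- (Cr y) at 2. apply pser_term. auto. }
    assert (X : ex_series (fun n => INR n * r ^ n)) by (apply ex_series_n; auto).
    replace (pser c (RtoC r * cis (s * x)) - pser c (RtoC r * cis (s' * x)))%C with
      (CS (fun n => RtoC (c n) * (RtoC r * cis (s * x)) ^ n + - (1) * (RtoC (c n) * (RtoC r * cis (s' * x)) ^ n)))%C.
    2:{ unfold pser. rewrite (CS_plus _ _ (fun n => INR n * r ^ n) (fun n => INR n * r ^ n)); auto.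
        - rewrite (CS_scal _ _ (fun n => INR n * r ^ n)); auto. ring.
        - intros n. rewrite Cmod_mult, Cmod_opp, Cmod_1, Rmult_1_l. auto. }
    replace (2 * Rabs x * Series M * Rabs (s - s')) with (Series (fun n => 2 * Rabs x * Rabs (s - s') * M n))
      by (rewrite Series_scal_l; ring).
    apply dom_bound; [|apply ex_series_scal'; auto].
    intros n.
    replace (RtoC (c n) * (RtoC r * cis (s * x)) ^ n + - (1) * (RtoC (c n) * (RtoC r * cis (s' * x)) ^ n))%C
      with (RtoC (c n) * RtoC r ^ n * (cis (INR n * (s * x)) - cis (INR n * (s' * x))))%C
      by (rewrite !Cpow_mult_l, !cis_pow; ring).
    rewrite !Cmod_mult, Cmod_pow, !Cmod_R, (Rabs_pos_eq r) by lra.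
    assert (L : Cmod (cis (INR n * (s * x)) - cis (INR n * (s' * x))) <= 2 * (INR n * Rabs x * Rabs (s - s'))).
    { eapply Rle_trans; [apply cis_lipschitz|]. apply Rmult_le_compat_l; [lra|].
      replace (INR n * (s * x) - INR n * (s' * x)) with (INR n * x * (s - s')) by ring.
      rewrite !Rabs_mult, (Rabs_pos_eq (INR n)) by apply pos_INR. lra. }
    unfold M. replace (2 * Rabs x * Rabs (s - s') * (INR n ^ 2 * r ^ n))
      with (INR n * r ^ n * (2 * (INR n * Rabs x * Rabs (s - s')))) by ring.
    apply Rmult_le_compat; auto using Cmod_ge_0.
    + apply Rmult_le_pos; [apply Rabs_pos|apply pow_le; lra].
    + apply Rmult_le_compat_r; auto. apply pow_le; lra.
Qed.

Lemma Cmod_lipschitz_continuous (f : R -> C) L : 0 <= L -> (forall s s', Cmod (f s - f s') <= L * Rabs (s - s')) ->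
  forall s, continuity_pt (fun s => Cmod (f s)) s.
Proof.
  intros HL H s. apply continuity_pt_locally. intros [e He].
  assert (P : 0 < e / (L + 1)) by (apply Rdiv_lt_0_compat; lra).
  exists (mkposreal _ P). intros y Hy. simpl in *.
  assert (Hy' : Rabs (y - s) < e / (L + 1)) by exact Hy.
  apply Rle_lt_trans with (L * Rabs (y - s)).
  - eapply Rle_trans; [|apply (H y s)]. pose proof (Cmod_sub_ge (f y) (f s)). pose proof (Cmod_sub_ge' (f y) (f s)).
    apply Rabs_le. lra.
  - apply Rle_lt_trans with (L * (e / (L + 1))); [apply Rmult_le_compat_l; lra|].
    apply Rmult_lt_reg_r with (L + 1); [lra|]. replace (L * (e / (L + 1)) * (L + 1)) with (L * e) by (field; lra). nra.
Qed.

Lemma Cmod_1_minus_cis r x : 0 <= r -> Cmod (1 - RtoC r * cis x) ^ 2 = 1 - 2 * r * cos x + r ^ 2.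
Proof.
  intros Hr. rewrite Cmod_sq. unfold cis; simpl. pose proof (sin2_cos2 x) as Q. unfold Rsqr in Q.
  transitivity (1 - 2 * r * cos x + r * r * (sin x * sin x + cos x * cos x)); [ring|rewrite Q; ring].
Qed.

(* [D (D + 2 m) = e] with [|e| < |m|^2] has a small and a large root; [F >= 0] selects the small one on the
   real axis, and it stays selected along the arc because [|D| = |m|] is impossible. *)
Lemma pser_ee_small r x : 0 < r < 1 -> Rabs x <= PI ->
  Cmod (1 - RtoC r * cis x) ^ 3 * (3 * K * (/ (1 - r)) ^ 3 * (exp (th * ln (1 - r)) + ka)) < r ^ 2 ->
  Cmod (pser ee (RtoC r * cis x)) <=
    Cmod (1 - RtoC r * cis x) ^ 2 * (3 * K * (/ (1 - r)) ^ 3 * (exp (th * ln (1 - r)) + ka)) / r.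
Proof.
  intros Hr Hx Hsm. set (S := 3 * K * (/ (1 - r)) ^ 3 * (exp (th * ln (1 - r)) + ka)) in *.
  set (z := fun s => (RtoC r * cis (s * x))%C).
  assert (Cr : forall s, Cmod (z s) = r) by (intros; unfold z; rewrite Cmod_mult, Cmod_R, Cmod_cis, Rabs_pos_eq; lra).
  assert (HS : 0 <= S).
  { unfold S. apply Rmult_le_pos; [apply Rmult_le_pos; [lra|]|pose proof (exp_pos (th * ln (1 - r))); lra].
    apply pow_le; left; apply Rinv_0_lt_compat; lra. }
  assert (N1 : forall s, 1 - r <= Cmod (1 - z s)).
  { intros s. pose proof (Cmod_sub_ge 1 (z s)) as T. rewrite Cmod_1, Cr in T. lra. }
  assert (NZ : forall s, (1 - z s)%C <> RtoC 0) by (intros; apply Cmod_gt_0; specialize (N1 s); lra).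
  (* The distance to 1 grows along the arc, so the smallness assumed at its end holds all the
     way. *)
  assert (Hmono : forall s, 0 <= s <= 1 -> Cmod (1 - z s) <= Cmod (1 - z 1)).
  { intros s Hs. apply pow_incr_le2. 1: apply Cmod_ge_0.
    unfold z. rewrite !Cmod_1_minus_cis by lra. rewrite Rmult_1_l.
    assert (cos x <= cos (s * x)); [|nra].
    rewrite <- (cos_abs x), <- (cos_abs (s * x)). rewrite Rabs_mult, (Rabs_pos_eq s) by lra.
    pose proof (Rabs_pos x). apply cos_decr_1; nra. }
  set (D := fun s => pser ee (z s)). set (m := fun s => pser unit1 (z s)).
  assert (Em : forall s, Cmod (m s) = r / Cmod (1 - z s)).
  { intros s. unfold m. rewrite Cpow_geom_unit by (rewrite Cr; lra). rewrite Cmod_div, Cr by auto. auto. }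
  assert (Pm : forall s, 0 < Cmod (m s)) by (intros; rewrite Em; apply Rdiv_lt_0_compat; [lra|specialize (N1 s); lra]).
  assert (EI : forall s, (D s * (D s + 2 * m s))%C = ((1 - z s) * pser gE (z s))%C).
  { intros s. apply (generating_identity (K * 2)); [rewrite Cr; lra|apply gE_poly]. }
  assert (Be : forall s, Cmod (D s) * Cmod (D s + 2 * m s) <= Cmod (1 - z s) * S).
  { intros s. rewrite <- Cmod_mult, EI, Cmod_mult. apply Rmult_le_compat_l; [apply Cmod_ge_0|].
    pose proof (gE_pser_bound (z s) ltac:(rewrite Cr; lra)) as B. rewrite Cr in B. exact B. }
  assert (Bm : forall s, 0 <= s <= 1 -> Cmod (D s) * Cmod (D s + 2 * m s) < Cmod (m s) ^ 2).
  { intros s Hs. eapply Rle_lt_trans; [apply Be|]. rewrite Em.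
    assert (P : 0 < Cmod (1 - z s)) by (specialize (N1 s); lra).
    apply Rmult_lt_reg_r with (Cmod (1 - z s) ^ 2); [apply pow_lt; auto|].
    replace ((r / Cmod (1 - z s)) ^ 2 * Cmod (1 - z s) ^ 2) with (r ^ 2) by (field; lra).
    eapply Rle_lt_trans; [|apply Hsm].
    replace (Cmod (1 - z s) * S * Cmod (1 - z s) ^ 2) with (Cmod (1 - z s) ^ 3 * S) by ring.
    apply Rmult_le_compat_r; auto. replace (RtoC r * cis x)%C with (z 1) by (unfold z; rewrite Rmult_1_l; auto).
    apply pow_incr. split; [apply Cmod_ge_0|auto]. }
  assert (Tri : forall s, 2 * Cmod (m s) - Cmod (D s) <= Cmod (D s + 2 * m s)).
  { intros s. pose proof (Cmod_sub_ge (2 * m s) (- D s)) as T. rewrite Cmod_opp, Cmod_mult, Cmod_R, Rabs_pos_eq in T by lra.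
    replace (2 * m s - - D s)%C with (D s + 2 * m s)%C in T by ring. lra. }
  set (q := fun s => Cmod (D s) - Cmod (m s)).
  assert (Nq : forall s, 0 <= s <= 1 -> q s <> 0).
  { intros s Hs E. unfold q in E. specialize (Bm s Hs). specialize (Tri s). specialize (Pm s).
    assert (E' : Cmod (D s) = Cmod (m s)) by lra. rewrite E' in *.
    assert (Cmod (m s) * Cmod (m s) <= Cmod (m s) * Cmod (D s + 2 * m s)) by (apply Rmult_le_compat_l; lra).
    simpl in Bm. lra. }
  assert (Q0 : q 0 < 0).
  { assert (Z0 : z 0 = RtoC r) by (unfold z; rewrite Rmult_0_l, cis_0; ring).
    destruct (pser_R Lambda r ltac:(lra) Lambda_le_INR) as [EF XF].
    destruct (pser_R unit1 r ltac:(lra) unit1_le) as [EU XU].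
    set (F := Series (fun n => Lambda n * r ^ n)) in *. set (m0 := Series (fun n => unit1 n * r ^ n)) in *.
    assert (D0 : D 0 = RtoC (F - m0)).
    { unfold D. rewrite Z0, pser_ee, EF, EU, RtoC_minus by (rewrite Cmod_R, Rabs_pos_eq; lra). auto. }
    assert (M0 : m 0 = RtoC m0) by (unfold m; rewrite Z0, EU; auto).
    assert (F0 : 0 <= F).
    { pose proof (Rsum_le_Series _ 0 (fun n => Rmult_le_pos _ _ (Lambda_nonneg n) (pow_le r n ltac:(lra))) XF) as T. exact T. }
    assert (P0 : 0 <= m0).
    { pose proof (Rsum_le_Series _ 0 (fun n => Rmult_le_pos _ _ (proj1 (unit1_le n)) (pow_le r n ltac:(lra))) XU) as T. exact T. }
    pose proof (Bm 0 ltac:(lra)) as B. pose proof (Nq 0 ltac:(lra)) as N0. pose proof (Pm 0) as P1. unfold q in *.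
    rewrite D0, M0 in *. rewrite <- RtoC_mult, <- RtoC_plus in B. rewrite !Cmod_R in *.
    rewrite (Rabs_pos_eq m0) in * by auto.
    replace (F - m0 + 2 * m0) with (F + m0) in B by ring. rewrite (Rabs_pos_eq (F + m0)) in B by lra.
    apply Rnot_le_lt. intros L. unfold Rabs in *. destruct (Rcase_abs (F - m0)); nra. }
  destruct (pser_arc_lipschitz ee r x ltac:(lra) ee_le) as [L1 [HL1 Lip1]].
  destruct (pser_arc_lipschitz unit1 r x ltac:(lra)) as [L2 [HL2 Lip2]].
  { intros n. rewrite Rabs_pos_eq; apply unit1_le. }
  assert (Q1 : q 1 < 0).
  { apply Rnot_le_lt. intros H. destruct (Req_dec (q 1) 0) as [E|E]; [apply (Nq 1); auto; lra|].
    destruct (Ranalysis5.IVT_interv q 0 1) as [s [Hs Es]]; try lra.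
    - intros s _. unfold q. apply continuity_pt_minus.
      + apply (Cmod_lipschitz_continuous D L1 HL1 Lip1).
      + apply (Cmod_lipschitz_continuous m L2 HL2 Lip2).
    - apply (Nq s); auto. }
  replace (RtoC r * cis x)%C with (z 1) by (unfold z; rewrite Rmult_1_l; auto).
  fold (D 1). unfold q in Q1. specialize (Tri 1). specialize (Be 1). specialize (Pm 1).
  assert (P : 0 < Cmod (1 - z 1)) by (specialize (N1 1); lra).
  (* On the small branch [|D + 2 m| >= |m|], so [|D|] is at most the right side of the identity
     divided by [|m|]. *)
  assert (X : Cmod (D 1) * Cmod (m 1) <= Cmod (1 - z 1) * S).
  { eapply Rle_trans; [|apply Be]. apply Rmult_le_compat_l; [apply Cmod_ge_0|lra]. }
  rewrite Em in X. apply Rmult_le_reg_r with (r / Cmod (1 - z 1)); [apply Rdiv_lt_0_compat; lra|].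
  eapply Rle_trans; [apply X|]. apply Req_le. field. lra.
Qed.

End Generating.

(** * Smoothed prime sums *)

(** A Gamma density up to normalization, with mode 1, standard deviation about [j^(-1/2)] and total
    mass [1 / j]. [bq] is the sum of [Lambda(n) - 1] smoothed by it around [n = 1 / tau]. *)
Definition kern (j : nat) (x : R) : R := exp (- (INR j * x)) * (INR j * x) ^ j / INR (fact j).
Definition bq (j : nat) (tau : R) : C := CS (fun n => RtoC (ee (S n) * kern j (INR (S n) * tau))).

Lemma rho_pow_lower j : (2 <= j)%nat -> / 9 <= (1 - / INR j) ^ j.
Proof.
  intros Hj. assert (P : 2 <= INR j) by (replace 2 with (INR 2) by auto; apply le_INR; auto).
  assert (E : exp (- (1 / (INR j - 1))) <= 1 - / INR j).
  { pose proof (exp_ineq1_le (1 / (INR j - 1))) as A. rewrite exp_Ropp.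
    assert (Q : 1 + 1 / (INR j - 1) = / (1 - / INR j)) by (field; lra). rewrite Q in A.
    apply Rinv_le_contravar in A; [rewrite Rinv_inv in A; auto|].
    apply Rinv_0_lt_compat. assert (/ INR j < 1) by (rewrite <- Rinv_1; apply Rinv_lt_contravar; lra). lra. }
  apply Rle_trans with (exp (- (1 / (INR j - 1))) ^ j).
  - rewrite exp_pow. apply Rle_trans with (exp (- (2))).
    + rewrite exp_Ropp. apply Rinv_le_contravar; [apply exp_pos|].
      replace 2 with (1 + 1) by ring. rewrite exp_plus. pose proof exp_le_3. pose proof (exp_pos 1). nra.
    + apply exp_le. apply Rmult_le_reg_r with (INR j - 1); [lra|].
      replace (INR j * - (1 / (INR j - 1)) * (INR j - 1)) with (- INR j) by (field; lra). lra.
  - apply pow_incr. split; [left; apply exp_pos|auto].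
Qed.

Lemma Cexp_pow z n : (Cexp z ^ n)%C = Cexp (RtoC (INR n) * z).
Proof.
  induction n; [simpl; rewrite Cmult_0_l, Cexp_0; auto|].
  rewrite Cpow_S, IHn, <- Cexp_plus, S_INR, RtoC_plus. f_equal. ring.
Qed.

Lemma Cexp_R x : Cexp (RtoC x) = RtoC (exp x).
Proof. unfold Cexp; simpl. rewrite cos_0, sin_0. apply injective_projections; simpl; ring. Qed.

(** [kern j (n tau)] is the coefficient of [ze^j] in [exp(- n j tau (1 - ze))], so [bq] is a
    coefficient of [pser ee] composed with an exponential. Extracting it on the circle of radius
    [1 - 1/j] keeps the argument of [pser] inside the unit disc and costs only
    [(1 - 1/j)^-j <= 9]. *)
Lemma bq_extract j tau H : (2 <= j)%nat -> 0 < tau ->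
  (forall ze, Cmod ze = 1 - / INR j -> Cmod (pser ee (Cexp (- (RtoC (INR j * tau) * (1 - ze))))) <= H) ->
  Cmod (bq j tau) <= 9 * H.
Proof.
  intros Hj Ht HH. set (y := INR j * tau) in *. set (rho := 1 - / INR j) in *.
  assert (P : 2 <= INR j) by (replace 2 with (INR 2) by auto; apply le_INR; auto).
  assert (Hy : 0 < y) by (unfold y; nra).
  assert (Ij : 0 < / INR j <= / 2) by (split; [apply Rinv_0_lt_compat; lra|apply Rinv_le_contravar; lra]).
  assert (Hrho : 1 / 2 <= rho < 1) by (unfold rho; lra).
  set (r := exp (- (y * (1 - rho)))).
  assert (Hr : 0 < r < 1) by (split; [apply exp_pos|rewrite <- exp_0; apply exp_increasing; nra]).
  set (A := fun N n => avg N (fun l => Cexp (RtoC (INR n * y) * (RtoC rho * rou N l)) * rouV N l ^ j)%C).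
  assert (BA : forall N n, (0 < N)%nat -> Cmod (A N n) <= exp (INR n * y * rho)).
  { intros N n HN. apply avg_bound; auto. intros l _.
    rewrite Cmod_mult, Cmod_pow, Cmod_rouV, pow1, Rmult_1_r, Cmod_exp. apply exp_le.
    eapply Rle_trans; [apply Re_le_Cmod'|]. rewrite !Cmod_mult, !Cmod_R, Cmod_rou, Rmult_1_r.
    pose proof (pos_INR n). rewrite !Rabs_pos_eq; nra. }
  assert (Dom : forall N n, (0 < N)%nat -> Cmod (RtoC (ee n * exp (- (INR n * y))) * A N n) <= INR n * r ^ n).
  { intros N n HN. rewrite Cmod_mult, Cmod_R, Rabs_mult, (Rabs_pos_eq (exp _)), Rmult_assoc by (left; apply exp_pos).
    apply Rmult_le_compat; [apply Rabs_pos| |apply ee_le|].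
    - apply Rmult_le_pos; [left; apply exp_pos|apply Cmod_ge_0].
    - unfold r. rewrite exp_pow. apply Rle_trans with (exp (- (INR n * y)) * exp (INR n * y * rho)).
      + apply Rmult_le_compat_l; [left; apply exp_pos|auto].
      + rewrite <- exp_plus. apply exp_le. lra. }
  assert (Ex : ex_series (fun n => INR n * r ^ n)) by (apply ex_series_n; lra).
  set (lim := CS (fun n => RtoC (ee n * exp (- (INR n * y))) * (expt (RtoC (INR n * y)) j * RtoC rho ^ j))%C).
  assert (L : Ccvg (fun N => CS (fun n => RtoC (ee n * exp (- (INR n * y))) * A (S N) n))%C lim).
  { apply (tannery _ _ (fun n => INR n * r ^ n)); auto.
    - intros N n. apply Dom; lia.
    - intros n. apply Ccvg_scal.
      apply -> (Ccvg_S (fun N => A N n)).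
      apply (coef_extract rho (fun w => Cexp (RtoC (INR n * y) * w)) (expt (RtoC (INR n * y))) j); [lra|].
      apply Ana_exp. lra. }
  assert (B : Cmod lim <= H).
  { apply (Ccvg_bound _ _ _ L). intros N.
    replace (CS (fun n => RtoC (ee n * exp (- (INR n * y))) * A (S N) n)%C)
      with (avg (S N) (fun l => pser ee (Cexp (- (RtoC y * (1 - RtoC rho * rou (S N) l)))) * rouV (S N) l ^ j)%C).
    - apply avg_bound; [lia|]. intros l _. rewrite Cmod_mult, Cmod_pow, Cmod_rouV, pow1, Rmult_1_r.
      apply HH. rewrite Cmod_mult, Cmod_R, Cmod_rou, Rabs_pos_eq; lra.
    - symmetry. unfold A, avg at 2.
      set (T := fun l n => (RtoC (ee n * exp (- (INR n * y))) *
         (Cexp (RtoC (INR n * y) * (RtoC rho * rou (S N) l)) * rouV (S N) l ^ j))%C).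
      assert (DT : forall l n, Cmod (T l n) <= INR n * r ^ n).
      { intros l n. unfold T.
        rewrite Cmod_mult, Cmod_R, Rabs_mult, (Rabs_pos_eq (exp _)), Rmult_assoc by (left; apply exp_pos).
        apply Rmult_le_compat; [apply Rabs_pos| |apply ee_le|].
        - apply Rmult_le_pos; [left; apply exp_pos|apply Cmod_ge_0].
        - rewrite Cmod_mult, Cmod_pow, Cmod_rouV, pow1, Rmult_1_r, Cmod_exp, <- exp_plus.
          unfold r. rewrite exp_pow. apply exp_le.
          pose proof (Re_le_Cmod' (RtoC (INR n * y) * (RtoC rho * rou (S N) l))%C) as Q.
          rewrite !Cmod_mult, !Cmod_R, Cmod_rou, Rmult_1_r in Q.
          pose proof (pos_INR n). rewrite !Rabs_pos_eq in Q by nra. lra. }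
      transitivity (RtoC (/ INR (S N)) * Csum (fun l => CS (T l)) (S N))%C.
      + rewrite <- (CS_Csum T (fun _ n => INR n * r ^ n)); auto.
        rewrite <- (CS_scal _ _ (fun n => INR (S N) * (INR n * r ^ n))).
        * apply CS_ext. intros n. unfold T, avg. rewrite Csum_scal. ring.
        * intros n. rewrite <- Rsum_const. apply Cmod_Csum_le. auto.
        * apply ex_series_scal'; auto.
      + f_equal. apply Csum_ext. intros l _. unfold pser, T. rewrite (Cmult_comm (CS _)).
        rewrite <- (CS_scal _ _ (fun n => INR n * r ^ n)); auto.
        * apply CS_ext. intros n. rewrite Cexp_pow.
          replace (RtoC (INR n) * - (RtoC y * (1 - RtoC rho * rou (S N) l)))%C
            with (RtoC (- (INR n * y)) + RtoC (INR n * y) * (RtoC rho * rou (S N) l))%C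
            by (rewrite RtoC_opp, RtoC_mult; ring).
          rewrite Cexp_plus, Cexp_R, (RtoC_mult (ee n)). ring.
        * intros n. specialize (DT l n). unfold T in DT. eapply Rle_trans; [|apply DT]. apply Req_le.
          rewrite Cexp_pow.
          replace (RtoC (INR n) * - (RtoC y * (1 - RtoC rho * rou (S N) l)))%C
            with (RtoC (- (INR n * y)) + RtoC (INR n * y) * (RtoC rho * rou (S N) l))%C
            by (rewrite RtoC_opp, RtoC_mult; ring).
          rewrite Cexp_plus, Cexp_R, (RtoC_mult (ee n)), !Cmod_mult, Cmod_pow, Cmod_rouV, pow1. ring. }
  assert (E : lim = (RtoC (rho ^ j) * bq j tau)%C).
  { assert (BT : forall n, Cmod (RtoC (ee n * exp (- (INR n * y))) * (expt (RtoC (INR n * y)) j * RtoC rho ^ j))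
       <= INR n * r ^ n).
    { intros n. apply (Ccvg_bound (fun N => RtoC (ee n * exp (- (INR n * y))) * A (S N) n)%C).
      - apply Ccvg_scal. apply -> (Ccvg_S (fun N => A N n)).
        apply (coef_extract rho (fun w => Cexp (RtoC (INR n * y) * w)) (expt (RtoC (INR n * y))) j); [lra|].
        apply Ana_exp. lra.
      - intros N. apply Dom; lia. }
    assert (R0 : rho ^ j <> 0) by (apply pow_nonzero; lra).
    unfold lim. rewrite (CS_S_l _ _ BT Ex).
    replace (ee 0) with 0 by (unfold ee, unit1; rewrite Lambda_0; simpl; ring).
    rewrite Rmult_0_l, Cmult_0_l, Cplus_0_l. unfold bq.
    rewrite <- (CS_scal _ _ (fun n => / rho ^ j * (INR (S n) * r ^ S n))).
    - apply CS_ext. intros n. rewrite expt_RtoC. unfold kern.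
      replace (INR j * (INR (S n) * tau)) with (INR (S n) * y) by (unfold y; ring).
      rewrite <- RtoC_pow, <- !RtoC_mult. f_equal. field. apply INR_fact_neq_0.
    - intros n. specialize (BT (S n)). apply Rmult_le_reg_l with (rho ^ j); [apply pow_lt; lra|].
      rewrite <- (Rabs_pos_eq (rho ^ j)) at 1 by (apply pow_le; lra). rewrite <- Cmod_R, <- Cmod_mult, <- Rmult_assoc, Rinv_r by auto.
      rewrite Rmult_1_l. eapply Rle_trans; [|apply BT]. apply Req_le. f_equal. rewrite expt_RtoC. unfold kern.
      replace (INR j * (INR (S n) * tau)) with (INR (S n) * y) by (unfold y; ring).
      rewrite <- RtoC_pow, <- !RtoC_mult. f_equal. field. apply INR_fact_neq_0.
    - apply ex_series_scal'. apply -> (ex_series_S (fun n => INR n * r ^ n)); auto. }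
  rewrite E, Cmod_mult, Cmod_R, Rabs_pos_eq in B by (apply pow_le; lra).
  pose proof (rho_pow_lower j Hj) as Q. fold rho in Q. pose proof (Cmod_ge_0 (bq j tau)). nra.
Qed.

Lemma one_minus_exp_lower x : 0 <= x <= 1 -> x / 2 <= 1 - exp (- x).
Proof.
  intros Hx. rewrite exp_Ropp. pose proof (exp_ineq1_le x) as E. pose proof (exp_pos x).
  assert (/ exp x <= / (1 + x)) by (apply Rinv_le_contravar; lra).
  assert (/ (1 + x) <= 1 - x / 2); [|lra]. apply Rmult_le_reg_r with (1 + x); [lra|]. rewrite Rinv_l by lra. nra.
Qed.

Lemma one_minus_exp_upper x : 1 - exp (- x) <= x.
Proof. pose proof (exp_ineq1_le (- x)). lra. Qed.

Section Bounds.

Variables (K th ka : R).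
Hypothesis (HE : Ebound K th ka) (Hth : 0 <= th <= 1) (Hka : 0 <= ka <= 1) (HK : 0 <= K).

(** On the extraction circle [Re (1 - ze) >= 1/j], hence [|z| <= e^-tau], and the Chebyshev bound
    for [pser ee] applies. *)
Lemma bq_trivial j tau : (2 <= j)%nat -> 0 < tau <= 1 -> Cmod (bq j tau) * tau <= 18 * (2 + 6 * K).
Proof.
  intros Hj Ht. assert (P : 2 <= INR j) by (replace 2 with (INR 2) by auto; apply le_INR; auto).
  assert (B : Cmod (bq j tau) <= 9 * ((2 + 6 * K) * (2 / tau))).
  { apply bq_extract; auto; [lra|]. intros ze Hze.
    assert (Rz : Re ze <= 1 - / INR j) by (rewrite <- Hze; apply Re_le_Cmod').
    set (z := Cexp (- (RtoC (INR j * tau) * (1 - ze)))).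
    assert (Cz : Cmod z <= exp (- tau)).
    { unfold z. rewrite Cmod_exp. apply exp_le.
      replace (Re (- (RtoC (INR j * tau) * (1 - ze)))%C) with (- (INR j * tau * (1 - Re ze))) by (destruct ze; simpl; ring).
      assert (INR j * tau * / INR j <= INR j * tau * (1 - Re ze)) by (apply Rmult_le_compat_l; nra).
      replace (INR j * tau * / INR j) with tau in H by (field; lra). lra. }
    pose proof (one_minus_exp_lower tau ltac:(lra)) as L.
    eapply Rle_trans; [apply (pser_ee_bound K th ka); auto; lra|].
    apply Rmult_le_compat_l; [lra|]. replace (2 / tau) with (/ (tau / 2)) by (field; lra).
    apply Rinv_le_contravar; lra. }
  apply Rle_trans with (9 * ((2 + 6 * K) * (2 / tau)) * tau).
  - apply Rmult_le_compat_r; lra.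
  - apply Req_le. field. lra.
Qed.

(** With [y = j tau] and [q = 1 - Re ze] between [1/j] and 2, the point [z] satisfies
    [|1 - z|^2 <= 8 y^2 q] and [1 - |z| >= y q / 2]. [pser_ee_small] then gives [384 K Y / (y q^2)],
    where [Y] is the saving; the worst case is [q = 1/j], and multiplying by [tau = y / j] leaves
    one factor [j]. *)
Lemma bq_small j tau : (2 <= j)%nat -> 0 < tau -> INR j * tau <= 1 / 4 ->
  (2400 * K) ^ 2 * INR j ^ 3 * (exp (th * ln (2 * (INR j * tau))) + ka) ^ 2 < 1 ->
  Cmod (bq j tau) * tau <= 9 * 400 * K * INR j * (exp (th * ln (2 * (INR j * tau))) + ka).
Proof.
  intros Hj Ht Hy Hsm. assert (P : 2 <= INR j) by (replace 2 with (INR 2) by auto; apply le_INR; auto).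
  set (y := INR j * tau) in *. assert (Hy0 : 0 < y) by (unfold y; nra).
  set (Y := exp (th * ln (2 * y)) + ka) in *.
  assert (HY : 0 < Y) by (unfold Y; pose proof (exp_pos (th * ln (2 * y))); lra).
  assert (B : Cmod (bq j tau) <= 9 * (400 * K * (INR j ^ 2 / y) * Y)).
  { apply bq_extract; auto. intros ze Hze.
    assert (Ij : 0 < / INR j <= / 2) by (split; [apply Rinv_0_lt_compat; lra|apply Rinv_le_contravar; lra]).
    pose proof (re_le_Cmod ze) as Rz. rewrite Hze in Rz. apply Rabs_le_between in Rz.
    pose proof (Im_le_Cmod ze) as Iz. rewrite Hze in Iz.
    pose proof (Cmod_sq ze) as Sz. rewrite Hze in Sz.
    set (q := 1 - Re ze). assert (Hq : / INR j <= q <= 2) by (unfold q; lra).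
    set (r := exp (- (y * q))). set (x := y * Im ze).
    assert (Ez : Cexp (- (RtoC y * (1 - ze))) = (RtoC r * cis x)%C).
    { unfold Cexp, r, x, q, cis. destruct ze as [u v]; simpl.
      replace (- (y * (1 + - u) - 0 * (0 + - v))) with (- (y * (1 - u))) by ring.
      replace (- (y * (0 + - v) + 0 * (1 + - u))) with (y * v) by ring.
      apply injective_projections; simpl; ring. }
    fold y. rewrite Ez.
    assert (Hyq : 0 < y * q <= 1 / 2) by nra.
    assert (Hr1 : r < 1) by (unfold r; rewrite <- exp_0; apply exp_increasing; lra).
    assert (Hr2 : 1 / 2 <= r) by (unfold r; pose proof (exp_ineq1_le (- (y * q))); lra).
    pose proof (one_minus_exp_lower (y * q) ltac:(lra)) as L1. pose proof (one_minus_exp_upper (y * q)) as L2.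
    fold r in L1, L2.
    assert (Hx : Rabs x <= y) by (unfold x; rewrite Rabs_mult, (Rabs_pos_eq y) by lra; nra).
    assert (Hx2 : x ^ 2 <= 2 * (y ^ 2 * q)).
    { unfold x. rewrite Rpow_mult_distr. assert (Im ze ^ 2 <= 2 * q); [|pose proof (pow2_ge_0 y); nra].
      unfold q. assert (Im ze ^ 2 = (1 - / INR j) ^ 2 - Re ze ^ 2) by lra. simpl in *. nra. }
    assert (HW : Cmod (1 - RtoC r * cis x) ^ 2 <= 8 * (y ^ 2 * q)).
    { rewrite Cmod_1_minus_cis by lra.
      assert (C2 : 1 - cos x <= x ^ 2).
      { pose proof (cis_lipschitz 0 (x / 2)) as T. pose proof (Im_le_Cmod (cis (x / 2) - cis 0)) as T2.
        unfold cis in T2; simpl in T2. rewrite sin_0, Ropp_0, Rplus_0_r in T2.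
        replace x with (2 * (x / 2)) at 1 by field. rewrite cos_2a_sin.
        rewrite Rminus_0_r in T. fold (cis (x / 2)) in T2.
        assert (S2 : sin (x / 2) ^ 2 <= x ^ 2 / 4 * 2).
        { assert (Hs : Rabs (sin (x / 2)) <= Rabs (x / 2)).
          { clear. destruct (Rle_dec 0 x) as [H|H].
            - destruct (Req_dec x 0) as [->|N]; [replace (0 / 2) with 0 by field; rewrite sin_0; lra|].
              pose proof (sin_lt_x (x / 2) ltac:(lra)). pose proof (SIN_bound (x / 2)).
              rewrite (Rabs_pos_eq (x / 2)) by lra. apply Rabs_le. split; [|lra].
              destruct (Rle_dec (x / 2) PI) as [Hp|Hp]; [pose proof (sin_ge_0 (x / 2) ltac:(lra) Hp); lra|].
              pose proof PI2_1. lra.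
            - pose proof (sin_lt_x (- (x / 2)) ltac:(lra)) as Q. rewrite sin_neg in Q. pose proof (SIN_bound (x / 2)).
              rewrite (Rabs_left (x / 2)) by lra. apply Rabs_le. split; [lra|].
              destruct (Rle_dec (- (x / 2)) PI) as [Hp|Hp];
                [pose proof (sin_ge_0 (- (x / 2)) ltac:(lra) Hp) as Z; rewrite sin_neg in Z; lra|].
              pose proof PI2_1. lra. }
          rewrite <- (pow2_abs (sin (x / 2))). apply Rle_trans with (Rabs (x / 2) ^ 2).
          - apply pow_incr. split; [apply Rabs_pos|auto].
          - rewrite pow2_abs. pose proof (pow2_ge_0 x). simpl in *. lra. }
        simpl in *. lra. }
      pose proof (pow2_ge_0 y). assert (0 <= y ^ 2 * q) by nra.
      assert ((1 - r) ^ 2 <= (y * q) ^ 2) by (apply pow_incr; lra).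
      assert ((y * q) ^ 2 <= 2 * (y ^ 2 * q)) by (simpl in *; nra).
      assert (2 * r * (1 - cos x) <= 2 * x ^ 2) by (pose proof (COS_bound x); simpl in *; nra).
      simpl in *. nra. }
    set (W := Cmod (1 - RtoC r * cis x)) in *. assert (HW0 : 0 <= W) by apply Cmod_ge_0.
    set (X := / (1 - r)). assert (HX : 0 < X <= 2 * / (y * q)).
    { unfold X. split; [apply Rinv_0_lt_compat; lra|]. replace (2 * / (y * q)) with (/ (y * q / 2)) by (field; nra).
      apply Rinv_le_contravar; lra. }
    set (Sx := 3 * K * X ^ 3 * (exp (th * ln (1 - r)) + ka)).
    assert (HSx : 0 <= Sx <= 24 * K * (/ (y * q)) ^ 3 * Y).
    { assert (E1 : exp (th * ln (1 - r)) + ka <= Y).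
      { unfold Y. apply Rplus_le_compat_r. apply exp_le. apply Rmult_le_compat_l; [lra|]. apply ln_le'; nra. }
      assert (0 < exp (th * ln (1 - r))) by apply exp_pos.
      assert (X3 : 0 <= X ^ 3 <= (2 * / (y * q)) ^ 3) by (split; [apply pow_le; lra|apply pow_incr; lra]).
      unfold Sx. split.
      - apply Rmult_le_pos; [apply Rmult_le_pos|]; lra.
      - replace (24 * K * (/ (y * q)) ^ 3 * Y) with (3 * K * (2 * / (y * q)) ^ 3 * Y) by ring.
        apply Rmult_le_compat; [apply Rmult_le_pos; lra|lra| |auto]. apply Rmult_le_compat_l; lra. }
    assert (Iq : 0 < / q <= INR j).
    { split; [apply Rinv_0_lt_compat; lra|]. rewrite <- (Rinv_inv (INR j)). apply Rinv_le_contravar; lra. }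
    assert (q0 : 0 < q) by lra.
    eapply Rle_trans; [apply (pser_ee_small K th ka); auto|].
    - lra.
    - pose proof PI2_1. lra.
    - fold W X Sx. apply (Rlt_le_trans _ (/ 4)); [|simpl; nra].
      apply Rnot_le_lt. intros C.
      (* The available bound is for [W^2], so the condition on [W^3] is checked after squaring; this
         is the source of [j^3] and of the squares in the hypothesis. *)
      assert (C2 : / 16 <= (W ^ 3 * Sx) ^ 2).
      { replace (/ 16) with ((/ 4) ^ 2) by field. apply pow_incr. lra. }
      assert (U : (W ^ 3 * Sx) ^ 2 <= (8 * (y ^ 2 * q)) ^ 3 * (24 * K * (/ (y * q)) ^ 3 * Y) ^ 2).
      { replace ((W ^ 3 * Sx) ^ 2) with ((W ^ 2) ^ 3 * Sx ^ 2) by ring.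
        apply Rmult_le_compat; [apply pow_le, pow_le; auto|apply pow2_ge_0| |apply pow_incr; lra].
        apply pow_incr. split; [apply pow2_ge_0|auto]. }
      replace ((8 * (y ^ 2 * q)) ^ 3 * (24 * K * (/ (y * q)) ^ 3 * Y) ^ 2)
        with (512 * 576 * K ^ 2 * Y ^ 2 * (/ q) ^ 3) in U by (field; lra).
      assert (U2 : 512 * 576 * K ^ 2 * Y ^ 2 * (/ q) ^ 3 <= 512 * 576 * K ^ 2 * Y ^ 2 * INR j ^ 3).
      { apply Rmult_le_compat_l; [|apply pow_incr; lra].
        pose proof (pow2_ge_0 K). pose proof (pow2_ge_0 Y). nra. }
      replace ((2400 * K) ^ 2 * INR j ^ 3 * Y ^ 2) with (5760000 * (K ^ 2 * Y ^ 2 * INR j ^ 3)) in Hsm by ring.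
      replace (512 * 576 * K ^ 2 * Y ^ 2 * INR j ^ 3) with (294912 * (K ^ 2 * Y ^ 2 * INR j ^ 3)) in U2 by ring.
      lra.
    - fold W X Sx.
      apply Rle_trans with (8 * (y ^ 2 * q) * (24 * K * (/ (y * q)) ^ 3 * Y) * 2).
      + unfold Rdiv. apply Rmult_le_compat; [apply Rmult_le_pos; [apply pow2_ge_0|lra]|left; apply Rinv_0_lt_compat; lra| |].
        * apply Rmult_le_compat; [apply pow2_ge_0|lra|auto|lra].
        * replace 2 with (/ (1 / 2)) by field. apply Rinv_le_contravar; lra.
      + replace (8 * (y ^ 2 * q) * (24 * K * (/ (y * q)) ^ 3 * Y) * 2) with (384 * (K * Y * / y * (/ q) ^ 2)) by (field; lra).
        replace (400 * K * (INR j ^ 2 / y) * Y) with (400 * (K * Y * / y * INR j ^ 2)) by (field; lra).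
        assert (A0 : 0 <= K * Y * / y) by (apply Rmult_le_pos; [apply Rmult_le_pos; lra|left; apply Rinv_0_lt_compat; auto]).
        assert (A1 : (/ q) ^ 2 <= INR j ^ 2) by (apply pow_incr; lra).
        assert (A2 : 0 <= (/ q) ^ 2) by apply pow2_ge_0.
        assert (K * Y * / y * (/ q) ^ 2 <= K * Y * / y * INR j ^ 2) by (apply Rmult_le_compat_l; auto).
        assert (0 <= K * Y * / y * (/ q) ^ 2) by (apply Rmult_le_pos; auto). lra. }
  apply Rle_trans with (9 * (400 * K * (INR j ^ 2 / y) * Y) * tau).
  - apply Rmult_le_compat_r; lra.
  - apply Req_le. unfold y. field. lra.
Qed.

End Bounds.

(** * Pointwise bounds for the kernel *)

Lemma kern_le_base j x : 0 < x -> 0 <= kern j x <= (x * exp (1 - x)) ^ j.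
Proof.
  intros Hx. assert (Q : 0 < INR (fact j)) by apply INR_fact_lt_0. pose proof (pos_INR j). unfold kern. split.
  { apply Rdiv_le_0_compat; auto. apply Rmult_le_pos; [left; apply exp_pos|apply pow_le; nra]. }
  rewrite !Rpow_mult_distr, exp_pow. pose proof (pow_n_fact j) as F.
  replace (exp (INR j * (1 - x))) with (exp (INR j) * exp (- (INR j * x))) by (rewrite <- exp_plus; f_equal; ring).
  replace (exp (- (INR j * x)) * (INR j ^ j * x ^ j) / INR (fact j))
    with ((INR j ^ j / INR (fact j)) * (x ^ j * exp (- (INR j * x)))) by (field; lra).
  replace (x ^ j * (exp (INR j) * exp (- (INR j * x)))) with (exp (INR j) * (x ^ j * exp (- (INR j * x)))) by ring.
  apply Rmult_le_compat_r; auto. apply Rmult_le_pos; [apply pow_le; lra|left; apply exp_pos].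
Qed.

Lemma x_exp_le_1 x : 0 < x -> 0 <= x * exp (1 - x) <= 1.
Proof.
  intros Hx. assert (Ev : exp (1 - x) = / exp (x - 1)) by (rewrite <- exp_Ropp; f_equal; ring).
  rewrite Ev. pose proof (exp_ineq1_le (x - 1)). pose proof (exp_pos (x - 1)). split.
  - apply Rmult_le_pos; [lra|left; apply Rinv_0_lt_compat; auto].
  - apply Rmult_le_reg_r with (exp (x - 1)); auto. rewrite Rmult_assoc, Rinv_l by lra. lra.
Qed.

(** [x e^(1-x) <= 2 / x] is used for six factors, and the other [j - 6] are at most 1. Decay of
    order 6 serves all sums over [n] and all integrals over large [x] that follow. *)
Lemma kern_le_pow j x : (6 <= j)%nat -> 1 <= x -> 0 <= kern j x <= 64 * (/ x) ^ 6.
Proof.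
  intros Hj Hx.
  assert (P : 6 <= INR j) by (replace 6 with (INR 6) by (simpl; ring); apply le_INR; auto).
  split; [apply kern_le_base; lra|].
  pose proof (proj2 (kern_le_base j x ltac:(lra))) as U.
  set (v := x * exp (1 - x)) in *.
  assert (Ev : exp (1 - x) = / exp (x - 1)) by (rewrite <- exp_Ropp; f_equal; ring).
  assert (V1 : 0 <= v <= 1) by (apply x_exp_le_1; lra).
  assert (V2 : v <= 2 * / x).
  { unfold v. rewrite Ev. pose proof (exp_pos (x - 1)).
    assert (E2 : exp (x - 1) = exp ((x - 1) / 2) * exp ((x - 1) / 2)) by (rewrite <- exp_plus; f_equal; field).
    pose proof (exp_ineq1_le ((x - 1) / 2)) as E3.
    assert (E4 : exp ((x - 1) / 2) * exp ((x - 1) / 2) >= (1 + (x - 1) / 2 + ((x - 1) / 2) ^ 2 / 2) ^ 2 ).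
    { assert (T : 1 + (x - 1) / 2 + ((x - 1) / 2) ^ 2 / 2 <= exp ((x - 1) / 2)).
      { pose proof (Rsum_le_Series (fun k => ((x - 1) / 2) ^ k / INR (fact k)) 3) as S3. rewrite Series_exp in S3.
        simpl in S3. simpl. eapply Rle_trans; [|apply S3].
        - apply Req_le. field.
        - intros n. apply Rdiv_le_0_compat; [apply pow_le; lra|apply INR_fact_lt_0].
        - apply ex_series_exp. }
      assert (0 <= ((x - 1) / 2) ^ 2) by apply pow2_ge_0. simpl. nra. }
    apply Rmult_le_reg_r with (exp (x - 1) * x); [nra|].
    replace (x * / exp (x - 1) * (exp (x - 1) * x)) with (x * x) by (field; lra).
    replace (2 * / x * (exp (x - 1) * x)) with (2 * exp (x - 1)) by (field; lra). rewrite E2.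
    set (w := (x - 1) / 2) in *. assert (Hw : x = 1 + 2 * w) by (unfold w; field). rewrite Hw.
    assert (0 <= w) by (unfold w; lra). simpl in E4.
    assert ((1 + 2 * w) * (1 + 2 * w) <= 2 * ((1 + w + w * (w * 1) / 2) * ((1 + w + w * (w * 1) / 2) * 1))).
    { assert (0 <= w * w * w) by (apply Rmult_le_pos; [nra|auto]). assert (0 <= w * w * w * w) by (apply Rmult_le_pos; auto). nra. }
    lra. }
  apply Rle_trans with (v ^ j); [exact U|]. replace j with (6 + (j - 6))%nat by lia. rewrite pow_add.
  assert (v ^ (j - 6) <= 1) by (rewrite <- (pow1 (j - 6)); apply pow_incr; auto).
  assert (0 <= v ^ (j - 6)) by (apply pow_le; lra).
  assert (v ^ 6 <= (2 * / x) ^ 6) by (apply pow_incr; lra).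
  assert (0 <= v ^ 6) by (apply pow_le; lra).
  assert (0 <= (/ x) ^ 6) by (apply pow_le; left; apply Rinv_0_lt_compat; lra).
  rewrite Rpow_mult_distr in H1. assert (2 ^ 6 <= 64) by (simpl; lra).
  assert (2 ^ 6 * (/ x) ^ 6 <= 64 * (/ x) ^ 6) by (apply Rmult_le_compat_r; auto). nra.
Qed.

Lemma kern_le_pow' j x : (6 <= j)%nat -> 0 < x -> 0 <= kern j x <= 64 * (/ x) ^ 6.
Proof.
  intros Hj Hx. destruct (Rle_dec 1 x); [apply kern_le_pow; auto|].
  destruct (kern_le_base j x Hx) as [A B]. split; auto. eapply Rle_trans; [apply B|].
  apply Rle_trans with (1 ^ j); [apply pow_incr, x_exp_le_1; auto|]. rewrite pow1.
  assert (1 <= / x) by (rewrite <- Rinv_1; apply Rinv_le_contravar; lra).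
  assert (1 <= (/ x) ^ 6) by (apply pow_R1_Rle; auto). lra.
Qed.

(** * Mellin-type integrals *)

Ltac Rring := match goal with |- @eq _ ?a ?b => change (@eq R a b) end; ring.

Definition contpos (h : R -> R) : Prop := forall x, 0 < x -> continuous h x.

Lemma contpos_derive h : (forall x, 0 < x -> ex_derive h x) -> contpos h.
Proof. intros H x Hx. apply (@ex_derive_continuous R_AbsRing R_NormedModule). auto. Qed.

Lemma contpos_mult f g : contpos f -> contpos g -> contpos (fun x => f x * g x).
Proof. intros Hf Hg x Hx. apply (continuous_mult f g); auto. Qed.

Lemma contpos_plus f g : contpos f -> contpos g -> contpos (fun x => f x + g x).
Proof. intros Hf Hg x Hx. apply (continuous_plus f g); auto. Qed.

Lemma contpos_const c : contpos (fun _ => c).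
Proof. intros x _. apply continuous_const. Qed.

Lemma contpos_Rsum (f : nat -> R -> R) N : (forall n, contpos (f n)) -> contpos (fun x => Rsum (fun n => f n x) N).
Proof. intros H. induction N; simpl; [apply contpos_const|]. apply contpos_plus; auto. Qed.

Lemma contpos_scale f c : 0 < c -> contpos f -> contpos (fun x => f (c * x)).
Proof.
  intros Hc Hf x Hx. apply (continuous_comp (fun x => c * x) f).
  - apply (@ex_derive_continuous R_AbsRing R_NormedModule). auto_derive. auto.
  - apply Hf. nra.
Qed.

Lemma contpos_RInt h al be : contpos h -> 0 < al <= be -> ex_RInt h al be.
Proof.
  intros H Hab. apply (@ex_RInt_continuous R_CompleteNormedModule). intros z Hz.
  rewrite Rmin_left, Rmax_right in Hz by lra. apply H. lra.
Qed.

Lemma RInt_scal_pos c g al be : contpos g -> 0 < al <= be -> RInt (fun x => c * g x) al be = c * RInt g al be.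
Proof. intros Hg Hab. exact (@RInt_scal R_CompleteNormedModule g al be c (contpos_RInt _ _ _ Hg Hab)). Qed.

Lemma RInt_plus_pos f g al be : contpos f -> contpos g -> 0 < al <= be ->
  RInt (fun x => f x + g x) al be = RInt f al be + RInt g al be.
Proof.
  intros Hf Hg Hab.
  exact (@RInt_plus R_CompleteNormedModule f g al be (contpos_RInt _ _ _ Hf Hab) (contpos_RInt _ _ _ Hg Hab)).
Qed.

Definition tcos (t : R) (h : R -> R) (x : R) : R := h x * cos (t * ln x).
Definition tsin (t : R) (h : R -> R) (x : R) : R := h x * sin (t * ln x).

Lemma contpos_cos t h : contpos h -> contpos (tcos t h).
Proof. intros H. apply contpos_mult; auto. apply contpos_derive. intros x Hx. auto_derive. auto. Qed.

Lemma contpos_sin t h : contpos h -> contpos (tsin t h).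
Proof. intros H. apply contpos_mult; auto. apply contpos_derive. intros x Hx. auto_derive. auto. Qed.

(** The integral of [h(x) x^(i t)] over a compact interval; improper integrals occur only as limits
    of these. *)
Definition CI (t : R) (h : R -> R) (al be : R) : C := (RInt (tcos t h) al be, RInt (tsin t h) al be).

(** The majorant comes with an explicit antiderivative [Gp], so its integral is never computed
    otherwise, and estimating the norm of the pair at once keeps the constant 1. *)
Lemma CI_bound t h g Gp al be : contpos h -> contpos g -> 0 < al <= be ->
  (forall x, al <= x <= be -> Rabs (h x) <= g x) ->
  (forall x, al <= x <= be -> is_derive Gp x (g x)) ->
  Cmod (CI t h al be) <= Gp be - Gp al.
Proof.
  intros Hh Hg Hab Hle HG.
  assert (I : is_RInt (V := prod_NormedModule R_AbsRing R_NormedModule R_NormedModule)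
    (fun x => (tcos t h x, tsin t h x)) al be (CI t h al be)).
  { apply (is_RInt_fct_extend_pair (U := R_NormedModule) (V := R_NormedModule)); simpl; apply (@RInt_correct R_CompleteNormedModule);
      apply contpos_RInt; auto; [apply contpos_cos|apply contpos_sin]; auto. }
  assert (J : is_RInt g al be (Gp be - Gp al)).
  { apply (is_RInt_derive Gp g); intros x Hx; rewrite Rmin_left, Rmax_right in Hx by lra; auto. apply Hg. lra. }
  assert (Nx : forall x, al <= x <= be -> norm ((tcos t h x, tsin t h x) : prod_NormedModule R_AbsRing R_NormedModule R_NormedModule) <= g x).
  { intros x Hx. change (sqrt (Rabs (tcos t h x) ^ 2 + Rabs (tsin t h x) ^ 2) <= g x).
    rewrite !pow2_abs. unfold tcos, tsin.
    replace ((h x * cos (t * ln x)) ^ 2 + (h x * sin (t * ln x)) ^ 2) with (Rsqr (h x)).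
    - rewrite sqrt_Rsqr_abs. auto.
    - pose proof (sin2_cos2 (t * ln x)) as Q. unfold Rsqr in *.
      transitivity (h x * h x * (sin (t * ln x) * sin (t * ln x) + cos (t * ln x) * cos (t * ln x))); [rewrite Q; ring|ring]. }
  pose proof (norm_RInt_le _ g al be _ _ (proj2 Hab) Nx I J) as N2.
  change (sqrt (Rabs (RInt (tcos t h) al be) ^ 2 + Rabs (RInt (tsin t h) al be) ^ 2) <= Gp be - Gp al) in N2.
  rewrite !pow2_abs in N2. exact N2.
Qed.

Lemma CI_ext t h g al be : 0 < al <= be -> (forall x, al < x < be -> h x = g x) -> CI t h al be = CI t g al be.
Proof.
  intros Hab E. unfold CI. f_equal; apply RInt_ext; intros x Hx; rewrite Rmin_left, Rmax_right in Hx by lra;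
    unfold tcos, tsin; rewrite E; auto.
Qed.

Lemma CI_plus t f g al be : contpos f -> contpos g -> 0 < al <= be ->
  CI t (fun x => f x + g x) al be = (CI t f al be + CI t g al be)%C.
Proof.
  intros Hf Hg Hab. unfold CI. apply injective_projections; simpl.
  - rewrite <- (@RInt_plus R_CompleteNormedModule); [|apply contpos_RInt; auto using contpos_cos|apply contpos_RInt; auto using contpos_cos].
    apply RInt_ext. intros x _. unfold tcos. apply Rmult_plus_distr_r.
  - rewrite <- (@RInt_plus R_CompleteNormedModule); [|apply contpos_RInt; auto using contpos_sin|apply contpos_RInt; auto using contpos_sin].
    apply RInt_ext. intros x _. unfold tsin. apply Rmult_plus_distr_r.
Qed.

Lemma CI_scal t c f al be : contpos f -> 0 < al <= be -> CI t (fun x => c * f x) al be = (RtoC c * CI t f al be)%C.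
Proof.
  intros Hf Hab. unfold CI.
  assert (S : forall g, contpos g -> RInt (fun x => c * g x) al be = c * RInt g al be).
  { intros g Hg. exact (@RInt_scal R_CompleteNormedModule g al be c (contpos_RInt _ _ _ Hg Hab)). }
  rewrite (RInt_ext (tcos t (fun x => c * f x)) (fun x => c * tcos t f x)) by (intros; unfold tcos; Rring).
  rewrite (RInt_ext (tsin t (fun x => c * f x)) (fun x => c * tsin t f x)) by (intros; unfold tsin; Rring).
  rewrite !S by auto using contpos_cos, contpos_sin. apply injective_projections; simpl; ring.
Qed.

Lemma CI_Rsum t (f : nat -> R -> R) N al be : (forall n, contpos (f n)) -> 0 < al <= be ->
  CI t (fun x => Rsum (fun n => f n x) N) al be = Csum (fun n => CI t (f n) al be) N.
Proof.
  intros Hf Hab. induction N; simpl.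
  - assert (Z : forall g, (forall x, g x = 0) -> RInt g al be = 0).
    { intros g Hg. rewrite (RInt_ext _ (fun _ => 0)) by (intros; apply Hg).
      rewrite RInt_const. apply Rmult_0_r. }
    unfold CI. rewrite !Z by (intros; unfold tcos, tsin; apply Rmult_0_l). reflexivity.
  - rewrite CI_plus; auto; [rewrite IHN; auto|]. apply contpos_Rsum; auto.
Qed.

Lemma CI_Chasles t f al be ga : contpos f -> 0 < al <= be -> be <= ga ->
  CI t f al ga = (CI t f al be + CI t f be ga)%C.
Proof.
  intros Hf Hab Hbg. unfold CI. apply injective_projections; simpl; symmetry;
    apply (@RInt_Chasles R_CompleteNormedModule); apply contpos_RInt; auto using contpos_cos, contpos_sin; lra.
Qed.

Lemma CI_scale t f c al be : contpos f -> 0 < c -> 0 < al <= be ->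
  CI t (fun x => f (c * x)) al be = (RtoC (/ c) * cis (- (t * ln c)) * CI t f (c * al) (c * be))%C.
Proof.
  intros Hf Hc Hab.
  assert (Hab' : 0 < c * al <= c * be) by (split; [nra|apply Rmult_le_compat_l; lra]).
  assert (CL : forall g, contpos g -> RInt (fun x => g (c * x)) al be = / c * RInt g (c * al) (c * be)).
  { intros g Hg. pose proof (@RInt_comp_lin R_CompleteNormedModule g c 0 al be) as E. rewrite !Rplus_0_r in E.
    rewrite <- E by (apply contpos_RInt; auto).
    rewrite (RInt_ext (fun y => scal c (g (c * y + 0))) (fun x => c * g (c * x))).
    - rewrite (RInt_scal_pos c (fun x => g (c * x))) by auto using contpos_scale.
      rewrite <- Rmult_assoc, Rinv_l, Rmult_1_l by lra. reflexivity.
    - intros x _. rewrite Rplus_0_r. reflexivity. }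
  set (k := t * ln c).
  assert (L : forall x, al < x < be -> t * ln x = t * ln (c * x) - k) by (intros x Hx; unfold k; rewrite ln_mult by lra; ring).
  assert (E1 : RInt (tcos t (fun x => f (c * x))) al be =
     cos k * (/ c * RInt (tcos t f) (c * al) (c * be)) + sin k * (/ c * RInt (tsin t f) (c * al) (c * be))).
  { rewrite <- !CL by auto using contpos_cos, contpos_sin.
    rewrite (RInt_ext _ (fun x => cos k * tcos t f (c * x) + sin k * tsin t f (c * x))).
    - rewrite (RInt_plus_pos (fun x => _ * _ (c * x)) (fun x => _ * _ (c * x))) by auto using contpos_mult, contpos_const, contpos_scale, contpos_cos, contpos_sin.
      rewrite !(RInt_scal_pos _ (fun x => _ (c * x))) by auto using contpos_scale, contpos_cos, contpos_sin. reflexivity.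
    - intros x Hx. rewrite Rmin_left, Rmax_right in Hx by lra. unfold tcos, tsin. rewrite (L x Hx), cos_minus. Rring. }
  assert (E2 : RInt (tsin t (fun x => f (c * x))) al be =
     cos k * (/ c * RInt (tsin t f) (c * al) (c * be)) + (- sin k) * (/ c * RInt (tcos t f) (c * al) (c * be))).
  { rewrite <- !CL by auto using contpos_cos, contpos_sin.
    rewrite (RInt_ext _ (fun x => cos k * tsin t f (c * x) + (- sin k) * tcos t f (c * x))).
    - rewrite (RInt_plus_pos (fun x => _ * _ (c * x)) (fun x => _ * _ (c * x))) by auto using contpos_mult, contpos_const, contpos_scale, contpos_cos, contpos_sin.
      rewrite !(RInt_scal_pos _ (fun x => _ (c * x))) by auto using contpos_scale, contpos_cos, contpos_sin. reflexivity.
    - intros x Hx. rewrite Rmin_left, Rmax_right in Hx by lra. unfold tcos, tsin. rewrite (L x Hx), sin_minus. Rring. }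
  unfold CI. rewrite E1, E2. unfold cis. rewrite cos_neg, sin_neg. apply injective_projections; simpl; ring.
Qed.

(** The integral of [e^(-c v) v^k / k!] from [l] to infinity in closed form, by repeated integration
    by parts. With [l = - ln x] or [l = ln x] it integrates powers of [x] times powers of [ln x]
    near 0 or near infinity. *)
Fixpoint Aexp (c : R) (k : nat) (l : R) : R :=
  match k with
  | O => / c * exp (- (c * l))
  | S i => / c * (exp (- (c * l)) * (l ^ k / INR (fact k)) + Aexp c i l)
  end.

Lemma Aexp_derive c k l : 0 < c -> is_derive (Aexp c k) l (- (exp (- (c * l)) * (l ^ k / INR (fact k)))).
Proof.
  intros Hc. induction k as [|k IH].
  - simpl. auto_derive; auto. field. lra.
  - apply (is_derive_ext (fun l => / c * (exp (- (c * l)) * (l ^ S k / INR (fact (S k))) + Aexp c k l))); [reflexivity|].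
    evar_last.
    + apply is_derive_scal. apply (is_derive_plus (V := R_NormedModule)); [|apply IH].
      apply (is_derive_mult (fun l => exp (- (c * l))) (fun l => l ^ S k / INR (fact (S k))) l
        (- c * exp (- (c * l))) (l ^ k / INR (fact k))).
      * auto_derive; auto. ring.
      * apply (is_derive_ext (fun l => / INR (fact (S k)) * l ^ S k)); [intros; unfold Rdiv; apply Rmult_comm|].
        evar_last; [apply is_derive_scal, is_derive_Reals, (derivable_pt_lim_pow l (S k))|].
        rewrite fact_simpl, mult_INR. simpl Nat.pred. field. split; [apply INR_fact_neq_0|apply not_0_INR; lia].
      * intros; apply Rmult_comm.
    + change plus with Rplus. change mult with Rmult. field. repeat split; try apply INR_fact_neq_0; lra.
Qed.

Lemma Aexp_0 c k : 0 < c -> Aexp c k 0 = / c ^ S k.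
Proof.
  intros Hc. induction k as [|k IH].
  - simpl. rewrite Rmult_0_r, Ropp_0, exp_0. field. lra.
  - cbn [Aexp]. rewrite IH, pow_i by lia. unfold Rdiv. rewrite Rmult_0_l, Rmult_0_r, Rplus_0_l.
    simpl. field. split; try (apply pow_nonzero); lra.
Qed.

Lemma Aexp_nonneg c k l : 0 < c -> 0 <= l -> 0 <= Aexp c k l.
Proof.
  intros Hc Hl. assert (0 < / c) by (apply Rinv_0_lt_compat; auto). induction k as [|k IH].
  - simpl. pose proof (exp_pos (- (c * l))). nra.
  - cbn [Aexp]. apply Rmult_le_pos; [lra|]. apply Rplus_le_le_0_compat; auto.
    apply Rmult_le_pos; [left; apply exp_pos|]. apply Rdiv_le_0_compat; [apply pow_le; auto|apply INR_fact_lt_0].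
Qed.

Lemma Aexp_small_derive c k x : 0 < c -> 0 < x ->
  is_derive (fun x => Aexp c k (- ln x)) x (exp ((c - 1) * ln x) * ((- ln x) ^ k / INR (fact k))).
Proof.
  intros Hc Hx. evar_last.
  - apply (is_derive_comp (Aexp c k) (fun x => - ln x)); [apply Aexp_derive; auto|].
    instantiate (1 := - / x). auto_derive; auto. field. lra.
  - change scal with Rmult. replace (/ x) with (exp (- ln x)) by (rewrite exp_Ropp, exp_ln; lra).
    replace ((c - 1) * ln x) with (- ln x + - (c * - ln x)) by ring. rewrite exp_plus. ring.
Qed.

Lemma Aexp_large_derive c k x : 0 < c -> 0 < x ->
  is_derive (fun x => - Aexp c k (ln x)) x (exp (- (c + 1) * ln x) * (ln x ^ k / INR (fact k))).
Proof.
  intros Hc Hx. evar_last.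
  - apply (is_derive_opp (V := R_NormedModule)).
    apply (is_derive_comp (Aexp c k) ln); [apply Aexp_derive; auto|apply is_derive_ln'; auto].
  - change scal with Rmult. change opp with Ropp. replace (/ x) with (exp (- ln x)) by (rewrite exp_Ropp, exp_ln; lra).
    replace (- (c + 1) * ln x) with (- ln x + - (c * ln x)) by ring. rewrite exp_plus. ring.
Qed.

Lemma Ccvg_cauchy (u : nat -> C) :
  (forall e, 0 < e -> exists N, forall n m, (N <= n)%nat -> (N <= m)%nat -> Cmod (u n - u m) < e) ->
  exists l, Ccvg u l.
Proof.
  intros H.
  assert (P : forall (p : C -> R), (forall z, Rabs (p z) <= Cmod z) -> (forall z w, p (z - w)%C = p z - p w) ->
    exists l : R, is_lim_seq (fun n => p (u n)) l).
  { intros p Hp Hl. apply ex_lim_seq_cauchy_corr. intros [e He]. destruct (H e He) as [N HN].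
    exists N. intros n m Hn Hm. simpl. rewrite <- Hl. eapply Rle_lt_trans; [apply Hp|auto]. }
  destruct (P Re) as [l1 H1]; [apply re_le_Cmod|intros [? ?] [? ?]; reflexivity|].
  destruct (P Im) as [l2 H2]; [apply Im_le_Cmod|intros [? ?] [? ?]; reflexivity|].
  exists (l1, l2). intros e He. apply is_lim_seq_spec in H1. apply is_lim_seq_spec in H2.
  destruct (H1 (mkposreal (e / 2) ltac:(lra))) as [N1 K1]. destruct (H2 (mkposreal (e / 2) ltac:(lra))) as [N2 K2].
  exists (N1 + N2)%nat. intros n Hn. specialize (K1 n ltac:(lia)). specialize (K2 n ltac:(lia)). simpl in *.
  eapply Rle_lt_trans; [apply Cmod_le_sum|].
  replace (Re (u n - (l1, l2))%C) with (Re (u n) - l1) by (destruct (u n); reflexivity).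
  replace (Im (u n - (l1, l2))%C) with (Im (u n) - l2) by (destruct (u n); reflexivity). lra.
Qed.

Lemma Aexp_le c k l : 0 < c -> 0 <= l -> Aexp c k l <= / c ^ S k.
Proof.
  intros Hc Hl. rewrite <- Aexp_0 by auto.
  destruct (MVT_gen (Aexp c k) 0 l (fun l => - (exp (- (c * l)) * (l ^ k / INR (fact k))))) as [x [Hx E]].
  - intros x _. apply Aexp_derive; auto.
  - intros x _. apply continuity_pt_filterlim. apply (@ex_derive_continuous R_AbsRing R_NormedModule).
    eexists. apply Aexp_derive; auto.
  - rewrite Rmin_left, Rmax_right in Hx by auto.
    assert (0 <= exp (- (c * x)) * (x ^ k / INR (fact k)) * (l - 0)); [|lra].
    apply Rmult_le_pos; [|lra]. apply Rmult_le_pos; [left; apply exp_pos|].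
    apply Rdiv_le_0_compat; [apply pow_le; lra|apply INR_fact_lt_0].
Qed.

Definition ub (J : R) (q : nat) (x : R) : R := (x - 1) * x ^ S q * exp (- (J * x)).

Lemma ub_derive J q x : is_derive (ub J q) x
  (x ^ q * exp (- (J * x)) * (x + (INR (S q) - J) * (x - 1) - J * (x - 1) ^ 2)).
Proof.
  unfold ub. evar_last.
  - apply (is_derive_mult (fun x => (x - 1) * x ^ S q) (fun x => exp (- (J * x))) x
      (1 * x ^ S q + (x - 1) * (INR (S q) * x ^ q)) (- J * exp (- (J * x)))).
    + apply (is_derive_mult (fun x => x - 1) (fun x => x ^ S q) x 1 (INR (S q) * x ^ q)).
      * auto_derive; auto; ring.
      * apply is_derive_Reals. exact (derivable_pt_lim_pow x (S q)).
      * intros; apply Rmult_comm.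
    + auto_derive; auto. ring.
    + intros; apply Rmult_comm.
  - change plus with Rplus. change mult with Rmult. simpl (x ^ S q). Rring.
Qed.

Definition c0 (j : nat) : R := INR j ^ j / INR (fact j).

Lemma kern_c0 j x : kern j x = c0 j * (x ^ j * exp (- (INR j * x))).
Proof. unfold kern, c0. rewrite Rpow_mult_distr. field. apply INR_fact_neq_0. Qed.

Lemma contpos_kern j : contpos (kern j).
Proof. apply contpos_derive. intros x _. unfold kern. auto_derive. auto. Qed.

(** This moment of the kernel and the next one differ from the mass [1 / j] by at most five factors
    [<= 9/8], because [j >= 40]. *)
Lemma c0_fact_up j : (40 <= j)%nat -> c0 j * INR (fact (j + 5)) * / INR j ^ S (j + 5) <= 2 * / INR j.
Proof.
  intros Hj. assert (P : 40 <= INR j) by (replace 40 with (INR 40) by (simpl; ring); apply le_INR; auto).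
  replace (j + 5)%nat with (S (S (S (S (S j))))) by lia. rewrite !fact_simpl, !mult_INR, !S_INR. unfold c0.
  replace (INR j ^ j / INR (fact j) *
     ((INR j + 1 + 1 + 1 + 1 + 1) * ((INR j + 1 + 1 + 1 + 1) * ((INR j + 1 + 1 + 1) * ((INR j + 1 + 1) * ((INR j + 1) * INR (fact j)))))) *
     / INR j ^ S (S (S (S (S (S j))))))
    with (((INR j + 5) / INR j) * ((INR j + 4) / INR j) * ((INR j + 3) / INR j) * ((INR j + 2) / INR j) * ((INR j + 1) / INR j) * / INR j).
  - apply Rmult_le_compat_r; [left; apply Rinv_0_lt_compat; lra|].
    assert (F : forall d, 0 <= d <= 5 -> 1 <= (INR j + d) / INR j <= 9 / 8).
    { intros d Hd. split; apply Rmult_le_reg_r with (INR j); try lra; unfold Rdiv; rewrite Rmult_assoc, Rinv_l; lra. }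
    pose proof (F 5 ltac:(lra)) as F5. pose proof (F 4 ltac:(lra)) as F4. pose proof (F 3 ltac:(lra)) as F3.
    pose proof (F 2 ltac:(lra)) as F2. pose proof (F 1 ltac:(lra)) as F1.
    set (x5 := (INR j + 5) / INR j) in *. set (x4 := (INR j + 4) / INR j) in *. set (x3 := (INR j + 3) / INR j) in *.
    set (x2 := (INR j + 2) / INR j) in *. set (x1 := (INR j + 1) / INR j) in *.
    assert (G2 : 1 <= x5 * x4 <= 81 / 64) by nra. assert (G3 : 1 <= x5 * x4 * x3 <= 729 / 512) by nra.
    assert (G4 : 1 <= x5 * x4 * x3 * x2 <= 6561 / 4096) by nra. nra.
  - simpl. field. repeat split; try apply INR_fact_neq_0; try apply pow_nonzero; lra.
Qed.

Lemma c0_fact_down i : (36 <= i)%nat -> c0 (4 + i) * INR (fact i) * / INR (4 + i) ^ S i <= 2 * / INR (4 + i).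
Proof.
  intros Hi. set (J := INR (4 + i)).
  assert (P : 40 <= J) by (unfold J; replace 40 with (INR 40) by (simpl; ring); apply le_INR; lia).
  assert (EJ : INR i = J - 4) by (unfold J; rewrite plus_INR; simpl; ring).
  unfold c0. fold J. replace (4 + i)%nat with (S (S (S (S i)))) by lia. rewrite !fact_simpl, !mult_INR, !S_INR, EJ.
  replace (J ^ S (S (S (S i))) / ((J - 4 + 1 + 1 + 1 + 1) * ((J - 4 + 1 + 1 + 1) * ((J - 4 + 1 + 1) * ((J - 4 + 1) * INR (fact i))))) *
     INR (fact i) * / J ^ S i) with ((J / (J - 1)) * (J / (J - 2)) * (J / (J - 3)) * / J).
  - apply Rmult_le_compat_r; [left; apply Rinv_0_lt_compat; lra|].
    assert (F : forall d, 0 <= d <= 3 -> 1 <= J / (J - d) <= 9 / 8).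
    { intros d Hd. split; apply Rmult_le_reg_r with (J - d); try lra; unfold Rdiv; rewrite Rmult_assoc, Rinv_l; lra. }
    pose proof (F 1 ltac:(lra)) as F1. pose proof (F 2 ltac:(lra)) as F2. pose proof (F 3 ltac:(lra)) as F3.
    set (x1 := J / (J - 1)) in *. set (x2 := J / (J - 2)) in *. set (x3 := J / (J - 3)) in *.
    assert (G2 : 1 <= x1 * x2 <= 81 / 64) by nra. nra.
  - simpl. field. repeat split; try apply INR_fact_neq_0; try apply pow_nonzero; lra.
Qed.

Lemma c0_fact_mid j : (1 <= j)%nat -> c0 j * INR (fact j) * / INR j ^ S j = / INR j.
Proof.
  intros Hj. assert (INR j <> 0) by (apply not_0_INR; lia). unfold c0. simpl. field.
  repeat split; try apply INR_fact_neq_0; try apply pow_nonzero; auto.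
Qed.

Lemma gamma_antideriv J q x : 0 < J ->
  is_derive (fun x => - (INR (fact q) * Aexp J q x)) x (x ^ q * exp (- (J * x))).
Proof.
  intros HJ. evar_last.
  - apply (is_derive_opp (V := R_NormedModule)). apply is_derive_scal. apply Aexp_derive; auto.
  - change opp with Ropp. match goal with |- @eq _ ?a ?b => change (@eq R a b) end. field. apply INR_fact_neq_0.
Qed.

(* The identity [J (x-1)^2 x^q e^(-Jx) = (x + (q+1-J)(x-1)) x^q e^(-Jx) - ub'] bounds the second moment. *)
Lemma kern_integral t h j al be A B : (40 <= j)%nat -> contpos h -> 0 < al <= 1 -> 1 <= be -> 0 <= A -> 0 <= B ->
  (forall x, al <= x <= be -> Rabs (h x) <= kern j x * (A + B * ((x - 1) ^ 2 * (x ^ 4 + (/ x) ^ 4)))) ->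
  Cmod (CI t h al be) <= A * / INR j + B * (18 * (/ INR j) ^ 2).
Proof.
  intros Hj Hh Hal Hbe HA HB Hle.
  set (J := INR j). assert (P : 40 <= J) by (unfold J; replace 40 with (INR 40) by (simpl; ring); apply le_INR; auto).
  set (i := (j - 4)%nat). assert (Ej : j = (4 + i)%nat) by (unfold i; lia).
  set (c := c0 j). assert (Hc : 0 < c) by (unfold c, c0; apply Rdiv_lt_0_compat; [apply pow_lt; fold J; lra|apply INR_fact_lt_0]).
  set (Gp := fun x => A * (c * - (INR (fact j) * Aexp J j x)) + B * (c * / J) *
    (6 * - (INR (fact (j + 5)) * Aexp J (j + 5) x) - ub J (j + 4) x
     + 3 * - (INR (fact i) * Aexp J i x) - ub J i x)).
  (* For [q = j + 4] the linear part is [6 x - 5 <= 6 x], and for [q = j - 4] it is [3 - 2 x <= 3];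
     hence the coefficients 6 and 3. The 18 in the conclusion is twice their sum. *)
  set (g := fun x => A * (c * (x ^ j * exp (- (J * x)))) + B * (c * / J) *
    (6 * (x ^ (j + 5) * exp (- (J * x)))
       - x ^ (j + 4) * exp (- (J * x)) * (x + (INR (S (j + 4)) - J) * (x - 1) - J * (x - 1) ^ 2)
     + 3 * (x ^ i * exp (- (J * x)))
       - x ^ i * exp (- (J * x)) * (x + (INR (S i) - J) * (x - 1) - J * (x - 1) ^ 2))).
  assert (DG : forall x, is_derive Gp x (g x)).
  { intros x. unfold Gp, g. 
    pose proof (gamma_antideriv J j x ltac:(lra)) as D1. pose proof (gamma_antideriv J (j + 5) x ltac:(lra)) as D2.
    pose proof (gamma_antideriv J i x ltac:(lra)) as D3. pose proof (ub_derive J (j + 4) x) as D4.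
    pose proof (ub_derive J i x) as D5.
    apply (is_derive_plus (V := R_NormedModule)); [apply is_derive_scal, is_derive_scal; exact D1|].
    apply is_derive_scal. apply (is_derive_minus (V := R_NormedModule)); [|exact D5].
    apply (is_derive_plus (V := R_NormedModule)); [|apply is_derive_scal; exact D3].
    apply (is_derive_minus (V := R_NormedModule)); [apply is_derive_scal; exact D2|exact D4]. }
  assert (Cg : contpos g).
  { apply contpos_derive. intros x _. unfold g. auto_derive. auto. }
  eapply Rle_trans; [apply (CI_bound t h g Gp al be); auto; [lra|]|].
  - intros x Hx. eapply Rle_trans; [apply Hle; auto|].
    assert (Hx0 : 0 < x) by lra. rewrite kern_c0. fold c J. unfold g.
    set (E := exp (- (J * x))). assert (HE : 0 < E) by apply exp_pos.
    assert (Q4 : x ^ (j + 4) = x ^ j * x ^ 4) by apply pow_add.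
    assert (Q5 : x ^ (j + 5) = x ^ j * x ^ 5) by apply pow_add.
    assert (Qi : x ^ i = x ^ j * (/ x) ^ 4).
    { rewrite Ej, pow_add, pow_inv. field. lra. }
    rewrite Q4, Q5, Qi.
    assert (S1 : INR (S (j + 4)) - J = 5) by (unfold J; rewrite S_INR, plus_INR; simpl; ring).
    assert (S2 : INR (S i) - J = - 3) by (assert (EJ : J = 4 + INR i) by (unfold J; rewrite Ej, plus_INR; simpl; ring); rewrite S_INR, EJ; ring).
    rewrite S1, S2.
    set (X := x ^ j). assert (HX : 0 < X) by (apply pow_lt; auto).
    set (y := / x). assert (Hy : 0 < y) by (apply Rinv_0_lt_compat; auto).
    assert (D : A * (c * (X * E)) + B * (c * / J) *
       (6 * (X * x ^ 5 * E) - X * x ^ 4 * E * (x + 5 * (x - 1) - J * (x - 1) ^ 2) +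
        3 * (X * y ^ 4 * E) - X * y ^ 4 * E * (x + - (3) * (x - 1) - J * (x - 1) ^ 2))
       - c * (X * E) * (A + B * ((x - 1) ^ 2 * (x ^ 4 + y ^ 4)))
       = B * (c * / J) * (X * E) * (5 * x ^ 4 + 2 * x * y ^ 4)).
    { field. lra. }
    assert (0 <= B * (c * / J) * (X * E) * (5 * x ^ 4 + 2 * x * y ^ 4)); [|lra].
    assert (0 < / J) by (apply Rinv_0_lt_compat; lra).
    assert (0 < x ^ 4) by (apply pow_lt; auto). assert (0 < y ^ 4) by (apply pow_lt; auto).
    apply Rmult_le_pos; [apply Rmult_le_pos; [apply Rmult_le_pos; auto; nra|nra]|nra].
  - assert (U : forall q, ub J q al <= 0 <= ub J q be).
    { intros q. unfold ub. pose proof (exp_pos (- (J * al))). pose proof (exp_pos (- (J * be))).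
      assert (0 < al ^ S q) by (apply pow_lt; lra). assert (0 < be ^ S q) by (apply pow_lt; lra). split.
      - assert (0 <= (1 - al) * al ^ S q * exp (- (J * al))) by (apply Rmult_le_pos; [apply Rmult_le_pos; lra|lra]). lra.
      - apply Rmult_le_pos; [apply Rmult_le_pos; lra|lra]. }
    assert (AA : forall q, 0 <= Aexp J q be) by (intros; apply Aexp_nonneg; lra).
    assert (AB : forall q, Aexp J q al <= / J ^ S q) by (intros; apply Aexp_le; lra).
    assert (FF : forall q, 0 < INR (fact q)) by (intros; apply INR_fact_lt_0).
    assert (I0 : 0 < c * / J) by (apply Rmult_lt_0_compat; auto; apply Rinv_0_lt_compat; lra).
    assert (T : forall q, - (INR (fact q) * Aexp J q be) - - (INR (fact q) * Aexp J q al) <= INR (fact q) * / J ^ S q).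
    { intros q. specialize (AA q). specialize (AB q). specialize (FF q).
      assert (INR (fact q) * Aexp J q al <= INR (fact q) * / J ^ S q) by (apply Rmult_le_compat_l; lra).
      assert (0 <= INR (fact q) * Aexp J q be) by (apply Rmult_le_pos; lra). lra. }
    pose proof (U (j + 4)%nat) as U1. pose proof (U i) as U2.
    pose proof (T j) as T1. pose proof (T (j + 5)%nat) as T2. pose proof (T i) as T3.
    pose proof (c0_fact_mid j ltac:(lia)) as M1. pose proof (c0_fact_up j Hj) as M2.
    pose proof (c0_fact_down i ltac:(unfold i; lia)) as M3. rewrite <- Ej in M3. fold J c in M1, M2, M3.
    unfold Gp.
    assert (X1 : c * (- (INR (fact j) * Aexp J j be) - - (INR (fact j) * Aexp J j al)) <= / J).
    { rewrite <- M1, Rmult_assoc. apply Rmult_le_compat_l; lra. }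
    set (V := (6 * - (INR (fact (j + 5)) * Aexp J (j + 5) be) - ub J (j + 4) be + 3 * - (INR (fact i) * Aexp J i be) - ub J i be)
      - (6 * - (INR (fact (j + 5)) * Aexp J (j + 5) al) - ub J (j + 4) al + 3 * - (INR (fact i) * Aexp J i al) - ub J i al)).
    assert (X2 : c * V <= 18 * / J).
    { apply Rle_trans with (c * (6 * (INR (fact (j + 5)) * / J ^ S (j + 5)) + 3 * (INR (fact i) * / J ^ S i))).
      - apply Rmult_le_compat_l; [lra|]. unfold V. lra.
      - lra. }
    match goal with |- ?L <= _ => replace L with
      (A * (c * (- (INR (fact j) * Aexp J j be) - - (INR (fact j) * Aexp J j al))) + B * / J * (c * V))
      by (unfold V; ring) end.
    apply Rplus_le_compat; [apply Rmult_le_compat_l; auto|].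
    replace (B * (18 * (/ J) ^ 2)) with (B * / J * (18 * / J)) by ring.
    apply Rmult_le_compat_l; auto. apply Rmult_le_pos; auto. left; apply Rinv_0_lt_compat; lra.
Qed.

(** The factor [|x - 1|] controls differences near the mode of the kernel, and [x^2 + x^-2] absorbs
    the growth of [x^a] and of powers of [ln x] at both ends. *)
Definition om (x : R) : R := Rabs (x - 1) * (x ^ 2 + (/ x) ^ 2).

(* AM-GM splits [|x-1|] against the standard deviation [1/S] of the kernel. *)
Lemma kern_integral_om t h j al be D S : (40 <= j)%nat -> contpos h -> 0 < al <= 1 -> 1 <= be -> 0 <= D ->
  0 < S -> S ^ 2 <= INR j ->
  (forall x, al <= x <= be -> Rabs (h x) <= kern j x * (D * om x)) ->
  Cmod (CI t h al be) <= D * (6 / S) * / INR j.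
Proof.
  intros Hj Hh Hal Hbe HD HS HSj Hle.
  assert (P : 40 <= INR j) by (replace 40 with (INR 40) by (simpl; ring); apply le_INR; auto).
  (* Balances [la / 2] against [18 / (la j)] when [S] is close to the square root of [j]. *)
  set (la := 6 / S). assert (Hla : 0 < la) by (apply Rdiv_lt_0_compat; lra).
  eapply Rle_trans; [apply (kern_integral t h j al be (D * (la / 2)) (D * / la)); auto|].
  - apply Rmult_le_pos; lra.
  - apply Rmult_le_pos; auto. left; apply Rinv_0_lt_compat; auto.
  - intros x Hx. eapply Rle_trans; [apply Hle; auto|].
    assert (K0 : 0 <= kern j x).
    { unfold kern. apply Rdiv_le_0_compat; [|apply INR_fact_lt_0]. apply Rmult_le_pos; [left; apply exp_pos|].
      apply pow_le. apply Rmult_le_pos; lra. }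
    apply Rmult_le_compat_l; auto. rewrite Rmult_assoc, <- Rmult_plus_distr_l. apply Rmult_le_compat_l; auto.
    unfold om. set (s := x ^ 2 + (/ x) ^ 2). set (d := Rabs (x - 1)).
    assert (Hd : (x - 1) ^ 2 = d ^ 2) by (unfold d; rewrite pow2_abs; auto). rewrite Hd.
    assert (Q : s ^ 2 <= 2 * (x ^ 4 + (/ x) ^ 4)).
    { unfold s. pose proof (pow2_ge_0 (x ^ 2 - (/ x) ^ 2)). simpl in *. lra. }
    assert (Q2 : d * s <= la / 2 + / la * (d ^ 2 * s ^ 2 / 2)).
    { apply Rmult_le_reg_l with la; auto. replace (la * (la / 2 + / la * (d ^ 2 * s ^ 2 / 2))) with (la ^ 2 / 2 + d ^ 2 * s ^ 2 / 2) by (field; lra).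
      pose proof (pow2_ge_0 (la - d * s)). simpl in *. lra. }
    eapply Rle_trans; [apply Q2|]. apply Rplus_le_compat_l. apply Rmult_le_compat_l; [left; apply Rinv_0_lt_compat; auto|].
    pose proof (pow2_ge_0 d). assert (d ^ 2 * s ^ 2 <= d ^ 2 * (2 * (x ^ 4 + (/ x) ^ 4))) by (apply Rmult_le_compat_l; auto). lra.
  - unfold la. replace (D * (6 / S / 2) * / INR j + D * / (6 / S) * (18 * (/ INR j) ^ 2))
      with (D * / INR j * (3 / S + 3 * S * / INR j)) by (field; lra).
    replace (D * (6 / S) * / INR j) with (D * / INR j * (6 / S)) by ring.
    apply Rmult_le_compat_l; [apply Rmult_le_pos; auto; left; apply Rinv_0_lt_compat; lra|].
    assert (3 * S * / INR j <= 3 / S); [|unfold Rdiv in *; lra].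
    apply Rmult_le_reg_r with (INR j * S); [nra|].
    replace (3 * S * / INR j * (INR j * S)) with (3 * S ^ 2) by (field; lra).
    replace (3 / S * (INR j * S)) with (3 * INR j) by (field; lra). lra.
Qed.

(** * Taylor coefficients of the Mellin transform of the kernel *)

Definition Hk (j : nat) (a : R) (i : nat) (x : R) : R := kern j x * (exp (a * ln x) * (ln x ^ i / INR (fact i))).

Lemma contpos_Hk j a i : contpos (Hk j a i).
Proof.
  apply contpos_mult; [apply contpos_kern|]. apply contpos_derive. intros x Hx. auto_derive. auto.
Qed.

Lemma ln_abs_exp x : 0 < x -> exp (Rabs (ln x)) <= x + / x /\ (1 <= x -> exp (Rabs (ln x)) = x) /\ (x <= 1 -> exp (Rabs (ln x)) = / x).
Proof.
  intros Hx. assert (0 < / x) by (apply Rinv_0_lt_compat; auto).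
  assert (A : 1 <= x -> exp (Rabs (ln x)) = x).
  { intros H1. rewrite Rabs_pos_eq, exp_ln; auto. apply ln_ge0; auto. }
  assert (B : x <= 1 -> exp (Rabs (ln x)) = / x).
  { intros H1. rewrite Rabs_left1, exp_Ropp, exp_ln; auto. rewrite <- ln_1. apply ln_le; auto. }
  split; [|auto]. destruct (Rle_dec 1 x); [rewrite A|rewrite B]; lra.
Qed.

Lemma ln_pow_fact_le x i : Rabs (ln x ^ i / INR (fact i)) <= exp (Rabs (ln x)).
Proof.
  unfold Rdiv. rewrite Rabs_mult, <- RPow_abs, (Rabs_pos_eq (/ _)) by (left; apply Rinv_0_lt_compat, INR_fact_lt_0).
  pose proof (pow_fact_exp 1 (Rabs (ln x)) i ltac:(lra) (Rabs_pos _)) as P.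
  rewrite Rmult_1_l, pow1 in P. unfold Rdiv in P. lra.
Qed.

Lemma exp_a_ln a x : 0 < a <= 1 -> 0 < x -> (1 <= x -> 1 <= exp (a * ln x) <= x) /\ (x <= 1 -> x <= exp (a * ln x) <= 1).
Proof.
  intros Ha Hx. split; intros H.
  - assert (0 <= ln x) by (apply ln_ge0; auto). split.
    + rewrite <- exp_0 at 1. apply exp_le. nra.
    + rewrite <- (exp_ln x) at 2 by auto. apply exp_le. nra.
  - assert (ln x <= 0) by (rewrite <- ln_1; apply ln_le; auto). split.
    + rewrite <- (exp_ln x) at 1 by auto. apply exp_le. nra.
    + rewrite <- exp_0. apply exp_le. nra.
Qed.

(** The majorant is integrable at both ends with antiderivative [- 256 / (1 + x)]. Uniformity in [i]
    comes from [|l|^i / i! <= e^|l|], which for [l = ln x] is the larger of [x] and [1/x]. *)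
Lemma Hk_bound j a i x : (40 <= j)%nat -> 0 < a <= 1 -> 0 < x -> Rabs (Hk j a i x) <= 256 * (/ (1 + x)) ^ 2.
Proof.
  intros Hj Ha Hx. unfold Hk. rewrite !Rabs_mult.
  rewrite (Rabs_pos_eq (kern j x)) by (apply kern_le_base; auto). rewrite (Rabs_pos_eq (exp _)) by (left; apply exp_pos).
  pose proof (ln_pow_fact_le x i) as L. pose proof (Rabs_pos (ln x ^ i / INR (fact i))).
  set (l := Rabs (ln x ^ i / INR (fact i))) in *.
  destruct (ln_abs_exp x Hx) as [_ [E1 E2]]. destruct (exp_a_ln a x Ha Hx) as [F1 F2].
  pose proof (exp_pos (a * ln x)). set (e := exp (a * ln x)) in *.
  rewrite pow_inv. destruct (Rle_dec 1 x) as [H1|H1].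
  - rewrite E1 in L by auto. specialize (F1 H1).
    destruct (kern_le_pow' j x ltac:(lia) Hx) as [K0 K1].
    assert (M : e * l <= x * x) by (apply Rmult_le_compat; lra).
    apply Rle_trans with (64 * (/ x) ^ 6 * (x * x)); [apply Rmult_le_compat; auto; nra|].
    replace (64 * (/ x) ^ 6 * (x * x)) with (64 * (/ x) ^ 2 * (/ x) ^ 2) by (simpl; field; lra).
    assert (I1 : 0 < / x <= 1) by (split; [apply Rinv_0_lt_compat; lra|rewrite <- Rinv_1; apply Rinv_le_contravar; lra]).
    apply Rle_trans with (64 * 1 * (/ x) ^ 2).
    + apply Rmult_le_compat_r; [apply pow2_ge_0|]. apply Rmult_le_compat_l; [lra|]. simpl; nra.
    + rewrite pow_inv. apply Rmult_le_reg_r with (x ^ 2 * (1 + x) ^ 2); [apply Rmult_lt_0_compat; apply pow_lt; lra|].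
      replace (64 * 1 * / x ^ 2 * (x ^ 2 * (1 + x) ^ 2)) with (64 * (1 + x) ^ 2) by (field; lra).
      replace (256 * / (1 + x) ^ 2 * (x ^ 2 * (1 + x) ^ 2)) with (256 * x ^ 2) by (field; lra). simpl; nra.
  - rewrite E2 in L by lra. specialize (F2 ltac:(lra)).
    destruct (kern_le_base j x Hx) as [K0 K1]. destruct (x_exp_le_1 x Hx) as [X0 X1].
    assert (X2 : (x * exp (1 - x)) ^ j <= x * 3).
    { apply Rle_trans with (x * exp (1 - x)).
      - replace j with (S (j - 1)) by lia. simpl.
        assert ((x * exp (1 - x)) ^ (j - 1) <= 1) by (apply Rle_trans with (1 ^ (j - 1)); [apply pow_incr; auto|rewrite pow1; lra]).
        assert (0 <= (x * exp (1 - x)) ^ (j - 1)) by (apply pow_le; auto). nra.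
      - apply Rmult_le_compat_l; [lra|]. apply Rle_trans with (exp 1); [apply exp_le; lra|apply exp_le_3]. }
    assert (0 < / x) by (apply Rinv_0_lt_compat; auto).
    assert (M : e * l <= 1 * / x) by (apply Rmult_le_compat; lra).
    apply Rle_trans with (x * 3 * (1 * / x)); [apply Rmult_le_compat; try lra; nra|].
    replace (x * 3 * (1 * / x)) with 3 by (field; lra).
    apply Rmult_le_reg_r with ((1 + x) ^ 2); [apply pow_lt; lra|].
    rewrite Rmult_assoc, Rinv_l by (apply pow_nonzero; lra). simpl; nra.
Qed.

Lemma CI_Hk_bound t j a i al be : (40 <= j)%nat -> 0 < a <= 1 -> 0 < al <= be ->
  Cmod (CI t (Hk j a i) al be) <= 256 * (/ (1 + al) - / (1 + be)).
Proof.
  intros Hj Ha Hab.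
  eapply Rle_trans; [apply (CI_bound t _ (fun x => 256 * (/ (1 + x)) ^ 2) (fun x => 256 * - / (1 + x)))|apply Req_le; ring].
  - apply contpos_Hk.
  - apply contpos_derive. intros x Hx. auto_derive. lra.
  - auto.
  - intros x Hx. apply Hk_bound; auto. lra.
  - intros x Hx. auto_derive; [lra|]. field. lra.
Qed.

(** The [i]-th Taylor coefficient, at the exponent with real part [a] and imaginary part [t], of the
    transform of [kern] over the whole half-line. It is specified by its rate of approximation
    through compact intervals, so [gam_spec] has to exhibit such a value. *)
Definition gam (t : R) (j : nat) (a : R) (i : nat) : C := epsilon (inhabits (RtoC 0)) (fun g =>
  forall al be, 0 < al <= 1 -> 1 <= be -> Cmod (CI t (Hk j a i) al be - g) <= 256 * (al + / be)).

Lemma CI_Hk_diff t j a i al be al' be' : (40 <= j)%nat -> 0 < a <= 1 -> 0 < al' <= al -> al <= 1 -> 1 <= be <= be' ->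
  Cmod (CI t (Hk j a i) al be - CI t (Hk j a i) al' be') <= 256 * (al + / be).
Proof.
  intros Hj Ha Hal Hal1 Hbe. pose proof (contpos_Hk j a i) as Hc.
  rewrite (CI_Chasles t _ al' al be'), (CI_Chasles t _ al be be') by (auto; lra).
  replace (CI t (Hk j a i) al be - (CI t (Hk j a i) al' al + (CI t (Hk j a i) al be + CI t (Hk j a i) be be')))%C
    with (- (CI t (Hk j a i) al' al + CI t (Hk j a i) be be'))%C by ring.
  rewrite Cmod_opp. eapply Rle_trans; [apply Cmod_triangle|]. rewrite Rmult_plus_distr_l.
  apply Rplus_le_compat; (eapply Rle_trans; [apply CI_Hk_bound; auto; lra|]); apply Rmult_le_compat_l; try lra.
  - assert (A : / (1 + al') <= 1) by (rewrite <- Rinv_1; apply Rinv_le_contravar; lra).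
    assert (B : 1 - al <= / (1 + al)).
    { apply Rmult_le_reg_r with (1 + al); [lra|]. rewrite Rinv_l by lra. nra. }
    lra.
  - assert (A : / (1 + be) <= / be) by (apply Rinv_le_contravar; lra).
    assert (0 < / (1 + be')) by (apply Rinv_0_lt_compat; lra). lra.
Qed.

Lemma inv_S_small e : 0 < e -> exists N, forall n, (N <= n)%nat -> / INR (S n) < e.
Proof.
  intros He. assert (0 < / e) by (apply Rinv_0_lt_compat; auto). destruct (INR_archimed_pos (/ e)) as [N [H1 _]]; [lra|].
  exists N. intros n Hn. apply le_INR in Hn. rewrite <- (Rinv_inv e). apply Rinv_lt_contravar.
  - apply Rmult_lt_0_compat; auto. rewrite S_INR. pose proof (pos_INR n). lra.
  - rewrite S_INR. lra.
Qed.

Lemma inv_S_range n : 0 < / INR (S n) <= 1.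
Proof.
  pose proof (INR_S_ge1 n). split; [apply Rinv_0_lt_compat; lra|rewrite <- Rinv_1; apply Rinv_le_contravar; lra].
Qed.

Lemma gam_spec t j a i : (40 <= j)%nat -> 0 < a <= 1 ->
  forall al be, 0 < al <= 1 -> 1 <= be -> Cmod (CI t (Hk j a i) al be - gam t j a i) <= 256 * (al + / be).
Proof.
  intros Hj Ha. unfold gam. apply epsilon_spec.
  set (u := fun m => CI t (Hk j a i) (/ INR (S m)) (INR (S m))).
  assert (D : forall n m, (n <= m)%nat -> Cmod (u n - u m) <= 512 * / INR (S n)).
  { intros n m Hnm. unfold u. eapply Rle_trans; [apply CI_Hk_diff; auto|apply Req_le; ring].
    - split; [apply inv_S_range|]. apply Rinv_le_contravar; [pose proof (INR_S_ge1 n); lra|apply le_INR; lia].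
    - apply inv_S_range.
    - split; [apply INR_S_ge1|apply le_INR; lia]. }
  destruct (Ccvg_cauchy u) as [g Hg].
  { intros e He. destruct (inv_S_small (e / 512)) as [N HN]; [lra|]. exists N. intros n m Hn Hm.
    destruct (Nat.le_ge_cases n m) as [H|H].
    - specialize (D n m H). specialize (HN n Hn). lra.
    - specialize (D m n H). specialize (HN m Hm). replace (u n - u m)%C with (- (u m - u n))%C by ring. rewrite Cmod_opp. lra. }
  exists g. intros al be Hal Hbe. destruct (inv_S_small al) as [N HN]; [lra|].
  destruct (INR_archimed_pos be) as [N' [HN' _]]; [lra|].
  apply (Ccvg_bound_loc (fun m => CI t (Hk j a i) al be - u m)%C _ _ (N + N')).
  - apply Ccvg_minus; [apply Ccvg_const|auto].
  - intros n Hn. apply CI_Hk_diff; auto; try lra.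
    + split; [apply inv_S_range|]. left; apply HN; lia.
    + split; auto. apply Rle_trans with (INR N'); auto. apply le_INR. lia.
Qed.

(** The end points carry a factor [c] because the substitution in [CI_kern_shift] rescales the
    interval by [n + 1]. *)
Lemma gam_lim t j a i c : (40 <= j)%nat -> 0 < a <= 1 -> 1 <= c ->
  Ccvg (fun m => CI t (Hk j a i) (c * / INR (S m)) (c * INR (S m))) (gam t j a i).
Proof.
  intros Hj Ha Hc. destruct (inv_S_small (/ c)) as [N HN]; [apply Rinv_0_lt_compat; lra|].
  apply (Ccvg_squeeze _ _ (fun m => 512 * c * / INR (S m)) N).
  - intros n Hn. specialize (HN n Hn). pose proof (inv_S_range n). pose proof (INR_S_ge1 n).
    eapply Rle_trans; [apply gam_spec; auto|].
    + split; [apply Rmult_lt_0_compat; lra|]. apply Rle_trans with (c * / c); [apply Rmult_le_compat_l; lra|].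
      rewrite Rinv_r by lra. lra.
    + nra.
    + assert (/ (c * INR (S n)) <= / INR (S n)) by (apply Rinv_le_contravar; [lra|]; nra).
      assert (/ INR (S n) <= c * / INR (S n)) by nra. lra.
  - apply is_lim_seq_spec. intros [e He]. cbn [pos]. destruct (inv_S_small (e / (512 * c))) as [N' HN']; [apply Rdiv_lt_0_compat; lra|].
    exists N'. intros n Hn. specialize (HN' n Hn). pose proof (inv_S_range n).
    rewrite Rminus_0_r, Rabs_pos_eq by (apply Rmult_le_pos; lra).
    apply Rlt_le_trans with (512 * c * (e / (512 * c))); [apply Rmult_lt_compat_l; lra|]. apply Req_le. field. lra.
Qed.

Lemma om_cases x : 0 < x -> (1 <= x -> (x - 1) * x ^ 2 <= om x) /\ (x <= 1 -> (1 - x) * (/ x) ^ 2 <= om x).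
Proof.
  intros Hx. unfold om. pose proof (pow2_ge_0 x). pose proof (pow2_ge_0 (/ x)). split; intros H1.
  - rewrite Rabs_pos_eq by lra. apply Rmult_le_compat_l; lra.
  - rewrite Rabs_left1 by lra. replace (- (x - 1)) with (1 - x) by ring. apply Rmult_le_compat_l; lra.
Qed.

Lemma cos_sub_1 x : Rabs (cos x - 1) <= Rabs x.
Proof.
  destruct (MVT_gen cos 0 x (fun y => - sin y)) as [c [_ E]].
  - intros y _. auto_derive; auto; ring.
  - intros y _. apply continuity_cos.
  - rewrite cos_0 in E. rewrite E, Rabs_mult, Rminus_0_r, Rabs_Ropp. pose proof (SIN_bound c) as B.
    apply Rle_trans with (1 * Rabs x); [|lra]. apply Rmult_le_compat_r; [apply Rabs_pos|]. apply Rabs_le. lra.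
Qed.

(** The change of [x^a] is split off from that of the cosine, which is at most [|t| |ln x|]; [om]
    dominates both [|x^a - 1|] and [x^a |ln x|]. *)
Lemma osc_0 t a x : 0 < a <= 1 -> 0 < x -> Rabs (exp (a * ln x) * cos (t * ln x) - 1) <= (Rabs t + 1) * om x.
Proof.
  intros Ha Hx. destruct (exp_a_ln a x Ha Hx) as [F1 F2]. destruct (om_cases x Hx) as [O1 O2].
  set (e := exp (a * ln x)) in *. assert (He : 0 < e) by apply exp_pos.
  assert (0 < / x) by (apply Rinv_0_lt_compat; auto).
  assert (E1 : Rabs (e - 1) <= om x /\ e * Rabs (ln x) <= om x).
  { destruct (Rle_dec 1 x) as [H1|H1].
    - specialize (F1 H1). specialize (O1 H1).
      assert (0 <= ln x) by (apply ln_ge0; auto). pose proof (ln_le_sub1 x Hx).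
      rewrite (Rabs_pos_eq (e - 1)), (Rabs_pos_eq (ln x)) by lra.
      assert (X : x * (x - 1) <= om x) by (eapply Rle_trans; [|apply O1]; assert (0 <= x * (x - 1)) by nra; simpl; nra).
      split; [nra|]. eapply Rle_trans; [|apply X]. apply Rmult_le_compat; lra.
    - specialize (F2 ltac:(lra)). specialize (O2 ltac:(lra)).
      assert (ln x <= 0) by (rewrite <- ln_1; apply ln_le; lra).
      pose proof (ln_le_sub1 (/ x) ltac:(auto)) as L. rewrite ln_Rinv in L by auto.
      assert (I1 : 1 <= / x) by (rewrite <- Rinv_1; apply Rinv_le_contravar; lra).
      assert (X1 : x * / x = 1) by (apply Rinv_r; lra).
      rewrite (Rabs_left1 (e - 1)), (Rabs_left1 (ln x)) by lra.
      assert (X : / x - 1 <= om x).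
      { eapply Rle_trans; [|apply O2]. replace (/ x - 1) with ((1 - x) * / x) by (field; lra).
        apply Rmult_le_compat_l; [lra|]. simpl. nra. }
      split; [nra|]. eapply Rle_trans; [|apply X].
      apply Rle_trans with (1 * (/ x - 1)); [apply Rmult_le_compat; lra|lra]. }
  destruct E1 as [E1 E2].
  replace (e * cos (t * ln x) - 1) with ((e - 1) + e * (cos (t * ln x) - 1)) by ring.
  eapply Rle_trans; [apply Rabs_triang|]. rewrite Rabs_mult, (Rabs_pos_eq e) by lra.
  pose proof (cos_sub_1 (t * ln x)) as Cc. rewrite Rabs_mult in Cc. pose proof (Rabs_pos t).
  assert (e * Rabs (cos (t * ln x) - 1) <= Rabs t * (e * Rabs (ln x))).
  { replace (Rabs t * (e * Rabs (ln x))) with (e * (Rabs t * Rabs (ln x))) by ring. apply Rmult_le_compat_l; lra. }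
  assert (Rabs t * (e * Rabs (ln x)) <= Rabs t * om x) by (apply Rmult_le_compat_l; auto). lra.
Qed.

Lemma pow_fact_exp_sub1 y i : 0 <= y -> y ^ S i / INR (fact (S i)) <= exp y - 1.
Proof.
  intros Hy. pose proof (Rsum_le_Series (fun k => y ^ k / INR (fact k)) (S (S i))) as Q. rewrite Series_exp in Q.
  assert (P : forall n, 0 <= y ^ n / INR (fact n)) by (intros n; apply Rdiv_le_0_compat; [apply pow_le; auto|apply INR_fact_lt_0]).
  specialize (Q P (ex_series_exp _)). rewrite Rsum_S_l in Q.
  change (Rsum (fun k => y ^ S k / INR (fact (S k))) (S i)) with
    (Rsum (fun k => y ^ S k / INR (fact (S k))) i + y ^ S i / INR (fact (S i))) in Q.
  assert (0 <= Rsum (fun k => y ^ S k / INR (fact (S k))) i) by (apply Rsum_nonneg; intros; apply P).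
  simpl (y ^ 0 / INR (fact 0)) in Q. lra.
Qed.

(** With [y = |ln x|] and [k = S i], [y^k / k! = 2^-k (2 y)^k / k! <= 2^-k (e^(2 y) - 1)]. The
    gained [2^-k] makes the higher coefficients summable against the zeroth. *)
Lemma osc_S a i x : 0 < a <= 1 -> 0 < x ->
  Rabs (exp (a * ln x) * (ln x ^ S i / INR (fact (S i)))) <= (/ 2) ^ S i * 2 * om x.
Proof.
  intros Ha Hx. destruct (exp_a_ln a x Ha Hx) as [F1 F2]. destruct (om_cases x Hx) as [O1 O2].
  destruct (ln_abs_exp x Hx) as [_ [E1 E2]].
  assert (0 < / x) by (apply Rinv_0_lt_compat; auto).
  rewrite Rabs_mult, (Rabs_pos_eq (exp _)) by (left; apply exp_pos).
  unfold Rdiv. rewrite Rabs_mult, <- RPow_abs, (Rabs_pos_eq (/ INR _)) by (left; apply Rinv_0_lt_compat, INR_fact_lt_0).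
  set (y := Rabs (ln x)) in *. assert (Hy : 0 <= y) by apply Rabs_pos.
  pose proof (pow_fact_exp_sub1 (2 * y) i ltac:(lra)) as P. rewrite Rpow_mult_distr in P.
  assert (Q : y ^ S i * / INR (fact (S i)) = (/ 2) ^ S i * (2 ^ S i * y ^ S i / INR (fact (S i)))).
  { unfold Rdiv. rewrite <- !Rmult_assoc, <- Rpow_mult_distr, Rinv_l, pow1 by lra. ring. }
  rewrite Q. pose proof (exp_pos (a * ln x)). set (e := exp (a * ln x)) in *.
  assert (T : 0 < (/ 2) ^ S i) by (apply pow_lt; lra).
  apply Rle_trans with ((/ 2) ^ S i * (e * (exp (2 * y) - 1))).
  - replace (e * ((/ 2) ^ S i * (2 ^ S i * y ^ S i / INR (fact (S i))))) with
      ((/ 2) ^ S i * (e * (2 ^ S i * y ^ S i / INR (fact (S i))))) by ring.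
    apply Rmult_le_compat_l; [lra|]. apply Rmult_le_compat_l; lra.
  - rewrite Rmult_assoc. apply Rmult_le_compat_l; [lra|].
    replace (2 * y) with (y + y) by ring. rewrite exp_plus. destruct (Rle_dec 1 x) as [H1|H1].
    + rewrite E1 by auto. specialize (F1 H1). specialize (O1 H1). simpl in O1.
      apply Rle_trans with (x * (x * x - 1)); [apply Rmult_le_compat_r; nra|].
      apply Rle_trans with (2 * ((x - 1) * (x * (x * 1)))); [|lra].
      replace (x * (x * x - 1)) with ((x - 1) * (x * (x + 1))) by ring.
      replace (2 * ((x - 1) * (x * (x * 1)))) with ((x - 1) * (x * (2 * x))) by ring.
      apply Rmult_le_compat_l; [lra|]. apply Rmult_le_compat_l; lra.
    + rewrite E2 by lra. specialize (F2 ltac:(lra)). specialize (O2 ltac:(lra)). simpl in O2.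
      assert (I1 : 1 <= / x) by (rewrite <- Rinv_1; apply Rinv_le_contravar; lra).
      assert (X1 : x * / x = 1) by (apply Rinv_r; lra).
      apply Rle_trans with (1 * (/ x * / x - 1)); [apply Rmult_le_compat_r; nra|].
      apply Rle_trans with (2 * ((1 - x) * (/ x * (/ x * 1)))); [|lra].
      replace (1 * (/ x * / x - 1)) with ((1 - x) * (/ x * / x) * (1 + x)) by (field; lra).
      replace (2 * ((1 - x) * (/ x * (/ x * 1)))) with ((1 - x) * (/ x * / x) * 2) by ring.
      apply Rmult_le_compat_l; [|lra]. apply Rmult_le_pos; [lra|nra].
Qed.

Section Moments.
Variables (t a : R) (j : nat) (W : R).
(** The kernel has width about [j^(-1/2) <= 1 / W], so across it [x^(i t)] turns by an angle of
    about [1/48] at most. *)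
Hypothesis (Hj : (40 <= j)%nat) (Ha : 0 < a <= 1) (HW : 48 * (Rabs t + 1) <= W) (HWj : W ^ 2 <= INR j).

Lemma gam_S i : Cmod (gam t j a (S i)) <= (/ 2) ^ S i * (/ 4) * / INR j.
Proof.
  pose proof (Rabs_pos t).
  assert (P : 40 <= INR j) by (replace 40 with (INR 40) by (simpl; ring); apply le_INR; auto).
  assert (T : 0 < (/ 2) ^ S i) by (apply pow_lt; lra).
  apply (Ccvg_bound_loc _ _ _ 0 (gam_lim t j a (S i) 1 Hj Ha ltac:(lra))).
  intros n _. rewrite !Rmult_1_l.
  eapply Rle_trans; [apply (kern_integral_om t _ j _ _ ((/ 2) ^ S i * 2) W); auto|].
  - apply contpos_Hk.
  - apply inv_S_range.
  - apply INR_S_ge1.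
  - lra.
  - lra.
  - intros x Hx. pose proof (inv_S_range n). unfold Hk. rewrite Rabs_mult, (Rabs_pos_eq (kern j x)) by (apply kern_le_base; lra).
    apply Rmult_le_compat_l; [apply kern_le_base; lra|]. apply osc_S; auto; lra.
  - apply Rmult_le_compat_r; [left; apply Rinv_0_lt_compat; lra|]. rewrite Rmult_assoc. apply Rmult_le_compat_l; [lra|].
    apply Rmult_le_reg_r with W; [lra|]. unfold Rdiv. replace (2 * (6 * / W) * W) with 12 by (field; lra). lra.
Qed.

Lemma Aexp_decay c k : 0 < c -> exists B, 0 <= B /\ forall l, 0 <= l -> Aexp c k l <= B * exp (- (c / 2 * l)).
Proof.
  intros Hc. assert (0 < / c) by (apply Rinv_0_lt_compat; auto). induction k as [|k [B [HB IH]]].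
  - exists (/ c). split; [lra|]. intros l Hl. simpl. apply Rmult_le_compat_l; [lra|]. apply exp_le. nra.
  - assert (D : 0 < (c / 2) ^ S k) by (apply pow_lt; lra).
    exists (/ c * (/ (c / 2) ^ S k + B)). assert (0 < / (c / 2) ^ S k) by (apply Rinv_0_lt_compat; auto).
    split; [apply Rmult_le_pos; lra|]. intros l Hl. specialize (IH l Hl). cbn [Aexp].
    rewrite Rmult_assoc. apply Rmult_le_compat_l; [lra|]. rewrite Rmult_plus_distr_r. apply Rplus_le_compat; auto.
    pose proof (pow_fact_exp (c / 2) l (S k) ltac:(lra) Hl) as Q.
    apply Rle_trans with (exp (- (c * l)) * (exp (c / 2 * l) / (c / 2) ^ S k)); [apply Rmult_le_compat_l; [left; apply exp_pos|auto]|].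
    replace (- (c / 2 * l)) with (- (c * l) + c / 2 * l) by field. rewrite exp_plus. apply Req_le. field. lra.
Qed.

Lemma kern_mass_antideriv x : is_derive (fun x => c0 j * - (INR (fact j) * Aexp (INR j) j x)) x (kern j x).
Proof.
  assert (P : 40 <= INR j) by (replace 40 with (INR 40) by (simpl; ring); apply le_INR; auto).
  rewrite kern_c0. apply is_derive_scal. apply gamma_antideriv. lra.
Qed.

Lemma kern_mass al be : 0 < al <= be -> RInt (kern j) al be = c0 j * INR (fact j) * (Aexp (INR j) j al - Aexp (INR j) j be).
Proof.
  intros Hab. apply is_RInt_unique.
  replace (c0 j * INR (fact j) * (Aexp (INR j) j al - Aexp (INR j) j be)) with
    ((c0 j * - (INR (fact j) * Aexp (INR j) j be)) - (c0 j * - (INR (fact j) * Aexp (INR j) j al))) by ring.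
  apply (is_RInt_derive (fun x => c0 j * - (INR (fact j) * Aexp (INR j) j x)) (kern j)).
  - intros x _. apply kern_mass_antideriv.
  - intros x Hx. rewrite Rmin_left, Rmax_right in Hx by lra. apply contpos_kern. lra.
Qed.

Lemma kern_mass_lim : is_lim_seq (fun m => RInt (kern j) (/ INR (S m)) (INR (S m))) (/ INR j).
Proof.
  assert (P : 40 <= INR j) by (replace 40 with (INR 40) by (simpl; ring); apply le_INR; auto).
  apply (is_lim_seq_ext (fun m => c0 j * INR (fact j) * (Aexp (INR j) j (/ INR (S m)) - Aexp (INR j) j (INR (S m))))).
  { intros m. symmetry. apply kern_mass. pose proof (inv_S_range m). pose proof (INR_S_ge1 m). lra. }
  rewrite <- (c0_fact_mid j) by lia. apply (is_lim_seq_scal_l _ _ (/ INR j ^ S j)).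
  rewrite <- (Rminus_0_r (/ INR j ^ S j)).
  assert (IL : is_lim_seq (fun m => / INR (S m)) 0).
  { apply is_lim_seq_spec. intros [e He]. destruct (inv_S_small e He) as [N HN]. exists N. intros n Hn. cbn [pos].
    rewrite Rminus_0_r, Rabs_pos_eq by (left; apply inv_S_range). exact (HN n Hn). }
  apply is_lim_seq_minus'.
  - rewrite <- Aexp_0 by lra. apply (is_lim_seq_continuous (Aexp (INR j) j)); auto.
    apply continuity_pt_filterlim, (@ex_derive_continuous R_AbsRing R_NormedModule). eexists. apply Aexp_derive. lra.
  - destruct (Aexp_decay (INR j) j ltac:(lra)) as [B [HB HD]].
    apply (is_lim_seq_le_le (fun _ => 0) _ (fun m => B * / INR (S m))).
    + intros m. pose proof (INR_S_ge1 m). split; [apply Aexp_nonneg; lra|].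
      eapply Rle_trans; [apply HD; lra|]. apply Rmult_le_compat_l; auto.
      rewrite exp_Ropp. apply Rinv_le_contravar; [lra|].
      pose proof (exp_ineq1_le (INR j / 2 * INR (S m))). nra.
    + apply is_lim_seq_const.
    + replace (Finite 0) with (Finite (B * 0)) by (f_equal; ring). apply (is_lim_seq_scal_l _ B 0 IL).
Qed.

(** By [osc_0], replacing [x^(a + i t)] by 1 changes the real part of the integral by at most
    [1 / (8 j)], and the mass is [1 / j]. *)
Lemma gam_0 : 3 / 4 * / INR j <= Cmod (gam t j a 0).
Proof.
  pose proof (Rabs_pos t).
  assert (P : 40 <= INR j) by (replace 40 with (INR 40) by (simpl; ring); apply le_INR; auto).
  assert (I : 0 < / INR j) by (apply Rinv_0_lt_compat; lra).
  pose proof (gam_lim t j a 0 1 Hj Ha ltac:(lra)) as L.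
  set (f := fun x => kern j x * (exp (a * ln x) * cos (t * ln x) - 1)).
  assert (Cf : contpos f).
  { apply contpos_mult; [apply contpos_kern|]. apply contpos_derive. intros x Hx. auto_derive. auto. }
  assert (B : forall n, Rabs (Re (CI t (Hk j a 0) (1 * / INR (S n)) (1 * INR (S n))) - RInt (kern j) (/ INR (S n)) (INR (S n))) <= / 8 * / INR j).
  { intros n. rewrite !Rmult_1_l. pose proof (inv_S_range n) as R1. pose proof (INR_S_ge1 n) as R2.
    assert (Rg : 0 < / INR (S n) <= INR (S n)) by lra.
    apply Rle_trans with (Cmod (CI 0 f (/ INR (S n)) (INR (S n)))).
    - eapply Rle_trans; [|apply re_le_Cmod]. apply Req_le. f_equal. unfold CI, Re; cbn [fst].
      rewrite (RInt_ext (tcos 0 f) (fun x => tcos t (Hk j a 0) x + (-1) * kern j x)).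
      + rewrite (RInt_plus_pos _ (fun x => -1 * kern j x)), RInt_scal_pos; auto using contpos_cos, contpos_Hk, contpos_kern, contpos_mult, contpos_const.
        Rring.
      + intros x Hx. unfold tcos, f, Hk. rewrite Rmult_0_l, cos_0. simpl. match goal with |- @eq _ ?a ?b => change (@eq R a b) end. field.
    - eapply Rle_trans; [apply (kern_integral_om 0 f j _ _ (Rabs t + 1) W); auto; try lra|].
      + intros x Hx. unfold f. rewrite Rabs_mult, (Rabs_pos_eq (kern j x)) by (apply kern_le_base; lra).
        apply Rmult_le_compat_l; [apply kern_le_base; lra|]. apply osc_0; auto; lra.
      + apply Rmult_le_compat_r; [lra|]. apply Rmult_le_reg_r with W; [lra|].
        replace ((Rabs t + 1) * (6 / W) * W) with (6 * (Rabs t + 1)) by (field; lra). lra. }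
  apply Rnot_lt_le. intros Hlt. set (g := gam t j a 0) in *.
  destruct (L (/ 32 * / INR j)) as [N HN]; [lra|].
  pose proof kern_mass_lim as ML. apply is_lim_seq_spec in ML.
  assert (X : 0 < / 32 * / INR j) by lra. destruct (ML (mkposreal _ X)) as [N' HN'].
  specialize (HN (N + N')%nat ltac:(lia)). specialize (HN' (N + N')%nat ltac:(lia)). specialize (B (N + N')%nat).
  set (n := (N + N')%nat) in *. set (v := CI t (Hk j a 0) (1 * / INR (S n)) (1 * INR (S n))) in *.
  set (m := RInt (kern j) (/ INR (S n)) (INR (S n))) in *. simpl pos in HN'.
  apply Rabs_lt_between in HN'. apply Rabs_le_between in B.
  pose proof (re_le_Cmod v) as V1. pose proof (Rle_abs (Re v)) as V2.
  assert (V3 : Cmod v <= Cmod (v - g) + Cmod g).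
  { replace v with ((v - g) + g)%C at 1 by ring. apply Cmod_triangle. }
  lra.
Qed.

End Moments.

(** * Mellin transform of the smoothed sums *)

Lemma pow_fact_plus x y k : (x + y) ^ k / INR (fact k)
  = Rsum (fun i => x ^ i / INR (fact i) * (y ^ (k - i) / INR (fact (k - i)))) (S k).
Proof.
  apply RtoC_inj. rewrite RtoC_Rsum, <- expt_RtoC, expt_plus. apply Csum_ext. intros i _.
  rewrite !expt_RtoC, RtoC_mult. reflexivity.
Qed.

Lemma Rcpow_s0 a t c : 0 < c -> Rcpow c (- ((1 + a)%R, t)) = (RtoC (/ c * exp (- (a * ln c))) * cis (- (t * ln c)))%C.
Proof.
  intros Hc. unfold Rcpow, Cexp, cis.
  replace (/ c) with (exp (- ln c)) by (rewrite exp_Ropp, exp_ln; auto). rewrite <- exp_plus.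
  replace (Re (- ((1 + a)%R, t) * RtoC (ln c))%C) with (- ln c + - (a * ln c)) by (unfold Re; simpl; ring).
  replace (Im (- ((1 + a)%R, t) * RtoC (ln c))%C) with (- (t * ln c)) by (unfold Im; simpl; ring).
  apply injective_projections; simpl; ring.
Qed.

(** After rescaling by [c = n + 1], [ln x = ln (c x) - ln c] splits the power of the logarithm
    binomially: Taylor coefficients of [c^-s] times those of the kernel transform. *)
Lemma CI_kern_shift t a j k n al be : 0 < al <= be ->
  CI t (fun x => kern j (INR (S n) * x) * (exp (a * ln x) * (ln x ^ k / INR (fact k)))) al be
  = Csum (fun i => dterm ((1 + a)%R, t) (k - i) n * CI t (Hk j a i) (INR (S n) * al) (INR (S n) * be))%C (S k).
Proof.
  intros Hab. set (c := INR (S n)). assert (Hc : 1 <= c) by apply INR_S_ge1.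
  set (co := fun i => exp (- (a * ln c)) * ((- ln c) ^ (k - i) / INR (fact (k - i)))).
  rewrite (CI_ext t _ (fun x => Rsum (fun i => co i * Hk j a i (c * x)) (S k))); auto.
  - rewrite (CI_Rsum t (fun i x => co i * Hk j a i (c * x))); auto.
    + apply Csum_ext. intros i _. rewrite CI_scal; auto; [|apply contpos_scale; [lra|apply contpos_Hk]].
      rewrite CI_scale; auto; [|apply contpos_Hk|lra]. unfold dterm. fold c. rewrite Rcpow_s0, expt_RtoC by lra.
      unfold co. rewrite !RtoC_mult. ring.
    + intros i. apply contpos_mult; [apply contpos_const|]. apply contpos_scale; [lra|apply contpos_Hk].
  - intros x Hx. assert (L : ln x = ln (c * x) + - ln c) by (rewrite ln_mult by lra; ring).
    rewrite L at 2. rewrite pow_fact_plus.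
    replace (exp (a * ln x)) with (exp (- (a * ln c)) * exp (a * ln (c * x))) by (rewrite <- exp_plus; f_equal; rewrite L; ring).
    rewrite <- Rmult_assoc. rewrite <- Rsum_scal. apply Rsum_ext. intros i _. unfold co, Hk. ring.
Qed.

Definition isq (n : nat) : R := (/ INR (S n)) ^ 2.

Lemma isq_nonneg n : 0 <= isq n.
Proof. apply pow2_ge_0. Qed.

Lemma Rsum_isq N : Rsum isq (S N) <= 2 - / INR (S N).
Proof.
  induction N as [|N IH]; [unfold isq; simpl; lra|].
  change (Rsum isq (S (S N))) with (Rsum isq (S N) + isq (S N)). pose proof (INR_S_ge1 N).
  assert (isq (S N) <= / INR (S N) - / INR (S (S N))); [|lra].
  unfold isq. rewrite (S_INR (S N)). set (x := INR (S N)) in *.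
  replace (/ x - / (x + 1)) with (/ (x * (x + 1))) by (field; lra). rewrite pow_inv.
  apply Rinv_le_contravar; simpl; nra.
Qed.

Lemma ex_series_isq : ex_series isq.
Proof.
  apply (ex_series_Rsum_bound isq 2); [apply isq_nonneg|]. intros [|n]; [simpl; lra|].
  pose proof (Rsum_isq n). pose proof (inv_S_range n). lra.
Qed.

Lemma Series_isq : Series isq <= 2.
Proof.
  pose proof (Series_lim isq ex_series_isq) as L.
  apply (is_lim_seq_le (Rsum isq) (fun _ => 2) (Series isq) 2); auto; [|apply is_lim_seq_const].
  intros [|n]; [simpl; lra|]. pose proof (Rsum_isq n). pose proof (inv_S_range n). lra.
Qed.

Lemma ee_kern_bound j tau n : (40 <= j)%nat -> 0 < tau ->
  Rabs (ee (S n) * kern j (INR (S n) * tau)) <= 64 * (/ tau) ^ 6 * isq n.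
Proof.
  intros Hj Ht. pose proof (INR_S_ge1 n) as P. rewrite Rabs_mult.
  assert (X : 0 < INR (S n) * tau) by nra.
  destruct (kern_le_pow' j _ ltac:(lia) X) as [K0 K1]. rewrite (Rabs_pos_eq (kern _ _)) by auto.
  apply Rle_trans with (INR (S n) * (64 * (/ (INR (S n) * tau)) ^ 6)).
  - apply Rmult_le_compat; auto; [apply Rabs_pos|apply ee_le].
  - rewrite Rinv_mult, Rpow_mult_distr. unfold isq. set (y := / INR (S n)).
    assert (Hy : 0 < y <= 1) by apply inv_S_range. assert (E : INR (S n) * y = 1) by (apply Rinv_r; lra).
    replace (INR (S n) * (64 * (y ^ 6 * (/ tau) ^ 6))) with (64 * (/ tau) ^ 6 * ((INR (S n) * y) * y ^ 5)) by ring.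
    rewrite E, Rmult_1_l. apply Rmult_le_compat_l.
    + apply Rmult_le_pos; [lra|]. apply pow_le. left; apply Rinv_0_lt_compat; auto.
    + replace (y ^ 5) with (y ^ 2 * y ^ 3) by ring. assert (y ^ 3 <= 1) by (rewrite <- (pow1 3); apply pow_incr; lra).
      assert (0 <= y ^ 2) by apply pow2_ge_0. nra.
Qed.

Lemma bq_large j tau : (40 <= j)%nat -> 0 < tau -> Cmod (bq j tau) <= 128 * (/ tau) ^ 6.
Proof.
  intros Hj Ht. assert (T : 0 <= (/ tau) ^ 6) by (apply pow_le; left; apply Rinv_0_lt_compat; auto).
  eapply Rle_trans; [apply (dom_bound _ (fun n => 64 * (/ tau) ^ 6 * isq n))|].
  - intros n. rewrite Cmod_R. apply ee_kern_bound; auto.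
  - apply ex_series_scal', ex_series_isq.
  - rewrite Series_scal_l. pose proof Series_isq. nra.
Qed.

(** Integrals are taken of finite sums only; [tl N] measures what truncation at [N] omits and is
    sent to 0 in [gam_conv]. *)
Definition SN (j N : nat) (x : R) : R := Rsum (fun n => ee (S n) * kern j (INR (S n) * x)) N.
Definition tl (N : nat) : R := Series isq - Rsum isq N.

Lemma tl_nonneg N : 0 <= tl N.
Proof. unfold tl. pose proof (Rsum_le_Series isq N isq_nonneg ex_series_isq). lra. Qed.

Lemma SN_bound j N tau : (40 <= j)%nat -> 0 < tau -> Rabs (SN j N tau) <= Cmod (bq j tau) + 64 * (/ tau) ^ 6 * tl N.
Proof.
  intros Hj Ht. pose proof (dom_tail (fun n => RtoC (ee (S n) * kern j (INR (S n) * tau))) (fun n => 64 * (/ tau) ^ 6 * isq n) N) as D.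
  specialize (D (fun n => Rle_trans _ _ _ (Req_le _ _ (Cmod_R _)) (ee_kern_bound j tau n Hj Ht)) (ex_series_scal' _ _ ex_series_isq)).
  rewrite Series_scal_l, Rsum_scal, <- Rmult_minus_distr_l in D. fold (tl N) in D. fold (bq j tau) in D.
  rewrite <- RtoC_Rsum in D. fold (SN j N tau) in D.
  rewrite <- Cmod_R. replace (RtoC (SN j N tau)) with (bq j tau - (bq j tau - RtoC (SN j N tau)))%C by ring.
  eapply Rle_trans; [apply Cmod_triangle|]. rewrite Cmod_opp. lra.
Qed.

Lemma contpos_SN j N : contpos (SN j N).
Proof.
  apply (contpos_Rsum (fun n x => ee (S n) * kern j (INR (S n) * x))). intros n.
  apply contpos_mult; [apply contpos_const|]. apply contpos_scale; [pose proof (INR_S_ge1 n); lra|apply contpos_kern].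
Qed.

Lemma is_derive_Rsum (f f' : nat -> R -> R) P x : (forall i, (i < P)%nat -> is_derive (f i) x (f' i x)) ->
  is_derive (fun x => Rsum (fun i => f i x) P) x (Rsum (fun i => f' i x) P).
Proof.
  induction P as [|P IH]; intros H; simpl; [apply (@is_derive_const R_AbsRing R_NormedModule)|].
  apply (is_derive_plus (V := R_NormedModule)); auto.
Qed.

Section Mellin.
Variables (t a : R) (j : nat) (P : nat) (Kc la : nat -> R).
Hypothesis (Hj : (40 <= j)%nat) (Ha : 0 < a <= 1).
Hypothesis (HKc : forall i, (i < P)%nat -> 0 <= Kc i) (Hla : forall i, (i < P)%nat -> 0 < a + la i <= 1).
Hypothesis (Hb : forall tau, 0 < tau <= 1 -> Cmod (bq j tau) * tau <= Rsum (fun i => Kc i * exp (la i * ln tau)) P).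

(** A bound [Kc tau^(la - 1)] for [tau <= 1] contributes [Kc / (a + la)^(k+1)] to the [k]-th
    coefficient, as if the transform were regular up to radius [a + la]; 128 comes from
    [tau >= 1]. *)
Definition JK (k : nat) : R := Rsum (fun i => Kc i * / (a + la i) ^ S k) P + 128.

Definition wt (k : nat) (x : R) : R := exp (a * ln x) * (ln x ^ k / INR (fact k)).

Lemma contpos_wt k : contpos (wt k).
Proof. apply contpos_derive. intros x Hx. unfold wt. auto_derive. auto. Qed.

Lemma wt_bound k x Y : 1 <= Y -> / Y <= x <= Y -> Rabs (wt k x) <= Y * Y.
Proof.
  intros HY Hx. assert (0 < / Y) by (apply Rinv_0_lt_compat; lra). assert (Hx0 : 0 < x) by lra.
  unfold wt. rewrite Rabs_mult, (Rabs_pos_eq (exp _)) by (left; apply exp_pos).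
  pose proof (ln_pow_fact_le x k) as L. destruct (ln_abs_exp x Hx0) as [_ [E1 E2]]. destruct (exp_a_ln a x Ha Hx0) as [F1 F2].
  assert (/ x <= Y) by (rewrite <- (Rinv_inv Y); apply Rinv_le_contravar; lra).
  apply Rmult_le_compat; [left; apply exp_pos|apply Rabs_pos| |].
  - destruct (Rle_dec 1 x) as [h|h]; [specialize (F1 h)|specialize (F2 ltac:(lra))]; lra.
  - eapply Rle_trans; [apply L|]. destruct (Rle_dec 1 x) as [h|h]; [rewrite E1|rewrite E2]; lra.
Qed.

(** The majorant of the full sum is a combination of powers of [x] and [- ln x] that [Aexp]
    integrates; the term growing with [Y] is the truncation error. *)
Lemma mellin_small k N Y : 1 <= Y ->
  Cmod (CI t (fun x => SN j N x * wt k x) (/ Y) 1) <= Rsum (fun i => Kc i * / (a + la i) ^ S k) P + 64 * Y ^ 9 * tl N.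
Proof.
  intros HY. assert (IY : 0 < / Y <= 1) by (split; [apply Rinv_0_lt_compat; lra|rewrite <- Rinv_1; apply Rinv_le_contravar; lra]).
  pose proof (tl_nonneg N) as TN. set (T := 64 * Y ^ 6 * tl N * (Y * Y)).
  assert (HT : 0 <= T) by (unfold T; repeat apply Rmult_le_pos; try lra; apply pow_le; lra).
  set (g := fun x => Rsum (fun i => Kc i * (exp ((a + la i - 1) * ln x) * ((- ln x) ^ k / INR (fact k)))) P + T).
  set (Gp := fun x => Rsum (fun i => Kc i * Aexp (a + la i) k (- ln x)) P + T * x).
  eapply Rle_trans; [apply (CI_bound t _ g Gp)|].
  - apply contpos_mult; [apply contpos_SN|apply contpos_wt].
  - apply contpos_plus; [|apply contpos_const].
    apply (contpos_Rsum (fun i x => Kc i * (exp ((a + la i - 1) * ln x) * ((- ln x) ^ k / INR (fact k))))).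
    intros i. apply contpos_derive. intros x Hx. auto_derive. auto.
  - auto.
  - intros x Hx. assert (Hx0 : 0 < x) by lra. rewrite Rabs_mult.
    pose proof (SN_bound j N x Hj Hx0) as S1. pose proof (wt_bound k x Y HY ltac:(lra)) as W1. pose proof (Rabs_pos (wt k x)) as W0.
    assert (X6 : (/ x) ^ 6 <= Y ^ 6).
    { apply pow_incr. split; [left; apply Rinv_0_lt_compat; auto|]. rewrite <- (Rinv_inv Y). apply Rinv_le_contravar; lra. }
    apply Rle_trans with ((Cmod (bq j x) + 64 * Y ^ 6 * tl N) * Rabs (wt k x)).
    { apply Rmult_le_compat_r; auto. eapply Rle_trans; [apply S1|]. apply Rplus_le_compat_l.
      apply Rmult_le_compat_r; auto. lra. }
    rewrite Rmult_plus_distr_r. unfold g. apply Rplus_le_compat.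
    + assert (ln x <= 0) by (rewrite <- ln_1; apply ln_le; lra).
      assert (Wx : Rabs (wt k x) = x * (exp ((a - 1) * ln x) * ((- ln x) ^ k / INR (fact k)))).
      { unfold wt, Rdiv. rewrite !Rabs_mult, <- RPow_abs, (Rabs_pos_eq (exp _)), (Rabs_pos_eq (/ _)), (Rabs_left1 (ln x));
          [|auto|left; apply Rinv_0_lt_compat, INR_fact_lt_0|left; apply exp_pos].
        replace (a * ln x) with (ln x + (a - 1) * ln x) by ring. rewrite exp_plus, exp_ln by auto. ring. }
      rewrite Wx, <- Rmult_assoc.
      assert (Q : 0 <= exp ((a - 1) * ln x) * ((- ln x) ^ k / INR (fact k))).
      { apply Rmult_le_pos; [left; apply exp_pos|]. apply Rdiv_le_0_compat; [apply pow_le; lra|apply INR_fact_lt_0]. }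
      eapply Rle_trans; [apply Rmult_le_compat_r; [exact Q|apply Hb; lra]|].
      rewrite Rmult_comm, <- Rsum_scal. apply Req_le, Rsum_ext. intros i _.
      replace ((a + la i - 1) * ln x) with ((a - 1) * ln x + la i * ln x) by ring. rewrite exp_plus. ring.
    + unfold T. apply Rmult_le_compat_l; auto. apply Rmult_le_pos; auto. apply Rmult_le_pos; [lra|apply pow_le; lra].
  - intros x Hx. unfold Gp, g. apply (is_derive_plus (V := R_NormedModule)).
    + apply (is_derive_Rsum (fun i x => Kc i * Aexp (a + la i) k (- ln x))
        (fun i x => Kc i * (exp ((a + la i - 1) * ln x) * ((- ln x) ^ k / INR (fact k))))).
      intros i Hi. apply is_derive_scal. apply Aexp_small_derive; [apply Hla; auto|lra].
    + auto_derive; auto. ring.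
  - unfold Gp. rewrite ln_1, Ropp_0.
    assert (A1 : Rsum (fun i => Kc i * Aexp (a + la i) k 0) P = Rsum (fun i => Kc i * / (a + la i) ^ S k) P).
    { apply Rsum_ext. intros i Hi. rewrite Aexp_0; auto. apply Hla; auto. }
    assert (A2 : 0 <= Rsum (fun i => Kc i * Aexp (a + la i) k (- ln (/ Y))) P).
    { apply Rsum_nonneg. intros i Hi. apply Rmult_le_pos; auto. apply Aexp_nonneg; [apply Hla; auto|].
      rewrite ln_Rinv, Ropp_involutive by lra. apply ln_ge0; auto. }
    rewrite A1. assert (T * 1 <= 64 * Y ^ 9 * tl N).
    { unfold T. replace (64 * Y ^ 6 * tl N * (Y * Y) * 1) with (64 * tl N * Y ^ 8) by ring.
      replace (64 * Y ^ 9 * tl N) with (64 * tl N * Y ^ 9) by ring. apply Rmult_le_compat_l; [lra|].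
      apply Rle_pow; auto. }
    assert (0 <= T * / Y) by (apply Rmult_le_pos; lra). lra.
Qed.

Lemma mellin_large k N Y : 1 <= Y ->
  Cmod (CI t (fun x => SN j N x * wt k x) 1 Y) <= 128 + 64 * Y ^ 9 * tl N.
Proof.
  intros HY. assert (IY : 0 < / Y <= 1) by (split; [apply Rinv_0_lt_compat; lra|rewrite <- Rinv_1; apply Rinv_le_contravar; lra]).
  pose proof (tl_nonneg N) as TN. set (T := 64 * tl N * (Y * Y)).
  assert (HT : 0 <= T) by (unfold T; repeat apply Rmult_le_pos; lra).
  set (g := fun x => 128 * (exp (- (1 + 1) * ln x) * (ln x ^ k / INR (fact k))) + T).
  set (Gp := fun x => 128 * - Aexp 1 k (ln x) + T * x).
  eapply Rle_trans; [apply (CI_bound t _ g Gp)|].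
  - apply contpos_mult; [apply contpos_SN|apply contpos_wt].
  - apply contpos_derive. intros x Hx. unfold g. auto_derive. auto.
  - lra.
  - intros x Hx. assert (Hx0 : 0 < x) by lra. rewrite Rabs_mult.
    pose proof (SN_bound j N x Hj Hx0) as S1. pose proof (wt_bound k x Y HY ltac:(lra)) as W1. pose proof (Rabs_pos (wt k x)) as W0.
    pose proof (bq_large j x Hj Hx0) as BL.
    assert (I1 : 0 < / x <= 1) by (split; [apply Rinv_0_lt_compat; lra|rewrite <- Rinv_1; apply Rinv_le_contravar; lra]).
    assert (X6 : (/ x) ^ 6 <= 1) by (rewrite <- (pow1 6); apply pow_incr; lra).
    apply Rle_trans with ((128 * (/ x) ^ 6 + 64 * tl N) * Rabs (wt k x)).
    { apply Rmult_le_compat_r; auto. eapply Rle_trans; [apply S1|]. apply Rplus_le_compat; auto.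
      apply Rmult_le_compat_r; auto. lra. }
    rewrite Rmult_plus_distr_r. unfold g. apply Rplus_le_compat.
    + assert (0 <= ln x) by (apply ln_ge0; lra).
      assert (LK : 0 <= ln x ^ k / INR (fact k)) by (apply Rdiv_le_0_compat; [apply pow_le; lra|apply INR_fact_lt_0]).
      unfold wt. rewrite Rabs_pos_eq by (apply Rmult_le_pos; [left; apply exp_pos|auto]).
      rewrite Rmult_assoc. apply Rmult_le_compat_l; [lra|]. rewrite <- Rmult_assoc. apply Rmult_le_compat_r; auto.
      destruct (exp_a_ln a x Ha Hx0) as [F1 _]. specialize (F1 ltac:(lra)).
      replace (exp (- (1 + 1) * ln x)) with ((/ x) ^ 2).
      * replace ((/ x) ^ 6) with ((/ x) ^ 2 * (/ x) ^ 3 * / x) by ring. rewrite (Rmult_assoc _ (/ x)), Rmult_assoc.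
        apply Rle_trans with ((/ x) ^ 2 * 1); [|lra]. apply Rmult_le_compat_l; [apply pow2_ge_0|].
        assert ((/ x) ^ 3 <= 1) by (rewrite <- (pow1 3); apply pow_incr; lra). assert (0 <= (/ x) ^ 3) by (apply pow_le; lra).
        assert (/ x * exp (a * ln x) <= 1).
        { apply Rle_trans with (/ x * x); [apply Rmult_le_compat_l; lra|rewrite Rinv_l; lra]. }
        assert (0 <= / x * exp (a * ln x)) by (apply Rmult_le_pos; lra). nra.
      * replace (- (1 + 1) * ln x) with (- ln x + - ln x) by ring. rewrite exp_plus, exp_Ropp, exp_ln by auto. ring.
    + unfold T. apply Rmult_le_compat_l; auto. lra.
  - intros x Hx. unfold Gp, g. apply (is_derive_plus (V := R_NormedModule)).
    + apply is_derive_scal. apply Aexp_large_derive; lra.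
    + auto_derive; auto. ring.
  - unfold Gp. rewrite ln_1, Aexp_0, pow1, Rinv_1 by lra.
    assert (0 <= Aexp 1 k (ln Y)) by (apply Aexp_nonneg; [lra|apply ln_ge0; auto]).
    assert (T * Y <= 64 * Y ^ 9 * tl N).
    { unfold T. replace (64 * tl N * (Y * Y) * Y) with (64 * tl N * Y ^ 3) by ring.
      replace (64 * Y ^ 9 * tl N) with (64 * tl N * Y ^ 9) by ring. apply Rmult_le_compat_l; [lra|].
      apply Rle_pow; auto. lia. }
    lra.
Qed.

Lemma mellin_bound k N m : Cmod (Csum (fun n => RtoC (ee (S n)) * Csum (fun i => dterm ((1 + a)%R, t) (k - i) n *
    CI t (Hk j a i) (INR (S n) * / INR (S m)) (INR (S n) * INR (S m))) (S k)) N)%C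
  <= JK k + 128 * INR (S m) ^ 9 * tl N.
Proof.
  pose proof (INR_S_ge1 m) as HY. pose proof (inv_S_range m) as IY. set (Y := INR (S m)) in *.
  assert (E : CI t (fun x => SN j N x * wt k x) (/ Y) Y = Csum (fun n => RtoC (ee (S n)) * Csum (fun i => dterm ((1 + a)%R, t) (k - i) n *
    CI t (Hk j a i) (INR (S n) * / Y) (INR (S n) * Y)) (S k))%C N).
  { assert (CK : forall n, contpos (fun x => kern j (INR (S n) * x) * wt k x)).
    { intros n. apply contpos_mult; [|apply contpos_wt]. apply contpos_scale; [pose proof (INR_S_ge1 n); lra|apply contpos_kern]. }
    rewrite (CI_ext t _ (fun x => Rsum (fun n => ee (S n) * (kern j (INR (S n) * x) * wt k x)) N)) by
      (try lra; intros x Hx; unfold SN; rewrite Rmult_comm, <- Rsum_scal; apply Rsum_ext; intros; ring).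
    rewrite (CI_Rsum t (fun n x => ee (S n) * (kern j (INR (S n) * x) * wt k x))); [| |lra].
    - apply Csum_ext. intros n _. rewrite CI_scal by (auto; lra). f_equal. apply CI_kern_shift. lra.
    - intros n. apply contpos_mult; [apply contpos_const|auto]. }
  rewrite <- E. rewrite (CI_Chasles t _ (/ Y) 1 Y); [|apply contpos_mult; [apply contpos_SN|apply contpos_wt]|lra|lra].
  eapply Rle_trans; [apply Cmod_triangle|]. pose proof (mellin_small k N Y HY). pose proof (mellin_large k N Y HY).
  unfold JK. lra.
Qed.

Lemma tl_lim : is_lim_seq tl 0.
Proof.
  unfold tl. replace (Finite 0) with (Finite (Series isq - Series isq)) by (f_equal; ring).
  apply is_lim_seq_minus'; [apply is_lim_seq_const|apply Series_lim, ex_series_isq].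
Qed.

(** The coefficient form of the identity that the transform of [bq] is the transform of the kernel
    times the Dirichlet series of [Lambda - 1]. First [N] tends to infinity with [Y = m + 1] fixed,
    which removes the term with [tl N], and then [m] does. *)
Lemma gam_conv k : Cmod (Csum (fun i => gam t j a i * epsc ((1 + a)%R, t) (k - i)) (S k))%C <= JK k.
Proof.
  set (s0 := ((1 + a)%R, t) : C). assert (Hs : 1 + a <= Re s0) by (simpl; lra).
  set (MM := fun n => Rsum (fun i => 256 * DM a (k - i) n) (S k)).
  assert (EM : ex_series MM).
  { unfold MM. assert (G : forall K, ex_series (fun n => Rsum (fun i => 256 * DM a (k - i) n) K)).
    { induction K as [|K IH]; simpl.
      - apply (ex_series_ext' (fun n => 0 * DM a 0 n)); [intros; ring|]. apply ex_series_scal', DM_ex. lra.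
      - apply ex_series_plus'; auto. apply ex_series_scal', DM_ex. lra. }
    apply G. }
  assert (Bd : forall (z : nat -> C) n, (forall i, Cmod (z i) <= 256) ->
    Cmod (RtoC (ee (S n)) * Csum (fun i => dterm s0 (k - i) n * z i)%C (S k)) <= MM n).
  { intros z n Hz. rewrite <- Csum_scal. apply Cmod_Csum_le. intros i _.
    replace (RtoC (ee (S n)) * (dterm s0 (k - i) n * z i))%C with (z i * (RtoC (ee (S n)) * dterm s0 (k - i) n))%C by ring.
    rewrite Cmod_mult. apply Rmult_le_compat; try apply Cmod_ge_0; auto.
    apply (Lambda_dterm_bound s0 a (k - i) n (ee (S n))); auto; [lra|]. exact (Lambda1_abs n). }
  set (aa := fun m n => (RtoC (ee (S n)) * Csum (fun i => dterm s0 (k - i) n *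
    CI t (Hk j a i) (INR (S n) * / INR (S m)) (INR (S n) * INR (S m))) (S k))%C).
  assert (Zb : forall m n i, Cmod (CI t (Hk j a i) (INR (S n) * / INR (S m)) (INR (S n) * INR (S m))) <= 256).
  { intros m n i. pose proof (inv_S_range m). pose proof (INR_S_ge1 m). pose proof (INR_S_ge1 n).
    assert (R1 : 0 < INR (S n) * / INR (S m)) by (apply Rmult_lt_0_compat; lra).
    assert (R2 : INR (S n) * / INR (S m) <= INR (S n) * INR (S m)) by (apply Rmult_le_compat_l; lra).
    eapply Rle_trans; [apply CI_Hk_bound; auto|].
    set (x := INR (S n) * / INR (S m)) in *. set (y := INR (S n) * INR (S m)) in *.
    assert (/ (1 + x) <= 1) by (rewrite <- Rinv_1; apply Rinv_le_contravar; lra).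
    assert (0 < / (1 + y)) by (apply Rinv_0_lt_compat; lra). lra. }
  assert (Ba : forall m n, Cmod (aa m n) <= MM n) by (intros m n; apply Bd; intros; apply Zb).
  assert (St1 : forall m, Cmod (CS (aa m)) <= JK k).
  { intros m. pose proof (dom_cv (aa m) MM (Ba m) EM) as L. apply Rnot_lt_le. intros Hlt.
    set (d := Cmod (CS (aa m)) - JK k). assert (Hd : 0 < d) by (unfold d; lra).
    destruct (L (d / 2)) as [N1 H1]; [lra|].
    pose proof tl_lim as TL. apply is_lim_seq_spec in TL.
    assert (YY : 0 < 128 * INR (S m) ^ 9) by (apply Rmult_lt_0_compat; [lra|apply pow_lt; pose proof (INR_S_ge1 m); lra]).
    assert (Hd2 : 0 < d / 2 / (128 * INR (S m) ^ 9)) by (apply Rdiv_lt_0_compat; lra).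
    destruct (TL (mkposreal _ Hd2)) as [N2 H2].
    specialize (H1 (N1 + N2)%nat ltac:(lia)). specialize (H2 (N1 + N2)%nat ltac:(lia)). cbn [pos] in H2.
    rewrite Rminus_0_r in H2. rewrite Rabs_pos_eq in H2 by apply tl_nonneg.
    pose proof (mellin_bound k (N1 + N2) m) as MB. fold s0 in MB. fold (aa m) in MB.
    assert (X : 128 * INR (S m) ^ 9 * tl (N1 + N2) < d / 2).
    { apply Rlt_le_trans with (128 * INR (S m) ^ 9 * (d / 2 / (128 * INR (S m) ^ 9))); [apply Rmult_lt_compat_l; auto|].
      set (y9 := 128 * INR (S m) ^ 9) in *. apply Req_le. field. lra. }
    change (Csum (fun n => aa m n) (N1 + N2)) with (Csum (aa m) (N1 + N2)) in *.
    assert (V : Cmod (CS (aa m)) <= Cmod (Csum (aa m) (N1 + N2) - CS (aa m)) + Cmod (Csum (aa m) (N1 + N2))).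
    { replace (CS (aa m)) with (- (Csum (aa m) (N1 + N2) - CS (aa m)) + Csum (aa m) (N1 + N2))%C at 1 by ring.
      eapply Rle_trans; [apply Cmod_triangle|]. rewrite Cmod_opp. lra. }
    unfold d in *. lra. }
  assert (Tn : Ccvg (fun m => CS (aa m)) (CS (fun n => RtoC (ee (S n)) * Csum (fun i => dterm s0 (k - i) n * gam t j a i) (S k))%C)).
  { apply (tannery aa _ MM); auto. intros n. unfold aa. apply Ccvg_scal.
    assert (G : forall K, Ccvg (fun m => Csum (fun i => dterm s0 (k - i) n * CI t (Hk j a i) (INR (S n) * / INR (S m)) (INR (S n) * INR (S m)))%C K)
       (Csum (fun i => dterm s0 (k - i) n * gam t j a i)%C K)).
    { induction K as [|K IH]; cbn [Csum]; [apply Ccvg_const|]. apply Ccvg_plus; auto. apply Ccvg_scal.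
      apply gam_lim; auto. apply INR_S_ge1. }
    apply G. }
  assert (F : CS (fun n => RtoC (ee (S n)) * Csum (fun i => dterm s0 (k - i) n * gam t j a i) (S k))%C
    = Csum (fun i => gam t j a i * epsc s0 (k - i))%C (S k)).
  { assert (Eb : forall i n, Cmod (RtoC (Lambda (S n) - 1) * dterm s0 (k - i) n) <= DM a (k - i) n).
    { intros i n. apply Lambda_dterm_bound; auto; [lra|apply Lambda1_abs]. }
    rewrite (CS_ext _ (fun n => Csum (fun i => gam t j a i * (RtoC (Lambda (S n) - 1) * dterm s0 (k - i) n)) (S k))%C).
    - rewrite (CS_Csum (fun i n => gam t j a i * (RtoC (Lambda (S n) - 1) * dterm s0 (k - i) n))%C (fun i n => Cmod (gam t j a i) * DM a (k - i) n)).
      + apply Csum_ext. intros i _. unfold epsc. apply (CS_scal _ _ (DM a (k - i))); auto. apply DM_ex; lra.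
      + intros i n _. rewrite Cmod_mult. apply Rmult_le_compat_l; [apply Cmod_ge_0|auto].
      + intros i _. apply ex_series_scal', DM_ex. lra.
    - intros n. rewrite <- Csum_scal. apply Csum_ext. intros i _. change (ee (S n)) with (Lambda (S n) - 1). ring. }
  rewrite <- F. apply (Ccvg_bound_loc _ _ _ 0 Tn). intros m _. apply St1.
Qed.

Lemma JK_mono k i : (i <= k)%nat -> 0 <= JK i <= JK k.
Proof.
  intros Hik. unfold JK. split.
  - apply Rplus_le_le_0_compat; [|lra]. apply Rsum_nonneg. intros l Hl. apply Rmult_le_pos; auto.
    left. apply Rinv_0_lt_compat, pow_lt. apply Hla; auto.
  - apply Rplus_le_compat_r. apply Rsum_le. intros l Hl. apply Rmult_le_compat_l; auto. specialize (Hla l Hl).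
    apply Rinv_le_contravar; [apply pow_lt; lra|].
    replace (S k) with (S i + (k - i))%nat by lia. rewrite pow_add.
    assert (0 < (a + la l) ^ S i) by (apply pow_lt; lra).
    assert ((a + la l) ^ (k - i) <= 1) by (rewrite <- (pow1 (k - i)); apply pow_incr; lra).
    assert (0 < (a + la l) ^ (k - i)) by (apply pow_lt; lra). nra.
Qed.

Variable W : R.
Hypothesis (HW : 48 * (Rabs t + 1) <= W) (HWj : W ^ 2 <= INR j).

Lemma half_sum k : Rsum (fun i => (/ 2) ^ S i) k <= 1.
Proof.
  assert (E : Rsum (fun i => (/ 2) ^ S i) k = 1 - (/ 2) ^ k).
  { induction k as [|k IH]; [simpl; ring|]. cbn [Rsum]. rewrite IH. simpl. field. }
  rewrite E. assert (0 < (/ 2) ^ k) by (apply pow_lt; lra). lra.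
Qed.

(** Inverts the triangular system of [gam_conv] by induction: the terms with [i >= 1] add up to at
    most [JK k / 2], and dividing by the zeroth coefficient, at least [3 / (4 j)], gives [2 j]. *)
Lemma epsc_bound k : Cmod (epsc ((1 + a)%R, t) k) <= 2 * INR j * JK k.
Proof.
  assert (Pj : 40 <= INR j) by (replace 40 with (INR 40) by (simpl; ring); apply le_INR; auto).
  assert (I : 0 < / INR j) by (apply Rinv_0_lt_compat; lra). assert (IJ : INR j * / INR j = 1) by (apply Rinv_r; lra).
  set (e := epsc ((1 + a)%R, t)).
  induction k as [k IH] using lt_wf_ind.
  pose proof (gam_conv k) as GC. fold e in GC. rewrite Csum_S_l in GC. rewrite Nat.sub_0_r in GC.
  pose proof (JK_mono k k (le_n _)) as [J0 _].
  assert (R : Cmod (Csum (fun i => gam t j a (S i) * e (k - S i)%nat)%C k) <= / 2 * JK k).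
  { eapply Rle_trans; [apply (Cmod_Csum_le _ (fun i => (/ 2 * JK k) * (/ 2) ^ S i))|].
    - intros i Hi. rewrite Cmod_mult.
      apply Rle_trans with (((/ 2) ^ S i * / 4 * / INR j) * (2 * INR j * JK k)).
      + apply Rmult_le_compat; try apply Cmod_ge_0; [apply (gam_S t a j W); auto|].
        eapply Rle_trans; [apply IH; lia|]. apply Rmult_le_compat_l; [lra|]. apply JK_mono; lia.
      + apply Req_le. transitivity ((/ 2) ^ S i * / 4 * (INR j * / INR j) * 2 * JK k); [ring|]. rewrite IJ. field.
    - rewrite Rsum_scal. pose proof (half_sum k). nra. }
  assert (V : Cmod (gam t j a 0 * e k) <= 3 / 2 * JK k).
  { replace (gam t j a 0 * e k)%C with ((gam t j a 0 * e k + Csum (fun i => gam t j a (S i) * e (k - S i)%nat) k)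
      + - Csum (fun i => gam t j a (S i) * e (k - S i)%nat) k)%C by ring.
    eapply Rle_trans; [apply Cmod_triangle|]. rewrite Cmod_opp. lra. }
  rewrite Cmod_mult in V. pose proof (gam_0 t a j W Hj Ha HW HWj) as G0. pose proof (Cmod_ge_0 (e k)) as E0.
  assert (3 / 4 * / INR j * Cmod (e k) <= 3 / 2 * JK k) by (eapply Rle_trans; [|exact V]; apply Rmult_le_compat_r; auto).
  apply Rmult_le_reg_l with (3 / 4 * / INR j); [lra|]. eapply Rle_trans; [exact H|]. apply Req_le.
  transitivity (3 / 2 * (INR j * / INR j) * JK k); [rewrite IJ; ring|field; lra].
Qed.

End Mellin.

(** * Power series with a holomorphic logarithmic derivative *)

Lemma Csum_triangle (F : nat -> nat -> C) K :
  Csum (fun N => Csum (fun m => F m (N - m)%nat) (S N)) K = Csum (fun m => Csum (F m) (K - m)) K.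
Proof.
  induction K; [auto|].
  change (Csum ?f (S K)) with (Csum f K + f K)%C. cbv beta. rewrite IHK.
  change (Csum (fun m => F m (K - m)%nat) (S K)) with (Csum (fun m => F m (K - m)%nat) K + F K (K - K)%nat)%C.
  rewrite Cplus_assoc, <- Csum_plus. f_equal.
  - apply Csum_ext. intros m Hm. replace (S K - m)%nat with (S (K - m)) by lia. reflexivity.
  - replace (S K - K)%nat with 1%nat by lia. rewrite Nat.sub_diag. simpl. ring.
Qed.

Lemma Csum_rev (f : nat -> C) n : Csum f (S n) = Csum (fun i => f (n - i)%nat) (S n).
Proof.
  induction n; [reflexivity|].
  rewrite (Csum_S_l (fun i => f (S n - i)%nat)). change (Csum f (S (S n))) with (Csum f (S n) + f (S n))%C.
  rewrite IHn, Cplus_comm. reflexivity.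
Qed.

Section Inverse.
Variables (t f : nat -> C).
Hypothesis Hrec : forall k, (RtoC (INR (S k)) * f (S k))%C = Csum (fun i => t i * f (k - i)%nat)%C (S k).

(** Coefficients of the exponential of minus the integral of [t], that is, of [f(0) / f]. Each value
    depends on all earlier ones, so the recursion builds tables; [htab n] is final up to index
    [n]. *)
Fixpoint htab (n : nat) : nat -> C := match n with
  | O => fun _ => RtoC 1
  | S n => fun k => if Nat.leb k n then htab n k
           else (- RtoC (/ INR (S n)) * Csum (fun i => t i * htab n (n - i)%nat) (S n))%C
  end.

Definition hinv (k : nat) : C := htab k k.

Lemma htab_stable n k : (k <= n)%nat -> htab n k = hinv k.
Proof.
  intros H. induction n as [|n IH].
  - replace k with O by lia. reflexivity.
  - destruct (Nat.eq_dec k (S n)) as [->|N]; [reflexivity|]. simpl. rewrite (proj2 (Nat.leb_le k n)) by lia. apply IH. lia.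
Qed.

Lemma hinv_rec k : (RtoC (INR (S k)) * hinv (S k))%C = (- Csum (fun i => t i * hinv (k - i)%nat) (S k))%C.
Proof.
  unfold hinv at 1. cbn [htab]. rewrite (proj2 (Nat.leb_gt (S k) k)) by lia.
  rewrite (Csum_ext (fun i => t i * hinv (k - i)%nat)%C (fun i => t i * htab k (k - i)%nat)%C)
    by (intros; rewrite htab_stable by lia; reflexivity).
  assert (E : (RtoC (INR (S k)) * RtoC (/ INR (S k)) = 1)%C).
  { rewrite <- RtoC_mult, Rinv_r; [reflexivity|apply not_0_INR; lia]. }
  set (X := Csum _ _). transitivity (- (RtoC (INR (S k)) * RtoC (/ INR (S k))) * X)%C; [ring|rewrite E; ring].
Qed.

(** With [h] the series of [hinv], the product [f h] has derivative [t f h - f t h = 0]; in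
    coefficients the two halves become the same triple sum with opposite signs. *)
Lemma hinv_conv k : Csum (fun i => f i * hinv (S k - i)%nat)%C (S (S k)) = RtoC 0.
Proof.
  set (F := fun l p => (t l * f p * hinv (k - (l + p)))%C).
  assert (A : Csum (fun i => RtoC (INR (S i)) * f (S i) * hinv (k - i)%nat)%C (S k) = Csum (fun m => Csum (F m) (S k - m)) (S k)).
  { rewrite <- Csum_triangle. apply Csum_ext. intros i Hi. rewrite Hrec, Cmult_comm, <- Csum_scal.
    apply Csum_ext. intros l Hl. unfold F. replace (l + (i - l))%nat with i by lia. ring. }
  assert (B : Csum (fun i => f i * (RtoC (INR (S (k - i))) * hinv (S (k - i))))%C (S k) = (- Csum (fun m => Csum (F m) (S k - m)) (S k))%C).
  { transitivity (- Csum (fun i => Csum (fun l => F l i) (S k - i)) (S k))%C.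
    - rewrite <- Csum_opp. apply Csum_ext. intros i Hi. rewrite hinv_rec.
      replace (S k - i)%nat with (S (k - i)) by lia. 
      transitivity (- (f i * Csum (fun i0 => t i0 * hinv (k - i - i0)%nat) (S (k - i))))%C; [ring|].
      rewrite <- Csum_scal. f_equal. apply Csum_ext. intros l Hl. unfold F. replace (k - (l + i))%nat with (k - i - l)%nat by lia. ring.
    - f_equal. rewrite <- (Csum_triangle (fun i l => F l i)), <- Csum_triangle. apply Csum_ext. intros N _.
      rewrite (Csum_rev (fun m => F m (N - m)%nat)). apply Csum_ext. intros i Hi. f_equal. lia. }
  assert (E : (RtoC (INR (S k)) * Csum (fun i => f i * hinv (S k - i)%nat)%C (S (S k)) = 0)%C).
  { transitivity (Csum (fun i => RtoC (INR i) * f i * hinv (S k - i)%nat)%C (S (S k))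
      + Csum (fun i => f i * (RtoC (INR (S k - i)) * hinv (S k - i)%nat))%C (S (S k)))%C.
    - rewrite <- Csum_scal, <- Csum_plus. apply Csum_ext. intros i Hi.
      replace (S k) with (i + (S k - i))%nat at 1 by lia. rewrite plus_INR, RtoC_plus. ring.
    - rewrite (Csum_S_l (fun i => RtoC (INR i) * f i * hinv (S k - i)%nat)%C).
      change (Csum (fun i => f i * (RtoC (INR (S k - i)) * hinv (S k - i)%nat))%C (S (S k)))
        with (Csum (fun i => f i * (RtoC (INR (S k - i)) * hinv (S k - i)%nat))%C (S k)
          + f (S k) * (RtoC (INR (S k - S k)) * hinv (S k - S k)%nat))%C.
      rewrite Nat.sub_diag.
      rewrite (Csum_ext (fun i => RtoC (INR (S i)) * f (S i) * hinv (S k - S i)%nat)%C (fun i => RtoC (INR (S i)) * f (S i) * hinv (k - i)%nat)%C)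
        by (intros; reflexivity).
      rewrite (Csum_ext (fun i => f i * (RtoC (INR (S k - i)) * hinv (S k - i)%nat))%C (fun i => f i * (RtoC (INR (S (k - i))) * hinv (S (k - i))))%C (S k))
        by (intros i Hi; replace (S k - i)%nat with (S (k - i)) by lia; reflexivity).
      rewrite A, B. simpl INR. ring. }
  apply (Cmult_reg_l (RtoC (INR (S k)))).
  - intros Z. apply RtoC_inj in Z. revert Z. apply not_0_INR. lia.
  - rewrite E. ring.
Qed.

(** In the recurrence, convolution with [t] costs a fixed factor [D] on the disc of radius [r], and
    division by [S k] follows. Beyond [K0 >= D] the maximum of the earlier scaled coefficients is
    never exceeded. *)
Lemma hinv_bound B rho r : 0 <= B -> 0 < r < rho -> (forall i, Cmod (t i) * rho ^ i <= B) ->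
  exists M, 0 <= M /\ forall k, Cmod (hinv k) * r ^ k <= M.
Proof.
  intros HB Hr Ht. set (x := r / rho).
  assert (Hx : 0 <= x < 1).
  { unfold x. split; [apply Rdiv_le_0_compat; lra|]. apply Rmult_lt_reg_r with rho; [lra|]. unfold Rdiv. rewrite Rmult_assoc, Rinv_l; lra. }
  set (D := r * B * / (1 - x)).
  assert (HD : 0 <= D) by (unfold D; apply Rmult_le_pos; [apply Rmult_le_pos; lra|left; apply Rinv_0_lt_compat; lra]).
  destruct (INR_archimed_pos D HD) as [K0 [HK0 _]].
  assert (Hp : forall i, 0 <= Cmod (hinv i) * r ^ i) by (intros; apply Rmult_le_pos; [apply Cmod_ge_0|apply pow_le; lra]).
  set (M := Rsum (fun i => Cmod (hinv i) * r ^ i) (S K0)).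
  assert (HM : 0 <= M) by (apply Rsum_nonneg; auto).
  exists M. split; auto.
  assert (Tr : forall i, Cmod (t i) * r ^ i <= B * x ^ i).
  { intros i. unfold x, Rdiv. rewrite Rpow_mult_distr, pow_inv.
    assert (0 < rho ^ i) by (apply pow_lt; lra). assert (0 < r ^ i) by (apply pow_lt; lra).
    apply Rmult_le_reg_r with (rho ^ i); auto.
    replace (B * (r ^ i * / rho ^ i) * rho ^ i) with (B * r ^ i) by (field; lra).
    specialize (Ht i). nra. }
  intros k. induction k as [k IH] using lt_wf_ind.
  destruct (le_lt_dec k K0) as [Hk|Hk].
  - unfold M. clear -Hk Hp.
    assert (G : forall n, (k < n)%nat -> Cmod (hinv k) * r ^ k <= Rsum (fun i => Cmod (hinv i) * r ^ i) n).
    { induction n; [lia|]. intros H. cbn [Rsum]. destruct (Nat.eq_dec k n) as [->|N].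
      - assert (0 <= Rsum (fun i => Cmod (hinv i) * r ^ i) n) by (apply Rsum_nonneg; auto). lra.
      - specialize (IHn ltac:(lia)). specialize (Hp n). lra. }
    apply G. lia.
  - destruct k as [|k]; [lia|].
    assert (Pk : 0 < INR (S k)) by (apply lt_0_INR; lia).
    assert (Q : INR (S k) * (Cmod (hinv (S k)) * r ^ S k) <= D * M).
    { replace (INR (S k) * (Cmod (hinv (S k)) * r ^ S k)) with (Cmod (RtoC (INR (S k)) * hinv (S k)) * r ^ S k)
        by (rewrite Cmod_mult, Cmod_R, Rabs_pos_eq by lra; ring).
      rewrite hinv_rec, Cmod_opp.
      apply Rle_trans with (Rsum (fun i => Cmod (t i) * Cmod (hinv (k - i))) (S k) * r ^ S k).
      { apply Rmult_le_compat_r; [apply pow_le; lra|]. apply Cmod_Csum_le. intros; rewrite Cmod_mult; lra. }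
      rewrite Rmult_comm, <- Rsum_scal.
      apply Rle_trans with (Rsum (fun i => (r * B * M) * x ^ i) (S k)).
      - apply Rsum_le. intros i Hi.
        replace (r ^ S k * (Cmod (t i) * Cmod (hinv (k - i)))) with
          (r * ((Cmod (t i) * r ^ i) * (Cmod (hinv (k - i)) * r ^ (k - i)))).
        + replace (r * B * M * x ^ i) with (r * ((B * x ^ i) * M)) by ring. apply Rmult_le_compat_l; [lra|].
          apply Rmult_le_compat; auto; [apply Rmult_le_pos; [apply Cmod_ge_0|apply pow_le; lra]|]. apply IH. lia.
        + replace (S k) with (S (i + (k - i))) by lia. simpl. rewrite pow_add. ring.
      - rewrite Rsum_scal. unfold D. pose proof (Rsum_geom_le x (S k) Hx) as GG.
        replace (r * B * / (1 - x) * M) with (r * B * M * / (1 - x)) by ring. apply Rmult_le_compat_l; auto.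
        apply Rmult_le_pos; auto. apply Rmult_le_pos; lra. }
    apply Rmult_le_reg_l with (INR (S k)); auto. eapply Rle_trans; [apply Q|]. apply Rmult_le_compat_r; auto.
    apply Rle_trans with (INR K0); auto. apply le_INR. lia.
Qed.

(** On the disc, [f] times the series of [hinv] is the nonzero constant [f 0]. *)
Lemma series_nonzero B H rho w : f O <> RtoC 0 -> 0 <= B -> (forall i, Cmod (t i) * rho ^ i <= B) ->
  (forall i, Cmod (f i) * rho ^ i <= H) -> Cmod w < rho -> CS (fun k => f k * w ^ k)%C <> RtoC 0.
Proof.
  intros Hf0 HB Ht Hf Hw Z. pose proof (Cmod_ge_0 w) as W0.
  set (r := (Cmod w + rho) / 2). assert (Hr : Cmod w < r < rho) by (unfold r; lra).
  destruct (hinv_bound B rho r HB ltac:(lra) Ht) as [M [HM Hh]].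
  assert (Dm : forall (g : nat -> C) ra Q, Cmod w < ra -> (forall i, Cmod (g i) * ra ^ i <= Q) ->
     (forall n, Cmod (g n * w ^ n) <= Q * (Cmod w / ra) ^ n) /\ ex_series (fun n => Q * (Cmod w / ra) ^ n)).
  { intros g ra Q Hra Hg. split.
    - intros n. rewrite Cmod_mult, Cmod_pow. assert (Hp : 0 < ra ^ n) by (apply pow_lt; lra).
      unfold Rdiv. rewrite Rpow_mult_distr, pow_inv. specialize (Hg n). assert (0 <= Cmod w ^ n) by (apply pow_le; auto).
      apply Rmult_le_reg_r with (ra ^ n); auto.
      replace (Q * (Cmod w ^ n * / ra ^ n) * ra ^ n) with (Q * Cmod w ^ n) by (field; lra). nra.
    - apply ex_series_scal', ex_series_geom'. split; [apply Rdiv_le_0_compat; lra|].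
      apply Rmult_lt_reg_r with ra; [lra|]. unfold Rdiv. rewrite Rmult_assoc, Rinv_l; lra. }
  destruct (Dm f rho H Hw Hf) as [F1 F2]. destruct (Dm hinv r M ltac:(lra) Hh) as [G1 G2].
  pose proof (CS_cauchy_product _ _ _ _ F1 F2 G1 G2) as CP. rewrite Z in CP.
  apply Hf0. apply (Ccvg_unique (Csum (fun N => Csum (fun m => f m * w ^ m * (hinv (N - m) * w ^ (N - m)))%C (S N)))).
  - apply (Ccvg_ext_loc (fun _ => f O) _ _ 1); [|apply Ccvg_const]. intros n Hn.
    destruct n as [|n]; [lia|]. rewrite Csum_S_l, (Csum_zero (fun k => Csum _ (S (S k)))).
    + simpl. unfold hinv. simpl. ring.
    + intros k _. transitivity (w ^ S k * Csum (fun i => f i * hinv (S k - i)%nat)%C (S (S k)))%C.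
      * rewrite <- Csum_scal. apply Csum_ext. intros i Hi.
        replace (w ^ S k)%C with (w ^ i * w ^ (S k - i))%C by (rewrite <- Cpow_add_r; f_equal; lia). ring.
      * rewrite hinv_conv. ring.
  - replace (RtoC 0) with (0 * CS (fun n => hinv n * w ^ n))%C by ring. exact CP.
Qed.

End Inverse.

(** Below a threshold [t0] the smallness condition of [bq_small] holds; above it the trivial bound
    is absorbed into [K']. Nothing is claimed about the dependence of [K'] on [j]. *)
Lemma bq_power_bound K th j : Ebound K th 0 -> 0 < th <= 1 -> 0 <= K -> (2 <= j)%nat ->
  exists K', 0 <= K' /\ forall tau, 0 < tau <= 1 -> Cmod (bq j tau) * tau <= K' * exp (th * ln tau).
Proof.
  intros HE Hth HK Hj. assert (P : 2 <= INR j) by (replace 2 with (INR 2) by auto; apply le_INR; auto).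
  (* [x0] is a size of [(2 j tau)^th] that [bq_small] tolerates, and [y0] the corresponding bound
     for [2 j tau], capped at [1/2]. *)
  set (x0 := / ((2400 * K + 1) * INR j ^ 2)).
  assert (J2 : 0 < INR j ^ 2) by (apply pow_lt; lra).
  assert (Hx0 : 0 < x0) by (apply Rinv_0_lt_compat, Rmult_lt_0_compat; lra).
  set (y0 := Rmin (1 / 2) (exp (ln x0 / th))).
  assert (Hy0 : 0 < y0 <= 1 / 2) by (split; [apply Rmin_glb_lt; [lra|apply exp_pos]|apply Rmin_l]).
  set (t0 := y0 / (2 * INR j)). assert (Ht0 : 0 < t0) by (apply Rdiv_lt_0_compat; lra).
  assert (Et0 : 2 * (INR j * t0) = y0) by (unfold t0; field; lra).
  set (A := 18 * (2 + 6 * K)). set (A2 := 9 * 400 * K * INR j * exp (th * ln (2 * INR j))).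
  assert (HA : 0 <= A) by (unfold A; lra).
  assert (HA2 : 0 <= A2) by (unfold A2; repeat apply Rmult_le_pos; try lra; left; apply exp_pos).
  exists (A * exp (- (th * ln t0)) + A2). split; [apply Rplus_le_le_0_compat; auto; apply Rmult_le_pos; auto; left; apply exp_pos|].
  intros tau Htau. rewrite Rmult_plus_distr_r, Rmult_assoc, <- exp_plus. pose proof (exp_pos (th * ln tau)).
  destruct (Rle_dec tau t0) as [H1|H1].
  - assert (X : 2 * (INR j * tau) <= y0) by (rewrite <- Et0; nra).
    assert (E : exp (th * ln (2 * (INR j * tau))) <= x0).
    { rewrite <- (exp_ln x0) by auto. apply exp_le. apply Rmult_le_reg_l with (/ th); [apply Rinv_0_lt_compat; lra|].
      rewrite <- Rmult_assoc, Rinv_l, Rmult_1_l by lra. rewrite (Rmult_comm (/ th)).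
      replace (ln x0 * / th) with (ln (exp (ln x0 / th))) by (rewrite ln_exp; reflexivity).
      apply ln_le; [nra|]. apply Rle_trans with y0; auto. apply Rmin_r. }
    pose proof (exp_pos (th * ln (2 * (INR j * tau)))).
    eapply Rle_trans; [apply (bq_small K th 0 HE ltac:(lra) ltac:(lra) HK j tau Hj); [lra|lra|]|].
    + rewrite Rplus_0_r.
      apply Rle_lt_trans with ((2400 * K) ^ 2 * INR j ^ 3 * x0 ^ 2).
      * apply Rmult_le_compat_l; [apply Rmult_le_pos; [apply pow2_ge_0|apply pow_le; lra]|]. apply pow_incr. lra.
      * unfold x0. rewrite pow_inv. apply Rmult_lt_reg_r with (((2400 * K + 1) * INR j ^ 2) ^ 2); [apply pow_lt, Rmult_lt_0_compat; lra|].
        rewrite Rmult_assoc, Rinv_l, Rmult_1_l, Rmult_1_r by (apply pow_nonzero; nra).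
        replace (((2400 * K + 1) * INR j ^ 2) ^ 2) with ((2400 * K + 1) ^ 2 * (INR j * INR j ^ 3)) by ring.
        assert (0 < INR j ^ 3) by (apply pow_lt; lra).
        apply Rle_lt_trans with ((2400 * K) ^ 2 * (INR j * INR j ^ 3)).
        -- apply Rmult_le_compat_l; [apply pow2_ge_0|]. nra.
        -- apply Rmult_lt_compat_r; [nra|]. simpl; nra.
    + rewrite Rplus_0_r. replace (2 * (INR j * tau)) with (2 * INR j * tau) by ring.
      rewrite ln_mult by lra. rewrite Rmult_plus_distr_l, exp_plus.
      pose proof (exp_pos (- (th * ln t0) + th * ln tau)).
      assert (0 <= A * exp (- (th * ln t0) + th * ln tau)) by (apply Rmult_le_pos; lra). unfold A2. lra.
  - eapply Rle_trans; [apply (bq_trivial K th 0 HE ltac:(lra) ltac:(lra) HK j tau Hj Htau)|]. fold A.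
    assert (1 <= exp (- (th * ln t0) + th * ln tau)).
    { rewrite <- exp_0 at 1. apply exp_le. assert (ln t0 <= ln tau) by (apply ln_le; lra). nra. }
    assert (0 <= A2 * exp (th * ln tau)) by (apply Rmult_le_pos; lra). nra.
Qed.

Lemma zeta_right_nonzero sigma t : 1 < sigma -> zeta (sigma, t) <> RtoC 0.
Proof.
  intros H. rewrite (zeta_phi0 (sigma, t) (sigma - 1)) by (simpl; lra). apply phi0_neq_0. auto.
Qed.

(** With [ka = 0] every coefficient is controlled: the Taylor series of [zeta'/zeta] at [5/4 + i t]
    converges up to radius [1/4 + th], and [series_nonzero] excludes zeros there. The constants may
    depend on [t], as only convergence matters. *)
Lemma zero_free_power K th eta sigma t : Ebound K th 0 -> 0 < th <= 3 / 4 -> 0 <= K -> 0 < eta < th -> eta <= 1 / 2 ->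
  6 <= Rabs t -> 1 - eta < sigma -> zeta (sigma, t) <> RtoC 0.
Proof.
  intros HE Hth HK Heta Heta2 Ht Hs.
  destruct (Rlt_dec 1 sigma) as [H1|H1]; [apply zeta_right_nonzero; auto|].
  set (a := 1 / 4). set (W := 48 * (Rabs t + 1)).
  assert (HW0 : 0 <= W ^ 2) by apply pow2_ge_0.
  destruct (INR_archimed_pos (W ^ 2) HW0) as [j [HWj _]].
  assert (Hj : (40 <= j)%nat).
  { apply INR_le. replace (INR 40) with 40 by (simpl; ring). unfold W in HWj. simpl in HWj. nra. }
  destruct (bq_power_bound K th j HE ltac:(lra) HK ltac:(lia)) as [K' [HK' Hb]].
  destruct (zeta_local t a (3 / 4) ltac:(unfold a; lra) ltac:(lra) Ht) as [Z1 Z2].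
  set (s0 := ((1 + a)%R, t) : C) in *.
  assert (Hs0 : 1 + a <= Re s0) by (unfold s0; simpl; lra).
  assert (EB : forall k, Cmod (epsc s0 k) <= 2 * INR j * (K' * / (a + th) ^ S k + 128)).
  { intros k. pose proof (epsc_bound t a j 1 (fun _ => K') (fun _ => th) Hj ltac:(unfold a; lra)
      ltac:(auto) ltac:(unfold a; intros; lra)) as E.
    eapply Rle_trans; [apply (E ltac:(intros; simpl; rewrite Rplus_0_l; apply Hb; auto) W); [unfold W; lra|auto]|].
    apply Req_le. unfold JK. cbn [Rsum]. ring. }
  set (rho := a + th). assert (Hrho : 0 < rho <= 1) by (unfold rho, a; lra).
  assert (E : ((sigma, t) = s0 + RtoC (sigma - (1 + a)))%C).
  { unfold s0. apply injective_projections; simpl; ring. }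
  assert (Hw : Cmod (RtoC (sigma - (1 + a))) < rho).
  { rewrite Cmod_R, Rabs_left1 by (unfold a; lra). unfold rho. lra. }
  rewrite E, Z2 by (unfold rho, a in *; lra).
  assert (Pj : 0 <= INR j) by apply pos_INR.
  assert (Hh : 0 <= Hz (3 / 4) t) by (eapply Rle_trans; [|apply (Z1 O)]; rewrite Rmult_1_r; apply Cmod_ge_0).
  assert (Phi : forall k, Cmod (phi s0 k) * rho ^ k <= Hz (3 / 4) t).
  { intros k. specialize (Z1 k). replace (a + 3 / 4) with 1 in Z1 by (unfold a; field). rewrite pow1 in Z1.
    assert (rho ^ k <= 1) by (rewrite <- (pow1 k); apply pow_incr; lra). assert (0 <= rho ^ k) by (apply pow_le; lra).
    pose proof (Cmod_ge_0 (phi s0 k)). nra. }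
  apply (series_nonzero (tcf s0) (phi s0)) with (B := 2 * INR j * (K' * / rho + 128) + Hz (3 / 4) t) (H := Hz (3 / 4) t) (rho := rho); auto.
  - intros k. apply (phi_rec s0 a); [exact Hs0|unfold a; lra].
  - apply phi0_neq_0. unfold a; lra.
  - apply Rplus_le_le_0_compat; auto. apply Rmult_le_pos; [lra|]. apply Rplus_le_le_0_compat; [|lra].
    apply Rmult_le_pos; auto. left; apply Rinv_0_lt_compat; lra.
  - intros k. rewrite (tcf_eps s0 a k Hs0) by (unfold a; lra). rewrite Cmod_opp.
    assert (0 < rho ^ k) by (apply pow_lt; lra).
    apply Rle_trans with ((Cmod (epsc s0 k) + Cmod (phi s0 k)) * rho ^ k); [apply Rmult_le_compat_r; [lra|apply Cmod_triangle]|].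
    rewrite Rmult_plus_distr_r. apply Rplus_le_compat; auto.
    eapply Rle_trans; [apply Rmult_le_compat_r; [lra|apply EB]|]. fold rho. rewrite Rmult_assoc. apply Rmult_le_compat_l; [lra|].
    rewrite Rmult_plus_distr_r. apply Rplus_le_compat.
    + apply Req_le. simpl. field. split; try apply pow_nonzero; lra.
    + assert (rho ^ k <= 1) by (rewrite <- (pow1 k); apply pow_incr; lra). lra.
Qed.

(** * Bookkeeping of exponents *)

Lemma growth al A : 0 < al -> exists u0, forall u, u0 <= u -> A <= exp (al * u) /\ u + 2 <= exp (al * u).
Proof.
  intros Hal. assert (H2 : 0 < al ^ 2) by (apply pow_lt; auto).
  assert (P1 : 0 < 8 / al ^ 2) by (apply Rdiv_lt_0_compat; lra).
  assert (P2 : 0 <= Rabs A / al) by (apply Rdiv_le_0_compat; [apply Rabs_pos|auto]).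
  exists (8 / al ^ 2 + 2 + Rabs A / al). intros u Hu. split.
  - assert (Rabs A <= al * u).
    { replace (Rabs A) with (al * (Rabs A / al)) by (field; lra). apply Rmult_le_compat_l; lra. }
    pose proof (exp_ineq1_le (al * u)). pose proof (Rle_abs A). lra.
  - replace (al * u) with (al * u / 2 + al * u / 2) by field. rewrite exp_plus.
    pose proof (exp_ineq1_le (al * u / 2)) as E. assert (Hau : 0 <= al * u / 2) by nra.
    assert (Q : (al * u / 2) * (al * u / 2) <= exp (al * u / 2) * exp (al * u / 2)) by (apply Rmult_le_compat; lra).
    assert (8 <= al ^ 2 * u).
    { replace 8 with (al ^ 2 * (8 / al ^ 2)) by (field; lra). apply Rmult_le_compat_l; lra. }
    assert (2 * u <= (al * u / 2) * (al * u / 2)).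
    { replace ((al * u / 2) * (al * u / 2)) with (al ^ 2 * u * u / 4) by field. nra. }
    lra.
Qed.

(** Quantities are kept in the form [0 <= x <= exp a], so that products reduce to linear arithmetic
    on exponents. *)
Lemma exp_mul_le x y a b : 0 <= x <= exp a -> 0 <= y <= exp b -> 0 <= x * y <= exp (a + b).
Proof.
  intros Hx Hy. split; [apply Rmult_le_pos; lra|]. rewrite exp_plus. apply Rmult_le_compat; lra.
Qed.

Lemma exp_pow_le x a k : 0 <= x <= exp a -> 0 <= x ^ k <= exp (INR k * a).
Proof. intros Hx. split; [apply pow_le; lra|]. rewrite <- exp_pow. apply pow_incr. auto. Qed.

Lemma bound_weaken x a b : 0 <= x <= exp a -> a <= b -> 0 <= x <= exp b.
Proof. intros Hx Hab. pose proof (exp_le a b Hab). lra. Qed.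

Lemma ln_2_le_1 : ln 2 <= 1.
Proof. pose proof (ln_le_sub1 2). lra. Qed.

Lemma Hz_exp d v t : Rabs t = exp v -> Hz d t = 100 * exp (d * v) * (1 + v).
Proof. intros E. unfold Hz. rewrite E, ln_exp. reflexivity. Qed.

(** * A zero-free region of width [|t|^-eps] *)

(** With [a = eta], a zero within [2 a] of [1 + a + i t] forces [|zeta(1 + a + i t)|] down to the
    order of [a |t|^(2 d)]. In the 3-4-1 inequality this leaves [a^-6 a^8 = a^2] against
    [|t|^(22 d)] up to constants, which [a <= |t|^(-20 d)] contradicts. *)
Lemma zero_free_narrow eps : 0 < eps <= 1 -> exists T, forall t eta sigma, T <= Rabs t ->
  0 < eta <= exp (- (eps * ln (Rabs t))) -> 1 - eta < sigma -> zeta (sigma, t) <> RtoC 0.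
Proof.
  intros Heps. set (d := eps / 20). assert (Hd : 0 < d <= 1 / 20) by (unfold d; lra).
  (* All constants of the final inequality, to be swallowed by one factor [|t|^d]. *)
  set (A := 2 ^ 6 * (400 / d) ^ 8 * 100 ^ 2 + 4 / d).
  assert (D4 : 80 <= 4 / d).
  { apply Rmult_le_reg_r with d; [lra|]. unfold Rdiv. rewrite Rmult_assoc, Rinv_l; lra. }
  destruct (growth d A ltac:(lra)) as [u0 Hu0].
  exists (exp (Rabs u0 + 2)). intros t eta sigma HT Heta Hs.
  destruct (Rlt_dec 1 sigma) as [H1|H1]; [apply zeta_right_nonzero; auto|].
  assert (Pt : 0 < Rabs t) by (pose proof (exp_pos (Rabs u0 + 2)); lra).
  set (u := ln (Rabs t)) in *. assert (Et : Rabs t = exp u) by (unfold u; rewrite exp_ln; auto).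
  assert (Hu : Rabs u0 + 2 <= u) by (unfold u; rewrite <- (ln_exp (Rabs u0 + 2)); apply ln_le; auto; apply exp_pos).
  pose proof (Rle_abs u0). pose proof (Rabs_pos u0). destruct (Hu0 u ltac:(lra)) as [G1 G2].
  assert (HA : 0 <= 2 ^ 6 * (400 / d) ^ 8 * 100 ^ 2).
  { apply Rmult_le_pos; [|apply pow_le; lra]. apply Rmult_le_pos; [apply pow_le; lra|]. apply pow_le.
    apply Rdiv_le_0_compat; lra. }
  set (z := d * u) in *. assert (Hz0 : 0 < z) by (unfold z; nra).
  assert (He : eta <= exp (- (20 * z))) by (replace (20 * z) with (eps * u) by (unfold z, d; field); apply Heta).
  assert (Ez : exp (- (20 * z)) <= exp (- z)) by (apply exp_le; lra).
  assert (Eta1 : eta <= d / 4).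
  { apply Rle_trans with (exp (- z)); [lra|]. rewrite exp_Ropp. replace (d / 4) with (/ (4 / d)) by (field; lra).
    apply Rinv_le_contravar; [lra|]. unfold A in G1. lra. }
  assert (T6 : 6 <= Rabs t).
  { rewrite Et. apply Rle_trans with (exp z); [unfold A in G1; lra|]. apply exp_le. unfold z. nra. }
  set (a := eta). assert (Ha : 0 < a <= 1) by (unfold a; lra).
  destruct (zeta_local t a d Ha ltac:(lra) T6) as [Z1 Z2].
  assert (T62 : 6 <= Rabs (2 * t)) by (rewrite Rabs_mult, Rabs_pos_eq by lra; lra).
  destruct (zeta_local (2 * t) a d Ha ltac:(lra) T62) as [Z3 _]. specialize (Z3 O). rewrite Rmult_1_r in Z3.
  set (s0 := ((1 + a)%R, t) : C) in *. set (w := RtoC (sigma - (1 + a))).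
  assert (E : ((sigma, t) = s0 + w)%C) by (unfold s0, w; apply injective_projections; simpl; ring).
  assert (Hw : Cmod w <= 2 * a).
  { unfold w. rewrite Cmod_R, Rabs_left1 by lra. unfold a. lra. }
  rewrite E, Z2 by (unfold a in *; lra). intros Zero.
  set (x := Cmod w / (a + d)). pose proof (Cmod_ge_0 w).
  assert (Hx : 0 <= x <= 1 / 2).
  { unfold x. split; [apply Rdiv_le_0_compat; lra|]. apply Rmult_le_reg_r with (a + d); [lra|].
    unfold Rdiv. rewrite Rmult_assoc, Rinv_l; unfold a in *; lra. }
  assert (Hx2 : x <= 2 * a / d).
  { unfold x, Rdiv. apply Rmult_le_compat; auto; [left; apply Rinv_0_lt_compat; lra|apply Rinv_le_contravar; lra]. }
  set (HH := Hz d t) in *.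
  assert (HH0 : 0 <= HH) by (eapply Rle_trans; [|apply (Z1 O)]; rewrite Rmult_1_r; apply Cmod_ge_0).
  assert (Dm : forall k, Cmod (phi s0 k * w ^ k) <= HH * x ^ k).
  { intros k. rewrite Cmod_mult, Cmod_pow. unfold x, Rdiv. rewrite Rpow_mult_distr, pow_inv. specialize (Z1 k).
    assert (0 < (a + d) ^ k) by (apply pow_lt; lra). assert (0 <= Cmod w ^ k) by (apply pow_le; auto).
    apply Rmult_le_reg_r with ((a + d) ^ k); auto.
    replace (HH * (Cmod w ^ k * / (a + d) ^ k) * (a + d) ^ k) with (HH * Cmod w ^ k) by (field; lra). nra. }
  assert (DE : ex_series (fun k => HH * x ^ k)) by (apply ex_series_scal', ex_series_geom'; lra).
  rewrite (CS_S_l _ _ Dm DE) in Zero.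
  assert (P0 : Cmod (phi s0 0) <= HH * x * 2).
  { replace (phi s0 0) with (- CS (fun n => phi s0 (S n) * w ^ S n))%C.
    - rewrite Cmod_opp. eapply Rle_trans; [apply (dom_bound _ (fun k => HH * x * x ^ k))|].
      + intros n. eapply Rle_trans; [apply Dm|]. simpl; lra.
      + apply ex_series_scal', ex_series_geom'; lra.
      + rewrite Series_scal_l, Series_geom by (rewrite Rabs_pos_eq; lra). apply Rmult_le_compat_l; [apply Rmult_le_pos; lra|].
        replace 2 with (/ (1 / 2)) by field. apply Rinv_le_contravar; lra.
    - replace (phi s0 0) with (phi s0 0 * w ^ 0 + CS (fun n => phi s0 (S n) * w ^ S n) - CS (fun n => phi s0 (S n) * w ^ S n))%C by (simpl; ring).
      rewrite Zero. ring. }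
  assert (P1 : Cmod (phi s0 0) <= (4 / d) * a * HH).
  { eapply Rle_trans; [apply P0|]. replace (4 / d * a * HH) with (HH * (2 * a / d) * 2) by (field; lra).
    apply Rmult_le_compat_r; [lra|]. apply Rmult_le_compat_l; auto. }
  assert (BH : 0 <= HH / 100 <= exp (2 * z)).
  { unfold HH. rewrite (Hz_exp d u t Et). split; [apply Rdiv_le_0_compat; [|lra]; repeat apply Rmult_le_pos; try lra; left; apply exp_pos|].
    fold z. replace (100 * exp z * (1 + u) / 100) with (exp z * (1 + u)) by field. replace (2 * z) with (z + z) by ring.
    rewrite exp_plus. apply Rmult_le_compat_l; [left; apply exp_pos|lra]. }
  assert (BH2 : 0 <= Hz d (2 * t) / 100 <= exp (3 * z)).
  { assert (E2 : Rabs (2 * t) = exp (u + ln 2)) by (rewrite Rabs_mult, Rabs_pos_eq, exp_plus, exp_ln, Et by lra; ring).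
    pose proof ln_2_le_1. pose proof (ln_ge0 2 ltac:(lra)).
    rewrite (Hz_exp d _ _ E2). split; [apply Rdiv_le_0_compat; [|lra]; repeat apply Rmult_le_pos; try lra; left; apply exp_pos|].
    replace (100 * exp (d * (u + ln 2)) * (1 + (u + ln 2)) / 100) with (exp (d * (u + ln 2)) * (1 + (u + ln 2))) by field.
    replace (3 * z) with (2 * z + z) by ring. rewrite exp_plus. apply Rmult_le_compat; [left; apply exp_pos|lra| |lra].
    apply exp_le. unfold z. nra. }
  pose proof (three_four_one t (1 + a) ltac:(lra)) as TFO.
  pose proof (phi0_bound ((1 + a)%R, 0) a ltac:(simpl; lra) ltac:(lra)) as Q0.
  assert (Ia : 1 <= / a) by (rewrite <- Rinv_1; apply Rinv_le_contravar; lra).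
  assert (Y0 : Cmod (phi ((1 + a)%R, 0) 0) ^ 6 <= (2 * / a) ^ 6) by (apply pow_incr; split; [apply Cmod_ge_0|lra]).
  assert (Y1 : Cmod (phi s0 0) ^ 8 <= (400 / d * a * exp (2 * z)) ^ 8).
  { apply pow_incr. split; [apply Cmod_ge_0|]. eapply Rle_trans; [apply P1|].
    replace (4 / d * a * HH) with (400 / d * a * (HH / 100)) by (field; lra). apply Rmult_le_compat_l; [|lra].
    apply Rmult_le_pos; [apply Rdiv_le_0_compat|]; lra. }
  assert (Y2 : Cmod (phi ((1 + a)%R, (2 * t)%R) 0) ^ 2 <= (100 * exp (3 * z)) ^ 2).
  { apply pow_incr. split; [apply Cmod_ge_0|]. eapply Rle_trans; [apply Z3|]. lra. }
  assert (Big : Cmod (phi ((1 + a)%R, 0) 0) ^ 6 * Cmod (phi s0 0) ^ 8 * Cmod (phi ((1 + a)%R, (2 * t)%R) 0) ^ 2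
    <= (2 * / a) ^ 6 * (400 / d * a * exp (2 * z)) ^ 8 * (100 * exp (3 * z)) ^ 2).
  { apply Rmult_le_compat; auto; [apply Rmult_le_pos; apply pow_le, Cmod_ge_0|apply pow_le, Cmod_ge_0|].
    apply Rmult_le_compat; auto; apply pow_le, Cmod_ge_0. }
  replace ((2 * / a) ^ 6 * (400 / d * a * exp (2 * z)) ^ 8 * (100 * exp (3 * z)) ^ 2)
    with (2 ^ 6 * (400 / d) ^ 8 * 100 ^ 2 * (a * a * (exp (2 * z) ^ 8 * exp (3 * z) ^ 2))) in Big by (field; lra).
  assert (F : 0 <= 2 ^ 6 * (400 / d) ^ 8 * 100 ^ 2 * (a * a * (exp (2 * z) ^ 8 * exp (3 * z) ^ 2)) <=
    exp (z + ((- (20 * z) + - (20 * z)) + (INR 8 * (2 * z) + INR 2 * (3 * z))))).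
  { assert (E0 : forall y, 0 <= exp y <= exp y) by (intros y; pose proof (exp_pos y); lra).
    repeat apply exp_mul_le; try apply exp_pow_le; auto; try (unfold a; lra). unfold A in G1. split; lra. }
  assert (exp (z + ((- (20 * z) + - (20 * z)) + (INR 8 * (2 * z) + INR 2 * (3 * z)))) < 1).
  { rewrite <- exp_0. apply exp_increasing. simpl. lra. }
  change (phi ((1 + a)%R, t) 0) with (phi s0 0) in TFO. lra.
Qed.

(** * The disc of radius [(M + 1) eta] around [1 + M eta + i t] *)

Lemma exp_neg_2 : exp (- (1 + 1)) <= 1 / 4.
Proof.
  rewrite exp_Ropp, exp_plus. pose proof (exp_ineq1_le 1).
  replace (1 / 4) with (/ 4) by field. apply Rinv_le_contravar; nra.
Qed.

Lemma exp_ge_6 u : 4 <= u -> 6 <= exp u.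
Proof.
  intros Hu. replace u with (u / 2 + u / 2) by field. rewrite exp_plus. pose proof (exp_ineq1_le (u / 2)). nra.
Qed.

Section Core.
Variables (K C0 c M e' u t eta : R).
(** [z] is the unit of loss: [e^z = |t|^eps], and each constant and each factor [1/eta] or [u + 2]
    costs at most [e^z]. [p] is where the window of indices begins, [e' u] is about the degree of
    the polynomial, [r1 < r2] are the radii between which [min_modulus] chooses, and [Y] is its
    constant [2 e r2 / (r2 - r1)]. *)
Let eps := c / 64.
Let nu := 4 * eps.
Let d := 4 * eps.
Let z := eps * u.
Let p := M * u.
Let a := M * eta.
Let th := C0 * eta.
Let ka := exp (- (C0 * u)).
Let r1 := a + eta.
Let r2 := a + (1 + nu) * eta.
(** Chosen so that [exp(- Q e' u) = exp(- (p + 20 u))]: the truncation error [q^n] then beats the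
    crude bound [e^p] for the coefficients below the window. *)
Let Q := (M + 20) / e'.
Let R0 := a + d.
Let q := r2 / R0.
Let Y := 2 * exp 1 * ((M + 1 + nu) / nu).
Hypothesis (HE : Ebound K th ka) (HK : 0 <= K).
(** [HMC] makes [M] so large that [(r2 / (a + th))^p] is at most [|t|^-(C0 - 1)] up to [e^(5 z)];
    [HY] keeps the loss [Y^n] of [min_modulus] below [e^(2 z)]. *)
Hypothesis (Hc : 0 < c <= 1) (HC0 : 5 + c <= C0) (HM : 480 <= M) (HMC : C0 ^ 2 <= eps * M) (He' : 0 < e' <= 1).
Hypothesis (HY : e' * ln Y <= eps).
Hypothesis (Hu : 4 <= u) (Ht : Rabs t = exp u) (Heta : 0 < eta) (Hinv : / eta <= exp z) (Hu2 : u + 2 <= exp z).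
Hypothesis (Hsmall1 : 3 * C0 * eta <= eps) (Hsmall2 : (M + C0 + 2) * eta <= d * exp (- Q)).
Hypothesis (HA0 : 18 * (2 + 6 * K) <= exp z) (HA1 : 3600 * K * 10000 <= exp z)
  (HA2 : (2400 * K) ^ 2 * 4 * 10000 ^ 3 <= exp z) (HA3 : 20000 <= exp z) (HA4 : Y <= exp z) (HA5 : 10 * (M + 2) <= exp z).

Lemma core_basic : 0 < eps <= / 64 /\ 0 < z /\ 64 * z = c * u /\ 64 * z <= u /\ 480 * u <= p /\
  5 * u + 64 * z <= C0 * u /\ 500 <= Q /\ / M <= eps / 25 /\ 0 < r1 < r2 /\ 0 < r2 < a + C0 * eta /\
  (M + C0 + 2) * eta <= / 16 /\ r2 <= exp (- Q) /\ 0 <= q <= exp (- Q) /\ Q <= (M + 20) / e' /\ 0 < a.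
Proof.
  assert (E0 : 0 < eps <= / 64) by (unfold eps; lra).
  assert (Q5 : 500 <= Q).
  { unfold Q. apply Rmult_le_reg_r with e'; [lra|]. unfold Rdiv. rewrite Rmult_assoc, Rinv_l by lra. nra. }
  assert (EQ : exp (- Q) <= 1) by (rewrite <- exp_0; apply exp_le; lra). pose proof (exp_pos (- Q)) as EQ0.
  assert (Hd : 0 < d <= / 16) by (unfold d; lra).
  assert (Hn : 0 < nu <= / 16) by (unfold nu; lra).
  assert (Ha : 0 < a) by (unfold a; nra).
  assert (R2 : 0 < r2 <= (M + C0 + 2) * eta) by (unfold r2, a; split; nra).
  assert (S16 : (M + C0 + 2) * eta <= / 16) by nra.
  split; [auto|]. split; [unfold z; nra|]. split; [unfold z, eps; field|]. split; [unfold z, eps; nra|].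
  split; [unfold p; nra|]. split; [unfold z, eps; nra|]. split; [auto|].
  split. { apply Rmult_le_reg_l with M; [lra|]. rewrite Rinv_r by lra. assert (25 <= C0 ^ 2) by (simpl; nra). lra. }
  split; [unfold r1, r2; split; nra|]. split; [unfold r2 in *; split; [lra|]; nra|].
  split; [auto|]. split; [nra|]. split.
  { unfold q, R0. split; [apply Rdiv_le_0_compat; lra|]. apply Rmult_le_reg_r with (a + d); [lra|].
    unfold Rdiv. rewrite Rmult_assoc, Rinv_l, Rmult_1_r by lra. nra. }
  split; [unfold Q; lra|auto].
Qed.

Lemma core_sizes : 0 < a <= 1 /\ 0 < th <= 1 /\ eta <= 1 / 4 /\ eta <= a /\ 0 < a + a / 4 <= 1 /\ 0 < a + th <= 1.
Proof.
  destruct core_basic as (_ & _ & _ & _ & _ & _ & _ & _ & _ & _ & S16 & _).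
  assert (B : forall x, x <= M + C0 + 2 -> x * eta <= / 16) by (intros x Hx; eapply Rle_trans; [apply Rmult_le_compat_r; [lra|apply Hx]|auto]).
  pose proof (B M ltac:(lra)). pose proof (B C0 ltac:(lra)). pose proof (B 1 ltac:(lra)).
  assert (0 < M * eta) by (apply Rmult_lt_0_compat; lra). assert (0 < C0 * eta) by (apply Rmult_lt_0_compat; lra).
  assert (1 * eta <= M * eta) by (apply Rmult_le_compat_r; lra).
  unfold a, th. repeat split; lra.
Qed.

Lemma core_R0 : r2 < R0.
Proof.
  destruct core_basic as (E0 & _ & _ & _ & _ & _ & Q5 & _ & Hr & Hr2 & _).
  assert (EQ : exp (- Q) <= 1) by (rewrite <- exp_0; apply exp_le; lra).
  assert (D : d * exp (- Q) <= d * 1) by (apply Rmult_le_compat_l; unfold d; lra).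
  assert (0 < M * eta) by (apply Rmult_lt_0_compat; lra).
  unfold R0. unfold a in *. lra.
Qed.

Lemma exp_self y : 0 <= exp y <= exp y.
Proof. pose proof (exp_pos y). lra. Qed.

(** [W = 96 |t|] serves the estimates of the kernel moments, being at least [48 (|t| + 1)] as
    [|t| >= 1]. Hence [j] is of order [|t|^2]. *)
Lemma core_j : exists j, (40 <= j)%nat /\ (96 * exp u) ^ 2 <= INR j <= 10000 * exp (2 * u).
Proof.
  assert (E1 : 1 <= exp u) by (pose proof (exp_ineq1_le u); lra).
  destruct (INR_archimed_pos ((96 * exp u) ^ 2) (pow2_ge_0 _)) as [j [H1 H2]]. exists j.
  assert (E2 : exp (2 * u) = exp u * exp u) by (rewrite <- exp_plus; f_equal; ring).
  split; [|split; auto].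
  - apply INR_le. replace (INR 40) with 40 by (simpl; ring). simpl in H1. nra.
  - rewrite E2. simpl in H2. nra.
Qed.

Section Fixed_j.
Variable j : nat.
Hypothesis (Hj : (40 <= j)%nat) (Hj2 : (96 * exp u) ^ 2 <= INR j <= 10000 * exp (2 * u)).

(** Three regimes: the trivial bound, written as [e^(3 p / 16) tau^(a / 4)] so that it covers
    [tau >= exp(- 3 u / (4 eta))]; the saving [tau^th]; and the constant [ka]. *)
Definition Kc3 (i : nat) : R := match i with
  | O => 18 * (2 + 6 * K) * exp (3 / 16 * p)
  | 1%nat => 3600 * K * INR j * exp z
  | _ => 3600 * K * INR j * ka end.
Definition la3 (i : nat) : R := match i with O => a / 4 | 1%nat => th | _ => 0 end.

Lemma core_ln2j : 0 <= th * ln (2 * INR j) <= z.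
Proof.
  destruct core_basic as (E0 & Z0 & Zc & Zu & _).
  assert (P : 40 <= INR j) by (replace 40 with (INR 40) by (simpl; ring); apply le_INR; auto).
  assert (L0 : 0 <= ln (2 * INR j)) by (apply ln_ge0; lra).
  assert (L1 : ln (2 * INR j) <= 3 * u).
  { rewrite <- (ln_exp (3 * u)). apply ln_le; [lra|]. replace (3 * u) with (u + 2 * u) by ring. rewrite exp_plus.
    pose proof (exp_pos (2 * u)). assert (exp z <= exp u) by (apply exp_le; lra).
    apply Rle_trans with (20000 * exp (2 * u)); [lra|]. apply Rmult_le_compat_r; lra. }
  assert (0 <= th) by (unfold th; nra). split; [apply Rmult_le_pos; auto|].
  apply Rle_trans with (th * (3 * u)); [apply Rmult_le_compat_l; auto|]. unfold th, z. nra.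
Qed.

Lemma core_bq tau : 0 < tau <= 1 -> Cmod (bq j tau) * tau <= Rsum (fun i => Kc3 i * exp (la3 i * ln tau)) 3.
Proof.
  intros Ht0. destruct core_basic as (E0 & Z0 & Zc & Zu & Pu & Cu & Q5 & IM & Hr & Hr2 & S16 & _ & _ & _ & Ha).
  assert (P : 40 <= INR j) by (replace 40 with (INR 40) by (simpl; ring); apply le_INR; auto).
  destruct core_sizes as (Ha1 & Hth1 & Et4 & Ea & Aa & Ath). assert (Hth : 0 <= th <= 1) by lra.
  assert (Hka : 0 <= ka <= 1).
  { unfold ka. split; [left; apply exp_pos|]. rewrite <- exp_0. apply exp_le. lra. }
  cbn [Rsum Kc3 la3]. rewrite Rmult_0_l, exp_0, Rmult_1_r, Rplus_0_l.
  set (l := - ln tau). assert (Hl : 0 <= l).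
  { unfold l. assert (ln tau <= ln 1) by (apply ln_le; lra). rewrite ln_1 in H. lra. }
  assert (N0 : 0 <= 18 * (2 + 6 * K) * exp (3 / 16 * p) * exp (a / 4 * ln tau)).
  { repeat apply Rmult_le_pos; try lra; left; apply exp_pos. }
  assert (N1 : 0 <= 3600 * K * INR j * exp z * exp (th * ln tau)).
  { repeat apply Rmult_le_pos; try lra; left; apply exp_pos. }
  assert (N2 : 0 <= 3600 * K * INR j * ka) by (repeat apply Rmult_le_pos; lra).
  (* The cut [3/4] meets two demands. Beyond it [j^3 tau^(2 th)] is small, because [(3/2) C0 > 6];
     and [3/16 < 1/5], so the first term dies at index [p], where [(r2 / (a + a/4))^p] is about
     [e^(- p / 5)] or less. *)
  destruct (Rle_dec (l * eta) (3 / 4 * u)) as [H1|H1].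
  - eapply Rle_trans; [apply (bq_trivial K th ka HE Hth Hka HK j tau); [lia|auto]|].
    assert (1 <= exp (3 / 16 * p) * exp (a / 4 * ln tau)).
    { rewrite <- exp_plus. rewrite <- exp_0 at 1. apply exp_le. replace (ln tau) with (- l) by (unfold l; ring).
      unfold p, a. replace (3 / 16 * (M * u) + M * eta / 4 * - l) with (M / 4 * (3 / 4 * u - l * eta)) by field.
      apply Rmult_le_pos; lra. }
    rewrite Rmult_assoc in *.
    assert (18 * (2 + 6 * K) * 1 <= 18 * (2 + 6 * K) * (exp (3 / 16 * p) * exp (a / 4 * ln tau))) by (apply Rmult_le_compat_l; lra). lra.
  - assert (Hl2 : 3 * u <= l).
    { assert (l * eta <= l * (1 / 4)) by (apply Rmult_le_compat_l; lra). lra. }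
    pose proof core_ln2j as L2.
    assert (Jt : INR j * tau <= 1 / 4).
    { replace tau with (exp (- l)) by (unfold l; rewrite Ropp_involutive, exp_ln; lra).
      apply Rle_trans with (exp (z + 2 * u) * exp (- (3 * u))).
      - apply Rmult_le_compat; [lra|left; apply exp_pos| |apply exp_le; lra].
        rewrite exp_plus. pose proof (exp_pos (2 * u)). apply Rle_trans with (10000 * exp (2 * u)); [lra|].
        apply Rmult_le_compat_r; lra.
      - rewrite <- exp_plus. apply Rle_trans with (exp (- (1 + 1))); [apply exp_le; lra|].
        apply exp_neg_2. }
    set (X := exp (th * ln (2 * (INR j * tau)))).
    assert (EX : X = exp (th * ln (2 * INR j)) * exp (th * ln tau)).
    { unfold X. rewrite <- exp_plus. f_equal. replace (2 * (INR j * tau)) with (2 * INR j * tau) by ring.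
      rewrite ln_mult by lra. ring. }
    assert (X0 : 0 < X) by apply exp_pos.
    assert (X1 : X <= exp z * exp (th * ln tau)).
    { rewrite EX. apply Rmult_le_compat_r; [left; apply exp_pos|]. apply exp_le. lra. }
    assert (X2 : X <= exp (z - 3 / 4 * (C0 * u))).
    { eapply Rle_trans; [apply X1|]. rewrite <- exp_plus. apply exp_le. replace (ln tau) with (- l) by (unfold l; ring). unfold th.
      assert (C0 * (3 / 4 * u) <= C0 * (l * eta)) by (apply Rmult_le_compat_l; lra).
      replace (C0 * eta * - l) with (- (C0 * (l * eta))) by ring. lra. }
    assert (X3 : ka <= exp (z - 3 / 4 * (C0 * u))) by (unfold ka; apply exp_le; lra).
    eapply Rle_trans; [apply (bq_small K th ka HE Hth Hka HK j tau); [lia|lra|auto|]|].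
    + fold X. assert (S2 : 0 <= X + ka <= 2 * exp (z - 3 / 4 * (C0 * u))) by lra.
      apply Rle_lt_trans with ((2400 * K) ^ 2 * (10000 * exp (2 * u)) ^ 3 * (2 * exp (z - 3 / 4 * (C0 * u))) ^ 2).
      * apply Rmult_le_compat; [apply Rmult_le_pos; [apply pow2_ge_0|apply pow_le; lra]|apply pow2_ge_0| |apply pow_incr; auto].
        apply Rmult_le_compat_l; [apply pow2_ge_0|]. apply pow_incr. lra.
      * replace ((2400 * K) ^ 2 * (10000 * exp (2 * u)) ^ 3 * (2 * exp (z - 3 / 4 * (C0 * u))) ^ 2)
          with ((2400 * K) ^ 2 * 4 * 10000 ^ 3 * (exp (2 * u) ^ 3 * exp (z - 3 / 4 * (C0 * u)) ^ 2)) by ring.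
        assert (F : 0 <= (2400 * K) ^ 2 * 4 * 10000 ^ 3 * (exp (2 * u) ^ 3 * exp (z - 3 / 4 * (C0 * u)) ^ 2)
          <= exp (z + (INR 3 * (2 * u) + INR 2 * (z - 3 / 4 * (C0 * u))))).
        { apply exp_mul_le; [split; auto; repeat apply Rmult_le_pos; try lra; apply pow2_ge_0|].
          apply exp_mul_le; apply exp_pow_le, exp_self. }
        eapply Rle_lt_trans; [apply F|]. rewrite <- exp_0. apply exp_increasing. simpl. lra.
    + fold X. assert (3600 * K * INR j * X <= 3600 * K * INR j * exp z * exp (th * ln tau)).
      { rewrite (Rmult_assoc (3600 * K * INR j)). apply Rmult_le_compat_l; [repeat apply Rmult_le_pos; lra|auto]. }
      lra.
Qed.

Let s0 : C := ((1 + a)%R, t).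
Let x0 := r2 / (a + a / 4).
Let x1 := r2 / (a + th).
Let x2 := r2 / a.
Let HZ := Hz d t.

(** The terms come, in order, from the three regimes of [Kc3], from [tau >= 1], and from zeta
    itself, which [tcf_eps] separates from the Dirichlet series of [Lambda - 1]. *)
Lemma core_tcf k : Cmod (tcf s0 k) * r2 ^ k <=
  2 * INR j * (18 * (2 + 6 * K)) * exp (3 / 16 * p) * / (a + a / 4) * x0 ^ k
  + 2 * INR j * (3600 * K * INR j * exp z) * / (a + th) * x1 ^ k
  + 2 * INR j * (3600 * K * INR j * ka) * / a * x2 ^ k
  + 2 * INR j * 128 * r2 ^ k + HZ * q ^ k.
Proof.
  destruct core_basic as (E0 & Z0 & Zc & Zu & Pu & Cu & Q5 & IM & Hr & Hr2 & S16 & _ & _ & _ & Ha).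
  assert (P : 40 <= INR j) by (replace 40 with (INR 40) by (simpl; ring); apply le_INR; auto).
  destruct core_sizes as (Ha1 & Hth1 & Et4 & Ea & Aa & Ath).
  assert (Hth : 0 < th) by lra.
  assert (E6 : 6 <= Rabs t) by (rewrite Ht; apply exp_ge_6; auto).
  pose proof (epsc_bound t a j 3 Kc3 la3 Hj Ha1) as EB.
  specialize (EB ltac:(intros [|[|i]] _; unfold Kc3; repeat apply Rmult_le_pos; try lra; left; apply exp_pos)).
  specialize (EB ltac:(intros [|[|i]] _; unfold la3; lra)).
  specialize (EB core_bq (96 * exp u)).
  specialize (EB ltac:(rewrite Ht in *; pose proof (exp_ineq1_le u); lra) ltac:(lra) k). fold s0 in EB.
  unfold JK in EB. cbn [Rsum Kc3 la3] in EB. rewrite Rplus_0_r, Rplus_0_l in EB.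
  destruct (zeta_local t a d Ha1 ltac:(unfold d; lra) E6) as [Z1 _]. specialize (Z1 k). fold s0 HZ R0 in Z1.
  assert (R00 : 0 < R0) by (unfold R0, d; lra).
  rewrite (tcf_eps s0 a k) by (try lra; unfold s0; simpl; lra). rewrite Cmod_opp.
  assert (RK : 0 < r2 ^ k) by (apply pow_lt; lra).
  apply Rle_trans with ((Cmod (epsc s0 k) + Cmod (phi s0 k)) * r2 ^ k); [apply Rmult_le_compat_r; [lra|apply Cmod_triangle]|].
  rewrite Rmult_plus_distr_r. apply Rplus_le_compat.
  - eapply Rle_trans; [apply Rmult_le_compat_r; [lra|apply EB]|]. apply Req_le.
    unfold x0, x1, x2, Rdiv. rewrite !Rpow_mult_distr, !pow_inv. cbn [pow]. 
    assert (N0 : (a + a * / 4) ^ k <> 0) by (apply pow_nonzero; lra).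
    assert (N1 : (a + th) ^ k <> 0) by (apply pow_nonzero; lra). assert (N2 : a ^ k <> 0) by (apply pow_nonzero; lra).
    set (y0 := (a + a * / 4) ^ k) in *. set (y1 := (a + th) ^ k) in *. set (y2 := a ^ k) in *.
    field. repeat split; auto; lra.
  - unfold q, Rdiv. rewrite Rpow_mult_distr, pow_inv. assert (0 < R0 ^ k) by (apply pow_lt; auto).
    apply Rmult_le_reg_r with (R0 ^ k); auto.
    replace (HZ * (r2 ^ k * / R0 ^ k) * R0 ^ k) with (HZ * r2 ^ k) by (field; lra).
    rewrite Rmult_assoc, (Rmult_comm (r2 ^ k)), <- Rmult_assoc. apply Rmult_le_compat_r; lra.
Qed.

Lemma core_HZ : 0 <= HZ <= exp (6 * z).
Proof.
  destruct core_basic as (E0 & Z0 & _).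
  unfold HZ. rewrite (Hz_exp d u t Ht). replace (d * u) with (4 * z) by (unfold d, z; ring).
  replace (6 * z) with ((z + 4 * z) + z) by ring.
  apply exp_mul_le; [|lra]. apply exp_mul_le; [lra|apply exp_self].
Qed.

(** The [4 u] in the exponents is [j^2]: one [j] from [epsc_bound], one from [bq_small]. The last
    clause bounds the growth of the [ka] term up to the end of the window by [|t|], up to
    [e^(5 z)]. *)
Lemma core_terms k : 
  0 <= 2 * INR j * (18 * (2 + 6 * K)) * exp (3 / 16 * p) * / (a + a / 4) <= exp (2 * u + 3 * z + 3 / 16 * p) /\
  0 <= 2 * INR j * (3600 * K * INR j * exp z) * / (a + th) <= exp (4 * u + 4 * z) /\
  0 <= 2 * INR j * (3600 * K * INR j * ka) * / a <= exp (4 * u + 3 * z - C0 * u) /\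
  0 <= 2 * INR j * 128 <= exp (2 * u + 2 * z) /\
  0 <= x0 <= exp ((1 + nu) / M - 1 / 5) /\ (1 + nu) / M <= 1 / 5 /\
  0 <= x1 <= exp (- ((C0 - 1 - nu) / (M + C0))) /\ 0 <= (C0 - 1 - nu) / (M + C0) /\
  C0 * u - u - 5 * z <= p * ((C0 - 1 - nu) / (M + C0)) /\
  0 <= x2 <= exp ((1 + nu) / M) /\
  (INR k <= p + u + 2 -> INR k * ((1 + nu) / M) <= u + 5 * z).
Proof.
  destruct core_basic as (E0 & Z0 & Zc & Zu & Pu & Cu & Q5 & IM & Hr & Hr2 & S16 & _ & _ & _ & Ha).
  assert (P : 40 <= INR j) by (replace 40 with (INR 40) by (simpl; ring); apply le_INR; auto).
  destruct core_sizes as (Ha1 & Hth1 & Et4 & Ea & Aa & Ath). assert (Hth : 0 < th) by lra.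
  assert (Hn : nu = 4 * eps) by reflexivity.
  assert (J1 : 0 <= 2 * INR j <= exp (z + 2 * u)).
  { split; [lra|]. rewrite exp_plus. pose proof (exp_pos (2 * u)).
    apply Rle_trans with (20000 * exp (2 * u)); [lra|]. apply Rmult_le_compat_r; lra. }
  assert (Iv : forall y, eta <= y -> 0 <= / y <= exp z).
  { intros y Hy. split; [left; apply Rinv_0_lt_compat; lra|]. apply Rle_trans with (/ eta); auto. apply Rinv_le_contravar; lra. }
  assert (J2 : 0 <= 3600 * K * INR j <= exp (z + 2 * u)).
  { split; [repeat apply Rmult_le_pos; lra|]. rewrite exp_plus. pose proof (exp_pos (2 * u)).
    apply Rle_trans with (3600 * K * (10000 * exp (2 * u))); [apply Rmult_le_compat_l; lra|].
    rewrite <- Rmult_assoc. apply Rmult_le_compat_r; lra. }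
  assert (Mp : 0 < / M) by (apply Rinv_0_lt_compat; lra).
  split.
  { replace (2 * u + 3 * z + 3 / 16 * p) with ((((z + 2 * u) + z) + 3 / 16 * p) + z) by ring.
    apply exp_mul_le; [|apply Iv; lra]. apply exp_mul_le; [|apply exp_self]. apply exp_mul_le; auto. lra. }
  split.
  { replace (4 * u + 4 * z) with (((z + 2 * u) + ((z + 2 * u) + z)) + z) by ring.
    apply exp_mul_le; [|apply Iv; lra]. apply exp_mul_le; auto. apply exp_mul_le; auto. apply exp_self. }
  split.
  { replace (4 * u + 3 * z - C0 * u) with (((z + 2 * u) + ((z + 2 * u) + - (C0 * u))) + z) by ring.
    apply exp_mul_le; [|apply Iv; lra]. apply exp_mul_le; auto. apply exp_mul_le; auto. apply exp_self. }
  split.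
  { replace (2 * u + 2 * z) with ((z + 2 * u) + z) by ring. apply exp_mul_le; auto. lra. }
  assert (T1 : (1 + nu) / M <= 1 / 5).
  { unfold Rdiv. apply Rle_trans with (2 * / M); [apply Rmult_le_compat_r; lra|]. lra. }
  assert (X2 : 0 <= x2 <= exp ((1 + nu) / M)).
  { unfold x2. split; [apply Rdiv_le_0_compat; lra|]. eapply Rle_trans; [|apply exp_ineq1_le].
    apply Req_le. unfold r2, a. field. lra. }
  split.
  { unfold Rminus. rewrite exp_plus. assert (Ex : x0 = x2 * (4 / 5)) by (unfold x0, x2; field; lra). rewrite Ex.
    split; [lra|]. apply Rmult_le_compat; try lra. pose proof (exp_ineq1_le (- (1 / 5))). lra. }
  split; [auto|]. split.
  { unfold x1. split; [apply Rdiv_le_0_compat; lra|]. eapply Rle_trans; [|apply exp_ineq1_le].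
    apply Req_le. unfold r2, th, a. field. unfold th, a in Ath. split; lra. }
  split; [apply Rdiv_le_0_compat; lra|]. split.
  { assert (G : C0 - 1 - nu - eps <= M * ((C0 - 1 - nu) / (M + C0))).
    { apply Rmult_le_reg_r with (M + C0); [lra|].
      replace (M * ((C0 - 1 - nu) / (M + C0)) * (M + C0)) with (M * (C0 - 1 - nu)) by (field; lra).
      assert (0 <= M * eps) by (apply Rmult_le_pos; lra). assert (0 <= C0 * (nu + eps)) by (apply Rmult_le_pos; lra).
      simpl in HMC. lra. }
    unfold p. replace (M * u * ((C0 - 1 - nu) / (M + C0))) with (u * (M * ((C0 - 1 - nu) / (M + C0)))) by ring.
    replace (C0 * u - u - 5 * z) with (u * (C0 - 1 - nu - eps)) by (rewrite Hn; unfold z; ring).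
    apply Rmult_le_compat_l; lra. }
  split; [auto|]. intros Hk.
  assert (N0 : 0 <= (1 + nu) / M) by (apply Rdiv_le_0_compat; lra).
  apply Rle_trans with ((p + u + 2) * ((1 + nu) / M)); [apply Rmult_le_compat_r; auto|].
  replace ((p + u + 2) * ((1 + nu) / M)) with ((1 + nu) * (u + (u + 2) * / M)) by (unfold p; field; lra).
  assert ((u + 2) * / M <= 3 * u * (eps / 25)) by (apply Rmult_le_compat; lra).
  replace (3 * u * (eps / 25)) with (3 / 25 * z) in H by (unfold z; field).
  apply Rle_trans with ((1 + nu) * (u + 3 / 25 * z)); [apply Rmult_le_compat_l; lra|].
  replace ((1 + nu) * (u + 3 / 25 * z)) with (u + 4 * z + (1 + nu) * (3 / 25) * z) by (rewrite Hn; unfold z; ring).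
  assert ((1 + nu) * (3 / 25) * z <= 1 * z) by (apply Rmult_le_compat_r; lra). lra.
Qed.

(** The critical term is the one with [th]: [4 u + 4 z - (C0 u - u - 5 z) = 5 u + 9 z - C0 u <= - 55
    z] because [C0 u >= 5 u + 64 z], and this asks for [C0 > 5]. The [ka] term gives almost the same
    exponent. [M >= 480] serves the first term, where only [p / 5 - 3 p / 16 = p / 80] is gained. *)
Lemma core_large k : p <= INR k <= p + u + 2 -> Cmod (tcf s0 k) * r2 ^ k <= 5 * exp (- (55 * z)).
Proof.
  intros Hk. destruct core_basic as (E0 & Z0 & Zc & Zu & Pu & Cu & Q5 & IM & Hr & Hr2 & S16 & RQ & QQ & _ & Ha).
  destruct (core_terms k) as (A0 & A1 & A2 & A3 & X0 & N0 & X1 & N1 & N1' & X2 & N2). specialize (N2 ltac:(lra)).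
  pose proof core_HZ as A4. eapply Rle_trans; [apply core_tcf|].
  assert (B0 := exp_mul_le _ _ _ _ A0 (exp_pow_le _ _ k X0)). assert (B1 := exp_mul_le _ _ _ _ A1 (exp_pow_le _ _ k X1)).
  assert (B2 := exp_mul_le _ _ _ _ A2 (exp_pow_le _ _ k X2)).
  assert (B3 := exp_mul_le _ _ _ _ A3 (exp_pow_le r2 (- Q) k ltac:(lra))).
  assert (B4 := exp_mul_le _ _ _ _ A4 (exp_pow_le _ _ k QQ)).
  assert (KQ : INR k * - Q <= - p).
  { assert (p * 1 <= INR k * Q) by (apply Rmult_le_compat; lra). lra. }
  assert (K0 : INR k * ((1 + nu) / M - 1 / 5) <= u + 4 * z - p / 5).
  { apply Rle_trans with (p * ((1 + nu) / M - 1 / 5)).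
    { assert (p * (1 / 5 - (1 + nu) / M) <= INR k * (1 / 5 - (1 + nu) / M)) by (apply Rmult_le_compat_r; lra). lra. }
    apply Req_le. unfold p, z, nu. field. lra. }
  assert (K1 : INR k * - ((C0 - 1 - nu) / (M + C0)) <= - (C0 * u - u - 5 * z)).
  { assert (p * ((C0 - 1 - nu) / (M + C0)) <= INR k * ((C0 - 1 - nu) / (M + C0))) by (apply Rmult_le_compat_r; lra). lra. }
  apply (bound_weaken _ _ (- (55 * z))) in B0; [|lra]. apply (bound_weaken _ _ (- (55 * z))) in B1; [|lra].
  apply (bound_weaken _ _ (- (55 * z))) in B2; [|lra]. apply (bound_weaken _ _ (- (55 * z))) in B3; [|lra].
  apply (bound_weaken _ _ (- (55 * z))) in B4; [|lra]. lra.
Qed.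

(** Below the window a crude bound is enough, because [q^n] absorbs [e^p]. *)
Lemma core_all k : INR k <= p + u + 2 -> Cmod (tcf s0 k) * r2 ^ k <= 5 * exp p.
Proof.
  intros Hk. destruct core_basic as (E0 & Z0 & Zc & Zu & Pu & Cu & Q5 & IM & Hr & Hr2 & S16 & RQ & QQ & _ & Ha).
  destruct (core_terms k) as (A0 & A1 & A2 & A3 & X0 & N0 & X1 & N1 & N1' & X2 & N2). specialize (N2 Hk).
  pose proof core_HZ as A4. eapply Rle_trans; [apply core_tcf|]. pose proof (pos_INR k) as Pk.
  assert (B0 := exp_mul_le _ _ _ _ A0 (exp_pow_le _ _ k X0)). assert (B1 := exp_mul_le _ _ _ _ A1 (exp_pow_le _ _ k X1)).
  assert (B2 := exp_mul_le _ _ _ _ A2 (exp_pow_le _ _ k X2)).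
  assert (B3 := exp_mul_le _ _ _ _ A3 (exp_pow_le r2 (- Q) k ltac:(lra))).
  assert (B4 := exp_mul_le _ _ _ _ A4 (exp_pow_le _ _ k QQ)).
  assert (KQ : INR k * - Q <= 0) by (assert (0 <= INR k * Q) by (apply Rmult_le_pos; lra); lra).
  assert (K0 : INR k * ((1 + nu) / M - 1 / 5) <= 0) by (assert (0 <= INR k * (1 / 5 - (1 + nu) / M)) by (apply Rmult_le_pos; lra); lra).
  assert (K1 : INR k * - ((C0 - 1 - nu) / (M + C0)) <= 0) by (assert (0 <= INR k * ((C0 - 1 - nu) / (M + C0))) by (apply Rmult_le_pos; lra); lra).
  apply (bound_weaken _ _ p) in B0; [|lra]. apply (bound_weaken _ _ p) in B1; [|lra].
  apply (bound_weaken _ _ p) in B2; [|lra]. apply (bound_weaken _ _ p) in B3; [|lra].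
  apply (bound_weaken _ _ p) in B4; [|lra]. lra.
Qed.

(** [zero_free_disc] is applied to zeta divided by its value at the centre, which [phi0_lower]
    bounds from below by [1 / (1 + 1/a)]. Here [m] is about [p] and [n] about [e' u <= u], so the
    indices from [m] to [n + m] stay in the window of [core_large]. *)
Lemma core_disc w : Cmod w < r1 -> CS (fun k => phi s0 k * w ^ k)%C <> RtoC 0.
Proof.
  intros Hw. destruct core_basic as (E0 & Z0 & Zc & Zu & Pu & Cu & Q5 & IM & Hr & Hr2 & S16 & RQ & QQ & _ & Ha).
  destruct core_sizes as (Ha1 & Hth1 & Et4 & Ea & Aa & Ath).
  assert (E6 : 6 <= Rabs t) by (rewrite Ht; apply exp_ge_6; auto).
  destruct (zeta_local t a d Ha1 ltac:(unfold d; lra) E6) as [Z1 _]. fold s0 HZ R0 in Z1.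
  assert (R00 : 0 < R0) by (unfold R0, d; lra).
  destruct (INR_archimed_pos p ltac:(lra)) as [m [Hm1 Hm2]].
  destruct (INR_archimed_pos (e' * u) ltac:(apply Rmult_le_pos; lra)) as [n [Hn1 Hn2]].
  assert (Heu : 0 < e' * u <= u) by (split; [apply Rmult_lt_0_compat; lra|]; rewrite <- (Rmult_1_l u) at 2; apply Rmult_le_compat_r; lra).
  assert (Hn0 : (0 < n)%nat) by (apply INR_lt; simpl; lra).
  set (p0 := phi s0 0). assert (Hp0 : p0 <> RtoC 0) by (apply phi0_neq_0; lra).
  pose proof (phi0_lower t a Ha) as L0. change (phi ((1 + a)%R, t) 0) with p0 in L0.
  assert (Ia : 0 < / a <= exp z).
  { split; [apply Rinv_0_lt_compat; auto|]. apply Rle_trans with (/ eta); auto. apply Rinv_le_contravar; lra. }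
  set (HH := HZ * (1 + / a)). pose proof core_HZ as BZ.
  assert (BH : 0 <= HH <= exp (8 * z)).
  { replace (8 * z) with (6 * z + 2 * z) by ring. apply exp_mul_le; auto. split; [lra|].
    replace (2 * z) with (z + z) by ring. rewrite exp_plus.
    apply Rle_trans with (2 * exp z); [lra|]. apply Rmult_le_compat_r; lra. }
  assert (Q2 : exp (- Q) <= 1 / 2).
  { rewrite exp_Ropp. pose proof (exp_ineq1_le Q). replace (1 / 2) with (/ 2) by field. apply Rinv_le_contravar; lra. }
  assert (Qn : 0 <= q ^ n <= exp (- (p + 20 * u))).
  { apply (bound_weaken _ (INR n * - Q)); [apply exp_pow_le; auto|].
    assert (QE : Q * (e' * u) = p + 20 * u) by (unfold Q, p; field; lra).
    assert (Q * (e' * u) <= Q * INR n) by (apply Rmult_le_compat_l; lra). lra. }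
  intros Zero.
  apply (zero_free_disc n m (fun k => phi s0 k * / p0)%C (tcf s0) r1 r2 HH (5 * exp p) (5 * exp (- (55 * z))) q w); auto; try lra.
  - pose proof (exp_pos p). lra.
  - pose proof (exp_pos (- (55 * z))). lra.
  - unfold p0. field. auto.
  - intros k. rewrite Cmult_assoc, (phi_rec s0 a k) by (unfold s0; simpl; lra). rewrite Cmult_comm, <- Csum_scal.
    apply Csum_ext. intros; ring.
  - intros k. rewrite Cmod_mult, Cmod_inv by auto.
    assert (IP : / Cmod p0 <= 1 + / a).
    { rewrite <- (Rinv_inv (1 + / a)). apply Rinv_le_contravar; [apply Rinv_0_lt_compat; lra|auto]. }
    assert (PP : 0 <= / Cmod p0) by (left; apply Rinv_0_lt_compat, Cmod_gt_0; auto).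
    specialize (Z1 k). unfold q, Rdiv. rewrite Rpow_mult_distr, pow_inv.
    assert (0 < R0 ^ k) by (apply pow_lt; auto). assert (0 < r2 ^ k) by (apply pow_lt; lra).
    apply Rmult_le_reg_r with (R0 ^ k); auto. unfold HH.
    replace (HZ * (1 + / a) * (r2 ^ k * / R0 ^ k) * R0 ^ k) with (HZ * (1 + / a) * r2 ^ k) by (field; lra).
    replace (Cmod (phi s0 k) * / Cmod p0 * r2 ^ k * R0 ^ k) with (Cmod (phi s0 k) * R0 ^ k * / Cmod p0 * r2 ^ k) by ring.
    apply Rmult_le_compat_r; [lra|]. apply Rmult_le_compat; auto. apply Rmult_le_pos; [apply Cmod_ge_0|lra].
  - intros i Hi. apply core_all. apply lt_INR in Hi. lra.
  - intros i [Hi1 Hi2]. apply core_large. apply le_INR in Hi1. apply lt_INR in Hi2. rewrite plus_INR in Hi2. lra.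
  - assert (F := exp_mul_le _ _ _ _ BH Qn). destruct F as [_ F]. eapply Rle_trans; [apply F|].
    apply Rle_trans with (exp (- (1))); [apply exp_le; lra|]. rewrite exp_Ropp.
    pose proof (exp_ineq1_le 1). replace (1 / 2) with (/ 2) by field. apply Rinv_le_contravar; lra.
  (* Final balance in the exponent: the constant 4 costs [z], [HH] costs [8 z], the defect gains
     [52 z], and [Y^n] costs [2 z]. *)
  - assert (EY : 2 * exp 1 * (r2 / (r2 - r1)) = Y).
    { unfold Y, r2, r1, a. field. assert (0 < nu) by (unfold nu; lra). assert (0 < nu * eta) by (apply Rmult_lt_0_compat; lra). split; lra. }
    rewrite EY.
    assert (Y0 : 0 < Y).
    { unfold Y. apply Rmult_lt_0_compat; [pose proof (exp_pos 1); lra|]. apply Rdiv_lt_0_compat; unfold nu; lra. }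
    assert (Y1 : 1 <= Y).
    { unfold Y. pose proof (exp_ineq1_le 1). assert (1 <= (M + 1 + nu) / nu).
      { apply Rmult_le_reg_r with nu; [unfold nu; lra|]. unfold Rdiv. rewrite Rmult_assoc, Rinv_l by (unfold nu; lra). lra. }
      assert (1 * 1 <= 2 * exp 1 * ((M + 1 + nu) / nu)) by (apply Rmult_le_compat; lra). lra. }
    assert (LY : 0 <= ln Y) by (apply ln_ge0; auto).
    assert (Yn : 0 <= Y ^ n <= exp (2 * z)).
    { split; [apply pow_le; lra|]. rewrite <- (exp_ln Y) at 1 by auto. rewrite exp_pow. apply exp_le.
      assert (LZ : ln Y <= z) by (rewrite <- (ln_exp z); apply ln_le; auto).
      apply Rle_trans with ((e' * u + 1) * ln Y); [apply Rmult_le_compat_r; auto|].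
      assert (e' * ln Y * u <= eps * u) by (apply Rmult_le_compat_r; lra). unfold z in *. lra. }
    assert (Mz : 0 <= INR m <= exp (2 * z) / 10).
    { split; [apply pos_INR|]. replace (2 * z) with (z + z) by ring. rewrite exp_plus.
      assert (10 * (M + 2) * (u + 2) <= exp z * exp z) by (apply Rmult_le_compat; lra).
      assert (0 <= M) by lra. unfold p in Hm2. lra. }
    assert (Nz : 0 <= INR n <= exp z) by (split; [apply pos_INR|]; lra).
    assert (T1 : 0 <= (2 * INR m * (5 * exp p) * r2 + INR (n + m)) * q ^ n <= exp (- (55 * z))).
    { pose proof (exp_pos p) as Pp. assert (Pe : 1 <= exp p) by (rewrite <- exp_0; apply exp_le; lra).
      assert (G : 0 <= 2 * INR m * (5 * exp p) * r2 + INR (n + m) <= exp (3 * z + p)).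
      { assert (R1 : r2 <= 1) by lra.
        assert (U : 0 <= 2 * INR m * (5 * exp p) * r2 <= 2 * INR m * (5 * exp p)).
        { split; [repeat apply Rmult_le_pos; lra|]. rewrite <- (Rmult_1_r (2 * INR m * (5 * exp p))) at 2.
          apply Rmult_le_compat_l; [repeat apply Rmult_le_pos; lra|lra]. }
        rewrite plus_INR. split; [lra|]. replace (3 * z + p) with (z + (2 * z + p)) by ring. rewrite exp_plus, (exp_plus (2 * z)).
        assert (V : 2 * INR m * (5 * exp p) <= exp (2 * z) * exp p).
        { replace (2 * INR m * (5 * exp p)) with ((10 * INR m) * exp p) by ring. apply Rmult_le_compat_r; lra. }
        assert (V2 : exp z <= exp (2 * z)) by (apply exp_le; lra).
        assert (V3 : exp (2 * z) <= exp (2 * z) * exp p) by (rewrite <- (Rmult_1_r (exp (2 * z))) at 1; apply Rmult_le_compat_l; [left; apply exp_pos|lra]).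
        set (E := exp (2 * z) * exp p) in *. assert (0 < E) by (unfold E; apply Rmult_lt_0_compat; apply exp_pos).
        apply Rle_trans with (3 * E); [lra|]. apply Rmult_le_compat_r; lra. }
      apply (bound_weaken _ ((3 * z + p) + - (p + 20 * u))); [apply exp_mul_le; auto|lra]. }
    assert (T2 : 0 <= 2 * INR n * r2 * (5 * exp (- (55 * z))) <= exp (z + (z + - (55 * z)))).
    { replace (2 * INR n * r2 * (5 * exp (- (55 * z)))) with ((10 * r2) * (INR n * exp (- (55 * z)))) by ring.
      apply exp_mul_le; [split; lra|]. apply exp_mul_le; auto. apply exp_self. }
    assert (T3 : 0 <= (2 * INR m * (5 * exp p) * r2 + INR (n + m)) * q ^ n + 2 * INR n * r2 * (5 * exp (- (55 * z))) <= exp (- (52 * z))).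
    { split; [lra|]. replace (- (52 * z)) with (z + - (53 * z)) by ring. rewrite exp_plus.
      assert (exp (- (55 * z)) <= exp (- (53 * z))) by (apply exp_le; lra).
      replace (z + (z + - (55 * z))) with (- (53 * z)) in T2 by ring. pose proof (exp_pos (- (53 * z))).
      apply Rle_trans with (2 * exp (- (53 * z))); [lra|]. apply Rmult_le_compat_r; lra. }
    set (TT := (2 * INR m * (5 * exp p) * r2 + INR (n + m)) * q ^ n + 2 * INR n * r2 * (5 * exp (- (55 * z)))) in *.
    assert (F : 0 <= 4 * (HH * TT) * Y ^ n <= exp ((z + (8 * z + - (52 * z))) + 2 * z)).
    { apply exp_mul_le; auto. apply exp_mul_le; [lra|]. apply exp_mul_le; auto. }
    eapply Rle_lt_trans; [apply F|]. rewrite <- exp_0. apply exp_increasing. lra.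
  - rewrite (CS_ext _ (fun k => / p0 * (phi s0 k * w ^ k))%C) by (intros; ring).
    assert (WR : Cmod w < R0) by (pose proof core_R0; lra).
    rewrite (CS_scal (/ p0) _ (fun k => HZ * (Cmod w / R0) ^ k)).
    + rewrite Zero. ring.
    + intros k. rewrite Cmod_mult, Cmod_pow. unfold Rdiv. rewrite Rpow_mult_distr, pow_inv. specialize (Z1 k).
      assert (0 < R0 ^ k) by (apply pow_lt; auto). assert (0 <= Cmod w ^ k) by (apply pow_le, Cmod_ge_0).
      apply Rmult_le_reg_r with (R0 ^ k); auto.
      replace (HZ * (Cmod w ^ k * / R0 ^ k) * R0 ^ k) with (HZ * Cmod w ^ k) by (field; lra).
      rewrite Rmult_assoc, (Rmult_comm (Cmod w ^ k)), <- Rmult_assoc. apply Rmult_le_compat_r; lra.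
    + apply ex_series_scal', ex_series_geom'. split; [apply Rdiv_le_0_compat; [apply Cmod_ge_0|auto]|].
      apply Rmult_lt_reg_r with R0; auto. unfold Rdiv. rewrite Rmult_assoc, Rinv_l; lra.
Qed.

End Fixed_j.

Lemma core_zero_free sigma : 1 - eta < sigma -> zeta (sigma, t) <> RtoC 0.
Proof.
  intros Hs. destruct (Rlt_dec 1 sigma) as [H1|H1]; [apply zeta_right_nonzero; auto|].
  destruct core_j as [j [Hj Hj2]]. destruct core_basic as (E0 & _ & _ & _ & _ & _ & _ & _ & Hr & Hr2 & _).
  destruct core_sizes as (Ha1 & _). pose proof core_R0 as HR.
  destruct (zeta_local t a d Ha1 ltac:(unfold d; lra) ltac:(rewrite Ht; apply exp_ge_6; auto)) as [_ Z2].
  set (w := RtoC (sigma - (1 + a))).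
  assert (E : ((sigma, t) = ((1 + a)%R, t) + w)%C) by (unfold w; apply injective_projections; simpl; ring).
  assert (Hw : Cmod w < r1) by (unfold w; rewrite Cmod_R, Rabs_left1 by lra; unfold r1; lra).
  rewrite E, Z2; [apply (core_disc j Hj Hj2 w Hw)|unfold R0 in HR; lra|].
  unfold r1 in Hw. destruct core_sizes as (_ & _ & Et4 & _). lra.
Qed.

End Core.

(** [N^2 / 2] and [N (N - 1) / 2] differ by [N / 2], which [N^2 N^-th] covers as [th <= 1]; the
    values at [N < 4] go into the constant. [K1] is chosen before [th] and [ka], which will depend
    on [t]. *)
Lemma Ebound_of_asymp (e : nat -> R) K :
  (forall N, (4 <= N)%nat -> Rabs (G N - INR N ^ 2 / 2) <= K * (INR N ^ 2 * e N)) ->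
  exists K1, 0 <= K1 /\ forall th ka, 0 <= th <= 1 -> 0 <= ka ->
    (forall N, (4 <= N)%nat -> 0 <= e N <= exp (- th * ln (INR N)) + ka) -> Ebound K1 th ka.
Proof.
  intros H. set (K' := Rabs (gE 1) + Rabs (gE 2) + Rabs (gE 3)).
  pose proof (Rabs_pos (gE 1)). pose proof (Rabs_pos (gE 2)). pose proof (Rabs_pos (gE 3)). pose proof (Rabs_pos K).
  exists (Rabs K + 1 / 2 + K'). split; [unfold K'; lra|].
  intros th ka Hth Hka He N HN.
  assert (PN : 1 <= INR N) by (replace 1 with (INR 1) by auto; apply le_INR; auto).
  assert (LN : 0 <= ln (INR N)) by (apply ln_ge0; auto).
  set (E := exp (- th * ln (INR N))).
  assert (E1 : / INR N <= E).
  { unfold E. replace (/ INR N) with (exp (- ln (INR N))) by (rewrite exp_Ropp, exp_ln; lra). apply exp_le. nra. }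
  assert (E2 : INR N <= INR N ^ 2 * E).
  { replace (INR N) with (INR N ^ 2 * / INR N) at 1 by (field; lra). apply Rmult_le_compat_l; [apply pow2_ge_0|auto]. }
  set (X := INR N ^ 2 * (E + ka)).
  assert (E3 : INR N <= X).
  { unfold X. rewrite Rmult_plus_distr_l. assert (0 <= INR N ^ 2 * ka) by (apply Rmult_le_pos; [apply pow2_ge_0|auto]). lra. }
  rewrite !Rmult_plus_distr_r.
  destruct (le_lt_dec 4 N) as [H4|H4].
  - assert (Eq : gE N = (G N - INR N ^ 2 / 2) + INR N / 2) by (unfold gE; field). rewrite Eq.
    eapply Rle_trans; [apply Rabs_triang|]. rewrite (Rabs_pos_eq (INR N / 2)) by lra.
    specialize (H N H4). specialize (He N H4). fold E in He.
    assert (Y : INR N ^ 2 * e N <= X) by (unfold X; apply Rmult_le_compat_l; [apply pow2_ge_0|lra]).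
    assert (Y0 : 0 <= INR N ^ 2 * e N) by (apply Rmult_le_pos; [apply pow2_ge_0|lra]).
    assert (K * (INR N ^ 2 * e N) <= Rabs K * X) by (pose proof (Rle_abs K); apply Rle_trans with (Rabs K * (INR N ^ 2 * e N)); [apply Rmult_le_compat_r|apply Rmult_le_compat_l]; lra).
    assert (0 <= K' * X) by (apply Rmult_le_pos; unfold K'; lra). lra.
  - assert (Rabs (gE N) <= K') by (unfold K'; destruct N as [|[|[|[|N]]]]; try lia; lra).
    assert (0 <= Rabs K * X) by (apply Rmult_le_pos; lra).
    assert (K' * 1 <= K' * X) by (apply Rmult_le_compat_l; unfold K'; lra). lra.
Qed.

Theorem theorem2 (eta eta' : R -> R)
  (eta_continuous : forall u, 0 <= u -> continue_in eta (fun v => 0 <= v) u)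
  (eta_decreasing : forall u v, 0 <= u -> u <= v -> eta v <= eta u)
  (eta_derivative : forall u, 0 <= u -> D_in eta eta' (fun v => 0 <= v) u)
  (eta_range : forall u, 0 <= u -> 0 < eta u <= 1 / 2)
  (eta'_limit : is_lim eta' p_infty 0)
  (A : R) (A_gt1 : 1 < A)
  (Gasymp : exists C0 : R, 5 * A < C0 /\ exists K : R,
     forall N : nat, (4 <= N)%nat ->
       Rabs (G N - INR N ^ 2 / 2)
         <= K * (INR N ^ 2 * exp (- C0 * varpi eta (INR N)))) :
  exists T : R, forall sigma t : R,
    T <= Rabs t -> sigma > 1 - eta (ln (Rabs t)) ->
    zeta (sigma, t) <> RtoC 0.
Proof.
  destruct Gasymp as [C0 [HC [K HG]]]. assert (HC5 : 5 < C0) by lra.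
  destruct (Ebound_of_asymp (fun N => exp (- C0 * varpi eta (INR N))) K HG) as [K1 [HK1 HE]].
  assert (VM : forall N, (4 <= N)%nat -> 0 <= ln (INR N) /\ exists v, 0 <= v /\ varpi eta (INR N) = eta v * ln (INR N) + v).
  { intros N HN. assert (P : 4 <= INR N) by (replace 4 with (INR 4) by (simpl; ring); apply le_INR; auto).
    split; [apply ln_ge0; lra|].
    apply (varpi_is_min eta (INR N) eta_continuous); [intros; apply eta_range; auto|lra]. }
  assert (Lt : forall x t, 0 <= x -> exp x <= Rabs t -> x <= ln (Rabs t) /\ Rabs t = exp (ln (Rabs t))).
  { intros x t Hx Ht. pose proof (exp_pos x). split; [|rewrite exp_ln; lra].
    rewrite <- (ln_exp x). apply ln_le; auto. }
  (* Either [eta] has a positive infimum or, being decreasing, it tends to 0. *)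
  destruct (classic (exists e0, 0 < e0 /\ forall u, 0 <= u -> e0 <= eta u)) as [[e0 [He0 Hlow]]|Hno].
  - destruct (completeness (fun x => forall u, 0 <= u -> x <= eta u)) as [s [Hs1 Hs2]].
    { exists (1 / 2). intros x Hx. specialize (Hx 0 ltac:(lra)). pose proof (eta_range 0 ltac:(lra)). lra. }
    { exists e0. auto. }
    assert (Hs0 : e0 <= s) by (apply Hs1; auto).
    assert (Hs : forall u, 0 <= u -> s <= eta u) by (intros u Hu; apply Hs2; intros x Hx; auto).
    assert (Hu1 : exists u1, 0 <= u1 /\ eta u1 < 2 * s).
    { apply NNPP. intros N. assert (2 * s <= s); [|lra]. apply Hs1. intros u Hu. apply Rnot_lt_le. intros L. apply N. eauto. }
    destruct Hu1 as [u1 [Hu1 Hu1']].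
    (* With [s] the infimum of [eta], [varpi(x) >= s log x] and [C0 > 5] allow [th = 5 s];
       eventually [eta < 2 s], hence [eta < th]. The cap [3/4] still exceeds [eta <= 1/2] and is the
       largest width [zeta_local] accepts. *)
    set (th := Rmin (5 * s) (3 / 4)).
    assert (Hth : 0 < th <= 3 / 4) by (split; [apply Rmin_glb_lt; lra|apply Rmin_r]).
    assert (Hth5 : th <= 5 * s) by apply Rmin_l.
    assert (EB : Ebound K1 th 0).
    { apply HE; try lra. intros N HN. split; [left; apply exp_pos|]. rewrite Rplus_0_r. apply exp_le.
      destruct (VM N HN) as [L [v [Hv ->]]]. specialize (Hs v Hv).
      assert (th * ln (INR N) <= C0 * s * ln (INR N)) by (apply Rmult_le_compat_r; nra).
      assert (s * ln (INR N) <= eta v * ln (INR N)) by (apply Rmult_le_compat_r; auto). nra. }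
    exists (6 + exp u1). intros sigma t HT Hsig. pose proof (exp_pos u1).
    destruct (Lt u1 t Hu1 ltac:(lra)) as [Hu _]. set (u := ln (Rabs t)) in *.
    pose proof (eta_range u ltac:(lra)). pose proof (eta_decreasing u1 u Hu1 Hu).
    apply (zero_free_power K1 th (eta u)); auto; try lra.
    split; [lra|]. apply Rmin_glb_lt; lra.
  - set (c := Rmin 1 (C0 - 5)). assert (Hc : 0 < c <= 1) by (split; [apply Rmin_glb_lt; lra|apply Rmin_l]).
    assert (Hc5 : 5 + c <= C0) by (pose proof (Rmin_r 1 (C0 - 5)); unfold c; lra).
    set (eps := c / 64). assert (Heps : 0 < eps <= 1) by (unfold eps; lra).
    (* Order of choices: [M], [Y] and [e'] depend on [C0] alone; then [s1] and [s2] say how small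
       [eta] has to become, and finally [growth] says how large [u] must be in terms of these and of
       [K1]. *)
    set (M := 480 + C0 ^ 2 / eps).
    assert (PM : 0 <= C0 ^ 2 / eps) by (apply Rdiv_le_0_compat; [apply pow2_ge_0|lra]).
    assert (HM : C0 ^ 2 <= eps * M) by (unfold M; replace (eps * (480 + C0 ^ 2 / eps)) with (480 * eps + C0 ^ 2) by (field; lra); lra).
    set (Y := 2 * exp 1 * ((M + 1 + 4 * eps) / (4 * eps))).
    set (e' := eps / (1 + Rabs (ln Y))). pose proof (Rabs_pos (ln Y)) as LY.
    assert (He' : 0 < e' <= 1).
    { unfold e'. split; [apply Rdiv_lt_0_compat; lra|]. apply Rmult_le_reg_r with (1 + Rabs (ln Y)); [lra|].
      unfold Rdiv. rewrite Rmult_assoc, Rinv_l; lra. }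
    assert (HY : e' * ln Y <= eps).
    { apply Rle_trans with (e' * (1 + Rabs (ln Y))); [apply Rmult_le_compat_l; [lra|]; pose proof (Rle_abs (ln Y)); lra|].
      unfold e'. apply Req_le. field. lra. }
    set (s1 := eps / (3 * C0)). set (s2 := 4 * eps * exp (- ((M + 20) / e')) / (M + C0 + 2)).
    pose proof (exp_pos (- ((M + 20) / e'))) as PQ.
    assert (S1 : 0 < s1) by (apply Rdiv_lt_0_compat; lra).
    assert (S2 : 0 < s2) by (apply Rdiv_lt_0_compat; [apply Rmult_lt_0_compat; lra|unfold M; lra]).
    assert (Hu1 : exists u1, 0 <= u1 /\ eta u1 < Rmin s1 s2).
    { apply NNPP. intros N. apply Hno. exists (Rmin s1 s2). split; [apply Rmin_glb_lt; auto|].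
      intros u Hu. apply Rnot_lt_le. intros L. apply N. eauto. }
    destruct Hu1 as [u1 [Hu1 Hsm]]. pose proof (Rmin_l s1 s2). pose proof (Rmin_r s1 s2).
    set (A0 := 18 * (2 + 6 * K1)). set (A1 := 3600 * K1 * 10000). set (A2 := (2400 * K1) ^ 2 * 4 * 10000 ^ 3).
    assert (P2 : 0 <= A2) by (unfold A2; repeat apply Rmult_le_pos; try lra; apply pow2_ge_0).
    assert (P1 : 0 <= A1) by (unfold A1; lra). assert (P0 : 0 <= A0) by (unfold A0; lra).
    pose proof (Rabs_pos Y) as PY. pose proof (Rle_abs Y) as PY'.
    destruct (growth eps (A0 + A1 + A2 + 20000 + Rabs Y + 10 * (M + 2)) ltac:(lra)) as [u0 Hgr].
    destruct (zero_free_narrow eps Heps) as [T1 HT1].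
    pose proof (Rabs_pos u0) as PU0. pose proof (Rle_abs u0) as PU1. pose proof (Rle_abs T1) as PT1. pose proof (Rabs_pos T1) as PT0.
    exists (Rabs T1 + exp (u1 + Rabs u0 + 4)). intros sigma t HT Hsig. pose proof (exp_pos (u1 + Rabs u0 + 4)).
    destruct (Lt (u1 + Rabs u0 + 4) t ltac:(lra) ltac:(lra)) as [Hu Et]. set (u := ln (Rabs t)) in *.
    pose proof (eta_range u ltac:(lra)) as Er. pose proof (eta_decreasing u1 u Hu1 ltac:(lra)) as Ed.
    (* Very small [eta] falls under [zero_free_narrow]; otherwise [1 / eta <= e^(eps u)], as
       [core_zero_free] requires. *)
    destruct (Rle_dec (eta u) (exp (- (eps * u)))) as [Hn|Hn]; [apply (HT1 t (eta u) sigma); try lra; split; [lra|exact Hn]|].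
    destruct (Hgr u ltac:(lra)) as [G1 G2].
    assert (B1 : 3 * C0 * eta u <= eps).
    { apply Rle_trans with (3 * C0 * s1); [apply Rmult_le_compat_l; lra|]. unfold s1. apply Req_le. field. lra. }
    assert (B2 : (M + C0 + 2) * eta u <= 4 * eps * exp (- ((M + 20) / e'))).
    { assert (0 < M + C0 + 2) by (unfold M; lra).
      apply Rle_trans with ((M + C0 + 2) * s2); [apply Rmult_le_compat_l; lra|]. unfold s2. apply Req_le. field. lra. }
    assert (EB : Ebound K1 (C0 * eta u) (exp (- (C0 * u)))).
    { apply HE; [split; [apply Rmult_le_pos; lra|lra]|left; apply exp_pos|].
      intros N HN. split; [left; apply exp_pos|].
      destruct (VM N HN) as [L [v [Hv ->]]]. pose proof (eta_range v Hv) as Rv.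
      pose proof (exp_pos (- (C0 * eta u) * ln (INR N))). pose proof (exp_pos (- (C0 * u))).
      (* The minimum defining varpi at v splits at [v <= u]: either term alone beats the claimed bound. *)
      destruct (Rle_dec v u) as [h|h].
      - apply Rle_trans with (exp (- (C0 * eta u) * ln (INR N))); [|lra]. apply exp_le.
        pose proof (eta_decreasing v u Hv h).
        assert (eta u * ln (INR N) <= eta v * ln (INR N)) by (apply Rmult_le_compat_r; auto). nra.
      - apply Rle_trans with (exp (- (C0 * u))); [|lra]. apply exp_le.
        assert (0 <= eta v * ln (INR N)) by (apply Rmult_le_pos; lra). nra. }
    apply (core_zero_free K1 C0 c M e' u t (eta u)); auto; fold eps; try lra.
    + unfold M; lra.
    + replace (exp (eps * u)) with (/ exp (- (eps * u))) by (rewrite exp_Ropp, Rinv_inv; reflexivity).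
      apply Rinv_le_contravar; [apply exp_pos|lra].
    + fold A0. unfold M in *; lra.
    + fold A1. unfold M in *; lra.
    + fold A2. unfold M in *; lra.
    + unfold M in *; lra.
    + fold Y. unfold M in *; lra.
Qed.
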